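(* Let $m\ge1$ be an integer, $f(z)=\sum_{n\ge0}a_n z^{-n/m}\in\mathbb{C}[[z^{-1/m}]]$ a Gevrey-1 series, and $\widetilde f(\zeta)=\sum_{n\ge1}\frac{a_n\zeta^{n/m-1}}{\Gamma(n/m)}\in\zeta^{-1+\frac1m}\mathbb{C}\{\zeta^{1/m}\}$ its Borel transform. For $l=1,\dots,m$ let $f_l(w)=\sum_{j\ge1}a_{l,j}w^{-j}$ with $a_{l,j}=a_{l+m(j-1)}$, and $\widetilde{f_l}(\xi)=\sum_{j\ge1}\frac{a_{l,j}\xi^{j-1}}{(j-1)!}$ its Borel transform. The following are equivalent: (1) There exists $r>0$ such that $\widetilde f$ extends analytically to $\mathcal{D}_r^\star$, and there exist $A>0$, $B>0$ with $|\widetilde f(\zeta)\zeta^{\frac{m-1}{m}}|\le Ae^{B|\zeta|}$ for all $\zeta\in\mathcal{D}_r^\star$. (2) There exist $r>0$, $B>0$, constants $A_l>0$ ($1\le l\le m$) and functions $\mathrm{S}_0f_l(w)$ holomorphic on $\{w\in\mathbb{C}:\Re w>B\}$ such that for all $w$ with $\Re w>B$, all $n\ge1$ and all $1\le l\le m$, $$\Big|\mathrm{S}_0f_l(w)-\sum_{j=1}^n\frac{a_{l,j}}{w^j}\Big|\le R_{as}(r,A_l,B,n,w),\qquad R_{as}(r,A,B,n,w)=Ae^{Br}\frac{n!}{r^n}\frac{1}{|w|^n(\Re(w)-B)}.$$ Moreover, in this situation, for $\Re(w)>B$, $\mathrm{S}_0f_l(w)=\int_0^\infty\widetilde{f_l}(\xi)e^{-w\xi}\,d\xi$;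 for $z\in P(B)$, $$\mathrm{S}_0f(z):=a_0+\int_0^\infty\widetilde f(\zeta)e^{-z\zeta}\,d\zeta=a_0+\sum_{l=1}^m z^{\frac{m-l}{m}}\,\mathrm{S}_0f_l(\dot z);$$ and for all $z\in P(B)$ and $n\ge1$, $$\Big|\mathrm{S}_0f(z)-\sum_{k=0}^{mn}\frac{a_k}{z^{k/m}}\Big|\le C e^{Br}\frac{n!}{r^n}\,\frac{\sum_{i=0}^{m-1}|z|^{i/m}}{|z|^n(\Re(\dot z)-B)},\qquad C=\max_{1\le l\le m}A_l.$$
   Context: $\mathbb{C}_m^\star$ is the $m$-sheeted covering of $\mathbb{C}^\star$ (Riemann surface of $X^{1/m}$ without the origin): a point $x$ is a pair $(|x|,\arg x)$ with $|x|>0$, $\arg x\in\mathbb{R}/2\pi m\mathbb{Z}$, with projection $\pi(x)=\dot x=|x|e^{i\arg x}$; $|\arg x|$ refers to the representative in $]-m\pi,m\pi]$. For $k\in\mathbb{Z}$, $x^{k/m}$ has modulus $|x|^{k/m}$ and argument $\frac km\arg x$; complex values are read via $\pi$ (e.g. $e^{-z\zeta}=e^{-\dot z\dot\zeta}$). For $r>0$, $\mathcal{B}_r=\{\zeta\in\mathbb{C}:d(\zeta,\mathbb{R}^+)<r\}$ (Euclidean distance), $\mathcal{B}_r^\star=\mathcal{B}_r\setminus\{0\}$, and $\mathcal{D}_r^\star=\pi^{-1}(\mathcal{B}_r^\star)\subset\mathbb{C}_m^\star$. $P(B)=\{z\in\mathbb{C}_m^\star:|\arg z|\le\pi/2,\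 \Re(\dot z)>B\}$. A series $\sum a_nz^{-n/m}$ is Gevrey-1 if $|a_n|\le CK^n\Gamma(1+n/m)$ for some constants. Laplace integrals are taken along the ray of argument $0$. *)

(* Defs.v *)
From Stdlib Require Import Reals Factorial.
From Coquelicot Require Import Coquelicot.

Local Open Scope R_scope.
Local Open Scope C_scope.

Definition Cexp (u : C) : C :=
  (exp (Re u) * cos (Im u), exp (Re u) * sin (Im u))%R.

Fixpoint Cpow (w : C) (n : nat) : C :=
  match n with O => 1 | S k => w * Cpow w k end.

Definition Gamma (s : R) : R :=
  RInt_gen (fun t => Rpower t (s - 1) * exp (- t))%R
           (at_right 0) (Rbar_locally p_infty).

Definition Gevrey1 (m : nat) (a : nat -> C) : Prop :=
  exists Cst K : R, forall n : nat,
    (Cmod (a n) <= Cst * K ^ n * Gamma (1 + INR n / INR m))%R.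

(** B_r = { zeta : d(zeta, R^+) < r } (the distance to the closed set R^+ is attained). *)
Definition InB (r : R) (zeta : C) : Prop :=
  exists t : R, (0 <= t)%R /\ (Cmod (zeta - RtoC t) < r)%R.

(** Points of C_m^* are represented in logarithmic coordinates: u : C stands for
    the point with |x| = exp (Re u) and arg x = Im u (mod 2 pi m); pi(x) = Cexp u,
    and x^{k/m} = Cexp ((k/m) u).  Functions on (open subsets of) C_m^* are
    functions of u that are (2 pi i m)-periodic; u represents a point of D_r^*
    iff InB r (Cexp u). *)

(** k-th term (k >= 0, i.e. n = k+1 >= 1) of the Borel transform
    tilde f(zeta) = sum_{n>=1} a_n zeta^{n/m - 1} / Gamma(n/m), at zeta = point u. *)
Definition borel_term (m : nat) (a : nat -> C) (u : C) (k : nat) : C :=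
  a (S k) * Cexp (RtoC (INR (S k) / INR m - 1) * u) / RtoC (Gamma (INR (S k) / INR m)).

(** F (in log coordinates) is the analytic continuation of tilde f to D_r^*:
    F is a function on C_m^*, holomorphic on D_r^*, and coincides with the
    convergent series of tilde f in a punctured neighbourhood of the origin. *)
Definition IsBorelCont (m : nat) (a : nat -> C) (r : R) (F : C -> C) : Prop :=
  (forall u : C, F (u + (0, 2 * PI * INR m)%R) = F u) /\
  (forall u : C, InB r (Cexp u) -> ex_derive F u) /\
  (exists rho : R, (0 < rho)%R /\
     forall u : C, (exp (Re u) < rho)%R -> is_series (borel_term m a u) (F u)).

Definition alj (m : nat) (a : nat -> C) (l j : nat) : C := a (l + m * (j - 1))%nat.

(** k-th term of tilde f_l(xi) = sum_{j>=1} a_{l,j} xi^{j-1}/(j-1)! (k = j-1). *)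
Definition borel_l_term (m : nat) (a : nat -> C) (l : nat) (xi : C) (k : nat) : C :=
  alj m a l (S k) * Cpow xi k / RtoC (INR (fact k)).

Definition IsBorelContL (m : nat) (a : nat -> C) (l : nat) (r : R) (G : C -> C) : Prop :=
  (forall xi : C, InB r xi -> ex_derive G xi) /\
  (exists rho : R, (0 < rho)%R /\
     forall xi : C, (Cmod xi < rho)%R -> is_series (borel_l_term m a l xi) (G xi)).

Definition Ras (r A B : R) (n : nat) (w : C) : R :=
  (A * exp (B * r) * INR (fact n) / r ^ n * / (Cmod w ^ n * (Re w - B)))%R.

Definition cond2 (m : nat) (a : nat -> C) (r B : R) (A : nat -> R) (S0 : nat -> C -> C) : Prop :=
  (0 < r)%R /\ (0 < B)%R /\
  (forall l, (1 <= l <= m)%nat -> (0 < A l)%R) /\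
  (forall l, (1 <= l <= m)%nat -> forall w : C, (Re w > B)%R -> ex_derive (S0 l) w) /\
  (forall w : C, (Re w > B)%R -> forall n : nat, (1 <= n)%nat ->
     forall l, (1 <= l <= m)%nat ->
       Rle (Cmod (S0 l w - sum_n_m (fun j => alj m a l j / Cpow w j) 1 n))
           (Ras r (A l) B n w)).

Definition cond1 (m : nat) (a : nat -> C) : Prop :=
  exists r : R, (0 < r)%R /\ exists F : C -> C, IsBorelCont m a r F /\
    exists A B : R, (0 < A)%R /\ (0 < B)%R /\
      forall u : C, InB r (Cexp u) ->
        Rle (Cmod (F u * Cexp (RtoC (INR (m - 1) / INR m) * u)))
            (A * exp (B * Cmod (Cexp u)))%R.

(** max_{1<=l<=m} A_l (for positive A_l, m >= 1). *)
Fixpoint maxA (A : nat -> R) (k : nat) : R :=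
  match k with O => 0%R | S k' => Rmax (A (S k')) (maxA A k') end.

(** z in P(B), in log coordinates v: |arg z| = |Im v| <= pi/2 and Re(dot z) > B. *)
Definition InP (B : R) (v : C) : Prop :=
  (- (PI / 2) <= Im v <= PI / 2)%R /\ (Re (Cexp v) > B)%R.

(* Main.v *)
(** Call _jet_ a family [d n] of functions on [0, +oo) with [(d n)' = d (n + 1)] and
    [|d n x| <= M n! rho^-n exp (b x)]; its Taylor series at the points of the half-line glue to a
    holomorphic function of exponential growth on [B_r], [r < rho], and conversely Cauchy's estimates
    turn such a function into a jet.

    Integrating by parts, the Laplace transform of a jet satisfies the remainder estimates of (2).
    Conversely (Nevanlinna) the jet is recovered from [S0 l] by the inverse Laplace integral on a
    vertical line, after subtraction of enough terms of the expansion to make it converge.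

    Averaging [zeta^(1 - l/m) F] over the [m] sheets isolates the exponents congruent to [l] modulo
    [m]: this gives a function [h_l] of [zeta] whose Taylor coefficients are those of the Borel
    transform of [f_l] multiplied by [n! / Gamma (l/m + n)].  Both this multiplier and its inverse are
    compositions of averages [d |-> int_0^1 kap(t) d (x phi(t)) dt] and Euler operators
    [x d/dx + lam], which preserve jets; this gives (1) <=> (2), with [F] the sum of the
    [zeta^(l/m - 1) h_l].  Since [h_l] comes from a fractional integral of the Borel transform of
    [f_l], the convolution theorem and [int_0^oo t^(al - 1) exp (- z t) dt = Gamma al z^(- al)] give
    the Laplace integral of [F], and the identity theorem along the real axis gives independence of
    the chosen continuation. *)

Require Import Defs.
From Stdlib Require Import Reals Factorial Lra Lia Psatz ZArith ClassicalEpsilon.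
From Coquelicot Require Import Coquelicot.

Local Open Scope R_scope.

(** * Complex-valued functions: modulus, derivatives, integrals *)

(** Jets rather than holomorphic functions carry the argument, so that Laplace integrals,
    integrations by parts and changes of Taylor coefficients become calculus in one real variable;
    complex analysis is confined to the passage between jets and functions. The multiplier
    [n!/Gamma (l/m + n)] grows like [n^(1 - l/m)], so it is no moment sequence of a bounded kernel;
    for [l < m] its inverse is a Beta moment, but of the singular kernel [(1 - y)^(-l/m)]. Powers
    are moved from the kernels into Euler operators until the kernels are bounded and proper Riemann
    integrals suffice. No double integral is ever exchanged: both sides of such an identity are
    compared as functions of an upper limit, through their derivatives. Passing through jets shrinks
    the radius and raises the exponential rate, which the existential constants of (1) and (2)
    absorb. The formulas after the equivalence must hold on all of [Re w > B], so there a rate [c]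
    strictly between [B] and [Re w] is chosen for each point. *)

Lemma Cpow_Cpow (w : C) (n : nat) : Defs.Cpow w n = (w ^ n)%C.
Proof. induction n as [|n IH]; simpl; [|rewrite IH]; reflexivity. Qed.

Lemma Ceq (a b : C) : Re a = Re b -> Im a = Im b -> a = b.
Proof. destruct a, b; simpl; intros -> ->; reflexivity. Qed.

Lemma RtoC_nz (x : R) : x <> 0 -> RtoC x <> RtoC 0.
Proof. intros H E. apply H. exact (f_equal fst E). Qed.

Lemma im_le_Cmod (z : C) : Rabs (Im z) <= Cmod z.
Proof. eapply Rle_trans; [|apply Rmax_Cmod]. apply Rmax_r. Qed.

Lemma Cmod_le_sum (z : C) : Cmod z <= Rabs (Re z) + Rabs (Im z).
Proof.
  destruct z as [x y]. unfold Re, Im; simpl.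
  replace ((x, y) : C) with (RtoC x + (Ci * RtoC y))%C by (apply Ceq; unfold Ci; simpl; ring).
  eapply Rle_trans; [apply Cmod_triangle|].
  rewrite Cmod_mult, Cmod_Ci, !Cmod_R. lra.
Qed.

Lemma Cmod_sub_triangle (x y : C) : Cmod (x - y) <= Cmod x + Cmod y.
Proof. unfold Cminus. rewrite <- (Cmod_opp y). apply Cmod_triangle. Qed.

Lemma Cmod_sub_sym (x y : C) : Cmod (x - y) = Cmod (y - x).
Proof. rewrite <- Cmod_opp. f_equal. ring. Qed.

Lemma Cmod_sub_rev (x y : C) : Cmod x - Cmod y <= Cmod (x - y).
Proof. pose proof (Cmod_triangle (x - y) y). replace (x - y + y)%C with x in H by ring. lra. Qed.

Lemma Cmod_le_0 (z : C) : (forall eps, 0 < eps -> Cmod z <= eps) -> z = RtoC 0.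
Proof.
  intros H. apply Cmod_eq_0. apply Rle_antisym; [|apply Cmod_ge_0].
  apply le_epsilon. intros e He. rewrite Rplus_0_l. auto.
Qed.

Lemma Cmod_prod_norm (x : C) : @norm R_AbsRing C_R_NormedModule x = Cmod x.
Proof.
  unfold norm; simpl. unfold prod_norm, Cmod. f_equal.
  change (norm (fst x)) with (Rabs (fst x)). change (norm (snd x)) with (Rabs (snd x)).
  rewrite !pow2_abs. reflexivity.
Qed.

(** * Complex differentiability by increments *)

Definition Cder (f : C -> C) (z l : C) : Prop :=
  forall eps, 0 < eps -> exists del, 0 < del /\
    forall h, Cmod h < del -> Cmod (f (z + h) - f z - l * h)%C <= eps * Cmod h.

Lemma Cder_is_derive f z l : Cder f z l <-> is_derive (K:=C_AbsRing) (V:=C_NormedModule) f z l.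
Proof.
  split.
  - intros H. split.
    + apply is_linear_scal_l.
    + intros x Hx eps.
      assert (x = z) as ->.
      { symmetry. apply (is_filter_lim_locally_unique (K:=C_AbsRing)). exact Hx. }
      destruct (H eps (cond_pos eps)) as [del [Hdel Hd]].
      exists (mkposreal _ Hdel). intros y0 Hy. pose (y := (y0 : C)).
      change (Cmod (minus y z) < del) in Hy.
      specialize (Hd (y - z)%C Hy).
      change (Cmod (f y - f z - (y - z) * l)%C <= eps * Cmod (y - z)).
      replace (z + (y - z))%C with y in Hd by ring.
      replace (f y - f z - (y - z) * l)%C with (f y - f z - l * (y - z))%C by ring. exact Hd.
  - intros [_ H] eps Heps.
    assert (Hl : is_filter_lim (T:=AbsRing_UniformSpace C_AbsRing) (locally (T:=AbsRing_UniformSpace C_AbsRing) z) z)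
      by (intros P HP; exact HP).
    destruct (H z Hl (mkposreal _ Heps)) as [del Hd].
    exists del. split; [apply cond_pos|]. intros h Hh.
    assert (Ezh : (z + h - z)%C = h) by (clear; ring).
    assert (Hb : @ball (AbsRing_UniformSpace C_AbsRing) z del (z + h)%C).
    { change (Cmod (z + h - z)%C < del). rewrite Ezh. exact Hh. }
    specialize (Hd _ Hb).
    change (Cmod (f (z + h) - f z - (z + h - z) * l)%C <= eps * Cmod (z + h - z)) in Hd.
    rewrite Ezh in Hd.
    replace (f (z + h) - f z - l * h)%C with (f (z + h) - f z - h * l)%C by ring. exact Hd.
Qed.

Definition small (phi : C -> C) : Prop :=
  forall eps, 0 < eps -> exists del, 0 < del /\ forall h, Cmod h < del -> Cmod (phi h) <= eps.

(** Carathéodory's form of the derivative: with the error written as a factor [phi h] in front of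
    [h], the product and chain rules reduce to polynomial identities between small functions. *)
Lemma Cder_small f z l :
  Cder f z l <-> exists phi, small phi /\ forall h, (f (z + h) = f z + (l + phi h) * h)%C.
Proof.
  split.
  - intros H.
    exists (fun h => if Ceq_dec h 0%C then RtoC 0 else ((f (z + h) - f z) / h - l)%C).
    split.
    + intros eps He. destruct (H eps He) as [del [Hd Hh]]. exists del. split; [exact Hd|].
      intros h Hlt. destruct (Ceq_dec h 0%C) as [->|Hn].
      * rewrite Cmod_0. lra.
      * specialize (Hh h Hlt).
        replace ((f (z + h) - f z) / h - l)%C with ((f (z + h) - f z - l * h) / h)%C by (field; auto).
        rewrite Cmod_div by auto. apply Cmod_gt_0 in Hn.
        apply Rmult_le_reg_r with (Cmod h); [exact Hn|]. field_simplify; lra.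
    + intros h. destruct (Ceq_dec h 0%C) as [->|Hn].
      * replace (z + 0)%C with z by ring. ring.
      * field; auto.
  - intros [phi [Hs Hf]] eps He. destruct (Hs eps He) as [del [Hd Hh]].
    exists del; split; [exact Hd|]. intros h Hlt.
    rewrite Hf. replace (f z + (l + phi h) * h - f z - l * h)%C with (phi h * h)%C by ring.
    rewrite Cmod_mult. apply Rmult_le_compat_r; [apply Cmod_ge_0|auto].
Qed.

Lemma small_plus p q : small p -> small q -> small (fun h => p h + q h)%C.
Proof.
  intros Hp Hq eps He.
  destruct (Hp (eps / 2)) as [d1 [P1 Q1]]; [lra|]. destruct (Hq (eps / 2)) as [d2 [P2 Q2]]; [lra|].
  exists (Rmin d1 d2). split; [apply Rmin_pos; auto|]. intros h Hh.
  eapply Rle_trans; [apply Cmod_triangle|].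
  specialize (Q1 h (Rlt_le_trans _ _ _ Hh (Rmin_l _ _))).
  specialize (Q2 h (Rlt_le_trans _ _ _ Hh (Rmin_r _ _))). lra.
Qed.

Lemma small_mult_bounded p q (M d : R) :
  0 < d -> (forall h, Cmod h < d -> Cmod (q h) <= M) -> small p -> small (fun h => p h * q h)%C.
Proof.
  intros Hd HM Hp eps He.
  assert (HM0 : 0 <= M) by (eapply Rle_trans; [apply Cmod_ge_0|apply (HM 0%C); rewrite Cmod_0; lra]).
  destruct (Hp (eps / (M + 1))) as [d1 [P1 Q1]]; [apply Rdiv_lt_0_compat; lra|].
  exists (Rmin d1 d). split; [apply Rmin_pos; auto|]. intros h Hh.
  rewrite Cmod_mult.
  specialize (Q1 h (Rlt_le_trans _ _ _ Hh (Rmin_l _ _))).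
  specialize (HM h (Rlt_le_trans _ _ _ Hh (Rmin_r _ _))).
  pose proof (Cmod_ge_0 (p h)). pose proof (Cmod_ge_0 (q h)).
  apply Rle_trans with (eps / (M + 1) * (M + 1)); [apply Rmult_le_compat; lra|].
  right; field; lra.
Qed.

Lemma small_bounded p : small p -> exists d, 0 < d /\ forall h, Cmod h < d -> Cmod (p h) <= 1.
Proof. intros H. apply (H 1). lra. Qed.

Lemma small_id : small (fun h => h).
Proof. intros eps He. exists eps. split; [exact He|]. intros; lra. Qed.

Lemma small_ext p q : (forall h, p h = q h) -> small p -> small q.
Proof.
  intros E H eps He. destruct (H eps He) as [d [Hd Hh]]. exists d; split; auto.
  intros h Hlt; rewrite <- E; auto.
Qed.

Lemma small_cmult c p : small p -> small (fun h => c * p h)%C.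
Proof.
  intros H. apply small_ext with (fun h => p h * c)%C; [intros; ring|].
  apply (small_mult_bounded p (fun _ => c) (Cmod c) 1); auto; [lra|intros; lra].
Qed.

Lemma small_comp p q : small p -> small q -> small (fun h => p (q h)).
Proof.
  intros Hp Hq eps He. destruct (Hp eps He) as [d [Hd Hh]].
  destruct (Hq (d / 2)) as [d' [Hd' Hh']]; [lra|]. exists d'; split; auto.
  intros h Hlt. apply Hh. specialize (Hh' h Hlt). lra.
Qed.

Lemma Cder_const c z : Cder (fun _ => c) z (RtoC 0).
Proof.
  apply Cder_small. exists (fun _ => RtoC 0). split; [|intros; ring].
  intros eps He. exists 1. split; [lra|]. intros. rewrite Cmod_0. lra.
Qed.

Lemma Cder_id z : Cder (fun x => x) z 1%C.
Proof.
  apply Cder_small. exists (fun _ => RtoC 0). split; [|intros; ring].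
  intros eps He. exists 1. split; [lra|]. intros. rewrite Cmod_0. lra.
Qed.

Lemma Cder_plus f g z l k : Cder f z l -> Cder g z k -> Cder (fun x => f x + g x)%C z (l + k)%C.
Proof.
  rewrite !Cder_small. intros [p [Hp Ep]] [q [Hq Eq]].
  exists (fun h => p h + q h)%C. split; [apply small_plus; auto|].
  intros h. rewrite Ep, Eq. ring.
Qed.

Lemma Cder_mult f g z l k :
  Cder f z l -> Cder g z k -> Cder (fun x => f x * g x)%C z (l * g z + f z * k)%C.
Proof.
  rewrite !Cder_small. intros [p [Hp Ep]] [q [Hq Eq]].
  (* The coefficient of [h] beyond [l * g z + f z * k] in the product of the two expansions,
     arranged so that every summand is visibly small. *)
  exists (fun h => (f z * q h + (g z * p h + (l * k) * h)) + ((k * p h + l * q h) * h + (p h * q h) * h))%C.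
  split.
  - repeat apply small_plus; try apply small_cmult; auto; try apply small_id.
    + apply (small_mult_bounded _ (fun h => h) 1 1); try lra; [intros; lra|].
      apply small_plus; apply small_cmult; auto.
    + apply (small_mult_bounded _ (fun h => h) 1 1); try lra; [intros; lra|].
      destruct (small_bounded _ Hq) as [d [Hd Hb]]. apply (small_mult_bounded _ _ 1 d); auto.
  - intros h. rewrite Ep, Eq. ring.
Qed.

Lemma Cder_comp f g z l k : Cder f (g z) l -> Cder g z k -> Cder (fun x => f (g x)) z (l * k)%C.
Proof.
  rewrite !Cder_small. intros [p [Hp Ep]] [q [Hq Eq]].
  destruct (small_bounded _ Hq) as [d [Hd Hb]].
  assert (Hbd : forall h, Cmod h < d -> Cmod (k + q h) <= Cmod k + 1).
  { intros h Hh. eapply Rle_trans; [apply Cmod_triangle|]. specialize (Hb h Hh). lra. }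
  exists (fun h => l * q h + p ((k + q h) * h) * (k + q h))%C. split.
  - apply small_plus; [apply small_cmult; auto|].
    apply (small_mult_bounded _ _ (Cmod k + 1) d); auto.
    apply (small_comp p (fun h => (k + q h) * h)%C Hp).
    apply small_ext with (fun h => h * (k + q h))%C; [intros; ring|].
    apply (small_mult_bounded (fun h => h) _ (Cmod k + 1) d); auto. apply small_id.
  - intros h. rewrite Eq, Ep. ring.
Qed.

Lemma Cder_unique_val f z l k : Cder f z l -> l = k -> Cder f z k.
Proof. intros H <-; exact H. Qed.

Lemma Cder_ext_loc f g z l (d : R) :
  0 < d -> (forall h, Cmod h < d -> f (z + h)%C = g (z + h)%C) -> Cder f z l -> Cder g z l.
Proof.
  intros Hd E H eps He. destruct (H eps He) as [d' [Hd' Hh]].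
  exists (Rmin d d'). split; [apply Rmin_pos; auto|]. intros h Hlt.
  rewrite <- E by (eapply Rlt_le_trans; [exact Hlt|apply Rmin_l]).
  replace (g z) with (g (z + 0)%C) by (f_equal; ring).
  rewrite <- E by (rewrite Cmod_0; auto). replace (z + 0)%C with z by ring.
  apply Hh. eapply Rlt_le_trans; [exact Hlt|apply Rmin_r].
Qed.

Lemma Cder_ext f g z l : (forall x, f x = g x) -> Cder f z l -> Cder g z l.
Proof. intros E. apply (Cder_ext_loc _ _ _ _ 1); [lra|auto]. Qed.

Lemma Cder_cmult c f z l : Cder f z l -> Cder (fun x => c * f x)%C z (c * l)%C.
Proof.
  intros H. eapply Cder_unique_val; [apply (Cder_mult _ _ _ _ _ (Cder_const c z) H)|]. ring.
Qed.

Lemma Cder_opp f z l : Cder f z l -> Cder (fun x => - f x)%C z (- l)%C.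
Proof.
  intros H. apply Cder_ext with (fun x => (-(1)) * f x)%C; [intros; ring|].
  eapply Cder_unique_val; [apply Cder_cmult; exact H|]. ring.
Qed.

Lemma Cder_minus f g z l k : Cder f z l -> Cder g z k -> Cder (fun x => f x - g x)%C z (l - k)%C.
Proof. intros. apply Cder_plus; [|apply Cder_opp]; auto. Qed.

Lemma Cder_continuous f z l : Cder f z l ->
  forall eps, 0 < eps -> exists del, 0 < del /\ forall h, Cmod h < del -> Cmod (f (z + h) - f z)%C < eps.
Proof.
  intros H eps He. destruct (H 1) as [d [Hd Hh]]; [lra|].
  pose proof (Cmod_ge_0 l).
  exists (Rmin d (eps / (Cmod l + 2))). split.
  { apply Rmin_pos; auto. apply Rdiv_lt_0_compat; lra. }
  intros h Hlt. specialize (Hh h (Rlt_le_trans _ _ _ Hlt (Rmin_l _ _))).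
  pose proof (Rlt_le_trans _ _ _ Hlt (Rmin_r _ _)) as Hs.
  replace (f (z + h) - f z)%C with ((f (z + h) - f z - l * h) + l * h)%C by ring.
  eapply Rle_lt_trans; [apply Cmod_triangle|]. rewrite Cmod_mult.
  pose proof (Cmod_ge_0 h).
  apply Rle_lt_trans with ((Cmod l + 1) * Cmod h); [lra|].
  apply Rle_lt_trans with ((Cmod l + 1) * (eps / (Cmod l + 2))); [apply Rmult_le_compat_l; lra|].
  apply Rlt_le_trans with ((Cmod l + 2) * (eps / (Cmod l + 2))); [|right; field; lra].
  apply Rmult_lt_compat_r; [apply Rdiv_lt_0_compat; lra|lra].
Qed.

Lemma Cder_inv (z : C) : z <> RtoC 0 -> Cder (fun x => / x)%C z (- / (z * z))%C.
Proof.
  intros Hz. assert (Hc := proj1 (Cmod_gt_0 z) Hz). intros eps He.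
  (* The error is [h^2 / (z^2 (z + h))], and [|h| <= |z|/2] gives [|z + h| >= |z|/2]. *)
  set (K := 2 / (Cmod z ^ 3)).
  assert (HK : 0 < K) by (apply Rdiv_lt_0_compat; [lra|apply pow_lt; auto]).
  exists (Rmin (Cmod z / 2) (eps / K)). split.
  { apply Rmin_pos; [lra|apply Rdiv_lt_0_compat; lra]. }
  intros h Hh. assert (H1 := Rlt_le_trans _ _ _ Hh (Rmin_l _ _)).
  assert (H2 := Rlt_le_trans _ _ _ Hh (Rmin_r _ _)).
  assert (Hb : Cmod z / 2 <= Cmod (z + h)).
  { pose proof (Cmod_sub_rev z (- h)). replace (z - - h)%C with (z + h)%C in H by ring.
    rewrite Cmod_opp in H. lra. }
  assert (Hn : (z + h)%C <> 0%C) by (apply Cmod_gt_0; lra).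
  replace (/ (z + h) - / z - - / (z * z) * h)%C with (h * h / ((z * z) * (z + h)))%C by (field; auto).
  rewrite Cmod_div by (repeat apply Cmult_neq_0; auto). rewrite !Cmod_mult.
  assert (Hk : Cmod h / (Cmod z * Cmod z * Cmod (z + h)) <= eps).
  { apply Rle_trans with (Cmod h * K).
    - unfold Rdiv. apply Rmult_le_compat_l; [apply Cmod_ge_0|].
      unfold K. replace (2 / Cmod z ^ 3) with (/ (Cmod z * Cmod z * (Cmod z / 2))) by (field; lra).
      apply Rinv_le_contravar; [repeat apply Rmult_lt_0_compat; lra|].
      apply Rmult_le_compat_l; [apply Rmult_le_pos; lra|lra].
    - apply Rle_trans with (eps / K * K); [apply Rmult_le_compat_r; lra|]. right; field; lra. }
  unfold Rdiv in *. rewrite (Rmult_assoc (Cmod h)), Rmult_comm.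
  apply Rmult_le_compat_r; [apply Cmod_ge_0|exact Hk].
Qed.

Lemma Cder_pow n z : Cder (fun x => x ^ S n)%C z (RtoC (INR (S n)) * z ^ n)%C.
Proof.
  induction n as [|n IH].
  - apply Cder_ext with (fun x => x); [intros; simpl; ring|].
    eapply Cder_unique_val; [apply Cder_id|]. simpl. ring.
  - apply Cder_ext with (fun x => x * x ^ S n)%C; [intros; reflexivity|].
    eapply Cder_unique_val; [apply (Cder_mult _ _ _ _ _ (Cder_id z) IH)|].
    rewrite (S_INR (S n)), RtoC_plus. simpl (z ^ S n)%C. ring.
Qed.

(** Functions of a real variable are handled componentwise, so that the real
    library applies directly. *)
Definition Rder (f : R -> C) (x : R) (l : C) : Prop :=
  is_derive (fun t => Re (f t)) x (Re l) /\ is_derive (fun t => Im (f t)) x (Im l).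

Definition cont (f : R -> C) (x : R) : Prop :=
  continuous (fun t => Re (f t)) x /\ continuous (fun t => Im (f t)) x.

Definition CI (f : R -> C) (a b : R) : C :=
  (RInt (fun t => Re (f t)) a b, RInt (fun t => Im (f t)) a b).

Lemma is_derive_eps (f : R -> R) x l :
  is_derive f x l <-> forall eps, 0 < eps -> exists del, 0 < del /\
    forall h, Rabs h < del -> Rabs (f (x + h) - f x - l * h) <= eps * Rabs h.
Proof.
  split.
  - intros [_ H] eps He.
    assert (Hl : is_filter_lim (locally x) x) by (intros P HP; exact HP).
    destruct (H x Hl (mkposreal _ He)) as [d Hd]. exists d. split; [apply cond_pos|].
    intros h Hh. assert (Hb : ball x d (x + h)).
    { change (Rabs (x + h - x) < d). replace (x + h - x) with h by ring. exact Hh. }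
    specialize (Hd _ Hb). change (Rabs (f (x + h) - f x - (x + h - x) * l) <= eps * Rabs (x + h - x)) in Hd.
    replace (x + h - x) with h in Hd by ring. rewrite (Rmult_comm l). exact Hd.
  - intros H. split; [apply is_linear_scal_l|].
    intros y Hy eps. assert (y = x) as ->.
    { symmetry. apply is_filter_lim_locally_unique. exact Hy. }
    destruct (H eps (cond_pos eps)) as [d [Hd Hh]]. exists (mkposreal _ Hd). intros t0 Ht. pose (t := (t0 : R)).
    specialize (Hh (t - x) Ht). change (Rabs (f t - f x - (t - x) * l) <= eps * Rabs (t - x)).
    replace (x + (t - x)) with t in Hh by ring. rewrite (Rmult_comm _ l). exact Hh.
Qed.

Lemma Rder_eps f x l :
  Rder f x l <-> forall eps, 0 < eps -> exists del, 0 < del /\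
    forall h, Rabs h < del -> Cmod (f (x + h) - f x - l * RtoC h) <= eps * Rabs h.
Proof.
  unfold Rder. rewrite !is_derive_eps. split.
  - intros [H1 H2] eps He.
    destruct (H1 (eps / 2)) as [d1 [P1 Q1]]; [lra|]. destruct (H2 (eps / 2)) as [d2 [P2 Q2]]; [lra|].
    exists (Rmin d1 d2). split; [apply Rmin_pos; auto|]. intros h Hh.
    specialize (Q1 h (Rlt_le_trans _ _ _ Hh (Rmin_l _ _))).
    specialize (Q2 h (Rlt_le_trans _ _ _ Hh (Rmin_r _ _))).
    eapply Rle_trans; [apply Cmod_le_sum|].
    replace (Re (f (x + h)%R - f x - l * RtoC h)) with (Re (f (x + h)%R) - Re (f x) - Re l * h) by (unfold Re, Im; simpl; ring).
    replace (Im (f (x + h)%R - f x - l * RtoC h)) with (Im (f (x + h)%R) - Im (f x) - Im l * h) by (unfold Re, Im; simpl; ring).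
    lra.
  - intros H; split; intros eps He; destruct (H eps He) as [d [Hd Hh]]; exists d; split; auto;
      intros h Hlt; eapply Rle_trans; [| apply (Hh h Hlt) | | apply (Hh h Hlt)].
    + eapply Rle_trans; [|apply re_le_Cmod]. right. f_equal. unfold Re, Im; simpl; ring.
    + eapply Rle_trans; [|apply im_le_Cmod]. right. f_equal. unfold Re, Im; simpl; ring.
Qed.

Lemma Rder_val f x l k : Rder f x l -> l = k -> Rder f x k.
Proof. intros H <-; exact H. Qed.

Ltac creim := unfold Re, Im; simpl.

Lemma Rder_const c x : Rder (fun _ => c) x (RtoC 0).
Proof. split; simpl; apply @is_derive_const. Qed.

Lemma Rder_id x : Rder RtoC x (RtoC 1).
Proof. split; simpl; [apply @is_derive_id|apply @is_derive_const]. Qed.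

Lemma Rder_plus f g x l k : Rder f x l -> Rder g x k -> Rder (fun t => f t + g t)%C x (l + k)%C.
Proof.
  intros [H1 H2] [H3 H4]. split; [apply (is_derive_plus _ _ _ _ _ H1 H3)|apply (is_derive_plus _ _ _ _ _ H2 H4)].
Qed.

Lemma Rder_opp f x l : Rder f x l -> Rder (fun t => - f t)%C x (- l)%C.
Proof. intros [H1 H2]. split; [apply (is_derive_opp _ _ _ H1)|apply (is_derive_opp _ _ _ H2)]. Qed.

Lemma Rder_minus f g x l k : Rder f x l -> Rder g x k -> Rder (fun t => f t - g t)%C x (l - k)%C.
Proof. intros. apply Rder_plus; [|apply Rder_opp]; auto. Qed.

Lemma Rder_mult f g x l k :
  Rder f x l -> Rder g x k -> Rder (fun t => f t * g t)%C x (l * g x + f x * k)%C.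
Proof.
  intros [H1 H2] [H3 H4]. split.
  - apply is_derive_ext with (fun t => Re (f t) * Re (g t) - Im (f t) * Im (g t)); [intros; reflexivity|].
    evar_last.
    + exact (is_derive_minus _ _ x _ _
        (is_derive_mult (fun t => Re (f t)) (fun t => Re (g t)) x _ _ H1 H3 Rmult_comm)
        (is_derive_mult (fun t => Im (f t)) (fun t => Im (g t)) x _ _ H2 H4 Rmult_comm)).
    + unfold minus, plus, opp, mult; creim. ring.
  - apply is_derive_ext with (fun t => Re (f t) * Im (g t) + Im (f t) * Re (g t)); [intros; reflexivity|].
    evar_last.
    + exact (is_derive_plus _ _ x _ _
        (is_derive_mult (fun t => Re (f t)) (fun t => Im (g t)) x _ _ H1 H4 Rmult_comm)
        (is_derive_mult (fun t => Im (f t)) (fun t => Re (g t)) x _ _ H2 H3 Rmult_comm)).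
    + unfold plus, mult; creim. ring.
Qed.

Lemma Rder_cmult c f x l : Rder f x l -> Rder (fun t => c * f t)%C x (c * l)%C.
Proof. intros H. eapply Rder_val; [apply (Rder_mult _ _ _ _ _ (Rder_const c x) H)|]. ring. Qed.

Lemma Rder_ext f g x l : (forall t, f t = g t) -> Rder f x l -> Rder g x l.
Proof.
  intros E [H1 H2]. split; eapply is_derive_ext; try eassumption; intros; simpl; rewrite E; reflexivity.
Qed.

Lemma Rder_ext_loc f g x l (d : R) :
  0 < d -> (forall t, Rabs (t - x) < d -> f t = g t) -> Rder f x l -> Rder g x l.
Proof.
  intros Hd E [H1 H2].
  split; (eapply is_derive_ext_loc; [|eassumption]; exists (mkposreal _ Hd); intros t Ht; rewrite E; auto).
Qed.

Lemma Rder_RtoC (g : R -> R) x l : is_derive g x l -> Rder (fun t => RtoC (g t)) x (RtoC l).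
Proof. intros H. split; simpl; [exact H|apply @is_derive_const]. Qed.

Lemma Rder_comp_real f (g : R -> R) x l k :
  Rder f (g x) l -> is_derive g x k -> Rder (fun t => f (g t)) x (l * RtoC k)%C.
Proof.
  intros [H1 H2] Hg.
  split; (evar_last; [eapply (is_derive_comp (fun t => _ (f t)) g); eassumption|]);
    unfold scal; simpl; unfold mult; creim; ring.
Qed.

Lemma Rder_comp_Cder f g x l k : Cder f (g x) l -> Rder g x k -> Rder (fun t => f (g t)) x (l * k)%C.
Proof.
  intros Hf Hg. apply Rder_eps. intros eps He. rewrite Rder_eps in Hg.
  pose proof (Cmod_ge_0 l) as Pl. pose proof (Cmod_ge_0 k) as Pk.
  destruct (Hf (eps / (2 * (Cmod k + 1)))) as [d1 [P1 Q1]]; [apply Rdiv_lt_0_compat; lra|].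
  destruct (Hg (Rmin 1 (eps / (2 * (Cmod l + 1))))) as [d2 [P2 Q2]].
  { apply Rmin_pos; [lra|apply Rdiv_lt_0_compat; lra]. }
  exists (Rmin d2 (d1 / (Cmod k + 1))). split; [apply Rmin_pos; [auto|apply Rdiv_lt_0_compat; lra]|].
  intros h Hh. specialize (Q2 h (Rlt_le_trans _ _ _ Hh (Rmin_l _ _))).
  pose proof (Rlt_le_trans _ _ _ Hh (Rmin_r _ _)) as Hh2.
  pose proof (Rabs_pos h) as Ph.
  set (w := (g (x + h)%R - g x)%C) in *.
  assert (Q2a : Cmod (w - k * RtoC h) <= 1 * Rabs h).
  { eapply Rle_trans; [exact Q2|]. apply Rmult_le_compat_r; [lra|apply Rmin_l]. }
  assert (Q2b : Cmod (w - k * RtoC h) <= eps / (2 * (Cmod l + 1)) * Rabs h).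
  { eapply Rle_trans; [exact Q2|]. apply Rmult_le_compat_r; [lra|apply Rmin_r]. }
  assert (Hw : Cmod w <= (Cmod k + 1) * Rabs h).
  { replace w with ((w - k * RtoC h) + k * RtoC h)%C by ring.
    eapply Rle_trans; [apply Cmod_triangle|]. rewrite Cmod_mult, Cmod_R. lra. }
  assert (Hw1 : Cmod w < d1).
  { eapply Rle_lt_trans; [exact Hw|].
    apply Rlt_le_trans with ((Cmod k + 1) * (d1 / (Cmod k + 1))); [apply Rmult_lt_compat_l; lra|right; field; lra]. }
  specialize (Q1 w Hw1). replace (g x + w)%C with (g (x + h)%R) in Q1 by (unfold w; ring).
  replace (f (g (x + h)%R) - f (g x) - l * k * RtoC h)%C
    with ((f (g (x + h)%R) - f (g x) - l * w) + l * (w - k * RtoC h))%C by ring.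
  eapply Rle_trans; [apply Cmod_triangle|]. rewrite Cmod_mult.
  replace (eps * Rabs h) with (eps / (2 * (Cmod k + 1)) * ((Cmod k + 1) * Rabs h) + (Cmod l + 1) * (eps / (2 * (Cmod l + 1)) * Rabs h)) by (field; lra).
  apply Rplus_le_compat.
  - eapply Rle_trans; [exact Q1|]. apply Rmult_le_compat_l; [|exact Hw].
    apply Rlt_le, Rdiv_lt_0_compat; lra.
  - apply Rmult_le_compat; [lra|apply Cmod_ge_0|lra|exact Q2b].
Qed.

Lemma cont_eps f x :
  cont f x <-> forall eps, 0 < eps -> exists del, 0 < del /\
    forall t, Rabs (t - x) < del -> Cmod (f t - f x) < eps.
Proof.
  split.
  - intros [H1 H2] eps He. assert (He2 : 0 < eps / 2) by lra.
    destruct (proj1 (filterlim_locally _ _) H1 (mkposreal _ He2)) as [d1 Q1].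
    destruct (proj1 (filterlim_locally _ _) H2 (mkposreal _ He2)) as [d2 Q2].
    exists (Rmin d1 d2). split; [apply Rmin_pos; apply cond_pos|]. intros t Ht.
    specialize (Q1 t (Rlt_le_trans _ _ _ Ht (Rmin_l _ _))).
    specialize (Q2 t (Rlt_le_trans _ _ _ Ht (Rmin_r _ _))).
    change (Rabs (Re (f t) - Re (f x)) < eps / 2) in Q1.
    change (Rabs (Im (f t) - Im (f x)) < eps / 2) in Q2.
    eapply Rle_lt_trans; [apply Cmod_le_sum|]. creim. unfold Re, Im in Q1, Q2. unfold Rminus in *. lra.
  - intros H; split; apply filterlim_locally; intros e; destruct (H e (cond_pos e)) as [d [Hd Hh]];
      exists (mkposreal _ Hd); intros t Ht; (eapply Rle_lt_trans; [|apply (Hh t Ht)]);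
      [eapply Rle_trans; [|apply re_le_Cmod]|eapply Rle_trans; [|apply im_le_Cmod]]; right; reflexivity.
Qed.

Lemma Rder_cont f x l : Rder f x l -> cont f x.
Proof.
  intros [H1 H2]. split; (apply (ex_derive_continuous (V:=R_NormedModule)); eexists; eassumption).
Qed.

Lemma cont_const c x : cont (fun _ => c) x.
Proof. split; apply continuous_const. Qed.

Lemma cont_RtoC (g : R -> R) x : continuous g x -> cont (fun t => RtoC (g t)) x.
Proof. intros H; split; simpl; [exact H|apply continuous_const]. Qed.

Lemma cont_plus f g x : cont f x -> cont g x -> cont (fun t => f t + g t)%C x.
Proof. intros [H1 H2] [H3 H4]. split; apply @continuous_plus; auto. Qed.

Lemma cont_opp f x : cont f x -> cont (fun t => - f t)%C x.
Proof. intros [H1 H2]. split; apply @continuous_opp; auto. Qed.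

Lemma cont_minus f g x : cont f x -> cont g x -> cont (fun t => f t - g t)%C x.
Proof. intros. apply cont_plus; [|apply cont_opp]; auto. Qed.

Lemma cont_mult f g x : cont f x -> cont g x -> cont (fun t => f t * g t)%C x.
Proof.
  intros [H1 H2] [H3 H4]. split.
  - apply (continuous_minus (fun t => Re (f t) * Re (g t)) (fun t => Im (f t) * Im (g t)));
      apply (@continuous_mult _ R_AbsRing); auto.
  - apply (continuous_plus (fun t => Re (f t) * Im (g t)) (fun t => Im (f t) * Re (g t)));
      apply (@continuous_mult _ R_AbsRing); auto.
Qed.

Lemma cont_pow f n x : cont f x -> cont (fun t => f t ^ n)%C x.
Proof. intros H. induction n as [|n IH]; [apply cont_const|apply (cont_mult _ _ _ H IH)]. Qed.

Lemma cont_comp_real f (g : R -> R) x : cont f (g x) -> continuous g x -> cont (fun t => f (g t)) x.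
Proof.
  intros [H1 H2] Hg. split; [apply (continuous_comp g (fun y => Re (f y)))|apply (continuous_comp g (fun y => Im (f y)))]; auto.
Qed.

Lemma cont_comp_Cder f g x l : cont g x -> Cder f (g x) l -> cont (fun t => f (g t)) x.
Proof.
  intros Hg Hf. rewrite cont_eps in *. intros eps He.
  destruct (Cder_continuous _ _ _ Hf eps He) as [d [Hd Hh]].
  destruct (Hg d Hd) as [d' [Hd' Hh']]. exists d'. split; auto. intros t Ht.
  specialize (Hh (g t - g x)%C (Hh' t Ht)). replace (g x + (g t - g x))%C with (g t) in Hh by ring. exact Hh.
Qed.

Lemma cont_ext f g x : (forall t, f t = g t) -> cont f x -> cont g x.
Proof.
  intros E [H1 H2]. split.
  - apply (continuous_ext (fun t => Re (f t))); auto. intros; rewrite E; auto.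
  - apply (continuous_ext (fun t => Im (f t))); auto. intros; rewrite E; auto.
Qed.

Lemma cont_Cmod f x : cont f x -> continuous (fun t => Cmod (f t)) x.
Proof.
  intros H. rewrite cont_eps in H. apply filterlim_locally. intros e.
  destruct (H e (cond_pos e)) as [d [Hd Hh]]. exists (mkposreal _ Hd). intros t Ht.
  eapply Rle_lt_trans; [|apply (Hh t Ht)]. change (Rabs (Cmod (f t) - Cmod (f x)) <= Cmod (f t - f x)).
  apply Rabs_le. split; [|apply Cmod_sub_rev].
  rewrite Cmod_sub_sym. pose proof (Cmod_sub_rev (f x) (f t)). lra.
Qed.

(** * Integrals over segments and mean value inequalities *)

Definition contI (f : R -> C) a b := forall x, a <= x <= b -> cont f x.

Lemma contI_sub f a b a' b' : a <= a' -> b' <= b -> contI f a b -> contI f a' b'.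
Proof. intros H1 H2 H x Hx. apply H. lra. Qed.

Lemma ex_RInt_Re f a b : a <= b -> contI f a b -> ex_RInt (fun t => Re (f t)) a b.
Proof.
  intros Hab H. apply (ex_RInt_continuous (V:=R_CompleteNormedModule)). intros z Hz.
  rewrite Rmin_left, Rmax_right in Hz by lra. apply (H z Hz).
Qed.

Lemma ex_RInt_Im f a b : a <= b -> contI f a b -> ex_RInt (fun t => Im (f t)) a b.
Proof.
  intros Hab H. apply (ex_RInt_continuous (V:=R_CompleteNormedModule)). intros z Hz.
  rewrite Rmin_left, Rmax_right in Hz by lra. apply (H z Hz).
Qed.

Lemma is_RInt_CI f a b : a <= b -> contI f a b -> is_RInt (V:=C_R_NormedModule) f a b (CI f a b).
Proof.
  intros Hab H. apply (is_RInt_fct_extend_pair (U:=R_NormedModule) (V:=R_NormedModule)).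
  - apply (RInt_correct (V:=R_CompleteNormedModule)). apply ex_RInt_Re; auto.
  - apply (RInt_correct (V:=R_CompleteNormedModule)). apply ex_RInt_Im; auto.
Qed.

Lemma CI_unique f a b l : is_RInt (V:=C_R_NormedModule) f a b l -> CI f a b = l.
Proof.
  intros H. apply Ceq; simpl; apply is_RInt_unique.
  - apply (is_RInt_fct_extend_fst (U:=R_NormedModule) (V:=R_NormedModule) _ _ _ _ H).
  - apply (is_RInt_fct_extend_snd (U:=R_NormedModule) (V:=R_NormedModule) _ _ _ _ H).
Qed.

Lemma CI_ext f g a b : a <= b -> (forall x, a < x < b -> f x = g x) -> CI f a b = CI g a b.
Proof.
  intros Hab E. unfold CI. f_equal; apply RInt_ext; intros x Hx; rewrite Rmin_left, Rmax_right in Hx by lra; rewrite E; auto.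
Qed.

Lemma CI_plus f g a b : a <= b -> contI f a b -> contI g a b ->
  CI (fun t => f t + g t)%C a b = (CI f a b + CI g a b)%C.
Proof.
  intros Hab Hf Hg. apply CI_unique.
  apply (is_RInt_plus (V:=C_R_NormedModule)); apply is_RInt_CI; auto.
Qed.

Lemma CI_cmult c f a b : a <= b -> contI f a b -> CI (fun t => c * f t)%C a b = (c * CI f a b)%C.
Proof.
  intros Hab Hf. pose proof (ex_RInt_Re _ _ _ Hab Hf) as H1. pose proof (ex_RInt_Im _ _ _ Hab Hf) as H2.
  apply (RInt_correct (V:=R_CompleteNormedModule)) in H1. apply (RInt_correct (V:=R_CompleteNormedModule)) in H2.
  apply Ceq; unfold CI; creim; apply is_RInt_unique.
  - apply (is_RInt_ext (V:=R_NormedModule) (fun t => Re c * Re (f t) - Im c * Im (f t))); [intros x _; reflexivity|].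
    apply (is_RInt_minus (V:=R_NormedModule) _ _ a b _ _ (is_RInt_scal (V:=R_NormedModule) _ a b (Re c) _ H1)
      (is_RInt_scal (V:=R_NormedModule) _ a b (Im c) _ H2)).
  - apply (is_RInt_ext (V:=R_NormedModule) (fun t => Re c * Im (f t) + Im c * Re (f t))); [intros x _; reflexivity|].
    apply (is_RInt_plus (V:=R_NormedModule) _ _ a b _ _ (is_RInt_scal (V:=R_NormedModule) _ a b (Re c) _ H2)
      (is_RInt_scal (V:=R_NormedModule) _ a b (Im c) _ H1)).
Qed.

Lemma contI_cmult c f a b : contI f a b -> contI (fun t => c * f t)%C a b.
Proof. intros H x Hx. apply cont_mult; [apply cont_const|auto]. Qed.

Lemma CI_opp f a b : a <= b -> contI f a b -> CI (fun t => - f t)%C a b = (- CI f a b)%C.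
Proof.
  intros Hab Hf. rewrite (CI_ext _ (fun t => (-(1)) * f t)%C); [|auto|intros; ring].
  rewrite CI_cmult by auto. ring.
Qed.

Lemma CI_minus f g a b : a <= b -> contI f a b -> contI g a b ->
  CI (fun t => f t - g t)%C a b = (CI f a b - CI g a b)%C.
Proof.
  intros Hab Hf Hg. unfold Cminus. rewrite CI_plus; auto.
  - rewrite CI_opp; auto.
  - intros x Hx. apply cont_opp; auto.
Qed.

Lemma CI_chasles f a b c : a <= b -> b <= c -> contI f a c -> (CI f a b + CI f b c)%C = CI f a c.
Proof.
  intros Hab Hbc H.
  assert (H1 : contI f a b) by (apply (contI_sub f a c); auto; lra).
  assert (H2 : contI f b c) by (apply (contI_sub f a c); auto; lra).
  apply Ceq; simpl; apply (RInt_Chasles (V:=R_CompleteNormedModule)); auto using ex_RInt_Re, ex_RInt_Im.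
Qed.

Lemma CI_point f a : CI f a a = RtoC 0.
Proof. apply Ceq; simpl; apply (RInt_point (V:=R_CompleteNormedModule)). Qed.

Lemma CI_FTC f g a b : a <= b -> (forall x, a <= x <= b -> Rder f x (g x)) -> contI g a b ->
  CI g a b = (f b - f a)%C.
Proof.
  intros Hab Hd Hc.
  apply Ceq; simpl; apply is_RInt_unique;
    [apply (is_RInt_derive (V:=R_CompleteNormedModule) (fun t => Re (f t)) (fun t => Re (g t)))
    |apply (is_RInt_derive (V:=R_CompleteNormedModule) (fun t => Im (f t)) (fun t => Im (g t)))];
    intros x; rewrite Rmin_left, Rmax_right by lra; intros Hx; try apply (Hd x Hx); apply (Hc x Hx).
Qed.

Lemma CI_bound f g a b lg : a <= b -> contI f a b -> (forall x, a <= x <= b -> Cmod (f x) <= g x) ->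
  is_RInt g a b lg -> Cmod (CI f a b) <= lg.
Proof.
  intros Hab Hc Hg HI. rewrite <- Cmod_prod_norm.
  apply (norm_RInt_le (V:=C_R_NormedModule) f g a b); auto.
  - intros. rewrite Cmod_prod_norm; auto.
  - apply is_RInt_CI; auto.
Qed.

Lemma CI_bound_const f M a b : a <= b -> contI f a b -> (forall x, a <= x <= b -> Cmod (f x) <= M) ->
  Cmod (CI f a b) <= M * (b - a).
Proof.
  intros Hab Hc HM. apply (CI_bound f (fun _ => M)); auto.
  replace (M * (b - a)) with (scal (b - a) M) by (unfold scal; simpl; unfold mult; simpl; ring).
  apply @is_RInt_const.
Qed.

Lemma CI_const c a b : a <= b -> CI (fun _ => c) a b = (RtoC (b - a) * c)%C.
Proof.
  intros Hab. apply Ceq; unfold CI; creim; rewrite RInt_const; unfold scal; simpl; unfold mult; simpl; ring.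
Qed.

Lemma RInt_bounded_R (f f' : R -> R) a b K : a <= b -> 0 <= K ->
  (forall x, a <= x <= b -> continuous f x) -> (forall x, a < x < b -> is_derive f x (f' x)) ->
  (forall x, a < x < b -> Rabs (f' x) <= K) -> Rabs (f b - f a) <= K * (b - a).
Proof.
  intros Hab HK Hc Hd Hb.
  (* [MVT_gen] yields an intermediate point of the closed interval, while [f'] is controlled only
     inside; setting the derivative to 0 elsewhere makes the bound valid at every such point. *)
  set (df := fun x => if Rlt_dec a x then if Rlt_dec x b then f' x else 0 else 0).
  destruct (MVT_gen f a b df) as [c [Hc1 Hc2]]; rewrite ?Rmin_left, ?Rmax_right by lra.
  - intros x Hx. unfold df. destruct (Rlt_dec a x); [|lra]. destruct (Rlt_dec x b); [|lra]. auto.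
  - intros x Hx. apply continuity_pt_filterlim. apply Hc; auto.
  - rewrite Hc2, Rabs_mult, (Rabs_pos_eq (b - a)) by lra. apply Rmult_le_compat_r; [lra|].
    unfold df. destruct (Rlt_dec a c); [destruct (Rlt_dec c b)|]; auto; rewrite Rabs_R0; auto.
Qed.

(** The mean value theorem fails for complex values, so the inequality is applied to the real and
    imaginary parts separately, which costs the factor 2. Derivatives are asked for in the interior
    only, because jets and real powers offer none at 0. *)
Lemma C_MVT f f' a b K : a <= b -> contI f a b -> (forall x, a < x < b -> Rder f x (f' x)) ->
  (forall x, a < x < b -> Cmod (f' x) <= K) -> Cmod (f b - f a) <= 2 * K * (b - a).
Proof.
  intros Hab Hc Hd Hb. destruct (Req_dec a b) as [->|Hne].
  { replace (f b - f b)%C with (RtoC 0) by ring. rewrite Cmod_0. lra. }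
  assert (HK : 0 <= K) by (eapply Rle_trans; [apply Cmod_ge_0|apply (Hb ((a + b) / 2)); lra]).
  eapply Rle_trans; [apply Cmod_le_sum|].
  assert (H1 : Rabs (Re (f b) - Re (f a)) <= K * (b - a)).
  { apply (RInt_bounded_R (fun t => Re (f t)) (fun t => Re (f' t))); auto.
    - intros x Hx; apply (Hc x Hx).
    - intros x Hx; apply (Hd x Hx).
    - intros x Hx. eapply Rle_trans; [apply re_le_Cmod|auto]. }
  assert (H2 : Rabs (Im (f b) - Im (f a)) <= K * (b - a)).
  { apply (RInt_bounded_R (fun t => Im (f t)) (fun t => Im (f' t))); auto.
    - intros x Hx; apply (Hc x Hx).
    - intros x Hx; apply (Hd x Hx).
    - intros x Hx. eapply Rle_trans; [apply im_le_Cmod|auto]. }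
  unfold Re, Im in *; simpl; unfold Rminus in *. lra.
Qed.

Lemma C_const_of_Rder0 f a b : a <= b -> contI f a b -> (forall x, a < x < b -> Rder f x (RtoC 0)) -> f b = f a.
Proof.
  intros Hab Hc Hd. apply Ceq_minus. apply Cmod_eq_0. apply Rle_antisym; [|apply Cmod_ge_0].
  replace 0 with (2 * 0 * (b - a)) by ring.
  apply (C_MVT f (fun _ => RtoC 0)); auto. intros. rewrite Cmod_0. lra.
Qed.

(** * The complex exponential *)

Lemma Cexp_plus u v : Cexp (u + v) = (Cexp u * Cexp v)%C.
Proof. apply Ceq; unfold Cexp; creim; rewrite exp_plus, ?cos_plus, ?sin_plus; ring. Qed.

Lemma Cexp_0 : Cexp (RtoC 0) = RtoC 1.
Proof. apply Ceq; unfold Cexp; creim; rewrite exp_0, ?cos_0, ?sin_0; ring. Qed.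

Lemma Cexp_RtoC x : Cexp (RtoC x) = RtoC (exp x).
Proof. apply Ceq; unfold Cexp; creim; rewrite ?cos_0, ?sin_0; ring. Qed.

Lemma Cmod_Cexp u : Cmod (Cexp u) = exp (Re u).
Proof.
  unfold Cmod, Cexp; simpl.
  replace (exp (Re u) * cos (Im u) * (exp (Re u) * cos (Im u) * 1) + exp (Re u) * sin (Im u) * (exp (Re u) * sin (Im u) * 1))
    with (exp (Re u) * exp (Re u) * (Rsqr (sin (Im u)) + Rsqr (cos (Im u)))) by (unfold Rsqr; ring).
  rewrite sin2_cos2, Rmult_1_r. apply sqrt_square. left; apply exp_pos.
Qed.

Lemma Cexp_nz u : Cexp u <> RtoC 0.
Proof. apply Cmod_gt_0. rewrite Cmod_Cexp. apply exp_pos. Qed.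

Lemma Cexp_opp u : Cexp (- u) = (/ Cexp u)%C.
Proof.
  assert (H : (Cexp (- u) * Cexp u)%C = RtoC 1).
  { rewrite <- Cexp_plus. replace (- u + u)%C with (RtoC 0) by ring. apply Cexp_0. }
  replace (Cexp (- u)) with (Cexp (- u) * Cexp u * / Cexp u)%C by (field; apply Cexp_nz). rewrite H. ring.
Qed.

Lemma Cexp_nat n u : Cexp (RtoC (INR n) * u) = (Cexp u ^ n)%C.
Proof.
  induction n as [|n IH]; [simpl; rewrite Cmult_0_l; apply Cexp_0|].
  rewrite S_INR, RtoC_plus, Cmult_plus_distr_r, Cexp_plus, IH, Cmult_1_l. simpl. ring.
Qed.

Lemma Rder_Cexp_lin s x : Rder (fun t => Cexp (s * RtoC t)) x (s * Cexp (s * RtoC x))%C.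
Proof.
  assert (E : forall t, Cexp (s * RtoC t) = (exp (Re s * t) * cos (Im s * t), exp (Re s * t) * sin (Im s * t))).
  { intros t. unfold Cexp. rewrite re_scal_r, im_scal_r. reflexivity. }
  apply Rder_ext with (fun t => (exp (Re s * t) * cos (Im s * t), exp (Re s * t) * sin (Im s * t)) : C); [intros; rewrite E; auto|].
  rewrite E. destruct s as [p q]. split; creim; auto_derive; auto; ring.
Qed.

Lemma exp_le x y : x <= y -> exp x <= exp y.
Proof. intros [H| ->]; [left; apply exp_increasing; auto|right; auto]. Qed.

Lemma Cexp_bound_1 s : Cmod (Cexp s - 1) <= 2 * Cmod s * exp (Rabs (Re s)).
Proof.
  pose proof (C_MVT (fun t => Cexp (s * RtoC t)) (fun t => s * Cexp (s * RtoC t))%C 0 1 (Cmod s * exp (Rabs (Re s)))) as H.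
  cbv beta in H. replace (s * RtoC 1)%C with s in H by ring. replace (s * RtoC 0)%C with (RtoC 0) in H by ring.
  rewrite Cexp_0 in H. eapply Rle_trans; [apply H|right; ring]; [lra| | |].
  - intros x _. eapply Rder_cont. apply Rder_Cexp_lin.
  - intros; apply Rder_Cexp_lin.
  - intros x Hx. rewrite Cmod_mult, Cmod_Cexp. apply Rmult_le_compat_l; [apply Cmod_ge_0|].
    apply exp_le. rewrite re_scal_r. pose proof (Rle_abs (Re s)). pose proof (Rabs_pos (Re s)). nra.
Qed.

(** [C_MVT] along the segment from 0 to [s], where the derivative [s (Cexp (s x) - 1)] is bounded by
    [Cexp_bound_1]. Later differentiations of exponentials under an integral sign rest on this
    quadratic remainder. *)
Lemma Cexp_bound_2 s : Cmod (Cexp s - 1 - s) <= 4 * (Cmod s * Cmod s) * exp (Rabs (Re s)).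
Proof.
  pose proof (C_MVT (fun t => Cexp (s * RtoC t) - s * RtoC t)%C (fun t => s * Cexp (s * RtoC t) - s * RtoC 1)%C 0 1
    (2 * (Cmod s * Cmod s) * exp (Rabs (Re s)))) as H.
  cbv beta in H. replace (s * RtoC 1)%C with s in H by ring. replace (s * RtoC 0)%C with (RtoC 0) in H by ring.
  rewrite Cexp_0 in H. replace (Cexp s - 1 - s)%C with (Cexp s - s - (RtoC 1 - RtoC 0))%C by ring.
  assert (D : forall x, Rder (fun t => Cexp (s * RtoC t) - s * RtoC t)%C x (s * Cexp (s * RtoC x) - s)%C).
  { intros x. eapply Rder_val; [apply (Rder_minus _ _ _ _ _ (Rder_Cexp_lin s x) (Rder_cmult s _ _ _ (Rder_id x)))|]. ring. }
  eapply Rle_trans; [apply H|right; ring]; [lra| | |].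
  - intros x _. eapply Rder_cont. apply D.
  - intros; apply D.
  - intros x Hx. replace (s * Cexp (s * RtoC x) - s)%C with (s * (Cexp (s * RtoC x) - 1))%C by ring.
    rewrite Cmod_mult.
    apply Rle_trans with (Cmod s * (2 * Cmod s * exp (Rabs (Re s)))); [|right; ring].
    apply Rmult_le_compat_l; [apply Cmod_ge_0|]. eapply Rle_trans; [apply Cexp_bound_1|].
    rewrite Cmod_mult, Cmod_R, re_scal_r, Rabs_mult.
    pose proof (Cmod_ge_0 s). pose proof (Rabs_pos (Re s)). rewrite (Rabs_pos_eq x) by lra.
    apply Rmult_le_compat; [nra|left; apply exp_pos|nra|]. apply exp_le. nra.
Qed.

Lemma Cder_Cexp z : Cder Cexp z (Cexp z).
Proof.
  intros eps He. set (K := 4 * Cmod (Cexp z) * exp 1).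
  assert (HK : 0 < K).
  { unfold K. rewrite Cmod_Cexp. pose proof (exp_pos (Re z)). pose proof (exp_pos 1). nra. }
  exists (Rmin 1 (eps / K)). split; [apply Rmin_pos; [lra|apply Rdiv_lt_0_compat; auto]|].
  intros h Hh. pose proof (Rlt_le_trans _ _ _ Hh (Rmin_l _ _)) as H1.
  pose proof (Rlt_le_trans _ _ _ Hh (Rmin_r _ _)) as H2.
  rewrite Cexp_plus. replace (Cexp z * Cexp h - Cexp z - Cexp z * h)%C with (Cexp z * (Cexp h - 1 - h))%C by ring.
  rewrite Cmod_mult. pose proof (Cexp_bound_2 h) as H. pose proof (Cmod_ge_0 (Cexp z)). pose proof (Cmod_ge_0 h).
  apply Rle_trans with (Cmod (Cexp z) * (4 * (Cmod h * Cmod h) * exp 1)).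
  { apply Rmult_le_compat_l; auto. eapply Rle_trans; [exact H|]. apply Rmult_le_compat_l; [nra|].
    apply exp_le. pose proof (re_le_Cmod h). lra. }
  replace (Cmod (Cexp z) * (4 * (Cmod h * Cmod h) * exp 1)) with (K * Cmod h * Cmod h) by (unfold K; ring).
  apply Rmult_le_compat_r; auto.
  apply Rle_trans with (K * (eps / K)); [apply Rmult_le_compat_l; lra|right; field; lra].
Qed.

Lemma Rder_Cexp f x l : Rder f x l -> Rder (fun t => Cexp (f t)) x (Cexp (f x) * l)%C.
Proof. intros H. apply (Rder_comp_Cder Cexp f); auto. apply Cder_Cexp. Qed.

Lemma cont_Cexp f x : cont f x -> cont (fun t => Cexp (f t)) x.
Proof. intros H. eapply cont_comp_Cder; [exact H|apply Cder_Cexp]. Qed.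

(** * Goursat's lemma on curvilinear rectangles *)

Definition quad := ((R * R) * (R * R))%type.

Section Bisection.

Variable J : quad -> C.
Variables a0 b0 c0 d0 : R.
Hypothesis Hab : a0 <= b0.
Hypothesis Hcd : c0 <= d0.

Let inside (a b c d : R) := a0 <= a /\ a <= b /\ b <= b0 /\ c0 <= c /\ c <= d /\ d <= d0.

Hypothesis Hadd : forall a b c d, inside a b c d ->
  let x := (a + b) / 2 in let y := (c + d) / 2 in
  J ((a, b), (c, d)) = (J ((a, x), (c, y)) + J ((x, b), (c, y)) + J ((a, x), (y, d)) + J ((x, b), (y, d)))%C.

Hypothesis Hloc : forall x y, a0 <= x <= b0 -> c0 <= y <= d0 -> forall eps, 0 < eps ->
  exists del, 0 < del /\ forall a b c d, inside a b c d -> a <= x <= b -> c <= y <= d ->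
    b - a < del -> d - c < del -> Cmod (J ((a, b), (c, d))) <= eps * ((b - a) + (d - c)) ^ 2.

(** If each of the first three quarters carries less than a quarter of [Cmod (J q)], additivity and
    the triangle inequality force the fourth to carry at least that much, so the last case has no
    test. *)
Let step (q : quad) : quad :=
  let '((a, b), (c, d)) := q in
  let x := (a + b) / 2 in let y := (c + d) / 2 in
  if Rle_dec (Cmod (J q) / 4) (Cmod (J ((a, x), (c, y)))) then ((a, x), (c, y)) else
  if Rle_dec (Cmod (J q) / 4) (Cmod (J ((x, b), (c, y)))) then ((x, b), (c, y)) else
  if Rle_dec (Cmod (J q) / 4) (Cmod (J ((a, x), (y, d)))) then ((a, x), (y, d)) else ((x, b), (y, d)).

Let seq (n : nat) : quad := Nat.iter n step ((a0, b0), (c0, d0)).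
Let sa n := fst (fst (seq n)).
Let sb n := snd (fst (seq n)).
Let sc n := fst (snd (seq n)).
Let sd n := snd (snd (seq n)).

(** Quartering keeps a quarter of the modulus while the sides halve: at stage [n] the modulus is at
    least [mu / 4^n] on a rectangle of half-perimeter [s / 2^n]. Near the common point of these
    rectangles, [Hloc] bounds it by an arbitrarily small multiple of [s^2 / 4^n]. *)
Lemma bisection_zero : J ((a0, b0), (c0, d0)) = RtoC 0.
Proof.
  assert (Hstep : forall a b c d, inside a b c d -> exists a' b' c' d',
    step ((a, b), (c, d)) = ((a', b'), (c', d')) /\ inside a' b' c' d' /\
    a <= a' /\ b' <= b /\ c <= c' /\ d' <= d /\ b' - a' = (b - a) / 2 /\ d' - c' = (d - c) / 2 /\
    Cmod (J ((a, b), (c, d))) / 4 <= Cmod (J ((a', b'), (c', d')))).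
  { intros a b c d Hin. pose proof (Hadd a b c d Hin) as HJ. cbv zeta in HJ.
    pose proof (Cmod_triangle (J ((a, (a + b) / 2), (c, (c + d) / 2)) + J (((a + b) / 2, b), (c, (c + d) / 2)) + J ((a, (a + b) / 2), ((c + d) / 2, d))) (J (((a + b) / 2, b), ((c + d) / 2, d)))) as T1.
    pose proof (Cmod_triangle (J ((a, (a + b) / 2), (c, (c + d) / 2)) + J (((a + b) / 2, b), (c, (c + d) / 2))) (J ((a, (a + b) / 2), ((c + d) / 2, d)))) as T2.
    pose proof (Cmod_triangle (J ((a, (a + b) / 2), (c, (c + d) / 2))) (J (((a + b) / 2, b), (c, (c + d) / 2)))) as T3.
    rewrite <- HJ in T1. unfold inside in *. unfold step.
    destruct (Rle_dec _ _) as [H1|H1];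
      [|destruct (Rle_dec _ _) as [H2|H2]; [|destruct (Rle_dec _ _) as [H3|H3]]];
      (do 4 eexists; split; [reflexivity|]); repeat split; lra. }
  assert (Hseq : forall n, seq (S n) = step (seq n)) by reflexivity.
  assert (Hs : forall n, inside (sa n) (sb n) (sc n) (sd n) /\
     sa n <= sa (S n) /\ sb (S n) <= sb n /\ sc n <= sc (S n) /\ sd (S n) <= sd n /\
     sb n - sa n = (b0 - a0) / 2 ^ n /\ sd n - sc n = (d0 - c0) / 2 ^ n /\
     Cmod (J ((a0, b0), (c0, d0))) / 4 ^ n <= Cmod (J (seq n))).
  { assert (H0 : forall n, inside (sa n) (sb n) (sc n) (sd n) /\
      sb n - sa n = (b0 - a0) / 2 ^ n /\ sd n - sc n = (d0 - c0) / 2 ^ n /\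
      Cmod (J ((a0, b0), (c0, d0))) / 4 ^ n <= Cmod (J (seq n))).
    { induction n as [|n IH].
      - unfold sa, sb, sc, sd, inside; simpl. repeat split; lra.
      - destruct IH as [Hi [H1 [H2 H3]]].
        unfold sa, sb, sc, sd in *. rewrite Hseq.
        destruct (seq n) as [[a b] [c d]]. cbn [fst snd] in *.
        destruct (Hstep a b c d Hi) as [a' [b' [c' [d' [E' [Hi' [P1 [P2 [P3 [P4 [P5 [P6 P7]]]]]]]]]]]].
        rewrite E'. cbn [fst snd pow]. split; [exact Hi'|].
        assert (0 < 2 ^ n) by (apply pow_lt; lra). assert (0 < 4 ^ n) by (apply pow_lt; lra).
        rewrite P5, P6, H1, H2. repeat split; [field; lra|field; lra|].
        eapply Rle_trans; [|exact P7]. replace (Cmod (J ((a0, b0), (c0, d0))) / (4 * 4 ^ n)) with (Cmod (J ((a0, b0), (c0, d0))) / 4 ^ n / 4) by (field; lra). lra. }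
    intros n. destruct (H0 n) as [Hi [H1 [H2 H3]]]. split; [exact Hi|].
    destruct (Hstep _ _ _ _ Hi) as [a' [b' [c' [d' [E' [Hi' [P1 [P2 [P3 [P4 [P5 [P6 P7]]]]]]]]]]]].
    assert (E2 : seq (S n) = ((a', b'), (c', d'))).
    { rewrite Hseq, <- E'. unfold sa, sb, sc, sd. destruct (seq n) as [[? ?] [? ?]]; reflexivity. }
    assert (E3 : sa (S n) = a' /\ sb (S n) = b' /\ sc (S n) = c' /\ sd (S n) = d')
      by (unfold sa, sb, sc, sd; rewrite E2; auto).
    destruct E3 as [-> [-> [-> ->]]]. repeat split; auto. }
  assert (Hmono : forall n k, sa n <= sa (n + k)%nat /\ sb (n + k)%nat <= sb n /\ sc n <= sc (n + k)%nat /\ sd (n + k)%nat <= sd n).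
  { intros n k. induction k as [|k IH]; [rewrite Nat.add_0_r; lra|].
    rewrite Nat.add_succ_r. destruct (Hs (n + k)%nat) as [_ H]. lra. }
  assert (Hcross : forall n k, sa n <= sb k /\ sc n <= sd k).
  { intros n k. destruct (Hmono n k) as [A1 [_ [A3 _]]]. destruct (Hmono k n) as [_ [A2 [_ A4]]].
    rewrite (Nat.add_comm k n) in *. destruct (Hs (n + k)%nat) as [[B1 [B2 [B3 [B4 [B5 B6]]]]] _]. lra. }
  assert (Hlub : forall (u v : nat -> R), (forall n k, u n <= v k) -> exists x, forall n, u n <= x <= v n).
  { intros u v H. destruct (completeness (fun r => exists n, r = u n)) as [x [Hx1 Hx2]].
    - exists (v 0%nat). intros r [n ->]. auto.
    - exists (u 0%nat), 0%nat. reflexivity.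
    - exists x. intros n. split; [apply Hx1; exists n; reflexivity|].
      apply Hx2. intros r [k ->]. auto. }
  destruct (Hlub sa sb) as [x Hx]; [intros; apply Hcross|].
  destruct (Hlub sc sd) as [y Hy]; [intros; apply Hcross|].
  apply Cmod_eq_0. destruct (Req_dec (Cmod (J ((a0, b0), (c0, d0)))) 0) as [|Hne]; [auto|exfalso].
  set (mu := Cmod (J ((a0, b0), (c0, d0)))) in *.
  assert (Hmu : 0 < mu) by (pose proof (Cmod_ge_0 (J ((a0, b0), (c0, d0)))); unfold mu in *; lra).
  set (s := (b0 - a0) + (d0 - c0)). assert (Hs0 : 0 <= s) by (unfold s; lra).
  (* This value makes the local bound at most half of [mu / 4^N]; [s + 1] in place of [s] admits
     degenerate rectangles. *)
  destruct (Hloc x y) with (eps := mu / (2 * (s + 1) ^ 2)) as [del [Hdel Hd]].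
  { specialize (Hx 0%nat). unfold sa, sb in Hx. simpl in Hx. exact Hx. }
  { specialize (Hy 0%nat). unfold sc, sd in Hy. simpl in Hy. exact Hy. }
  { apply Rdiv_lt_0_compat; [auto|]. apply Rmult_lt_0_compat; [lra|apply pow_lt; lra]. }
  destruct (pow_lt_1_zero (1 / 2)) with (y := del / (s + 1)) as [N HN].
  { rewrite Rabs_pos_eq; lra. }
  { apply Rdiv_lt_0_compat; lra. }
  specialize (HN N (Nat.le_refl N)). rewrite Rabs_pos_eq in HN by (apply pow_le; lra).
  destruct (Hs N) as [Hin [_ [_ [_ [_ [H1 [H2 H3]]]]]]].
  assert (P2 : 0 < 2 ^ N) by (apply pow_lt; lra).
  assert (E12 : (1 / 2) ^ N = / 2 ^ N) by (unfold Rdiv; rewrite Rmult_1_l, pow_inv; reflexivity).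
  assert (Hsmall : (s + 1) / 2 ^ N < del).
  { rewrite E12 in HN. unfold Rdiv. apply Rlt_le_trans with ((s + 1) * (del / (s + 1))); [apply Rmult_lt_compat_l; lra|right; field; lra]. }
  assert (Hpos : 0 < / 2 ^ N) by (apply Rinv_0_lt_compat; auto).
  specialize (Hd _ _ _ _ Hin (Hx N) (Hy N)).
  rewrite H1, H2 in Hd.
  assert (Q : Cmod (J ((sa N, sb N), (sc N, sd N))) <= mu / (2 * (s + 1) ^ 2) * ((b0 - a0) / 2 ^ N + (d0 - c0) / 2 ^ N) ^ 2).
  { apply Hd; (eapply Rle_lt_trans; [|exact Hsmall]); unfold Rdiv; apply Rmult_le_compat_r; unfold s; lra. }
  replace ((sa N, sb N), (sc N, sd N)) with (seq N) in Q
    by (unfold sa, sb, sc, sd; destruct (seq N) as [[? ?] [? ?]]; reflexivity).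
  pose proof (Rle_trans _ _ _ H3 Q) as F.
  replace ((b0 - a0) / 2 ^ N + (d0 - c0) / 2 ^ N) with (s / 2 ^ N) in F by (unfold s; field; lra).
  replace (4 ^ N) with (2 ^ N * 2 ^ N) in F by (rewrite <- Rpow_mult_distr; f_equal; lra).
  assert (F2 : mu <= mu / (2 * (s + 1) ^ 2) * s ^ 2).
  { apply Rmult_le_reg_r with (/ (2 ^ N * 2 ^ N)); [apply Rinv_0_lt_compat; nra|].
    eapply Rle_trans; [exact F|]. right. field. lra. }
  assert (F3 : mu / (2 * (s + 1) ^ 2) * s ^ 2 < mu).
  { apply Rmult_lt_reg_r with (2 * (s + 1) ^ 2); [nra|].
    replace (mu / (2 * (s + 1) ^ 2) * s ^ 2 * (2 * (s + 1) ^ 2)) with (mu * s ^ 2) by (field; lra). nra. }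
  lra.
Qed.

End Bisection.

(** The affine part of [f] at [P] has the explicit antiderivative [A], so its path integral depends
    on the end points only; what is left is the integral of the linearization error. *)
Lemma path_linearization f (g g' : R -> C) a b (P l : C) (E L : R) :
  a <= b -> (forall t, a <= t <= b -> Rder g t (g' t)) -> contI g' a b ->
  (forall t, a <= t <= b -> exists k, Cder f (g t) k) ->
  0 <= E -> (forall t, a <= t <= b -> Cmod (f (g t) - f P - l * (g t - P))%C <= E) ->
  (forall t, a <= t <= b -> Cmod (g' t) <= L) ->
  let A := fun z => (f P * z + l / 2 * ((z - P) * (z - P)))%C in
  Cmod (CI (fun t => f (g t) * g' t)%C a b - (A (g b) - A (g a))) <= E * L * (b - a).
Proof.
  intros Hab Hg Hg' Hf HE Herr HL A.
  assert (Cg : contI g a b) by (intros t Ht; eapply Rder_cont; apply Hg; auto).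
  assert (Cf : contI (fun t => f (g t)) a b).
  { intros t Ht. destruct (Hf t Ht) as [k Hk]. eapply cont_comp_Cder; [apply Cg; auto|exact Hk]. }
  assert (Clin : contI (fun t => f P + l * (g t - P))%C a b).
  { intros t Ht. apply cont_plus; [apply cont_const|]. apply cont_mult; [apply cont_const|].
    apply cont_minus; [apply Cg; auto|apply cont_const]. }
  rewrite <- (CI_FTC (fun t => A (g t)) (fun t => (f P + l * (g t - P)) * g' t)%C); auto.
  - rewrite <- CI_minus; auto.
    + eapply Rle_trans; [apply (CI_bound_const _ (E * L)); auto|right; ring].
      * intros t Ht. apply cont_minus; apply cont_mult; auto.
      * intros t Ht. replace (f (g t) * g' t - (f P + l * (g t - P)) * g' t)%C
          with ((f (g t) - f P - l * (g t - P)) * g' t)%C by ring.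
        rewrite Cmod_mult. apply Rmult_le_compat; auto using Cmod_ge_0.
    + intros t Ht. apply cont_mult; auto.
    + intros t Ht. apply cont_mult; auto.
  - intros t Ht. unfold A.
    eapply Rder_val.
    + apply Rder_plus; [apply Rder_cmult, Hg; auto|]. apply Rder_cmult.
      apply Rder_mult; (apply Rder_minus; [apply Hg; auto|apply Rder_const]).
    + cbv beta. field.
  - intros t Ht. apply cont_mult; auto.
Qed.

Lemma C_MVT_abs f f' a b K x y : contI f a b -> (forall x, a <= x <= b -> Rder f x (f' x)) ->
  (forall x, a <= x <= b -> Cmod (f' x) <= K) -> a <= x <= b -> a <= y <= b ->
  Cmod (f x - f y) <= 2 * K * Rabs (x - y).
Proof.
  intros Hc Hd HK Hx Hy. destruct (Rle_dec x y) as [H|H].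
  - rewrite Cmod_sub_sym, Rabs_minus_sym, Rabs_pos_eq by lra.
    apply (C_MVT f f'); auto; try (intros; apply Hd || apply HK; lra).
    apply (contI_sub f a b); auto; lra.
  - rewrite Rabs_pos_eq by lra.
    apply (C_MVT f f'); try lra; try (intros; apply Hd || apply HK; lra).
    apply (contI_sub f a b); auto; lra.
Qed.

(** The bisection takes place in the parameter rectangle, and [Phi] is only differentiated in each
    variable separately, with bounded partial derivatives. One statement thus serves both for boxes
    and for the contraction of a circle to a point. *)
Theorem goursat f (Phi Px Py : R -> R -> C) (a0 b0 c0 d0 L : R) :
  a0 <= b0 -> c0 <= d0 ->
  (forall x y, a0 <= x <= b0 -> c0 <= y <= d0 ->
     Rder (fun t => Phi t y) x (Px x y) /\ Rder (fun t => Phi x t) y (Py x y) /\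
     cont (fun t => Px t y) x /\ cont (fun t => Py x t) y /\
     Cmod (Px x y) <= L /\ Cmod (Py x y) <= L /\ exists k, Cder f (Phi x y) k) ->
  (CI (fun t => f (Phi t c0) * Px t c0) a0 b0 + CI (fun t => f (Phi b0 t) * Py b0 t) c0 d0
   = CI (fun t => f (Phi t d0) * Px t d0) a0 b0 + CI (fun t => f (Phi a0 t) * Py a0 t) c0 d0)%C.
Proof.
  intros Hab Hcd H.
  set (J := fun q : quad => let '((a, b), (c, d)) := q in
    (CI (fun t => f (Phi t c) * Px t c) a b + CI (fun t => f (Phi b t) * Py b t) c d
     - CI (fun t => f (Phi t d) * Px t d) a b - CI (fun t => f (Phi a t) * Py a t) c d)%C).
  assert (HL : 0 <= L).
  { destruct (H a0 c0) as [_ [_ [_ [_ [HL _]]]]]; try lra. eapply Rle_trans; [apply Cmod_ge_0|exact HL]. }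
  assert (Cx : forall y, c0 <= y <= d0 -> contI (fun t => f (Phi t y) * Px t y)%C a0 b0).
  { intros y Hy x Hx. destruct (H x y Hx Hy) as [D1 [_ [C1 [_ [_ [_ [k Hk]]]]]]]. apply cont_mult; auto.
    apply (cont_comp_Cder f (fun t => Phi t y) x k); auto. eapply Rder_cont; exact D1. }
  assert (Cy : forall x, a0 <= x <= b0 -> contI (fun t => f (Phi x t) * Py x t)%C c0 d0).
  { intros x Hx y Hy. destruct (H x y Hx Hy) as [_ [D1 [_ [C1 [_ [_ [k Hk]]]]]]]. apply cont_mult; auto.
    apply (cont_comp_Cder f (fun t => Phi x t) y k); auto. eapply Rder_cont; exact D1. }
  assert (HJ : J ((a0, b0), (c0, d0)) = RtoC 0).
  { apply bisection_zero; auto.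
    - intros a b c d [I1 [I2 [I3 [I4 [I5 I6]]]]] x y. unfold J.
      assert (Hx : a <= x <= b) by (unfold x; lra). assert (Hy : c <= y <= d) by (unfold y; lra).
      assert (Ex : forall s, c0 <= s <= d0 -> CI (fun t => f (Phi t s) * Px t s)%C a b =
        (CI (fun t => f (Phi t s) * Px t s) a x + CI (fun t => f (Phi t s) * Px t s) x b)%C).
      { intros s Hs. symmetry. apply CI_chasles; try lra. apply (contI_sub _ a0 b0); auto. }
      assert (Ey : forall s, a0 <= s <= b0 -> CI (fun t => f (Phi s t) * Py s t)%C c d =
        (CI (fun t => f (Phi s t) * Py s t) c y + CI (fun t => f (Phi s t) * Py s t) y d)%C).
      { intros s Hs. symmetry. apply CI_chasles; try lra. apply (contI_sub _ c0 d0); auto. }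
      rewrite (Ex c), (Ex d), (Ey a), (Ey b) by lra. ring.
    - intros x y Hx Hy eps He. destruct (H x y Hx Hy) as [_ [_ [_ [_ [_ [_ [l Hl]]]]]]].
      set (P := Phi x y) in *.
      (* Points of a small rectangle of half-perimeter [s] are mapped within [2 L s] of [P], so the
         linearization error is at most [e' 2 L s], integrated along boundary curves of total length
         at most [2 L s]. *)
      set (e' := eps / (4 * L * L + 1)).
      assert (He' : 0 < e') by (apply Rdiv_lt_0_compat; nra).
      destruct (Hl e' He') as [d' [Hd' Hh]].
      exists (d' / (4 * L + 1)). split; [apply Rdiv_lt_0_compat; lra|].
      intros a b c d [I1 [I2 [I3 [I4 [I5 I6]]]]] Hax Hcy Hb Hd.
      set (s := (b - a) + (d - c)) in *.
      assert (Hs : 0 <= s) by (unfold s; lra).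
      assert (Hdist : forall t u, a <= t <= b -> c <= u <= d -> Cmod (Phi t u - P) <= 2 * L * s).
      { intros t u Ht Hu. replace (Phi t u - P)%C with ((Phi t u - Phi x u) + (Phi x u - P))%C by ring.
        eapply Rle_trans; [apply Cmod_triangle|].
        assert (K1 : Cmod (Phi t u - Phi x u) <= 2 * L * Rabs (t - x)).
        { apply (C_MVT_abs (fun v => Phi v u) (fun v => Px v u) a0 b0); try lra.
          - intros v Hv. eapply Rder_cont. apply (H v u); lra.
          - intros v Hv. apply (H v u); lra.
          - intros v Hv. apply (H v u); lra. }
        assert (K2 : Cmod (Phi x u - P) <= 2 * L * Rabs (u - y)).
        { apply (C_MVT_abs (fun v => Phi x v) (fun v => Py x v) c0 d0); try lra.
          - intros v Hv. eapply Rder_cont. apply (H x v); lra.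
          - intros v Hv. apply (H x v); lra.
          - intros v Hv. apply (H x v); lra. }
        assert (Rabs (t - x) <= b - a) by (apply Rabs_le; lra).
        assert (Rabs (u - y) <= d - c) by (apply Rabs_le; lra).
        unfold s. nra. }
      assert (Hsd : 2 * L * s < d').
      { apply Rle_lt_trans with (4 * L * (d' / (4 * L + 1))).
        - unfold s. nra.
        - apply Rmult_lt_reg_r with (4 * L + 1); [lra|]. field_simplify; lra. }
      set (E := e' * (2 * L * s)).
      assert (HE : 0 <= E) by (unfold E; apply Rmult_le_pos; [lra|apply Rmult_le_pos; lra]).
      assert (Herr : forall t u, a <= t <= b -> c <= u <= d -> Cmod (f (Phi t u) - f P - l * (Phi t u - P))%C <= E).
      { intros t u Ht Hu. specialize (Hdist t u Ht Hu).
        specialize (Hh (Phi t u - P)%C). replace (P + (Phi t u - P))%C with (Phi t u) in Hh by ring.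
        eapply Rle_trans; [apply Hh; lra|]. unfold E. apply Rmult_le_compat_l; lra. }
      set (A := fun z => (f P * z + l / 2 * ((z - P) * (z - P)))%C).
      assert (Sx : forall u, c <= u <= d ->
        Cmod (CI (fun t => f (Phi t u) * Px t u)%C a b - (A (Phi b u) - A (Phi a u))) <= E * L * (b - a)).
      { intros u Hu. apply (path_linearization f (fun t => Phi t u) (fun t => Px t u)); auto;
          try (intros t Ht; apply (H t u); lra). }
      assert (Sy : forall u, a <= u <= b ->
        Cmod (CI (fun t => f (Phi u t) * Py u t)%C c d - (A (Phi u d) - A (Phi u c))) <= E * L * (d - c)).
      { intros u Hu. apply (path_linearization f (fun t => Phi u t) (fun t => Py u t)); auto;
          try (intros t Ht; apply (H u t); lra). }
      unfold J.
      pose proof (Sx c ltac:(lra)) as S1. pose proof (Sx d ltac:(lra)) as S2.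
      pose proof (Sy a ltac:(lra)) as S3. pose proof (Sy b ltac:(lra)) as S4.
      set (X1 := CI (fun t => f (Phi t c) * Px t c)%C a b) in *.
      set (X2 := CI (fun t => f (Phi t d) * Px t d)%C a b) in *.
      set (X3 := CI (fun t => f (Phi a t) * Py a t)%C c d) in *.
      set (X4 := CI (fun t => f (Phi b t) * Py b t)%C c d) in *.
      (* The values of [A] at the four corners cancel around the boundary. *)
      replace (X1 + X4 - X2 - X3)%C with
        (((X1 - (A (Phi b c) - A (Phi a c))) - (X2 - (A (Phi b d) - A (Phi a d))))
          + ((X4 - (A (Phi b d) - A (Phi b c))) - (X3 - (A (Phi a d) - A (Phi a c)))))%C by ring.
      eapply Rle_trans; [apply Cmod_triangle|].
      eapply Rle_trans; [apply Rplus_le_compat; apply Cmod_sub_triangle|].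
      apply Rle_trans with (2 * (E * L * s)); [unfold s; lra|].
      apply Rle_trans with (e' * (4 * L * L + 1) * s ^ 2).
      + unfold E. assert (0 <= e' * s ^ 2) by (apply Rmult_le_pos; [lra|apply pow2_ge_0]).
        replace (2 * (e' * (2 * L * s) * L * s)) with (e' * s ^ 2 * (4 * L * L)) by ring. nra.
      + right. unfold e'. field. nra. }
  unfold J in HJ.
  set (X1 := CI (fun t => f (Phi t c0) * Px t c0)%C a0 b0) in *.
  set (X2 := CI (fun t => f (Phi t d0) * Px t d0)%C a0 b0) in *.
  set (X3 := CI (fun t => f (Phi a0 t) * Py a0 t)%C c0 d0) in *.
  set (X4 := CI (fun t => f (Phi b0 t) * Py b0 t)%C c0 d0) in *.
  replace (X1 + X4)%C with ((X1 + X4 - X2 - X3) + (X2 + X3))%C by ring. rewrite HJ. ring.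
Qed.

(** * Complex series and power series *)

Fixpoint csum (a : nat -> C) (n : nat) : C :=
  match n with O => RtoC 0 | S k => (csum a k + a k)%C end.

Definition Cser (a : nat -> C) (l : C) : Prop :=
  forall eps, 0 < eps -> exists N, forall n, (N <= n)%nat -> Cmod (csum a n - l) < eps.

Lemma sum_n_csum (a : nat -> C) n : sum_n a n = csum a (S n).
Proof.
  induction n as [|n IH]; [rewrite sum_O; simpl; ring|]. rewrite sum_Sn, IH. reflexivity.
Qed.

Lemma Cser_is_series a l : Cser a l <-> is_series (K:=C_AbsRing) (V:=C_NormedModule) a l.
Proof.
  split.
  - intros H. apply filterlim_locally. intros eps. destruct (H eps (cond_pos eps)) as [N HN].
    exists N. intros n Hn. rewrite sum_n_csum. specialize (HN (S n) ltac:(lia)).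
    split; [change (Rabs (Re (csum a (S n)) - Re l) < eps)|change (Rabs (Im (csum a (S n)) - Im l) < eps)].
    + eapply Rle_lt_trans; [|exact HN]. eapply Rle_trans; [|apply re_le_Cmod]. right; reflexivity.
    + eapply Rle_lt_trans; [|exact HN]. eapply Rle_trans; [|apply im_le_Cmod]. right; reflexivity.
  - intros H eps He. assert (He2 : 0 < eps / 2) by lra.
    destruct (proj1 (filterlim_locally _ _) H (mkposreal _ He2)) as [N HN].
    exists (S N). intros [|n] Hn; [lia|]. destruct (HN n ltac:(lia)) as [H1 H2].
    rewrite sum_n_csum in H1, H2.
    change (Rabs (Re (csum a (S n)) - Re l) < eps / 2) in H1.
    change (Rabs (Im (csum a (S n)) - Im l) < eps / 2) in H2.
    eapply Rle_lt_trans; [apply Cmod_le_sum|].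
    unfold Re, Im in *. cbn [fst snd Cminus Cplus Copp] in *. unfold Rminus in *. lra.
Qed.

Lemma csum_ext a b n : (forall k, (k < n)%nat -> a k = b k) -> csum a n = csum b n.
Proof. induction n as [|n IH]; intros H; simpl; auto. rewrite IH, H; auto. Qed.

Lemma csum_plus a b n : csum (fun k => a k + b k)%C n = (csum a n + csum b n)%C.
Proof. induction n as [|n IH]; simpl; [ring|rewrite IH; ring]. Qed.

Lemma csum_cmult c a n : csum (fun k => c * a k)%C n = (c * csum a n)%C.
Proof. induction n as [|n IH]; simpl; [ring|rewrite IH; ring]. Qed.

Lemma csum_shift a n : csum a (S n) = (a 0%nat + csum (fun k => a (S k)) n)%C.
Proof. induction n as [|n IH]; simpl in *; [ring|rewrite IH; ring]. Qed.

Lemma Cser_ext a b l : (forall n, a n = b n) -> Cser a l -> Cser b l.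
Proof.
  intros E H eps He. destruct (H eps He) as [N HN]. exists N. intros n Hn.
  rewrite <- (csum_ext a); auto.
Qed.

Lemma Cser_unique a l k : Cser a l -> Cser a k -> l = k.
Proof.
  intros H1 H2. apply Ceq_minus. apply Cmod_le_0. intros eps He.
  destruct (H1 (eps / 2)) as [N1 P1]; [lra|]. destruct (H2 (eps / 2)) as [N2 P2]; [lra|].
  specialize (P1 (N1 + N2)%nat ltac:(lia)). specialize (P2 (N1 + N2)%nat ltac:(lia)).
  replace (l - k)%C with ((csum a (N1 + N2) - k) - (csum a (N1 + N2) - l))%C by ring.
  eapply Rle_trans; [apply Cmod_sub_triangle|]. lra.
Qed.

Lemma Cser_plus a b l k : Cser a l -> Cser b k -> Cser (fun n => a n + b n)%C (l + k)%C.
Proof.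
  intros H1 H2 eps He. destruct (H1 (eps / 2)) as [N1 P1]; [lra|]. destruct (H2 (eps / 2)) as [N2 P2]; [lra|].
  exists (N1 + N2)%nat. intros n Hn. specialize (P1 n ltac:(lia)). specialize (P2 n ltac:(lia)).
  rewrite csum_plus. replace (csum a n + csum b n - (l + k))%C with ((csum a n - l) + (csum b n - k))%C by ring.
  eapply Rle_lt_trans; [apply Cmod_triangle|]. lra.
Qed.

Lemma Cser_cmult c a l : Cser a l -> Cser (fun n => c * a n)%C (c * l)%C.
Proof.
  intros H eps He. pose proof (Cmod_ge_0 c).
  destruct (H (eps / (Cmod c + 1))) as [N HN]; [apply Rdiv_lt_0_compat; lra|].
  exists N. intros n Hn. specialize (HN n Hn). rewrite csum_cmult.
  replace (c * csum a n - c * l)%C with (c * (csum a n - l))%C by ring. rewrite Cmod_mult.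
  apply Rle_lt_trans with (Cmod c * (eps / (Cmod c + 1))); [apply Rmult_le_compat_l; lra|].
  apply Rmult_lt_reg_r with (Cmod c + 1); [lra|]. field_simplify; lra.
Qed.

Lemma Cser_minus a b l k : Cser a l -> Cser b k -> Cser (fun n => a n - b n)%C (l - k)%C.
Proof.
  intros H1 H2. apply Cser_ext with (fun n => a n + (-(1)) * b n)%C; [intros; ring|].
  replace (l - k)%C with (l + (-(1)) * k)%C by ring. apply Cser_plus; auto. apply Cser_cmult; auto.
Qed.

Lemma Cser_bound a l M : (forall n, Cmod (csum a n) <= M) -> Cser a l -> Cmod l <= M.
Proof.
  intros H HS. apply le_epsilon. intros eps He. destruct (HS eps He) as [N HN].
  specialize (HN N (Nat.le_refl N)). specialize (H N).
  pose proof (Cmod_sub_rev l (csum a N)). rewrite Cmod_sub_sym in HN. lra.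
Qed.

Lemma Cser_terms_bounded a l : Cser a l -> exists M, 0 <= M /\ forall n, Cmod (a n) <= M.
Proof.
  intros H. destruct (H 1) as [N HN]; [lra|].
  assert (HB : forall n, exists M, 0 <= M /\ forall k, (k < n)%nat -> Cmod (a k) <= M).
  { induction n as [|n [M [HM Hk]]]; [exists 0; split; [lra|lia]|].
    exists (M + Cmod (a n)). pose proof (Cmod_ge_0 (a n)). split; [lra|]. intros k Hkn.
    destruct (Nat.eq_dec k n) as [->|]; [lra|]. specialize (Hk k ltac:(lia)). lra. }
  destruct (HB N) as [M [HM Hk]]. exists (M + 2). split; [lra|]. intros n.
  destruct (Nat.lt_ge_cases n N) as [Hn|Hn]; [specialize (Hk n Hn); lra|].
  pose proof (HN n Hn) as A1. pose proof (HN (S n) ltac:(lia)) as A2. simpl in A2.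
  replace (a n) with ((csum a n + a n - l) - (csum a n - l))%C by ring.
  eapply Rle_trans; [apply Cmod_sub_triangle|]. lra.
Qed.

Lemma csum_geom_bound a M q n : 0 <= q < 1 -> (forall n, Cmod (a n) <= M * q ^ n) -> Cmod (csum a n) <= M / (1 - q).
Proof.
  intros Hq Ha. assert (HM : 0 <= M) by (specialize (Ha 0%nat); simpl in Ha; pose proof (Cmod_ge_0 (a 0%nat)); lra).
  assert (H : Cmod (csum a n) <= M * ((1 - q ^ n) / (1 - q))).
  { induction n as [|n IH]; simpl; [rewrite Cmod_0; right; field; lra|].
    eapply Rle_trans; [apply Cmod_triangle|]. specialize (Ha n).
    replace (M * ((1 - q * q ^ n) / (1 - q))) with (M * ((1 - q ^ n) / (1 - q)) + M * q ^ n) by (field; lra). lra. }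
  eapply Rle_trans; [exact H|]. unfold Rdiv. apply Rmult_le_compat_l; auto.
  rewrite <- (Rmult_1_l (/ (1 - q))) at 2. apply Rmult_le_compat_r; [left; apply Rinv_0_lt_compat; lra|].
  pose proof (pow_le q n (proj1 Hq)). lra.
Qed.

Lemma Cser_geom a M q : 0 <= q < 1 -> (forall n, Cmod (a n) <= M * q ^ n) ->
  exists l, Cser a l /\ Cmod l <= M / (1 - q).
Proof.
  intros Hq Ha.
  destruct (ex_series_le (K:=C_AbsRing) (V:=C_CompleteNormedModule) a (fun n => M * q ^ n)) as [l Hl].
  - intros n. change (Cmod (a n) <= M * q ^ n). apply Ha.
  - apply (ex_series_scal_l M (fun n => q ^ n)). apply ex_series_geom. rewrite Rabs_pos_eq; lra.
  - assert (HS : Cser a l) by (apply Cser_is_series; exact Hl).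
    exists l. split; auto. apply (Cser_bound a); auto. intros n. apply csum_geom_bound; auto.
Qed.

Lemma Cder_unique f z l k : Cder f z l -> Cder f z k -> l = k.
Proof.
  intros H1 H2. apply Ceq_minus. apply Cmod_le_0. intros eps He.
  destruct (H1 (eps / 2)) as [d1 [P1 Q1]]; [lra|]. destruct (H2 (eps / 2)) as [d2 [P2 Q2]]; [lra|].
  set (h := Rmin d1 d2 / 2). assert (Hh : 0 < h) by (unfold h; pose proof (Rmin_pos d1 d2 P1 P2); lra).
  assert (B1 : Cmod (RtoC h) < d1).
  { rewrite Cmod_R, Rabs_pos_eq by lra. unfold h in *. pose proof (Rmin_l d1 d2). lra. }
  assert (B2 : Cmod (RtoC h) < d2).
  { rewrite Cmod_R, Rabs_pos_eq by lra. unfold h in *. pose proof (Rmin_r d1 d2). lra. }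
  specialize (Q1 _ B1). specialize (Q2 _ B2).
  assert (E : Cmod ((l - k) * RtoC h) <= eps * Cmod (RtoC h)).
  { replace ((l - k) * RtoC h)%C with ((f (z + RtoC h) - f z - k * RtoC h) - (f (z + RtoC h) - f z - l * RtoC h))%C by ring.
    eapply Rle_trans; [apply Cmod_sub_triangle|]. lra. }
  rewrite Cmod_mult in E. rewrite Cmod_R, Rabs_pos_eq in E by lra. nra.
Qed.

(** The remainder of the first order Taylor formula of [z^n] is dominated by the
    same remainder at the real point [|s|] with increment [d]. *)
Lemma pow_remainder (s h : C) (d : R) n : 0 < d -> Cmod h <= d ->
  let P := fun n => ((s + h) ^ n - s ^ n - RtoC (INR n) * s ^ (pred n) * h)%C in
  let A := fun n => (Cmod s + d) ^ n - Cmod s ^ n - INR n * Cmod s ^ (pred n) * d in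
  0 <= A n /\ Cmod (P n) <= (Cmod h / d) ^ 2 * A n.
Proof.
  intros Hd Hh P A. pose proof (Cmod_ge_0 s) as Ps. pose proof (Cmod_ge_0 h) as Ph.
  assert (Hq0 : 0 <= (Cmod h / d) ^ 2) by apply pow2_ge_0.
  induction n as [|n [IH1 IH2]].
  - unfold P, A; simpl. split; [lra|]. replace (RtoC 1 - RtoC 1 - RtoC 0 * RtoC 1 * h)%C with (RtoC 0) by ring.
    rewrite Cmod_0. lra.
  - assert (EP : P (S n) = ((s + h) * P n + RtoC (INR n) * s ^ (pred n) * (h * h))%C).
    { unfold P. rewrite S_INR, RtoC_plus. destruct n as [|n]; simpl pred; [simpl; ring|].
      rewrite !Cpow_S. ring. }
    assert (EA : A (S n) = (Cmod s + d) * A n + INR n * Cmod s ^ (pred n) * (d * d)).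
    { unfold A. rewrite S_INR. destruct n as [|n]; simpl pred; simpl; ring. }
    assert (Hp : 0 <= INR n * Cmod s ^ (pred n)) by (apply Rmult_le_pos; [apply pos_INR|apply pow_le; auto]).
    split; [rewrite EA; apply Rplus_le_le_0_compat; apply Rmult_le_pos; nra|].
    rewrite EP, EA. eapply Rle_trans; [apply Cmod_triangle|].
    rewrite !Cmod_mult, Cmod_R, Cmod_pow, (Rabs_pos_eq (INR n)) by apply pos_INR.
    rewrite Rmult_plus_distr_l. apply Rplus_le_compat.
    + apply Rle_trans with ((Cmod s + d) * ((Cmod h / d) ^ 2 * A n)); [|right; ring].
      apply Rmult_le_compat; auto using Cmod_ge_0. eapply Rle_trans; [apply Cmod_triangle|lra].
    + right. field. lra.
Qed.

Lemma Cser_pow_bound c rho l : 0 < rho -> Cser (fun n => c n * RtoC rho ^ n)%C l ->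
  exists M, 0 <= M /\ forall n, Cmod (c n) <= M / rho ^ n.
Proof.
  intros Hr H. destruct (Cser_terms_bounded _ _ H) as [M [HM Hn]]. exists M. split; auto.
  intros n. specialize (Hn n). rewrite Cmod_mult, Cmod_pow, Cmod_R, Rabs_pos_eq in Hn by lra.
  assert (0 < rho ^ n) by (apply pow_lt; auto).
  apply Rmult_le_reg_r with (rho ^ n); auto. replace (M / rho ^ n * rho ^ n) with M by (field; lra). exact Hn.
Qed.

(** Convergence at a larger radius bounds the coefficients by [M / rho^n]. The remainder series of
    [f (s + h) - f s - l h] is then dominated, through [pow_remainder], by [(|h|/d)^2] times a
    geometric series, which makes the error quadratic. *)
Lemma ps_deriv c f R : (forall s, Cmod s < R -> Cser (fun n => c n * s ^ n)%C (f s)) ->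
  forall s, Cmod s < R -> exists l, Cser (fun n => RtoC (INR (S n)) * c (S n) * s ^ n)%C l /\ Cder f s l.
Proof.
  intros H s Hs. pose proof (Cmod_ge_0 s) as Ps.
  set (d := (R - Cmod s) / 3). assert (Hd : 0 < d) by (unfold d; lra).
  set (rho := Cmod s + 2 * d). assert (Hrho : 0 < rho < R) by (unfold rho, d; lra).
  destruct (Cser_pow_bound c rho (f (RtoC rho))) as [M [HM Hc]]; [lra| |].
  { apply H. rewrite Cmod_R, Rabs_pos_eq; lra. }
  set (q := (Cmod s + d) / rho).
  assert (Hq : 0 <= q < 1).
  { unfold q. split; [apply Rdiv_le_0_compat; lra|]. apply Rmult_lt_reg_r with rho; [lra|].
    replace ((Cmod s + d) / rho * rho) with (Cmod s + d) by (field; lra). unfold rho; lra. }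
  assert (Hcq : forall n, Cmod (c n) * (Cmod s + d) ^ n <= M * q ^ n).
  { intros n. assert (0 < rho ^ n) by (apply pow_lt; lra).
    unfold q, Rdiv. rewrite Rpow_mult_distr, pow_inv.
    replace (M * ((Cmod s + d) ^ n * / rho ^ n)) with (M / rho ^ n * (Cmod s + d) ^ n) by (unfold Rdiv; ring).
    apply Rmult_le_compat_r; [apply pow_le; lra|auto]. }
  (* The real remainder in [pow_remainder] is nonnegative; read with increment [d], this bounds the
     derived terms by powers of the larger radius [|s| + d]. *)
  assert (HA : forall n, INR n * Cmod s ^ (pred n) * d <= (Cmod s + d) ^ n).
  { intros n. destruct (pow_remainder s 0 d n Hd) as [HA _]; [rewrite Cmod_0; lra|].
    pose proof (pow_le (Cmod s) n Ps). lra. }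
  destruct (Cser_geom (fun n => RtoC (INR n) * c n * s ^ (pred n))%C (M / d) q Hq) as [l [Hl _]].
  { intros n. rewrite !Cmod_mult, Cmod_R, Cmod_pow, (Rabs_pos_eq (INR n)) by apply pos_INR.
    apply Rmult_le_reg_r with d; auto. replace (M / d * q ^ n * d) with (M * q ^ n) by (field; lra).
    eapply Rle_trans; [|apply Hcq].
    replace (INR n * Cmod (c n) * Cmod s ^ pred n * d) with (Cmod (c n) * (INR n * Cmod s ^ pred n * d)) by ring.
    apply Rmult_le_compat_l; [apply Cmod_ge_0|apply HA]. }
  exists l. split.
  - intros eps He. destruct (Hl eps He) as [N HN]. exists N. intros n Hn.
    specialize (HN (S n) ltac:(lia)). rewrite csum_shift in HN. simpl pred in HN.
    replace (RtoC (INR 0) * c 0%nat * s ^ 0)%C with (RtoC 0) in HN by (simpl; ring).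
    rewrite Cplus_0_l in HN. exact HN.
  - set (K := M / (1 - q) / d ^ 2).
    assert (HK : 0 <= K).
    { unfold K. apply Rdiv_le_0_compat; [apply Rdiv_le_0_compat; lra|apply pow_lt; auto]. }
    assert (Hrem : forall h, Cmod h < d -> Cmod (f (s + h) - f s - l * h)%C <= K * (Cmod h * Cmod h)).
    { intros h Hh. assert (HS : Cser (fun n => c n * ((s + h) ^ n - s ^ n - RtoC (INR n) * s ^ (pred n) * h))%C (f (s + h) - f s - l * h)%C).
      { apply Cser_ext with (fun n => (c n * (s + h) ^ n - c n * s ^ n) - h * (RtoC (INR n) * c n * s ^ (pred n)))%C; [intros; ring|].
        replace (l * h)%C with (h * l)%C by ring.
        apply Cser_minus; [apply Cser_minus; apply H|apply Cser_cmult; auto]; auto.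
        eapply Rle_lt_trans; [apply Cmod_triangle|]. unfold d in Hh. lra. }
      eapply Rle_trans; [eapply Cser_bound; [|exact HS]|right; reflexivity].
      intros n. replace (K * (Cmod h * Cmod h)) with ((M * (Cmod h / d) ^ 2) / (1 - q)) by (unfold K; field; lra).
      apply csum_geom_bound; auto. intros k.
      destruct (pow_remainder s h d k Hd) as [A1 A2]; [lra|].
      rewrite Cmod_mult. eapply Rle_trans; [apply Rmult_le_compat_l; [apply Cmod_ge_0|exact A2]|].
      replace (M * (Cmod h / d) ^ 2 * q ^ k) with ((Cmod h / d) ^ 2 * (M * q ^ k)) by ring.
      rewrite <- Rmult_assoc, (Rmult_comm (Cmod (c k))), Rmult_assoc.
      apply Rmult_le_compat_l; [apply pow2_ge_0|]. eapply Rle_trans; [|apply Hcq].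
      apply Rmult_le_compat_l; [apply Cmod_ge_0|].
      pose proof (pow_le (Cmod s) k Ps).
      assert (0 <= INR k * Cmod s ^ pred k * d).
      { apply Rmult_le_pos; [apply Rmult_le_pos; [apply pos_INR|apply pow_le; auto]|lra]. }
      lra. }
    intros eps He. exists (Rmin d (eps / (K + 1))). split; [apply Rmin_pos; [auto|apply Rdiv_lt_0_compat; lra]|].
    intros h Hh. eapply Rle_trans; [apply Hrem; eapply Rlt_le_trans; [exact Hh|apply Rmin_l]|].
    pose proof (Rlt_le_trans _ _ _ Hh (Rmin_r _ _)) as Hh2. pose proof (Cmod_ge_0 h).
    rewrite <- Rmult_assoc. apply Rmult_le_compat_r; auto.
    apply Rle_trans with ((K + 1) * (eps / (K + 1))); [apply Rmult_le_compat; lra|right; field; lra].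
Qed.

(** Differentiation shifts the coefficients: the derived series also sums to 0, so the induction
    hypothesis for the sequence [(k + 1) c (k + 1)] settles [c (n + 1)]. The induction therefore
    ranges over all sequences [c]. *)
Lemma ps_unique c R : 0 < R -> (forall s, Cmod s < R -> Cser (fun n => c n * s ^ n)%C (RtoC 0)) -> forall n, c n = RtoC 0.
Proof.
  intros HR H n. revert c H. induction n as [|n IH]; intros c H.
  - assert (H0 : Cser (fun n => c n * RtoC 0 ^ n)%C (RtoC 0)) by (apply H; rewrite Cmod_0; auto).
    apply Cser_unique with (fun n => c n * RtoC 0 ^ n)%C; auto.
    intros eps He. exists 1%nat. intros [|k] Hk; [lia|].
    rewrite csum_shift. rewrite (csum_ext _ (fun _ => RtoC 0 * RtoC 0)%C) by (intros; rewrite Cpow_S; ring).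
    rewrite csum_cmult. replace (c 0%nat * RtoC 0 ^ 0 + RtoC 0 * csum (fun _ => RtoC 0) k - c 0%nat)%C with (RtoC 0) by (simpl; ring).
    rewrite Cmod_0; auto.
  - assert (Hn : (RtoC (INR (S n)) * c (S n))%C = RtoC 0).
    { apply (IH (fun k => RtoC (INR (S k)) * c (S k))%C). intros s Hs.
      destruct (ps_deriv c (fun _ => RtoC 0) R H s Hs) as [l [H1 H2]].
      rewrite (Cder_unique _ _ _ _ (Cder_const (RtoC 0) s) H2). exact H1. }
    assert (HS : RtoC (INR (S n)) <> RtoC 0) by (apply RtoC_nz, not_0_INR; lia).
    replace (c (S n)) with (/ RtoC (INR (S n)) * (RtoC (INR (S n)) * c (S n)))%C by (field; auto).
    rewrite Hn. ring.
Qed.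

(** * Cauchy's formula on a disc and Taylor expansions *)

Definition unitc (t : R) : C := Cexp (Ci * RtoC t).

Lemma Cmod_unitc t : Cmod (unitc t) = 1.
Proof.
  unfold unitc. rewrite Cmod_Cexp. replace (Re (Ci * RtoC t)) with 0 by (creim; ring). apply exp_0.
Qed.

Lemma unitc_nz t : unitc t <> RtoC 0.
Proof. apply Cexp_nz. Qed.

Lemma unitc_2PI : unitc (2 * PI) = unitc 0.
Proof.
  unfold unitc, Cexp. rewrite !re_scal_r, !im_scal_r. unfold Ci; creim.
  rewrite !Rmult_1_l, cos_2PI, sin_2PI, cos_0, sin_0, !Rmult_0_l. reflexivity.
Qed.

Lemma Rder_unitc t : Rder unitc t (Ci * unitc t)%C.
Proof. apply Rder_Cexp_lin. Qed.

Lemma cont_unitc t : cont unitc t.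
Proof. eapply Rder_cont, Rder_unitc. Qed.

Lemma cont_inv f x : cont f x -> f x <> RtoC 0 -> cont (fun t => / f t)%C x.
Proof. intros H Hn. apply (cont_comp_Cder (fun z => / z)%C f x _ H (Cder_inv _ Hn)). Qed.

Lemma Cder_quotient_diff f h s l k : Cder f s l -> s <> h -> Cder (fun x => (f x - k) / (x - h))%C s
  (l * / (s - h) + (f s - k) * (- / ((s - h) * (s - h))))%C.
Proof.
  intros Hf Hs. assert (Hn : (s - h)%C <> RtoC 0) by (apply Cminus_eq_contra; auto).
  apply (Cder_mult (fun x => f x - k)%C (fun x => / (x - h))%C).
  - eapply Cder_unique_val; [apply Cder_minus; [exact Hf|apply Cder_const]|ring].
  - eapply Cder_unique_val.
    + apply (Cder_comp (fun x => / x)%C (fun x => x - h)%C s _ (RtoC 1 - RtoC 0)%C (Cder_inv _ Hn)).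
      apply Cder_minus; [apply Cder_id|apply Cder_const].
    + ring.
Qed.

Section CauchyDisc.

Variables (f : C -> C) (R0 rad : R).
Hypothesis HR : 0 < rad < R0.
Hypothesis Hf : forall s, Cmod s < R0 -> exists l, Cder f s l.

Lemma Cmod_circle t : Cmod (RtoC rad * unitc t) = rad.
Proof. rewrite Cmod_mult, Cmod_unitc, Cmod_R, Rabs_pos_eq; lra. Qed.

Lemma cont_f_circle t : cont (fun t => f (RtoC rad * unitc t)%C) t.
Proof.
  destruct (Hf (RtoC rad * unitc t)%C) as [l Hl]; [rewrite Cmod_circle; lra|].
  apply (cont_comp_Cder f (fun t => RtoC rad * unitc t)%C t l); auto.
  apply cont_mult; [apply cont_const|apply cont_unitc].
Qed.

(** [Phi] contracts the circle to [h]. The difference quotient [k] is holomorphic away from [h], so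
    the loop integral [I x] does not depend on [x] in [(0, 1]]; since [k] stays bounded near [h], it
    is also [O(x)]. *)
Lemma cauchy_disc h : Cmod h < rad ->
  CI (fun t => (f (RtoC rad * unitc t) - f h) / (RtoC rad * unitc t - h) * (RtoC rad * (Ci * unitc t)))%C 0 (2 * PI) = RtoC 0.
Proof.
  intros Hh. pose proof PI_RGT_0 as Hpi. pose proof (Cmod_ge_0 h) as Ph.
  set (k := fun s => ((f s - f h) / (s - h))%C).
  set (Phi := fun x t => (h + RtoC x * (RtoC rad * unitc t - h))%C).
  set (Px := fun (x t : R) => (RtoC rad * unitc t - h)%C).
  set (Py := fun x t => (RtoC x * (RtoC rad * (Ci * unitc t)))%C).
  assert (Hd : forall t, rad - Cmod h <= Cmod (RtoC rad * unitc t - h)).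
  { intros t. eapply Rle_trans; [|apply Cmod_sub_rev]. rewrite Cmod_circle. lra. }
  assert (Hin : forall x t, 0 <= x <= 1 -> Cmod (Phi x t) <= rad).
  { intros x t Hx. unfold Phi. replace (h + RtoC x * (RtoC rad * unitc t - h))%C
      with (RtoC (1 - x) * h + RtoC x * (RtoC rad * unitc t))%C by (rewrite RtoC_minus; ring).
    eapply Rle_trans; [apply Cmod_triangle|].
    rewrite (Cmod_mult (RtoC (1 - x))), (Cmod_mult (RtoC x)), Cmod_circle, !Cmod_R, !Rabs_pos_eq by lra. nra. }
  assert (Hne : forall x t, 0 < x <= 1 -> Phi x t <> h).
  { intros x t Hx E. assert (E2 : (RtoC x * (RtoC rad * unitc t - h))%C = RtoC 0).
    { replace (RtoC x * (RtoC rad * unitc t - h))%C with (Phi x t - h)%C by (unfold Phi; ring). rewrite E. ring. }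
    apply (f_equal Cmod) in E2. rewrite Cmod_mult, Cmod_0, Cmod_R, Rabs_pos_eq in E2 by lra. specialize (Hd t). nra. }
  assert (Hk : forall x t, 0 < x <= 1 -> exists l, Cder k (Phi x t) l).
  { intros x t Hx. destruct (Hf (Phi x t)) as [l Hl]; [eapply Rle_lt_trans; [apply Hin; lra|lra]|].
    eexists. apply Cder_quotient_diff; [exact Hl|apply Hne; auto]. }
  set (I := fun x => CI (fun t => k (Phi x t) * Py x t)%C 0 (2 * PI)).
  assert (HI : forall e, 0 < e <= 1 -> I 1 = I e).
  { intros e He. unfold I.
    pose proof (goursat k Phi Px Py e 1 0 (2 * PI) (2 * rad)) as G.
    (* The radial sides at [t = 0] and [t = 2 PI] are the same segment and will cancel. *)
    assert (G2 : CI (fun t => k (Phi t 0) * Px t 0)%C e 1 = CI (fun t => k (Phi t (2 * PI)%R) * Px t (2 * PI)%R)%C e 1).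
    { apply CI_ext; [lra|]. intros x _. unfold Phi, Px. rewrite unitc_2PI. reflexivity. }
    rewrite G2 in G.
    assert (G3 : (CI (fun t => k (Phi t (2 * PI)%R) * Px t (2 * PI)%R) e 1 + CI (fun t => k (Phi 1 t) * Py 1 t) 0 (2 * PI))%C
      = (CI (fun t => k (Phi t (2 * PI)%R) * Px t (2 * PI)%R) e 1 + CI (fun t => k (Phi e t) * Py e t) 0 (2 * PI))%C).
    { apply G; try lra. intros x t Hx Ht. refine (conj _ (conj _ (conj _ (conj _ (conj _ (conj _ _)))))).
      - apply (Rder_val (fun s => Phi s t) x (RtoC 0 + (RtoC 1 * (RtoC rad * unitc t - h) + RtoC x * RtoC 0))%C); [|unfold Px; ring].
        unfold Phi. apply Rder_plus; [apply Rder_const|]. apply (Rder_mult RtoC); [apply Rder_id|apply Rder_const].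
      - apply (Rder_val (fun s => Phi x s) t (RtoC 0 + RtoC x * (RtoC rad * (Ci * unitc t) - RtoC 0))%C); [|unfold Py; ring].
        unfold Phi. apply Rder_plus; [apply Rder_const|]. apply Rder_cmult. apply Rder_minus; [apply Rder_cmult, Rder_unitc|apply Rder_const].
      - apply cont_const.
      - unfold Py. do 3 (apply cont_mult; [apply cont_const|]). apply cont_unitc.
      - unfold Px. eapply Rle_trans; [apply Cmod_sub_triangle|]. rewrite Cmod_circle. lra.
      - unfold Py. rewrite !Cmod_mult, Cmod_unitc, Cmod_Ci, !Cmod_R. rewrite !Rabs_pos_eq by lra. nra.
      - apply Hk. lra. }
    set (X := CI (fun t => k (Phi t (2 * PI)%R) * Px t (2 * PI)%R)%C e 1) in *.
    replace (CI (fun t => k (Phi 1 t) * Py 1 t)%C 0 (2 * PI)) with ((X + CI (fun t => k (Phi 1 t) * Py 1 t)%C 0 (2 * PI)) - X)%C by ring.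
    rewrite G3. ring. }
  assert (H1 : CI (fun t => (f (RtoC rad * unitc t) - f h) / (RtoC rad * unitc t - h) * (RtoC rad * (Ci * unitc t)))%C 0 (2 * PI) = I 1).
  { unfold I. apply CI_ext; [lra|]. intros t _. unfold k, Py, Phi.
    replace (h + RtoC 1 * (RtoC rad * unitc t - h))%C with (RtoC rad * unitc t)%C by ring. ring. }
  rewrite H1. apply Cmod_le_0. intros eps He.
  destruct (Hf h) as [l Hl]; [lra|]. destruct (Hl 1) as [d [Hd0 Hd1]]; [lra|].
  pose proof (Cmod_ge_0 l) as Pl.
  set (e := Rmin 1 (Rmin (d / (4 * rad)) (eps / ((Cmod l + 1) * rad * (2 * PI))))).
  assert (Hden : 0 < (Cmod l + 1) * rad * (2 * PI)) by (apply Rmult_lt_0_compat; [apply Rmult_lt_0_compat; lra|lra]).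
  assert (He0 : 0 < e).
  { unfold e. repeat apply Rmin_pos; try lra; apply Rdiv_lt_0_compat; lra. }
  assert (He1 : e <= 1) by apply Rmin_l.
  assert (He2 : e <= d / (4 * rad)) by (eapply Rle_trans; [apply Rmin_r|apply Rmin_l]).
  assert (He3 : e <= eps / ((Cmod l + 1) * rad * (2 * PI))) by (eapply Rle_trans; [apply Rmin_r|apply Rmin_r]).
  rewrite (HI e) by lra. unfold I.
  apply Rle_trans with ((Cmod l + 1) * (e * rad) * (2 * PI - 0)).
  - apply CI_bound_const; [lra| |].
    + intros t _. destruct (Hk e t ltac:(lra)) as [m Hm]. apply cont_mult.
      * apply (cont_comp_Cder k (fun t => Phi e t) t m); auto. unfold Phi.
        apply cont_plus; [apply cont_const|]. apply cont_mult; [apply cont_const|].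
        apply cont_minus; [|apply cont_const]. apply cont_mult; [apply cont_const|apply cont_unitc].
      * unfold Py. do 3 (apply cont_mult; [apply cont_const|]). apply cont_unitc.
    + intros t _. rewrite Cmod_mult. unfold Py at 1. rewrite !Cmod_mult, Cmod_unitc, Cmod_Ci, !Cmod_R, !Rabs_pos_eq by lra.
      replace (e * (rad * (1 * 1))) with (e * rad) by ring. apply Rmult_le_compat_r; [nra|].
      set (w := (RtoC e * (RtoC rad * unitc t - h))%C).
      assert (Hw : Cmod w < d).
      { unfold w. rewrite Cmod_mult, Cmod_R, Rabs_pos_eq by lra.
        apply Rle_lt_trans with (d / (4 * rad) * (2 * rad)).
        - apply Rmult_le_compat; [lra|apply Cmod_ge_0|auto|]. eapply Rle_trans; [apply Cmod_sub_triangle|].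
          rewrite Cmod_circle. lra.
        - replace (d / (4 * rad) * (2 * rad)) with (d / 2) by (field; lra). lra. }
      assert (Hwn : w <> RtoC 0).
      { intros E. apply (Hne e t ltac:(lra)). unfold Phi. fold w. rewrite E. ring. }
      unfold k, Phi. fold w. replace (h + w - h)%C with w by ring.
      specialize (Hd1 w Hw). pose proof (proj1 (Cmod_gt_0 w) Hwn) as Pw.
      rewrite Cmod_div by auto. apply Rmult_le_reg_r with (Cmod w); auto.
      replace (Cmod (f (h + w)%C - f h) / Cmod w * Cmod w) with (Cmod (f (h + w)%C - f h)) by (field; lra).
      replace (f (h + w)%C - f h)%C with ((f (h + w)%C - f h - l * w) + l * w)%C by ring.
      eapply Rle_trans; [apply Cmod_triangle|]. rewrite Cmod_mult. lra.
  - replace ((Cmod l + 1) * (e * rad) * (2 * PI - 0)) with (e * ((Cmod l + 1) * rad * (2 * PI))) by ring.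
    apply Rle_trans with (eps / ((Cmod l + 1) * rad * (2 * PI)) * ((Cmod l + 1) * rad * (2 * PI))); [apply Rmult_le_compat_r; lra|].
    right. field. repeat split; lra.
Qed.

Let u t := (/ (RtoC rad * unitc t))%C.

Lemma circle_nz t : (RtoC rad * unitc t)%C <> RtoC 0.
Proof. apply Cmult_neq_0; [apply RtoC_nz; lra|apply unitc_nz]. Qed.

Lemma cont_u t : cont u t.
Proof. apply cont_inv; [|apply circle_nz]. apply cont_mult; [apply cont_const|apply cont_unitc]. Qed.

Lemma CI_u_pow n : CI (fun t => u t ^ n)%C 0 (2 * PI) = match n with O => RtoC (2 * PI) | _ => RtoC 0 end.
Proof.
  pose proof PI_RGT_0 as Hpi. destruct n as [|n].
  - rewrite (CI_ext _ (fun _ => RtoC 1)); [|lra|intros; reflexivity]. rewrite CI_const by lra.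
    rewrite Rminus_0_r. ring.
  - assert (Hn : RtoC (INR (S n)) <> RtoC 0) by (apply RtoC_nz, not_0_INR; lia).
    assert (HRn : RtoC rad <> RtoC 0) by (apply RtoC_nz; lra).
    assert (Du : forall t, Rder u t (- (Ci * u t))%C).
    { intros t. eapply Rder_val.
      - apply (Rder_comp_Cder (fun z => / z)%C (fun t => RtoC rad * unitc t)%C); [apply Cder_inv, circle_nz|].
        apply Rder_cmult, Rder_unitc.
      - unfold u. field. split; [apply unitc_nz|auto]. }
    rewrite (CI_FTC (fun t => (- / (Ci * RtoC (INR (S n)))) * u t ^ S n)%C).
    + unfold u. rewrite unitc_2PI. ring.
    + lra.
    + intros t _. eapply Rder_val.
      * apply Rder_cmult. apply (Rder_comp_Cder (fun z => z ^ S n)%C u); [apply Cder_pow|apply Du].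
      * rewrite Cpow_S. field. split; [auto|apply Ci_nz].
    + intros t _. apply cont_pow, cont_u.
Qed.

(** Cauchy's coefficient, the integral of [f(s) / s^(n+1) ds] divided by [2 pi i], on the circle
    parametrized so that [ds = Ci s dt]. *)
Definition taylor_coef n : C := (/ RtoC (2 * PI) * CI (fun t => f (RtoC rad * unitc t) * u t ^ n) 0 (2 * PI))%C.

Lemma taylor_coef_bound M : (forall s, Cmod s = rad -> Cmod (f s) <= M) -> forall n, Cmod (taylor_coef n) <= M / rad ^ n.
Proof.
  intros HM n. pose proof PI_RGT_0 as Hpi. unfold taylor_coef.
  rewrite Cmod_mult, Cmod_inv, Cmod_R, Rabs_pos_eq by (try apply RtoC_nz; lra).
  apply Rle_trans with (/ (2 * PI) * (M / rad ^ n * (2 * PI - 0))).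
  - apply Rmult_le_compat_l; [left; apply Rinv_0_lt_compat; lra|]. apply CI_bound_const; [lra| |].
    + intros t _. apply cont_mult; [apply cont_f_circle|apply cont_pow, cont_u].
    + intros t _. rewrite Cmod_mult, Cmod_pow. unfold u. rewrite Cmod_inv, Cmod_circle by apply circle_nz.
      rewrite pow_inv. unfold Rdiv. apply Rmult_le_compat_r; [left; apply Rinv_0_lt_compat, pow_lt; lra|].
      apply HM. apply Cmod_circle.
  - right. field. split; [apply pow_nonzero; lra|lra].
Qed.

Lemma circle_bounded : exists M, 0 <= M /\ forall t, 0 <= t <= 2 * PI -> Cmod (f (RtoC rad * unitc t)%C) <= M.
Proof.
  pose proof PI_RGT_0 as Hpi.
  destruct (continuity_ab_maj (fun t => Cmod (f (RtoC rad * unitc t)%C)) 0 (2 * PI)) as [t0 [H1 H2]]; [lra| |].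
  - intros t _. apply continuity_pt_filterlim. apply (cont_Cmod (fun t => f (RtoC rad * unitc t)%C)). apply cont_f_circle.
  - exists (Cmod (f (RtoC rad * unitc t0)%C)). split; [apply Cmod_ge_0|]. auto.
Qed.

(** No series is integrated. With [q = h/s], the identity [q^(n+1)/(1 - q) = q^n/(1 - q) - q^n] lets
    each step of [Hn] peel off one Taylor term, starting from [cauchy_disc], and the integral that
    remains is [O(r^n)]. *)
Lemma taylor_0 h : Cmod h < rad -> Cser (fun n => taylor_coef n * h ^ n)%C (f h).
Proof.
  intros Hh. pose proof PI_RGT_0 as Hpi. pose proof (Cmod_ge_0 h) as Ph.
  assert (HRn : RtoC rad <> RtoC 0) by (apply RtoC_nz; lra).
  assert (H2pi : RtoC (2 * PI) <> RtoC 0) by (apply RtoC_nz; lra).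
  set (q := fun t => (h * u t)%C). set (r := Cmod h / rad).
  assert (Hr : 0 <= r < 1).
  { unfold r. split; [apply Rdiv_le_0_compat; lra|]. apply Rmult_lt_reg_r with rad; [lra|].
    unfold Rdiv. rewrite Rmult_assoc, Rinv_l; lra. }
  assert (Hq : forall t, Cmod (q t) = r).
  { intros t. unfold q, u. rewrite Cmod_mult, Cmod_inv, Cmod_circle by apply circle_nz. reflexivity. }
  assert (Hq1 : forall t, 1 - r <= Cmod (RtoC 1 - q t)).
  { intros t. rewrite <- (Hq t). rewrite <- Cmod_1 at 1. apply Cmod_sub_rev. }
  assert (Hqn : forall t, (RtoC 1 - q t)%C <> RtoC 0) by (intros t; apply Cmod_gt_0; specialize (Hq1 t); lra).
  assert (Cq : forall t, cont q t) by (intros t; apply cont_mult; [apply cont_const|apply cont_u]).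
  set (g := fun t => (f (RtoC rad * unitc t) - f h)%C).
  assert (Cg : forall t, cont g t) by (intros t; apply cont_minus; [apply cont_f_circle|apply cont_const]).
  assert (Ciq : forall t, cont (fun t => / (RtoC 1 - q t))%C t).
  { intros t. apply cont_inv; auto. apply cont_minus; [apply cont_const|auto]. }
  assert (Cgn : forall n t, cont (fun t => g t * (q t ^ n * / (RtoC 1 - q t)))%C t).
  { intros n t. apply cont_mult; [apply Cg|apply cont_mult; [apply cont_pow, Cq|apply Ciq]]. }
  assert (H0 : CI (fun t => g t * / (RtoC 1 - q t))%C 0 (2 * PI) = RtoC 0).
  { pose proof (cauchy_disc h Hh) as Hc.
    rewrite (CI_ext _ (fun t => Ci * (g t * / (RtoC 1 - q t)))%C) in Hc; [|lra|].
    - rewrite CI_cmult in Hc; [|lra|intros t _; apply cont_mult; auto].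
      replace (CI (fun t => g t * / (RtoC 1 - q t))%C 0 (2 * PI)) with (/ Ci * (Ci * CI (fun t => g t * / (RtoC 1 - q t))%C 0 (2 * PI)))%C by (field; apply Ci_nz).
      rewrite Hc. ring.
    - intros t _. specialize (Hqn t). unfold g, q, u in *.
      assert (Hn2 : (RtoC rad * unitc t - h)%C <> RtoC 0).
      { replace (RtoC rad * unitc t - h)%C with ((RtoC rad * unitc t) * (RtoC 1 - h * / (RtoC rad * unitc t)))%C
          by (field; split; [apply unitc_nz|auto]).
        apply Cmult_neq_0; [apply circle_nz|auto]. }
      field. repeat split; auto using unitc_nz. }
  assert (Hn : forall n, CI (fun t => g t * (q t ^ n * / (RtoC 1 - q t)))%C 0 (2 * PI) =
     (RtoC (2 * PI) * (match n with O => RtoC 0 | _ => f h end - csum (fun n => taylor_coef n * h ^ n) n))%C).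
  { induction n as [|n IH].
    - rewrite (CI_ext _ (fun t => g t * / (RtoC 1 - q t))%C); [|lra|intros; simpl; ring]. rewrite H0. simpl. ring.
    - rewrite (CI_ext _ (fun t => g t * (q t ^ n * / (RtoC 1 - q t)) - g t * q t ^ n)%C); [|lra|].
      2: { intros t _. rewrite Cpow_S. field. auto. }
      rewrite CI_minus; [|lra| |].
      2: intros t _; apply Cgn.
      2: intros t _; apply cont_mult; [apply Cg|apply cont_pow, Cq].
      rewrite IH.
      assert (E : CI (fun t => g t * q t ^ n)%C 0 (2 * PI) =
        (RtoC (2 * PI) * (taylor_coef n * h ^ n - match n with O => f h | _ => RtoC 0 end))%C).
      { rewrite (CI_ext _ (fun t => h ^ n * (f (RtoC rad * unitc t) * u t ^ n) - (f h * h ^ n) * u t ^ n)%C); [|lra|].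
        2: { intros t _. unfold g, q. rewrite Cpow_mult_l. ring. }
        rewrite CI_minus; [|lra| |].
        - rewrite !CI_cmult; [|lra| |lra|].
          + rewrite CI_u_pow. unfold taylor_coef. destruct n; [simpl|]; field; auto.
          + intros t _. apply cont_pow, cont_u.
          + intros t _. apply cont_mult; [apply cont_f_circle|apply cont_pow, cont_u].
        - intros t _. apply cont_mult; [apply cont_const|]. apply cont_mult; [apply cont_f_circle|apply cont_pow, cont_u].
        - intros t _. apply cont_mult; [apply cont_const|]. apply cont_pow, cont_u. }
      rewrite E. simpl csum. destruct n; ring. }
  destruct circle_bounded as [M [HM HMt]].
  set (K := M + Cmod (f h)). assert (HK : 0 <= K) by (pose proof (Cmod_ge_0 (f h)); unfold K; lra).
  assert (Hest : forall n, Cmod (csum (fun n => taylor_coef n * h ^ n)%C (S n) - f h) <= K / (1 - r) * r ^ S n).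
  { intros n. specialize (Hn (S n)). cbv iota in Hn.
    replace (csum (fun n => taylor_coef n * h ^ n)%C (S n) - f h)%C with
      (- (/ RtoC (2 * PI) * CI (fun t => g t * (q t ^ S n * / (RtoC 1 - q t)))%C 0 (2 * PI)))%C by (rewrite Hn; field; auto).
    rewrite Cmod_opp, Cmod_mult, Cmod_inv, Cmod_R, Rabs_pos_eq by (auto; lra).
    apply Rle_trans with (/ (2 * PI) * (K / (1 - r) * r ^ S n * (2 * PI - 0))); [|right; field; lra].
    apply Rmult_le_compat_l; [left; apply Rinv_0_lt_compat; lra|]. apply CI_bound_const; [lra| |].
    - intros t _. apply Cgn.
    - intros t Ht. rewrite !Cmod_mult, Cmod_pow, Hq, Cmod_inv by auto.
      assert (G : Cmod (g t) <= K) by (unfold g, K; eapply Rle_trans; [apply Cmod_sub_triangle|]; specialize (HMt t Ht); lra).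
      assert (G2 : / Cmod (RtoC 1 - q t) <= / (1 - r)) by (apply Rinv_le_contravar; [lra|apply Hq1]).
      replace (K / (1 - r) * r ^ S n) with (K * (r ^ S n * / (1 - r))) by (unfold Rdiv; ring).
      assert (0 <= r ^ S n) by (apply pow_le; lra).
      apply Rmult_le_compat; auto using Cmod_ge_0.
      + apply Rmult_le_pos; auto. left. apply Rinv_0_lt_compat. specialize (Hq1 t). lra.
      + apply Rmult_le_compat_l; auto. }
  intros eps He.
  destruct (pow_lt_1_zero r) with (y := eps / (K / (1 - r) + 1)) as [N HN].
  { rewrite Rabs_pos_eq; lra. }
  { assert (0 <= K / (1 - r)) by (apply Rdiv_le_0_compat; lra). apply Rdiv_lt_0_compat; lra. }
  exists (S N). intros [|n] Hnn; [lia|].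
  eapply Rle_lt_trans; [apply Hest|]. specialize (HN (S n) ltac:(lia)). rewrite Rabs_pos_eq in HN by (apply pow_le; lra).
  assert (HK2 : 0 <= K / (1 - r)) by (apply Rdiv_le_0_compat; lra).
  apply Rle_lt_trans with (K / (1 - r) * (eps / (K / (1 - r) + 1))); [apply Rmult_le_compat_l; lra|].
  set (X := K / (1 - r)) in *. apply Rmult_lt_reg_r with (X + 1); [lra|].
  replace (X * (eps / (X + 1)) * (X + 1)) with (X * eps) by (field; lra). lra.
Qed.

End CauchyDisc.

Theorem taylor f z0 R0 R : 0 < R < R0 -> (forall z, Cmod (z - z0) < R0 -> exists l, Cder f z l) ->
  exists c, (forall M, (forall z, Cmod (z - z0) = R -> Cmod (f z) <= M) -> forall n, Cmod (c n) <= M / R ^ n) /\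
    forall h, Cmod h < R -> Cser (fun n => c n * h ^ n)%C (f (z0 + h)%C).
Proof.
  intros HR Hf. set (g := fun s => f (z0 + s)%C).
  assert (Hg : forall s, Cmod s < R0 -> exists l, Cder g s l).
  { intros s Hs. destruct (Hf (z0 + s)%C) as [l Hl]; [replace (z0 + s - z0)%C with s by ring; auto|].
    exists (l * (RtoC 0 + RtoC 1))%C. apply (Cder_comp f (fun s => z0 + s)%C); auto.
    apply Cder_plus; [apply Cder_const|apply Cder_id]. }
  exists (taylor_coef g R). split.
  - intros M HM n. apply (taylor_coef_bound g R0 R HR Hg). intros s Hs. apply HM.
    replace (z0 + s - z0)%C with s by ring. auto.
  - intros h Hh. apply (taylor_0 g R0 R HR Hg h Hh).
Qed.

(** * Higher derivatives, Cauchy's estimates and the identity theorem *)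

Lemma Cder_C_derive f z l : Cder f z l -> C_derive f z = l.
Proof. intros H. apply is_C_derive_unique. apply Cder_is_derive; auto. Qed.

Lemma Cder_shift f z0 s l : Cder (fun h => f (z0 + h)%C) s l -> Cder f (z0 + s)%C l.
Proof.
  intros H. apply Cder_ext with (fun z => f (z0 + (z - z0))%C); [intros; f_equal; ring|].
  eapply Cder_unique_val.
  - apply (Cder_comp (fun h => f (z0 + h)%C) (fun z => z - z0)%C (z0 + s)%C l (RtoC 1 - RtoC 0)%C).
    + replace (z0 + s - z0)%C with s by ring. exact H.
    + apply Cder_minus; [apply Cder_id|apply Cder_const].
  - ring.
Qed.

(** [C_derive] is a total operator, so the iterates exist everywhere; they carry meaning only where
    holomorphy is known. *)
Fixpoint Cder_n (f : C -> C) (n : nat) : C -> C :=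
  match n with O => f | S k => C_derive (Cder_n f k) end.

Lemma ps_deriv_n f z0 R c : (forall h, Cmod h < R -> Cser (fun n => c n * h ^ n)%C (f (z0 + h)%C)) ->
  forall n, exists b, (b 0%nat = RtoC (INR (fact n)) * c n)%C /\
    forall h, Cmod h < R -> Cser (fun k => b k * h ^ k)%C (Cder_n f n (z0 + h)%C) /\
      Cder (Cder_n f n) (z0 + h)%C (Cder_n f (S n) (z0 + h)%C).
Proof.
  intros H n.
  (* All coefficients of the [n]-th derivative are tracked through the induction, although only the
     constant one is exported. *)
  assert (G : exists b, (forall k, b k = RtoC (INR (fact (n + k)) / INR (fact k)) * c (n + k)%nat)%C /\
    forall h, Cmod h < R -> Cser (fun k => b k * h ^ k)%C (Cder_n f n (z0 + h)%C)).
  { induction n as [|n [b [Hb HS]]].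
    - exists c. split; [|exact H]. intros k. simpl.
      replace (INR (fact k) / INR (fact k)) with 1 by (field; apply INR_fact_neq_0). ring.
    - exists (fun k => RtoC (INR (S k)) * b (S k))%C. split.
      + intros k. rewrite Hb. replace (n + S k)%nat with (S n + k)%nat by lia.
        rewrite Cmult_assoc, <- RtoC_mult. f_equal. f_equal.
        change (fact (S k)) with (S k * fact k)%nat. rewrite mult_INR. field.
        split; [apply INR_fact_neq_0|apply not_0_INR; lia].
      + intros h Hh. destruct (ps_deriv b (fun h => Cder_n f n (z0 + h)%C) R HS h Hh) as [l [H1 H2]].
        simpl. rewrite (Cder_C_derive _ _ l); auto. apply Cder_shift; auto. }
  destruct G as [b [Hb HS]]. exists b. split.
  - rewrite Hb, Nat.add_0_r. simpl (fact 0). simpl (INR 1). rewrite Rdiv_1_r. reflexivity.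
  - intros h Hh. split; [auto|].
    destruct (ps_deriv b (fun h => Cder_n f n (z0 + h)%C) R HS h Hh) as [l [H1 H2]].
    simpl. rewrite (Cder_C_derive (Cder_n f n) (z0 + h)%C l); apply Cder_shift; auto.
Qed.

Lemma Cser_at_0 b l : Cser (fun k => b k * RtoC 0 ^ k)%C l -> l = b 0%nat.
Proof.
  intros H. apply Cser_unique with (fun k => b k * RtoC 0 ^ k)%C; auto.
  intros eps He. exists 1%nat. intros [|k] Hk; [lia|].
  rewrite csum_shift. rewrite (csum_ext _ (fun _ => RtoC 0 * RtoC 0)%C) by (intros; rewrite Cpow_S; ring).
  rewrite csum_cmult. replace (b 0%nat * RtoC 0 ^ 0 + RtoC 0 * csum (fun _ => RtoC 0) k - b 0%nat)%C with (RtoC 0) by (simpl; ring).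
  rewrite Cmod_0; auto.
Qed.

Lemma ps_Cder_n_0 f z0 R c : 0 < R -> (forall h, Cmod h < R -> Cser (fun n => c n * h ^ n)%C (f (z0 + h)%C)) ->
  forall n, Cder_n f n z0 = (RtoC (INR (fact n)) * c n)%C.
Proof.
  intros HR H n. destruct (ps_deriv_n f z0 R c H n) as [b [Hb HS]].
  destruct (HS (RtoC 0)) as [H1 _]; [rewrite Cmod_0; auto|].
  replace (z0 + RtoC 0)%C with z0 in H1 by ring. rewrite (Cser_at_0 _ _ H1). exact Hb.
Qed.

Lemma cauchy_estimate f z0 R0 R M n : 0 < R < R0 -> (forall z, Cmod (z - z0) < R0 -> exists l, Cder f z l) ->
  (forall z, Cmod (z - z0) = R -> Cmod (f z) <= M) -> Cmod (Cder_n f n z0) <= M * INR (fact n) / R ^ n.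
Proof.
  intros HR Hf HM. destruct (taylor f z0 R0 R HR Hf) as [c [Hc HS]].
  rewrite (ps_Cder_n_0 f z0 R c); [|lra|auto].
  rewrite Cmod_mult, Cmod_R, Rabs_pos_eq by apply pos_INR.
  specialize (Hc M HM n). replace (M * INR (fact n) / R ^ n) with (INR (fact n) * (M / R ^ n)) by (unfold Rdiv; ring).
  apply Rmult_le_compat_l; [apply pos_INR|auto].
Qed.

Lemma holo_Cder_n f z0 R0 n : 0 < R0 -> (forall z, Cmod (z - z0) < R0 -> exists l, Cder f z l) ->
  Cder (Cder_n f n) z0 (Cder_n f (S n) z0).
Proof.
  intros HR Hf. destruct (taylor f z0 R0 (R0 / 2)) as [c [_ HS]]; [lra|auto|].
  destruct (ps_deriv_n f z0 (R0 / 2) c HS n) as [b [_ Hb]].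
  destruct (Hb (RtoC 0)) as [_ H]; [rewrite Cmod_0; lra|].
  replace (z0 + RtoC 0)%C with z0 in H by ring. exact H.
Qed.

Lemma holo_zero_extends f z0 R0 d : 0 < d -> (forall z, Cmod (z - z0) < R0 -> exists l, Cder f z l) ->
  (forall z, Cmod (z - z0) < d -> f z = RtoC 0) -> forall z, Cmod (z - z0) < R0 -> f z = RtoC 0.
Proof.
  intros Hd Hf H0 z Hz. set (R := (R0 + Cmod (z - z0)) / 2).
  pose proof (Cmod_ge_0 (z - z0)) as Pz.
  destruct (taylor f z0 R0 R) as [c [_ HS]]; [unfold R; lra|auto|].
  assert (Hc : forall n, c n = RtoC 0).
  { apply (ps_unique c (Rmin d R)); [apply Rmin_pos; [auto|unfold R; lra]|].
    intros s Hs. rewrite <- (H0 (z0 + s)%C).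
    - apply HS. eapply Rlt_le_trans; [exact Hs|apply Rmin_r].
    - replace (z0 + s - z0)%C with s by ring. eapply Rlt_le_trans; [exact Hs|apply Rmin_l]. }
  specialize (HS (z - z0)%C). replace (z0 + (z - z0))%C with z in HS by ring.
  apply Cser_unique with (fun n => c n * (z - z0) ^ n)%C; [apply HS; unfold R; lra|].
  intros eps He. exists 0%nat. intros n _.
  rewrite (csum_ext _ (fun _ => RtoC 0 * RtoC 0)%C) by (intros; rewrite Hc; ring).
  rewrite csum_cmult. replace (RtoC 0 * csum (fun _ => RtoC 0) n - RtoC 0)%C with (RtoC 0) by ring. rewrite Cmod_0; auto.
Qed.

(** Vanishing propagates along discs of the fixed radius [R0] whose centres advance by at most
    [R0/2]: the previous disc then contains a disc around the new centre. [n] counts the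
    advances. *)
Lemma identity_on_segment f (x0 x1 R0 d : R) : x0 <= x1 -> 0 < R0 -> 0 < d ->
  (forall x z, x0 <= x <= x1 -> Cmod (z - RtoC x) < R0 -> exists l, Cder f z l) ->
  (forall z, Cmod (z - RtoC x0) < d -> f z = RtoC 0) -> forall x, x0 <= x <= x1 -> f (RtoC x) = RtoC 0.
Proof.
  intros Hx HR Hd Hf H0.
  assert (G : forall n x, x0 <= x <= x1 -> x <= x0 + INR n * (R0 / 2) ->
     forall z, Cmod (z - RtoC x) < R0 -> f z = RtoC 0).
  { induction n as [|n IH]; intros x Hx1 Hx2.
    - simpl in Hx2. assert (x = x0) as -> by lra. apply (holo_zero_extends f (RtoC x0) R0 d); auto.
      intros z. apply (Hf x0); lra.
    - rewrite S_INR in Hx2. set (y := Rmax x0 (x - R0 / 2)).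
      assert (Hy : x0 <= y <= x1 /\ y <= x0 + INR n * (R0 / 2) /\ Rabs (x - y) <= R0 / 2).
      { pose proof (pos_INR n). unfold y. destruct (Rle_dec x0 (x - R0 / 2)) as [H1|H1].
        - rewrite Rmax_right by lra. repeat split; try lra. apply Rabs_le; lra.
        - rewrite Rmax_left by lra. repeat split; try lra; [nra|]. apply Rabs_le; lra. }
      destruct Hy as [Hy1 [Hy2 Hy3]].
      apply (holo_zero_extends f (RtoC x) R0 (R0 / 2)); [lra|intros z; apply (Hf x); lra|].
      intros z Hz. apply (IH y Hy1 Hy2).
      replace (z - RtoC y)%C with ((z - RtoC x) + RtoC (x - y))%C by (rewrite RtoC_minus; ring).
      eapply Rle_lt_trans; [apply Cmod_triangle|]. rewrite Cmod_R. lra. }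
  intros x Hx1. destruct (nfloor_ex ((x - x0) / (R0 / 2))) as [n [_ Hn]]; [apply Rdiv_le_0_compat; lra|].
  apply (G (S n) x Hx1).
  - rewrite S_INR. assert ((x - x0) / (R0 / 2) * (R0 / 2) < (INR n + 1) * (R0 / 2)) by (apply Rmult_lt_compat_r; lra).
    replace ((x - x0) / (R0 / 2) * (R0 / 2)) with (x - x0) in H by (field; lra). lra.
  - replace (RtoC x - RtoC x)%C with (RtoC 0) by ring. rewrite Cmod_0; auto.
Qed.

(** * Improper integrals *)

Definition Limp (u : R -> C) (l : C) : Prop :=
  forall eps, 0 < eps -> exists X0, forall X, X0 <= X -> Cmod (u X - l) < eps.

Lemma Limp_unique u l k : Limp u l -> Limp u k -> l = k.
Proof.
  intros H1 H2. apply Ceq_minus. apply Cmod_le_0. intros eps He.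
  destruct (H1 (eps / 2)) as [X1 P1]; [lra|]. destruct (H2 (eps / 2)) as [X2 P2]; [lra|].
  specialize (P1 (Rmax X1 X2) (Rmax_l _ _)). specialize (P2 (Rmax X1 X2) (Rmax_r _ _)).
  replace (l - k)%C with ((u (Rmax X1 X2) - k) - (u (Rmax X1 X2) - l))%C by ring.
  eapply Rle_trans; [apply Cmod_sub_triangle|]. lra.
Qed.

Lemma Limp_ext u v l X1 : (forall X, X1 <= X -> u X = v X) -> Limp u l -> Limp v l.
Proof.
  intros E H eps He. destruct (H eps He) as [X0 HX]. exists (Rmax X0 X1). intros X HX2.
  rewrite <- E; [apply HX|]; eapply Rle_trans; [apply Rmax_l|eassumption|apply Rmax_r|eassumption].
Qed.

Lemma Limp_plus u v l k : Limp u l -> Limp v k -> Limp (fun X => u X + v X)%C (l + k)%C.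
Proof.
  intros H1 H2 eps He. destruct (H1 (eps / 2)) as [X1 P1]; [lra|]. destruct (H2 (eps / 2)) as [X2 P2]; [lra|].
  exists (Rmax X1 X2). intros X HX. specialize (P1 X (Rle_trans _ _ _ (Rmax_l _ _) HX)). specialize (P2 X (Rle_trans _ _ _ (Rmax_r _ _) HX)).
  replace (u X + v X - (l + k))%C with ((u X - l) + (v X - k))%C by ring.
  eapply Rle_lt_trans; [apply Cmod_triangle|]. lra.
Qed.

Lemma Limp_cmult c u l : Limp u l -> Limp (fun X => c * u X)%C (c * l)%C.
Proof.
  intros H eps He. pose proof (Cmod_ge_0 c). destruct (H (eps / (Cmod c + 1))) as [X0 HX]; [apply Rdiv_lt_0_compat; lra|].
  exists X0. intros X HX2. specialize (HX X HX2). replace (c * u X - c * l)%C with (c * (u X - l))%C by ring.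
  rewrite Cmod_mult. apply Rle_lt_trans with (Cmod c * (eps / (Cmod c + 1))); [apply Rmult_le_compat_l; lra|].
  apply Rmult_lt_reg_r with (Cmod c + 1); [lra|]. field_simplify; lra.
Qed.

Lemma Limp_const c : Limp (fun _ => c) c.
Proof. intros eps He. exists 0. intros. replace (c - c)%C with (RtoC 0) by ring. rewrite Cmod_0; auto. Qed.

Lemma Limp_minus u v l k : Limp u l -> Limp v k -> Limp (fun X => u X - v X)%C (l - k)%C.
Proof.
  intros H1 H2. apply Limp_ext with (fun X => u X + (-(1)) * v X)%C 0; [intros; ring|].
  replace (l - k)%C with (l + (-(1)) * k)%C by ring. apply Limp_plus, Limp_cmult; auto.
Qed.

Lemma Limp_bound u l M X1 : (forall X, X1 <= X -> Cmod (u X) <= M) -> Limp u l -> Cmod l <= M.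
Proof.
  intros HM H. apply le_epsilon. intros eps He. destruct (H eps He) as [X0 HX].
  specialize (HX (Rmax X0 X1) (Rmax_l _ _)). specialize (HM (Rmax X0 X1) (Rmax_r _ _)).
  pose proof (Cmod_sub_rev l (u (Rmax X0 X1))). rewrite Cmod_sub_sym in HX. lra.
Qed.

Lemma exp_decay K d eps : 0 < d -> 0 < eps -> exists X0, forall X, X0 <= X -> K * exp (- d * X) < eps.
Proof.
  intros Hd He. exists (Rmax 0 (K / (eps * d))). intros X HX.
  assert (H0 : 0 <= X) by (eapply Rle_trans; [apply Rmax_l|exact HX]).
  assert (H1 : K / (eps * d) <= X) by (eapply Rle_trans; [apply Rmax_r|exact HX]).
  assert (Hex : 1 + d * X <= exp (d * X)) by (destruct (Req_dec (d * X) 0) as [E|E]; [rewrite E, exp_0; lra|left; apply exp_ineq1; auto]).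
  replace (- d * X) with (- (d * X)) by ring. rewrite exp_Ropp.
  assert (Hp := exp_pos (d * X)). apply Rmult_lt_reg_r with (exp (d * X)); auto.
  rewrite Rmult_assoc, Rinv_l by lra.
  apply Rle_lt_trans with (eps * (d * X)); [|nra].
  apply Rmult_le_compat_r with (r := eps * d) in H1; [|nra].
  replace (K / (eps * d) * (eps * d)) with K in H1 by (field; lra). lra.
Qed.

Lemma C_cauchy_limit (u : nat -> C) (b : nat -> R) :
  (forall n m, (n <= m)%nat -> Cmod (u m - u n) <= b n) ->
  (forall eps, 0 < eps -> exists N, forall n, (N <= n)%nat -> b n < eps) ->
  exists l, forall n, Cmod (u n - l) <= b n.
Proof.
  intros Hu Hb.
  assert (Hc : forall p : C -> R, (forall x y, Rabs (p x - p y) <= Cmod (x - y)) -> ex_finite_lim_seq (fun n => p (u n))).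
  { intros p Hp. apply ex_lim_seq_cauchy_corr. intros eps.
    destruct (Hb (eps / 2)) as [N HN]; [pose proof (cond_pos eps); lra|]. exists N. intros n m Hn Hm.
    eapply Rle_lt_trans; [apply Hp|].
    replace (u n - u m)%C with ((u n - u N) - (u m - u N))%C by ring.
    eapply Rle_lt_trans; [apply Cmod_sub_triangle|].
    pose proof (Hu N n Hn). pose proof (Hu N m Hm). specialize (HN N (Nat.le_refl N)). lra. }
  destruct (Hc Re) as [l1 H1].
  { intros x y. eapply Rle_trans; [|apply re_le_Cmod]. right; f_equal. }
  destruct (Hc Im) as [l2 H2].
  { intros x y. eapply Rle_trans; [|apply im_le_Cmod]. right; f_equal. }
  exists (l1, l2). intros n. apply le_epsilon. intros eps He.
  apply is_lim_seq_spec in H1. apply is_lim_seq_spec in H2.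
  assert (He2 : 0 < eps / 2) by lra.
  destruct (H1 (mkposreal _ He2)) as [N1 P1]. destruct (H2 (mkposreal _ He2)) as [N2 P2].
  set (m := (n + N1 + N2)%nat). specialize (P1 m ltac:(lia)). specialize (P2 m ltac:(lia)). simpl in P1, P2.
  pose proof (Hu n m ltac:(lia)) as H3.
  replace (u n - (l1, l2))%C with ((u m - (l1, l2)) - (u m - u n))%C by ring.
  eapply Rle_trans; [apply Cmod_sub_triangle|].
  assert (Cmod (u m - (l1, l2)) <= eps).
  { eapply Rle_trans; [apply Cmod_le_sum|]. unfold Re, Im in *. simpl in *. unfold Rminus in *. lra. }
  lra.
Qed.

Lemma is_RInt_exp d X Y : 0 < d -> is_RInt (fun x => exp (- d * x)) X Y ((exp (- d * X) - exp (- d * Y)) / d).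
Proof.
  intros Hd.
  evar_last.
  - apply (is_RInt_derive (fun x => - exp (- d * x) / d) (fun x => exp (- d * x))).
    + intros x _. auto_derive; auto. field. lra.
    + intros x _. apply (ex_derive_continuous (fun x => exp (- d * x))). auto_derive; auto.
  - unfold minus, plus, opp; simpl. field. lra.
Qed.

Lemma CI_exp_bound f K d X Y : 0 < d -> X <= Y -> 0 <= K -> contI f X Y ->
  (forall x, X <= x <= Y -> Cmod (f x) <= K * exp (- d * x)) -> Cmod (CI f X Y) <= K / d * exp (- d * X).
Proof.
  intros Hd HXY HK Hc Hf.
  assert (H : Cmod (CI f X Y) <= K * ((exp (- d * X) - exp (- d * Y)) / d)).
  { apply (CI_bound f (fun x => K * exp (- d * x))); auto.
    apply (is_RInt_scal (V:=R_NormedModule) (fun x => exp (- d * x)) X Y K). apply is_RInt_exp; auto. }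
  eapply Rle_trans; [exact H|].
  replace (K / d * exp (- d * X)) with (K * (exp (- d * X) / d)) by (field; lra).
  apply Rmult_le_compat_l; auto. unfold Rdiv. apply Rmult_le_compat_r; [left; apply Rinv_0_lt_compat; auto|].
  pose proof (exp_pos (- d * Y)). lra.
Qed.

Lemma improper_exp f K d : 0 < d -> 0 <= K -> (forall x, 0 <= x -> cont f x) ->
  (forall x, 0 <= x -> Cmod (f x) <= K * exp (- d * x)) ->
  exists I, Limp (fun X => CI f 0 X) I /\ Cmod I <= K / d.
Proof.
  intros Hd HK Hc Hf.
  assert (Hdiff : forall X Y, 0 <= X -> X <= Y -> Cmod (CI f 0 Y - CI f 0 X) <= K / d * exp (- d * X)).
  { intros X Y HX HXY. rewrite <- (CI_chasles f 0 X Y); auto; [|intros x Hx; apply Hc; lra].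
    replace (CI f 0 X + CI f X Y - CI f 0 X)%C with (CI f X Y) by ring.
    apply CI_exp_bound; auto; intros x Hx; [apply Hc|apply Hf]; lra. }
  destruct (C_cauchy_limit (fun n => CI f 0 (INR n)) (fun n => K / d * exp (- d * INR n))) as [I HI].
  - intros n m Hnm. apply Hdiff; [apply pos_INR|apply le_INR; auto].
  - intros eps He. destruct (exp_decay (K / d) d eps Hd He) as [X0 HX0].
    destruct (nfloor_ex (Rmax 0 X0)) as [N [_ HN]]; [apply Rmax_l|].
    exists (S N). intros n Hn. apply HX0. apply le_INR in Hn. rewrite S_INR in Hn.
    pose proof (Rmax_r 0 X0). lra.
  - exists I. assert (HL : Limp (fun X => CI f 0 X) I).
    { intros eps He. destruct (exp_decay (K / d) d (eps / 2) Hd ltac:(lra)) as [X0 HX0].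
      exists (Rmax 0 X0 + 1). intros X HX. pose proof (Rmax_l 0 X0). pose proof (Rmax_r 0 X0).
      destruct (nfloor_ex X) as [n [Hn1 Hn2]]; [lra|].
      replace (CI f 0 X - I)%C with ((CI f 0 X - CI f 0 (INR n)) + (CI f 0 (INR n) - I))%C by ring.
      eapply Rle_lt_trans; [apply Cmod_triangle|].
      pose proof (Hdiff (INR n) X (pos_INR n) Hn1) as A1. pose proof (HI n) as A2.
      assert (A3 : K / d * exp (- d * INR n) < eps / 2) by (apply HX0; lra). lra. }
    split; auto. apply (Limp_bound (fun X => CI f 0 X) I _ 0); auto. intros X HX.
    pose proof (Hdiff 0 X (Rle_refl 0) HX) as A1. rewrite CI_point in A1.
    replace (CI f 0 X - RtoC 0)%C with (CI f 0 X) in A1 by ring.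
    rewrite Rmult_0_r, exp_0, Rmult_1_r in A1. exact A1.
Qed.

Lemma locally_C_eps (l : C) (P : C -> Prop) :
  locally (T:=C_UniformSpace) l P -> exists eps, 0 < eps /\ forall y, Cmod (y - l) < eps -> P y.
Proof.
  intros [eps H]. exists eps. split; [apply cond_pos|]. intros y Hy. apply H.
  split; [change (Rabs (Re y - Re l) < eps)|change (Rabs (Im y - Im l) < eps)].
  - eapply Rle_lt_trans; [|exact Hy]. eapply Rle_trans; [|apply re_le_Cmod]. right; reflexivity.
  - eapply Rle_lt_trans; [|exact Hy]. eapply Rle_trans; [|apply im_le_Cmod]. right; reflexivity.
Qed.

Lemma is_RInt_gen_0_infty f I : (forall x, 0 <= x -> cont f x) -> Limp (fun X => CI f 0 X) I ->
  is_RInt_gen (V:=C_R_NormedModule) f (at_point 0) (Rbar_locally p_infty) I.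
Proof.
  intros Hc HL P HP. destruct (locally_C_eps I P HP) as [eps [He HPe]].
  destruct (HL eps He) as [X0 HX0].
  exists (fun a => a = 0) (fun b => Rmax 0 X0 < b).
  - intros; reflexivity.
  - exists (Rmax 0 X0). auto.
  - intros a b -> Hb. pose proof (Rmax_l 0 X0). pose proof (Rmax_r 0 X0).
    exists (CI f 0 b). split; [apply is_RInt_CI; [lra|intros x Hx; apply Hc; lra]|]. apply HPe, HX0. lra.
Qed.

(** For the Laplace integral of [F], whose integrand may blow up like [t^(1/m - 1)] at the origin:
    the two ends are improper and tend to their limits independently. *)
Lemma is_RInt_gen_right_infty f I : (forall x, 0 < x -> cont f x) ->
  (forall eps, 0 < eps -> exists del X0, 0 < del /\ forall a b, 0 < a < del -> X0 <= b -> a <= b -> Cmod (CI f a b - I) < eps) ->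
  is_RInt_gen (V:=C_R_NormedModule) f (at_right 0) (Rbar_locally p_infty) I.
Proof.
  intros Hc HL P HP. destruct (locally_C_eps I P HP) as [eps [He HPe]].
  destruct (HL eps He) as [del [X0 [Hdel HX0]]].
  (* The thresholds [Rmin del 1] and [Rmax 1 X0] force [a < 1 < b], so that the segment is correctly
     ordered. *)
  exists (fun a => 0 < a < Rmin del 1) (fun b => Rmax 1 X0 < b).
  - assert (Hm : 0 < Rmin del 1) by (apply Rmin_pos; lra). exists (mkposreal _ Hm). intros a Ha Ha0. split; [auto|].
    change (Rabs (a - 0) < Rmin del 1) in Ha. rewrite Rminus_0_r, Rabs_pos_eq in Ha by lra. exact Ha.
  - exists (Rmax 1 X0). auto.
  - intros a b [Ha1 Ha2] Hb. pose proof (Rmax_l 1 X0). pose proof (Rmax_r 1 X0).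
    pose proof (Rmin_l del 1). pose proof (Rmin_r del 1).
    exists (CI f a b). simpl. split; [apply is_RInt_CI; [lra|intros x Hx; apply Hc; lra]|].
    apply HPe, HX0; lra.
Qed.

Lemma Rder_CI g a x : (forall t, cont g t) -> Rder (fun t => CI g a t) x (g x).
Proof.
  intros Hc. split; simpl.
  - apply (is_derive_RInt (fun t => Re (g t)) (fun t => RInt (fun t => Re (g t)) a t) a x); [|apply Hc].
    apply filter_forall. intros t. apply (RInt_correct (V:=R_CompleteNormedModule)).
    apply (ex_RInt_continuous (V:=R_CompleteNormedModule)). intros; apply Hc.
  - apply (is_derive_RInt (fun t => Im (g t)) (fun t => RInt (fun t => Im (g t)) a t) a x); [|apply Hc].
    apply filter_forall. intros t. apply (RInt_correct (V:=R_CompleteNormedModule)).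
    apply (ex_RInt_continuous (V:=R_CompleteNormedModule)). intros; apply Hc.
Qed.

Lemma continuous_clamp a b x : continuous (fun t => Rmax a (Rmin b t)) x.
Proof.
  apply continuity_pt_filterlim. intros eps He. exists eps. split; auto. intros t [_ Ht].
  simpl in *. unfold R_dist in *. eapply Rle_lt_trans; [|exact Ht].
  unfold Rmax, Rmin. repeat destruct Rle_dec; unfold Rabs; repeat destruct Rcase_abs; lra.
Qed.

(** Clamping the argument of [g] to the segment makes it continuous on the whole line, so its
    integral is differentiable everywhere, and [f] minus that integral has zero derivative inside.
    This admits the endpoint 0, where jets and real powers provide no derivative. *)
Lemma CI_FTC_open f g a b : a <= b -> contI f a b -> contI g a b ->
  (forall x, a < x < b -> Rder f x (g x)) -> CI g a b = (f b - f a)%C.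
Proof.
  intros Hab Hf Hg Hd. set (gc := fun t => g (Rmax a (Rmin b t))).
  assert (E : forall t, a <= t <= b -> Rmax a (Rmin b t) = t).
  { intros t Ht. rewrite Rmin_right by lra. apply Rmax_right; lra. }
  assert (Hgc : forall t, cont gc t).
  { intros t. apply (cont_comp_real g (fun t => Rmax a (Rmin b t))); [|apply continuous_clamp].
    apply Hg. split; [apply Rmax_l|]. apply Rmax_lub; [auto|apply Rmin_l]. }
  rewrite (CI_ext g gc); [|auto|intros x Hx; unfold gc; rewrite E; auto; lra].
  assert (H : (f b - CI gc a b)%C = (f a - CI gc a a)%C).
  { apply (C_const_of_Rder0 (fun t => f t - CI gc a t)%C a b); auto.
    - intros x Hx. apply cont_minus; [apply Hf; auto|]. eapply Rder_cont, Rder_CI; auto.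
    - intros x Hx. eapply Rder_val; [apply Rder_minus; [apply Hd; auto|apply Rder_CI; auto]|].
      unfold gc. rewrite E by lra. ring. }
  rewrite CI_point in H. replace (CI gc a b) with (f b - (f b - CI gc a b))%C by ring. rewrite H. ring.
Qed.

(** * The Laplace transform *)

Definition Lap (f : R -> C) (w : C) : C :=
  RInt_gen (V:=C_R_CompleteNormedModule) (fun x => f x * Cexp (- (w * RtoC x)))%C (at_point 0) (Rbar_locally p_infty).

Lemma cont_Cexp_lin w x : cont (fun t => Cexp (- (w * RtoC t))) x.
Proof.
  apply cont_Cexp. apply cont_opp. apply cont_mult; [apply cont_const|]. apply (Rder_cont _ _ _ (Rder_id x)).
Qed.

Lemma Rder_Cexp_neg w x : Rder (fun t => Cexp (- (w * RtoC t))) x (- w * Cexp (- (w * RtoC x)))%C.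
Proof.
  eapply Rder_val; [apply Rder_Cexp; apply Rder_opp, Rder_cmult, Rder_id|]. cbv beta. ring.
Qed.

Lemma Cmod_Cexp_neg w x : Cmod (Cexp (- (w * RtoC x))) = exp (- Re w * x).
Proof. rewrite Cmod_Cexp. f_equal. creim. ring. Qed.

Lemma Lap_integrand_bound f K b w x : Cmod (f x) <= K * exp (b * x) ->
  Cmod (f x * Cexp (- (w * RtoC x))) <= K * exp (- (Re w - b) * x).
Proof.
  intros Hf. rewrite Cmod_mult, Cmod_Cexp_neg.
  replace (exp (- (Re w - b) * x)) with (exp (b * x) * exp (- Re w * x)) by (rewrite <- exp_plus; f_equal; ring).
  rewrite <- Rmult_assoc. apply Rmult_le_compat_r; [left; apply exp_pos|auto].
Qed.

Section LaplaceBounded.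

Variables (f : R -> C) (K b : R).
Hypothesis HK : 0 <= K.
Hypothesis Hc : forall x, 0 <= x -> cont f x.
Hypothesis Hf : forall x, 0 <= x -> Cmod (f x) <= K * exp (b * x).

Lemma Lap_cont w x : 0 <= x -> cont (fun x => f x * Cexp (- (w * RtoC x)))%C x.
Proof. intros Hx. apply cont_mult; [apply Hc; auto|apply cont_Cexp_lin]. Qed.

Lemma Lap_spec w : b < Re w ->
  Limp (fun X => CI (fun x => f x * Cexp (- (w * RtoC x)))%C 0 X) (Lap f w) /\ Cmod (Lap f w) <= K / (Re w - b).
Proof.
  intros Hw. destruct (improper_exp (fun x => f x * Cexp (- (w * RtoC x)))%C K (Re w - b)) as [I [HI1 HI2]]; auto; try lra.
  - apply Lap_cont.
  - intros x Hx. apply Lap_integrand_bound; auto.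
  - assert (E : Lap f w = I).
    { pose proof (is_RInt_gen_0_infty _ I (fun x Hx => Lap_cont w x Hx) HI1) as G.
      exact (is_RInt_gen_unique (V:=C_R_CompleteNormedModule) _ I G). }
    rewrite E. auto.
Qed.

Lemma Lap_is_RInt_gen w : b < Re w ->
  is_RInt_gen (V:=C_R_NormedModule) (fun x => f x * Cexp (- (w * RtoC x)))%C (at_point 0) (Rbar_locally p_infty) (Lap f w).
Proof. intros Hw. apply is_RInt_gen_0_infty; [apply Lap_cont|apply Lap_spec; auto]. Qed.

Lemma Lap_limit w I : b < Re w -> Limp (fun X => CI (fun x => f x * Cexp (- (w * RtoC x)))%C 0 X) I -> Lap f w = I.
Proof. intros Hw HI. eapply Limp_unique; [apply Lap_spec; auto|exact HI]. Qed.

End LaplaceBounded.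

Lemma sq_le_exp x : 0 <= x -> x ^ 2 <= 4 * exp x.
Proof.
  intros Hx. assert (H : 1 + x / 2 <= exp (x / 2)).
  { destruct (Req_dec (x / 2) 0) as [E|E]; [rewrite E, exp_0; lra|left; apply exp_ineq1; auto]. }
  replace x with (x / 2 + x / 2) at 2 by field. rewrite exp_plus. nra.
Qed.

Lemma Lap_Cder f K b w : 0 <= K -> (forall x, 0 <= x -> cont f x) ->
  (forall x, 0 <= x -> Cmod (f x) <= K * exp (b * x)) -> b < Re w ->
  Cder (Lap f) w (Lap (fun x => - RtoC x * f x)%C w).
Proof.
  (* The margin [Re w - b] is [4 d]: one [d] pays for the increment [h], one for the factor [x^2] of
     the remainder, and what is left makes the integral converge. *)
  intros HK Hc Hf Hw. set (d := (Re w - b) / 4). assert (Hd : 0 < d) by (unfold d; lra).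
  set (g := fun x => (- RtoC x * f x)%C).
  assert (Hgc : forall x, 0 <= x -> cont g x).
  { intros x Hx. apply cont_mult; [|apply Hc; auto]. apply cont_opp. apply (Rder_cont _ _ _ (Rder_id x)). }
  assert (Hg : forall x, 0 <= x -> Cmod (g x) <= K / d * exp ((b + d) * x)).
  { intros x Hx. unfold g. rewrite Cmod_mult, Cmod_opp, Cmod_R, Rabs_pos_eq by auto.
    assert (H1 : d * x <= exp (d * x)) by (pose proof (exp_ineq1_le (d * x)); lra).
    replace ((b + d) * x) with (d * x + b * x) by ring. rewrite exp_plus.
    specialize (Hf x Hx). pose proof (exp_pos (b * x)). pose proof (Cmod_ge_0 (f x)).
    apply Rle_trans with (exp (d * x) / d * (K * exp (b * x))); [|right; field; lra].
    apply Rmult_le_compat; auto. apply Rmult_le_reg_r with d; auto.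
    replace (exp (d * x) / d * d) with (exp (d * x)) by (field; lra). lra. }
  assert (HKd : 0 <= K / d) by (apply Rdiv_le_0_compat; auto).
  set (Q := 16 * K / d ^ 2 / d).
  assert (HQ : 0 <= Q) by (unfold Q; apply Rdiv_le_0_compat; auto; apply Rdiv_le_0_compat; [lra|apply pow_lt; auto]).
  assert (Hrem : forall h, Cmod h < d -> Cmod (Lap f (w + h) - Lap f w - Lap g w * h) <= Q * (Cmod h * Cmod h)).
  { intros h Hh. pose proof (re_le_Cmod h) as Hre. pose proof (Rle_abs (Re h)). pose proof (Rle_abs (- Re h)) as Hre2. rewrite Rabs_Ropp in Hre2.
    pose proof (Cmod_ge_0 h) as Ph.
    assert (Ew : Re (w + h) = Re w + Re h) by reflexivity.
    destruct (Lap_spec f K b HK Hc Hf (w + h)%C) as [L1 _]; [unfold d in *; lra|].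
    destruct (Lap_spec f K b HK Hc Hf w Hw) as [L2 _].
    destruct (Lap_spec g (K / d) (b + d) HKd Hgc Hg w) as [L3 _]; [unfold d in *; lra|].
    assert (L : Limp (fun X => (CI (fun x => f x * Cexp (- ((w + h) * RtoC x))) 0 X - CI (fun x => f x * Cexp (- (w * RtoC x))) 0 X
       - h * CI (fun x => g x * Cexp (- (w * RtoC x))) 0 X)%C) (Lap f (w + h) - Lap f w - Lap g w * h)%C).
    { rewrite (Cmult_comm (Lap g w)). apply Limp_minus; [apply Limp_minus; auto|apply Limp_cmult; auto]. }
    apply (Limp_bound _ _ _ 0) with (2 := L). intros X HX.
    assert (C1 : forall w, contI (fun x => f x * Cexp (- (w * RtoC x)))%C 0 X).
    { intros w' x Hx. apply cont_mult; [apply Hc; lra|apply cont_Cexp_lin]. }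
    assert (C2 : contI (fun x => g x * Cexp (- (w * RtoC x)))%C 0 X).
    { intros x Hx. apply cont_mult; [apply Hgc; lra|apply cont_Cexp_lin]. }
    rewrite <- CI_cmult, <- CI_minus, <- CI_minus; auto.
    2: { intros x Hx. apply cont_minus; [apply C1|apply C1]; auto. }
    2: { apply contI_cmult; auto. }
    assert (Hb : Cmod (CI (fun t => f t * Cexp (- ((w + h) * RtoC t)) - f t * Cexp (- (w * RtoC t)) - h * (g t * Cexp (- (w * RtoC t))))%C 0 X)
       <= (16 * K / d ^ 2 * (Cmod h * Cmod h)) / d * exp (- d * 0)).
    { apply CI_exp_bound; auto.
      - apply Rmult_le_pos; [apply Rdiv_le_0_compat; [lra|apply pow_lt; auto]|nra].
      - intros x Hx. apply cont_minus; [apply cont_minus; apply C1; auto|]. apply (contI_cmult h _ 0 X C2 x Hx).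
      - intros x [Hx _]. unfold g.
        replace (- ((w + h) * RtoC x))%C with (- (w * RtoC x) + - (h * RtoC x))%C by ring. rewrite Cexp_plus.
        set (s := (- (h * RtoC x))%C).
        replace (f x * (Cexp (- (w * RtoC x)) * Cexp s) - f x * Cexp (- (w * RtoC x)) - h * (- RtoC x * f x * Cexp (- (w * RtoC x))))%C
          with ((f x * Cexp (- (w * RtoC x))) * (Cexp s - 1 - s))%C by (unfold s; ring).
        rewrite Cmod_mult. pose proof (Lap_integrand_bound f K b w x (Hf x Hx)) as B1. pose proof (Cexp_bound_2 s) as B2.
        assert (Hs : Cmod s = Cmod h * x) by (unfold s; rewrite Cmod_opp, Cmod_mult, Cmod_R, Rabs_pos_eq; auto).
        assert (Hs2 : Rabs (Re s) <= d * x).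
        { eapply Rle_trans; [apply re_le_Cmod|]. rewrite Hs. apply Rmult_le_compat_r; lra. }
        rewrite Hs in B2.
        assert (B3 : Cmod (Cexp s - 1 - s) <= 4 * (Cmod h * x * (Cmod h * x)) * exp (d * x)).
        { eapply Rle_trans; [exact B2|]. apply Rmult_le_compat_l; [nra|apply exp_le; auto]. }
        assert (B4 : (d * x) ^ 2 <= 4 * exp (d * x)) by (apply sq_le_exp; nra).
        assert (B5 : Cmod (Cexp s - 1 - s) <= 16 / d ^ 2 * (Cmod h * Cmod h) * exp (2 * d * x)).
        { eapply Rle_trans; [exact B3|]. replace (2 * d * x) with (d * x + d * x) by ring. rewrite exp_plus.
          pose proof (exp_pos (d * x)) as Pe.
          replace (4 * (Cmod h * x * (Cmod h * x)) * exp (d * x)) with (4 / d ^ 2 * (Cmod h * Cmod h) * ((d * x) ^ 2 * exp (d * x))) by (field; lra).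
          replace (16 / d ^ 2 * (Cmod h * Cmod h) * (exp (d * x) * exp (d * x))) with (4 / d ^ 2 * (Cmod h * Cmod h) * (4 * exp (d * x) * exp (d * x))) by (field; lra).
          apply Rmult_le_compat_l; [apply Rmult_le_pos; [apply Rdiv_le_0_compat; [lra|apply pow_lt; auto]|nra]|].
          apply Rmult_le_compat_r; lra. }
        eapply Rle_trans; [apply Rmult_le_compat; [apply Cmod_ge_0|apply Cmod_ge_0|exact B1|exact B5]|].
        replace (K * exp (- (Re w - b) * x) * (16 / d ^ 2 * (Cmod h * Cmod h) * exp (2 * d * x)))
          with (16 * K / d ^ 2 * (Cmod h * Cmod h) * (exp (- (Re w - b) * x) * exp (2 * d * x))) by (field; lra).
        rewrite <- exp_plus. apply Rmult_le_compat_l.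
        { apply Rmult_le_pos; [apply Rdiv_le_0_compat; [lra|apply pow_lt; auto]|nra]. }
        apply exp_le. unfold d. nra. }
    rewrite Rmult_0_r, exp_0 in Hb. eapply Rle_trans; [exact Hb|]. unfold Q. right. field. lra. }
  intros eps He. exists (Rmin d (eps / (Q + 1))). split; [apply Rmin_pos; [auto|apply Rdiv_lt_0_compat; lra]|].
  intros h Hh. eapply Rle_trans; [apply Hrem; eapply Rlt_le_trans; [exact Hh|apply Rmin_l]|].
  pose proof (Rlt_le_trans _ _ _ Hh (Rmin_r _ _)) as Hh2. pose proof (Cmod_ge_0 h).
  rewrite <- Rmult_assoc. apply Rmult_le_compat_r; auto.
  apply Rle_trans with ((Q + 1) * (eps / (Q + 1))); [apply Rmult_le_compat; lra|right; field; lra].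
Qed.

(** * Derivative jets along the positive half-line *)

(** [d n] plays the role of the [n]-th derivative, on the half-line, of a function
    holomorphic near it; negative arguments are irrelevant and only serve to make
    [d n] continuous at the origin from both sides. *)
Definition Data (d : nat -> R -> C) : Prop :=
  forall n, (forall x, cont (d n) x) /\ (forall x, 0 < x -> Rder (d n) x (d (S n) x)).

Definition DBound (d : nat -> R -> C) (rho b M : R) : Prop :=
  forall n x, 0 <= x -> Cmod (d n x) <= M * (INR (fact n) / rho ^ n) * exp (b * x).

Lemma continuous_Rmax0 x : continuous (Rmax 0) x.
Proof.
  apply continuity_pt_filterlim. intros eps He. exists eps. split; auto. intros t [_ Ht].
  simpl in *. unfold R_dist in *. eapply Rle_lt_trans; [|exact Ht].
  unfold Rmax. repeat destruct Rle_dec; unfold Rabs; repeat destruct Rcase_abs; lra.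
Qed.

(** Freezing the value at 0 for negative arguments turns continuity from the right into two-sided
    continuity. *)
Lemma Data_mk (e : nat -> R -> C) :
  (forall n x, 0 < x -> Rder (e n) x (e (S n) x)) ->
  (forall n eps, 0 < eps -> exists del, 0 < del /\ forall y, 0 <= y < del -> Cmod (e n y - e n 0) < eps) ->
  Data (fun n x => e n (Rmax 0 x)).
Proof.
  intros Hd Hc n. split.
  - intros x. destruct (Rlt_dec 0 x) as [Hx|Hx].
    + apply (cont_comp_real (e n) (Rmax 0)); [|apply continuous_Rmax0].
      rewrite Rmax_right by lra. eapply Rder_cont. apply Hd; auto.
    + apply cont_eps. intros eps He. destruct (Hc n eps He) as [del [Hdel Hy]].
      exists del. split; auto. intros t Ht. rewrite (Rmax_left 0 x) by lra. apply Hy.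
      split; [apply Rmax_l|]. apply Rmax_lub_lt; auto. apply Rabs_def2 in Ht. lra.
  - intros x Hx. rewrite (Rmax_right 0 x) by lra.
    apply Rder_ext_loc with (e n) x; auto. intros t Ht. apply Rabs_def2 in Ht. rewrite Rmax_right; [auto|lra].
Qed.

Lemma DBound_pos d rho b M : 0 < rho -> DBound d rho b M -> 0 <= M.
Proof.
  intros Hr H. specialize (H 0%nat 0 (Rle_refl 0)). simpl in H. rewrite Rmult_0_r, exp_0 in H.
  pose proof (Cmod_ge_0 (d 0%nat 0)). replace (M * (1 / 1) * 1) with M in H by field. lra.
Qed.

Lemma fact_ratio_pos n rho : 0 < rho -> 0 < INR (fact n) / rho ^ n.
Proof. intros H. apply Rdiv_lt_0_compat; [apply INR_fact_lt_0|apply pow_lt; auto]. Qed.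

Section LaplaceData.

Variables (d : nat -> R -> C) (rho b M : R).
Hypothesis Hrho : 0 < rho.
Hypothesis Hb : 0 <= b.
Hypothesis HD : Data d.
Hypothesis HB : DBound d rho b M.

Let Kn n := M * (INR (fact n) / rho ^ n).

Lemma Kn_pos n : 0 <= Kn n.
Proof. apply Rmult_le_pos; [eapply DBound_pos; eauto|left; apply fact_ratio_pos; auto]. Qed.

Lemma Lap_data_spec n w : b < Re w ->
  Limp (fun X => CI (fun x => d n x * Cexp (- (w * RtoC x)))%C 0 X) (Lap (d n) w) /\ Cmod (Lap (d n) w) <= Kn n / (Re w - b).
Proof.
  intros Hw. exact (Lap_spec (d n) (Kn n) b (Kn_pos n) (fun x _ => proj1 (HD n) x) (fun x Hx => HB n x Hx) w Hw).
Qed.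

(** Integration by parts; the boundary term at infinity dies because [Re w > b]. Iterated, this
    yields the asymptotic expansion with the exact remainder [Lap (d n) w / w^n]. *)
Lemma Lap_data_step n w : b < Re w -> (w * Lap (d n) w = d n 0 + Lap (d (S n)) w)%C.
Proof.
  intros Hw. destruct (Lap_data_spec n w Hw) as [L1 _]. destruct (Lap_data_spec (S n) w Hw) as [L2 _].
  apply (Limp_unique (fun X => w * CI (fun x => d n x * Cexp (- (w * RtoC x)))%C 0 X)%C); [apply Limp_cmult; auto|].
  assert (L3 : Limp (fun X => d n X * Cexp (- (w * RtoC X)))%C (RtoC 0)).
  { intros eps He. destruct (exp_decay (Kn n) (Re w - b) eps) as [X0 HX0]; [lra|auto|].
    exists (Rmax 0 X0). intros X HX. replace (d n X * Cexp (- (w * RtoC X)) - RtoC 0)%C with (d n X * Cexp (- (w * RtoC X)))%C by ring.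
    eapply Rle_lt_trans; [apply Lap_integrand_bound; apply HB; eapply Rle_trans; [apply Rmax_l|exact HX]|].
    apply HX0. eapply Rle_trans; [apply Rmax_r|exact HX]. }
  apply (Limp_ext (fun X => (d n 0 - d n X * Cexp (- (w * RtoC X))) + CI (fun x => d (S n) x * Cexp (- (w * RtoC x))) 0 X)%C _ _ 0).
  2: { replace (d n 0 + Lap (d (S n)) w)%C with ((d n 0 - RtoC 0) + Lap (d (S n)) w)%C by ring.
       apply Limp_plus; auto. apply Limp_minus; auto. apply Limp_const. }
  intros X HX.
  assert (C1 : forall k, contI (fun x => d k x * Cexp (- (w * RtoC x)))%C 0 X).
  { intros k x _. apply cont_mult; [apply HD|apply cont_Cexp_lin]. }
  pose proof (CI_FTC_open (fun x => d n x * Cexp (- (w * RtoC x)))%C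
    (fun x => d (S n) x * Cexp (- (w * RtoC x)) - w * (d n x * Cexp (- (w * RtoC x))))%C 0 X HX) as H.
  rewrite CI_minus, CI_cmult in H; auto using contI_cmult.
  assert (E0 : Cexp (- (w * RtoC 0)) = RtoC 1) by (replace (- (w * RtoC 0))%C with (RtoC 0) by ring; apply Cexp_0).
  rewrite E0 in H.
  set (A := CI (fun t => d n t * Cexp (- (w * RtoC t)))%C 0 X) in *.
  set (B := CI (fun t => d (S n) t * Cexp (- (w * RtoC t)))%C 0 X) in *.
  assert (H2 : (B - w * A)%C = (d n X * Cexp (- (w * RtoC X)) - d n 0 * RtoC 1)%C).
  { apply H.
    - apply C1.
    - intros x Hx. apply cont_minus; [apply C1; auto|apply (contI_cmult w _ 0 X (C1 n) x Hx)].
    - intros x Hx. eapply Rder_val; [apply Rder_mult; [apply HD; lra|apply Rder_Cexp_neg]|]. cbv beta. ring. }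
  replace (w * A)%C with (B - (B - w * A))%C by ring. rewrite H2. ring.
Qed.

Lemma w_nz w : b < Re w -> w <> RtoC 0.
Proof. intros Hw E. rewrite E in Hw. simpl in Hw. lra. Qed.

Lemma Lap_data_expansion n w : b < Re w ->
  (Lap (d 0%nat) w - csum (fun j => d j 0 / w ^ S j) n = Lap (d n) w / w ^ n)%C.
Proof.
  intros Hw. pose proof (w_nz w Hw) as Hn. induction n as [|n IH].
  - simpl. field.
  - cbn [csum]. replace (Lap (d 0%nat) w - (csum (fun j => d j 0 / w ^ S j) n + d n 0 / w ^ S n))%C
      with ((Lap (d 0%nat) w - csum (fun j => d j 0 / w ^ S j) n) - d n 0 / w ^ S n)%C by ring.
    rewrite IH. replace (Lap (d (S n)) w) with (w * Lap (d n) w - d n 0)%C by (rewrite Lap_data_step by auto; ring).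
    rewrite Cpow_S. field. split; auto. apply Cpow_nz; auto.
Qed.

Lemma Lap_data_bound n w : b < Re w ->
  Cmod (Lap (d 0%nat) w - csum (fun j => d j 0 / w ^ S j)%C n) <= M * INR (fact n) / rho ^ n * / (Cmod w ^ n * (Re w - b)).
Proof.
  intros Hw. rewrite Lap_data_expansion by auto. pose proof (w_nz w Hw) as Hn.
  rewrite Cmod_div by (apply Cpow_nz; auto). rewrite Cmod_pow.
  pose proof (proj1 (Cmod_gt_0 w) Hn) as Hp.
  assert (0 < Cmod w ^ n) by (apply pow_lt; auto).
  destruct (Lap_data_spec n w Hw) as [_ H2].
  replace (M * INR (fact n) / rho ^ n * / (Cmod w ^ n * (Re w - b))) with (Kn n / (Re w - b) / Cmod w ^ n).
  - unfold Rdiv. apply Rmult_le_compat_r; [left; apply Rinv_0_lt_compat; auto|exact H2].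
  - unfold Kn. field. repeat split; try lra. apply pow_nonzero; lra.
Qed.

Lemma Lap_data_Cder w : b < Re w -> exists l, Cder (Lap (d 0%nat)) w l.
Proof.
  intros Hw. eexists.
  exact (Lap_Cder (d 0%nat) (Kn 0) b w (Kn_pos 0) (fun x _ => proj1 (HD 0%nat) x) (fun x Hx => HB 0%nat x Hx) Hw).
Qed.

End LaplaceData.

(** Each of the [n + 1] terms of [1 + s + ... + s^n] is at least [s^n]. *)
Lemma npow_bound s n : 0 <= s < 1 -> (INR n + 1) * s ^ n <= 1 / (1 - s).
Proof.
  intros Hs. assert (H : (INR n + 1) * s ^ n <= (1 - s ^ S n) / (1 - s)).
  { induction n as [|n IH]; [simpl; right; field; lra|].
    rewrite S_INR. assert (0 <= s ^ n) by (apply pow_le; lra).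
    replace ((1 - s ^ S (S n)) / (1 - s)) with (s * ((1 - s ^ S n) / (1 - s)) + 1) by (simpl; field; lra).
    apply (Rmult_le_compat_l s) in IH; [|lra]. assert (s ^ S n <= 1).
    { rewrite <- (pow1 (S n)). apply pow_incr. lra. }
    simpl in *. lra. }
  eapply Rle_trans; [exact H|]. unfold Rdiv. apply Rmult_le_compat_r; [left; apply Rinv_0_lt_compat; lra|].
  assert (0 <= s ^ S n) by (apply pow_le; lra). lra.
Qed.

(** Writing [r = s^2], one factor [s^n] absorbs [n + 1] by [npow_bound] and the other tends to 0. *)
Lemma npow_small r eps : 0 <= r < 1 -> 0 < eps -> exists N, forall n, (N <= n)%nat -> (INR n + 1) * r ^ n < eps.
Proof.
  intros Hr He. set (s := sqrt r).
  assert (Hs : 0 <= s < 1).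
  { split; [apply sqrt_pos|]. rewrite <- sqrt_1. apply sqrt_lt_1; lra. }
  assert (Hss : s * s = r) by (apply sqrt_sqrt; lra).
  destruct (pow_lt_1_zero s) with (y := eps * (1 - s)) as [N HN]; [rewrite Rabs_pos_eq; lra|nra|].
  exists N. intros n Hn. specialize (HN n Hn). rewrite Rabs_pos_eq in HN by (apply pow_le; lra).
  rewrite <- Hss, Rpow_mult_distr, <- Rmult_assoc. pose proof (npow_bound s n Hs) as H.
  assert (0 <= s ^ n) by (apply pow_le; lra).
  apply Rle_lt_trans with (1 / (1 - s) * s ^ n); [apply Rmult_le_compat_r; auto|].
  apply Rlt_le_trans with (1 / (1 - s) * (eps * (1 - s))); [apply Rmult_lt_compat_l; auto; apply Rdiv_lt_0_compat; lra|].
  right. field. lra.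
Qed.

Definition Cseries (a : nat -> C) : C := (Series (fun n => Re (a n)), Series (fun n => Im (a n))).

Lemma Re_csum a n : Re (csum a (S n)) = sum_n (fun n => Re (a n)) n.
Proof.
  induction n as [|n IH]; [rewrite sum_O; creim; ring|]. rewrite sum_Sn, <- IH. reflexivity.
Qed.

Lemma Im_csum a n : Im (csum a (S n)) = sum_n (fun n => Im (a n)) n.
Proof.
  induction n as [|n IH]; [rewrite sum_O; creim; ring|]. rewrite sum_Sn, <- IH. reflexivity.
Qed.

Lemma Cseries_unique a l : Cser a l -> Cseries a = l.
Proof.
  intros H. apply Ceq; simpl; apply is_series_unique; apply filterlim_locally; intros eps;
    destruct (H eps (cond_pos eps)) as [N HN]; exists N; intros n Hn; specialize (HN (S n) ltac:(lia)).
  - rewrite <- Re_csum. eapply Rle_lt_trans; [|exact HN]. eapply Rle_trans; [|apply re_le_Cmod]. right; reflexivity.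
  - rewrite <- Im_csum. eapply Rle_lt_trans; [|exact HN]. eapply Rle_trans; [|apply im_le_Cmod]. right; reflexivity.
Qed.

(** * The holomorphic function defined by a jet *)

Section DataFunction.

Variables (d : nat -> R -> C) (rho b M : R).
Hypothesis Hrho : 0 < rho.
Hypothesis Hb : 0 <= b.
Hypothesis HD : Data d.
Hypothesis HB : DBound d rho b M.

Let term (x : R) (z : C) (n : nat) : C := (d n x / RtoC (INR (fact n)) * (z - RtoC x) ^ n)%C.

Lemma factC_nz n : RtoC (INR (fact n)) <> RtoC 0.
Proof. apply RtoC_nz, INR_fact_neq_0. Qed.

Lemma term_bound x z n : 0 <= x -> Cmod (term x z n) <= M * exp (b * x) * (Cmod (z - RtoC x) / rho) ^ n.
Proof.
  intros Hx. unfold term. rewrite Cmod_mult, Cmod_div, Cmod_R, Cmod_pow, (Rabs_pos_eq (INR (fact n))) by (apply factC_nz || apply pos_INR).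
  unfold Rdiv. rewrite Rpow_mult_distr, pow_inv. pose proof (HB n x Hx) as H. pose proof (INR_fact_lt_0 n) as Hf.
  assert (Hp : 0 < rho ^ n) by (apply pow_lt; auto).
  apply Rle_trans with (M * (INR (fact n) / rho ^ n) * exp (b * x) * / INR (fact n) * Cmod (z - RtoC x) ^ n).
  - apply Rmult_le_compat_r; [apply pow_le, Cmod_ge_0|]. apply Rmult_le_compat_r; [left; apply Rinv_0_lt_compat; auto|auto].
  - right. field. lra.
Qed.

Lemma term_series x z : 0 <= x -> Cmod (z - RtoC x) < rho ->
  exists l, Cser (term x z) l /\ Cmod l <= M * exp (b * x) / (1 - Cmod (z - RtoC x) / rho).
Proof.
  intros Hx Hz. apply Cser_geom; [|intros; apply term_bound; auto].
  pose proof (Cmod_ge_0 (z - RtoC x)). split; [apply Rdiv_le_0_compat; auto|].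
  apply Rmult_lt_reg_r with rho; auto. replace (Cmod (z - RtoC x) / rho * rho) with (Cmod (z - RtoC x)) by (field; lra). lra.
Qed.

(** The derivative in the base point of a partial Taylor sum telescopes. *)
Lemma Rder_partial_taylor z N x : 0 < x ->
  Rder (fun x => csum (term x z) (S N)) x (d (S N) x / RtoC (INR (fact N)) * (z - RtoC x) ^ N)%C.
Proof.
  intros Hx. induction N as [|N IH].
  - apply Rder_ext with (d 0%nat).
    + intros t. unfold term. simpl. field.
    + eapply Rder_val; [apply HD; auto|]. simpl. field.
  - apply Rder_ext with (fun x => csum (term x z) (S N) + term x z (S N))%C; [reflexivity|].
    eapply Rder_val.
    + apply Rder_plus; [exact IH|]. unfold term.
      apply (Rder_mult (fun x => d (S N) x / RtoC (INR (fact (S N))))%C (fun x => (z - RtoC x) ^ S N)%C x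
        (/ RtoC (INR (fact (S N))) * d (S (S N)) x)%C).
      * apply Rder_ext with (fun x => / RtoC (INR (fact (S N))) * d (S N) x)%C; [intros; unfold Cdiv; ring|].
        apply Rder_cmult, HD; auto.
      * apply (Rder_comp_Cder (fun s => s ^ S N)%C (fun x => z - RtoC x)%C); [apply Cder_pow|].
        apply Rder_minus; [apply Rder_const|apply Rder_id].
    + cbv beta. change (fact (S N)) with (S N * fact N)%nat. rewrite mult_INR, RtoC_mult, !Cpow_S.
      assert (HS : RtoC (INR (S N)) <> RtoC 0) by (apply RtoC_nz, not_0_INR; lia).
      field. split; [apply factC_nz|auto].
Qed.

(** The derivative of a partial Taylor sum with respect to its base point is a single term, of size
    [O((N + 1) r^N)] for all base points between [x] and [y]. The two partial sums therefore
    approach each other. *)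
Lemma term_series_indep x y z l k : 0 <= x -> x <= y -> Cmod (z - RtoC x) < rho -> Cmod (z - RtoC y) < rho ->
  Cser (term x z) l -> Cser (term y z) k -> l = k.
Proof.
  intros Hx Hxy H1 H2 S1 S2.
  set (q := Rmax (Cmod (z - RtoC x)) (Cmod (z - RtoC y))).
  assert (Hq : 0 <= q < rho).
  { unfold q. split; [eapply Rle_trans; [apply Cmod_ge_0|apply Rmax_l]|apply Rmax_lub_lt; auto]. }
  (* By convexity of the modulus, a base point between [x] and [y] is no farther from [z] than the
     farther of the two. *)
  assert (Hseg : forall t, x <= t <= y -> Cmod (z - RtoC t) <= q).
  { intros t Ht. destruct (Req_dec x y) as [E|E].
    - assert (t = x) as -> by lra. apply Rmax_l.
    - set (s := (t - x) / (y - x)). assert (Hs : 0 <= s <= 1).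
      { unfold s. split; [apply Rdiv_le_0_compat; lra|]. apply Rmult_le_reg_r with (y - x); [lra|].
        replace ((t - x) / (y - x) * (y - x)) with (t - x) by (field; lra). lra. }
      assert (Et : t = (1 - s) * x + s * y) by (unfold s; field; lra).
      replace (z - RtoC t)%C with (RtoC (1 - s) * (z - RtoC x) + RtoC s * (z - RtoC y))%C.
      2: { rewrite Et. rewrite RtoC_plus, !RtoC_mult, RtoC_minus. ring. }
      eapply Rle_trans; [apply Cmod_triangle|]. rewrite !Cmod_mult, !Cmod_R, !Rabs_pos_eq by lra.
      pose proof (Rmax_l (Cmod (z - RtoC x)) (Cmod (z - RtoC y))). pose proof (Rmax_r (Cmod (z - RtoC x)) (Cmod (z - RtoC y))).
      fold q in H, H0. nra. }
  assert (HM := DBound_pos _ _ _ _ Hrho HB).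
  set (r := q / rho). assert (Hr : 0 <= r < 1).
  { unfold r. split; [apply Rdiv_le_0_compat; lra|]. apply Rmult_lt_reg_r with rho; auto.
    replace (q / rho * rho) with q by (field; lra). lra. }
  set (K := M * exp (b * y) / rho). assert (HK : 0 <= K).
  { unfold K. apply Rdiv_le_0_compat; auto. apply Rmult_le_pos; auto. left; apply exp_pos. }
  assert (Hdiff : forall N, Cmod (csum (term y z) (S N) - csum (term x z) (S N)) <= 2 * (K * ((INR N + 1) * r ^ N)) * (y - x)).
  { intros N. apply (C_MVT (fun x => csum (term x z) (S N)) (fun x => d (S N) x / RtoC (INR (fact N)) * (z - RtoC x) ^ N)%C); auto.
    - intros t _. clear -HD. induction (S N) as [|n IH]; simpl; [apply cont_const|]. apply cont_plus; auto.
      unfold term. apply cont_mult; [apply cont_mult; [apply HD|apply cont_const]|]. apply cont_pow.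
      apply cont_minus; [apply cont_const|apply (Rder_cont _ _ _ (Rder_id t))].
    - intros t Ht. apply Rder_partial_taylor. lra.
    - intros t Ht. rewrite Cmod_mult, Cmod_div, Cmod_R, Cmod_pow, (Rabs_pos_eq (INR (fact N))) by (apply factC_nz || apply pos_INR).
      pose proof (HB (S N) t ltac:(lra)) as H. pose proof (INR_fact_lt_0 N) as Hf. assert (Hp : 0 < rho ^ N) by (apply pow_lt; auto).
      change (fact (S N)) with (S N * fact N)%nat in H. rewrite mult_INR, S_INR in H. simpl in H.
      assert (He : exp (b * t) <= exp (b * y)) by (apply exp_le; nra).
      pose proof (pos_INR N) as PN.
      apply Rle_trans with (M * ((INR N + 1) * INR (fact N) / (rho * rho ^ N)) * exp (b * y) / INR (fact N) * q ^ N).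
      + apply Rmult_le_compat; [apply Rdiv_le_0_compat; [apply Cmod_ge_0|auto]|apply pow_le, Cmod_ge_0| |].
        * unfold Rdiv at 1 3. apply Rmult_le_compat_r; [left; apply Rinv_0_lt_compat; auto|].
          eapply Rle_trans; [exact H|]. apply Rmult_le_compat_l; auto.
          apply Rmult_le_pos; auto. apply Rdiv_le_0_compat; [nra|nra].
        * apply pow_incr. split; [apply Cmod_ge_0|]. apply Hseg. lra.
      + right. unfold K, r, Rdiv. rewrite Rpow_mult_distr, pow_inv. field. lra. }
  apply Ceq_minus. apply Cmod_le_0. intros eps He.
  destruct (S1 (eps / 3)) as [N1 P1]; [lra|]. destruct (S2 (eps / 3)) as [N2 P2]; [lra|].
  set (W := 2 * K * (y - x)). assert (HW : 0 <= W) by (unfold W; apply Rmult_le_pos; lra).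
  destruct (npow_small r (eps / 3 / (W + 1)) Hr) as [N3 P3]; [apply Rdiv_lt_0_compat; lra|].
  set (n := (N1 + N2 + N3)%nat). specialize (P1 (S n) ltac:(lia)). specialize (P2 (S n) ltac:(lia)). specialize (P3 n ltac:(lia)).
  specialize (Hdiff n).
  assert (Hd3 : Cmod (csum (term y z) (S n) - csum (term x z) (S n)) <= eps / 3).
  { eapply Rle_trans; [exact Hdiff|]. replace (2 * (K * ((INR n + 1) * r ^ n)) * (y - x)) with (W * ((INR n + 1) * r ^ n)) by (unfold W; ring).
    assert (Hp : 0 <= (INR n + 1) * r ^ n) by (apply Rmult_le_pos; [pose proof (pos_INR n); lra|apply pow_le; lra]).
    apply Rle_trans with ((W + 1) * (eps / 3 / (W + 1))); [apply Rmult_le_compat; lra|right; field; lra]. }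
  replace (l - k)%C with ((csum (term y z) (S n) - k) - (csum (term x z) (S n) - l) - (csum (term y z) (S n) - csum (term x z) (S n)))%C by ring.
  eapply Rle_trans; [apply Cmod_sub_triangle|]. pose proof (Cmod_sub_triangle (csum (term y z) (S n) - k) (csum (term x z) (S n) - l)). lra.
Qed.

(** The Taylor series is taken at the point of the half-line nearest to [z], so it converges at
    every [z] of [B_rho]; [term_series_indep] makes the choice of base point immaterial. *)
Definition data_fun (z : C) : C := Cseries (term (Rmax 0 (Re z)) z).

Lemma nearest_point z x : 0 <= x -> Cmod (z - RtoC (Rmax 0 (Re z))) <= Cmod (z - RtoC x).
Proof.
  intros Hx. unfold Cmod. apply sqrt_le_1_alt. destruct z as [p q]. creim. unfold Rmax.
  destruct (Rle_dec 0 p) as [Hp|Hp].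
  - pose proof (pow2_ge_0 (p - x)). nra.
  - assert (0 <= x * - p) by (apply Rmult_le_pos; lra). nra.
Qed.

Lemma data_fun_series z x : 0 <= x -> Cmod (z - RtoC x) < rho -> Cser (term x z) (data_fun z).
Proof.
  intros Hx Hz. set (y := Rmax 0 (Re z)). assert (Hy : 0 <= y) by apply Rmax_l.
  assert (Hyz : Cmod (z - RtoC y) < rho) by (eapply Rle_lt_trans; [apply nearest_point; exact Hx|auto]).
  destruct (term_series x z Hx Hz) as [l [Hl _]]. destruct (term_series y z Hy Hyz) as [k [Hk _]].
  assert (E : data_fun z = k) by (apply Cseries_unique; auto).
  assert (El : l = k).
  { destruct (Rle_dec x y) as [H|H].
    - apply (term_series_indep x y z); auto.
    - symmetry. apply (term_series_indep y x z); auto. lra. }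
  rewrite E, <- El. auto.
Qed.

Lemma data_fun_ps x h : 0 <= x -> Cmod h < rho ->
  Cser (fun n => d n x / RtoC (INR (fact n)) * h ^ n)%C (data_fun (RtoC x + h)%C).
Proof.
  intros Hx Hh. assert (E : (RtoC x + h - RtoC x)%C = h) by ring.
  pose proof (data_fun_series (RtoC x + h)%C x Hx) as H. rewrite E in H. specialize (H Hh).
  apply Cser_ext with (term x (RtoC x + h)%C); auto. intros n. unfold term. rewrite E. reflexivity.
Qed.

Lemma data_fun_Cder z : InB rho z -> exists l, Cder data_fun z l.
Proof.
  intros [x [Hx Hz]].
  destruct (ps_deriv (fun n => d n x / RtoC (INR (fact n)))%C (fun h => data_fun (RtoC x + h)%C) rho) with (s := (z - RtoC x)%C) as [l [_ Hl]]; auto.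
  { intros s Hs. apply data_fun_ps; auto. }
  exists l. apply Cder_shift in Hl. replace (RtoC x + (z - RtoC x))%C with z in Hl by ring. auto.
Qed.

Lemma data_fun_real x : 0 <= x -> data_fun (RtoC x) = d 0%nat x.
Proof.
  intros Hx. pose proof (data_fun_ps x (RtoC 0) Hx) as H. rewrite Cmod_0 in H. specialize (H Hrho).
  replace (RtoC x + RtoC 0)%C with (RtoC x) in H by ring.
  rewrite (Cser_at_0 _ _ H). simpl. field.
Qed.

Lemma data_fun_at_0 z : Cmod z < rho -> Cser (fun n => d n 0 / RtoC (INR (fact n)) * z ^ n)%C (data_fun z).
Proof.
  intros Hz. pose proof (data_fun_ps 0 z (Rle_refl 0) Hz) as H. replace (RtoC 0 + z)%C with z in H by ring. auto.
Qed.

Lemma data_fun_bound r z : 0 < r < rho -> InB r z -> Cmod (data_fun z) <= M / (1 - r / rho) * exp (b * Cmod z).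
Proof.
  intros Hr [x [Hx Hz]]. set (y := Rmax 0 (Re z)). assert (Hy : 0 <= y) by apply Rmax_l.
  assert (Hyz : Cmod (z - RtoC y) < r) by (eapply Rle_lt_trans; [apply nearest_point; exact Hx|auto]).
  destruct (term_series y z Hy) as [l [Hl1 Hl2]]; [lra|].
  assert (E : data_fun z = l) by (apply Cseries_unique; auto). rewrite E.
  eapply Rle_trans; [exact Hl2|].
  assert (HM := DBound_pos _ _ _ _ Hrho HB).
  assert (Hyc : y <= Cmod z).
  { unfold y. apply Rmax_lub; [apply Cmod_ge_0|]. eapply Rle_trans; [apply Rle_abs|apply re_le_Cmod]. }
  assert (Hr1 : r / rho < 1).
  { apply Rmult_lt_reg_r with rho; auto. replace (r / rho * rho) with r by (field; lra). lra. }
  assert (Hq : Cmod (z - RtoC y) / rho <= r / rho) by (unfold Rdiv; apply Rmult_le_compat_r; [left; apply Rinv_0_lt_compat; auto|lra]).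
  unfold Rdiv at 1. replace (M / (1 - r / rho) * exp (b * Cmod z)) with (M * exp (b * Cmod z) * / (1 - r / rho)) by (unfold Rdiv; ring).
  apply Rmult_le_compat.
  - apply Rmult_le_pos; auto. left; apply exp_pos.
  - left. apply Rinv_0_lt_compat. lra.
  - apply Rmult_le_compat_l; auto. apply exp_le. nra.
  - apply Rinv_le_contravar; lra.
Qed.

End DataFunction.

Lemma Rder_of_quadratic (F : R -> C) x l K d : 0 < d ->
  (forall h, Rabs h < d -> Cmod (F (x + h)%R - F x - l * RtoC h) <= K * (h * h)) -> Rder F x l.
Proof.
  intros Hd H. apply Rder_eps. intros eps He. set (K' := Rabs K + 1).
  assert (HK : 0 < K' /\ K <= K') by (unfold K'; pose proof (Rabs_pos K); pose proof (Rle_abs K); lra).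
  exists (Rmin d (eps / K')). split; [apply Rmin_pos; [auto|apply Rdiv_lt_0_compat; lra]|].
  intros h Hh. eapply Rle_trans; [apply H; eapply Rlt_le_trans; [exact Hh|apply Rmin_l]|].
  pose proof (Rlt_le_trans _ _ _ Hh (Rmin_r _ _)) as Hh2. pose proof (Rabs_pos h).
  replace (h * h) with (Rabs h * Rabs h) by (rewrite <- Rabs_mult; apply Rabs_pos_eq; nra).
  rewrite <- Rmult_assoc. apply Rmult_le_compat_r; auto.
  apply Rle_trans with (K' * (eps / K')); [|right; field; lra].
  apply Rle_trans with (K' * Rabs h); [apply Rmult_le_compat_r; lra|apply Rmult_le_compat_l; lra].
Qed.

(** Differentiation under the integral sign, in which a quadratic remainder uniform in [t] takes the
    place of joint continuity of the partial derivative. *)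
Lemma param_der (psi : R -> R -> C) (dpsi : R -> C) a b x K d : a <= b -> 0 < d ->
  (forall y, Rabs (y - x) < d -> contI (psi y) a b) -> contI dpsi a b ->
  (forall h t, Rabs h < d -> a <= t <= b -> Cmod (psi (x + h)%R t - psi x t - dpsi t * RtoC h) <= K * (h * h)) ->
  Rder (fun y => CI (psi y) a b) x (CI dpsi a b).
Proof.
  intros Hab Hd Hc Hdc H. apply (Rder_of_quadratic _ x _ (K * (b - a)) d Hd). intros h Hh.
  assert (C1 : contI (psi (x + h)) a b) by (apply Hc; replace (x + h - x) with h by ring; auto).
  assert (C2 : contI (psi x) a b) by (apply Hc; replace (x - x) with 0 by ring; rewrite Rabs_R0; auto).
  rewrite (Cmult_comm (CI dpsi a b)), <- CI_cmult, <- CI_minus, <- CI_minus; auto.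
  - replace (K * (b - a) * (h * h)) with (K * (h * h) * (b - a)) by ring. apply CI_bound_const; auto.
    + intros t Ht. apply cont_minus; [apply cont_minus; auto|]. apply cont_mult; [apply cont_const|auto].
    + intros t Ht. rewrite (Cmult_comm (RtoC h)). apply H; auto.
  - intros t Ht. apply cont_minus; auto.
  - apply contI_cmult; auto.
Qed.

(** Two applications of [C_MVT], which tolerates the endpoint 0; the second order remainder is the
    one that [param_der] consumes. *)
Lemma data_taylor2 d n X K2 y z : Data d -> (forall u, 0 <= u <= X -> Cmod (d (S (S n)) u) <= K2) ->
  0 <= y <= X -> 0 <= z <= X ->
  Cmod (d n y - d n z - d (S n) z * RtoC (y - z)) <= 4 * K2 * ((y - z) * (y - z)).
Proof.
  intros HD HK Hy Hz.
  assert (HK0 : 0 <= K2) by (eapply Rle_trans; [apply Cmod_ge_0|apply (HK y Hy)]).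
  assert (L1 : forall u v, 0 <= u -> u <= v -> v <= X -> Cmod (d (S n) v - d (S n) u) <= 2 * K2 * (v - u)).
  { intros u v Hu Huv Hv. apply (C_MVT (d (S n)) (d (S (S n)))); auto.
    - intros t _. apply HD.
    - intros t Ht. apply HD. lra.
    - intros t Ht. apply HK. lra. }
  set (g := fun u => (d n u - d (S n) z * RtoC u)%C).
  assert (Dg : forall u, 0 < u -> Rder g u (d (S n) u - d (S n) z)%C).
  { intros u Hu. eapply Rder_val; [apply Rder_minus; [apply HD; auto|apply Rder_cmult, Rder_id]|]. ring. }
  assert (Cg : forall u, cont g u).
  { intros u. apply cont_minus; [apply HD|]. apply cont_mult; [apply cont_const|apply (Rder_cont _ _ _ (Rder_id u))]. }
  replace (d n y - d n z - d (S n) z * RtoC (y - z))%C with (g y - g z)%C by (unfold g; rewrite RtoC_minus; ring).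
  destruct (Rle_dec z y) as [H|H].
  - eapply Rle_trans; [apply (C_MVT g (fun u => d (S n) u - d (S n) z)%C z y (2 * K2 * (y - z)))|right; ring]; auto.
    + intros u _; apply Cg.
    + intros u Hu. apply Dg. lra.
    + intros u Hu. eapply Rle_trans; [apply L1; lra|]. nra.
  - rewrite Cmod_sub_sym.
    eapply Rle_trans; [apply (C_MVT g (fun u => d (S n) u - d (S n) z)%C y z (2 * K2 * (z - y)))|right; ring]; try lra.
    + intros u _; apply Cg.
    + intros u Hu. apply Dg. lra.
    + intros u Hu. rewrite Cmod_sub_sym. eapply Rle_trans; [apply L1; lra|]. nra.
Qed.

(** * Operators on jets: averages and the Euler operator *)

Section AverageOperator.

Variables (phi kap : R -> R) (Kk : R).
Hypothesis Hphi : forall t, 0 <= t <= 1 -> continuous phi t /\ 0 <= phi t <= 1.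
Hypothesis Hkap : forall t, 0 <= t <= 1 -> continuous kap t /\ Rabs (kap t) <= Kk.

(** The factor [phi t ^ n] comes from the chain rule: [avg d n] is the [n]-th derivative of
    [avg d 0]. At the origin the operator multiplies the [n]-th derivative by the moment of
    [phi^n kap]. *)
Definition avg (d : nat -> R -> C) (n : nat) (x : R) : C :=
  CI (fun t => RtoC (phi t ^ n * kap t) * d n (x * phi t)%R)%C 0 1.

Lemma continuous_pow (g : R -> R) n t : continuous g t -> continuous (fun t => g t ^ n) t.
Proof.
  intros H. induction n as [|n IH]; [apply continuous_const|].
  apply (@continuous_mult _ R_AbsRing g (fun t => g t ^ n)); auto.
Qed.

Lemma kernel_continuous n t : 0 <= t <= 1 -> continuous (fun t => phi t ^ n * kap t) t.
Proof.
  intros Ht. apply (@continuous_mult _ R_AbsRing (fun t => phi t ^ n) kap); [apply continuous_pow; apply Hphi; auto|apply Hkap; auto].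
Qed.

Lemma Kk_pos : 0 <= Kk.
Proof. eapply Rle_trans; [apply Rabs_pos|apply (Hkap 0)]; lra. Qed.

Lemma kernel_bound n t : 0 <= t <= 1 -> Rabs (phi t ^ n * kap t) <= Kk.
Proof.
  intros Ht. destruct (Hphi t Ht) as [_ Hp]. destruct (Hkap t Ht) as [_ Hk].
  rewrite Rabs_mult. rewrite (Rabs_pos_eq (phi t ^ n)) by (apply pow_le; lra).
  assert (phi t ^ n <= 1) by (rewrite <- (pow1 n); apply pow_incr; lra).
  assert (0 <= phi t ^ n) by (apply pow_le; lra). pose proof (Rabs_pos (kap t)). nra.
Qed.

Section AverageData.

Variables (d : nat -> R -> C) (rho b M : R).
Hypothesis Hrho : 0 < rho.
Hypothesis Hb : 0 <= b.
Hypothesis HD : Data d.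
Hypothesis HB : DBound d rho b M.

Lemma avg_cont n m x : contI (fun t => RtoC (phi t ^ m * kap t) * d n (x * phi t)%R)%C 0 1.
Proof.
  intros t Ht. apply cont_mult; [apply cont_RtoC, kernel_continuous; auto|].
  apply (cont_comp_real (d n) (fun t => x * phi t)); [apply HD|].
  apply (@continuous_mult _ R_AbsRing (fun _ => x) phi); [apply continuous_const|apply Hphi; auto].
Qed.

Lemma avg_Rder n x : 0 < x -> Rder (avg d n) x (avg d (S n) x).
Proof.
  intros Hx. assert (HM := DBound_pos _ _ _ _ Hrho HB).
  set (K2 := M * (INR (fact (S (S n))) / rho ^ S (S n)) * exp (b * (2 * x))).
  assert (HK2 : forall u, 0 <= u <= 2 * x -> Cmod (d (S (S n)) u) <= K2).
  { intros u Hu. eapply Rle_trans; [apply HB; lra|]. unfold K2. apply Rmult_le_compat_l.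
    - apply Rmult_le_pos; auto. left; apply fact_ratio_pos; auto.
    - apply exp_le. nra. }
  assert (HK20 : 0 <= K2) by (eapply Rle_trans; [apply Cmod_ge_0|apply (HK2 0)]; lra).
  apply (param_der (fun y t => RtoC (phi t ^ n * kap t) * d n (y * phi t)%R)%C _ 0 1 x (Kk * (4 * K2)) x); auto; try lra.
  - intros y _. apply avg_cont.
  - apply avg_cont.
  - intros h t Hh Ht. destruct (Hphi t Ht) as [_ Hp]. apply Rabs_def2 in Hh.
    pose proof (data_taylor2 d n (2 * x) K2 ((x + h) * phi t) (x * phi t) HD HK2) as T2.
    replace ((x + h) * phi t - x * phi t) with (h * phi t) in T2 by ring.
    replace (RtoC (phi t ^ n * kap t) * d n ((x + h) * phi t)%R - RtoC (phi t ^ n * kap t) * d n (x * phi t)%R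
      - RtoC (phi t ^ S n * kap t) * d (S n) (x * phi t)%R * RtoC h)%C
      with (RtoC (phi t ^ n * kap t) * (d n ((x + h) * phi t)%R - d n (x * phi t)%R - d (S n) (x * phi t)%R * RtoC (h * phi t)))%C.
    2: { simpl. rewrite !RtoC_mult. ring. }
    rewrite Cmod_mult, Cmod_R. rewrite Rmult_assoc. apply Rmult_le_compat; auto using Rabs_pos, Cmod_ge_0.
    + apply kernel_bound; auto.
    + eapply Rle_trans; [apply T2; nra|]. apply Rmult_le_compat_l; [lra|].
      assert (0 <= h * h) by nra. assert (phi t * phi t <= 1) by nra. nra.
Qed.

Lemma avg_right_cont n eps : 0 < eps -> exists del, 0 < del /\ forall y, 0 <= y < del -> Cmod (avg d n y - avg d n 0) < eps.
Proof.
  intros He. pose proof Kk_pos as HK. destruct (HD n) as [Hc _]. pose proof (proj1 (cont_eps _ _) (Hc 0)) as H0.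
  destruct (H0 (eps / (Kk + 1))) as [del [Hdel Hd]]; [apply Rdiv_lt_0_compat; lra|].
  exists del. split; auto. intros y Hy. unfold avg. rewrite <- CI_minus by (try lra; apply avg_cont).
  apply Rle_lt_trans with (Kk * (eps / (Kk + 1)) * (1 - 0)).
  - apply CI_bound_const; [lra| |].
    + intros t Ht. apply cont_minus; apply avg_cont; auto.
    + intros t Ht. destruct (Hphi t Ht) as [_ Hp].
      replace (RtoC (phi t ^ n * kap t) * d n (y * phi t)%R - RtoC (phi t ^ n * kap t) * d n (0 * phi t)%R)%C
        with (RtoC (phi t ^ n * kap t) * (d n (y * phi t)%R - d n (0 * phi t)%R))%C by ring.
      rewrite Cmod_mult, Cmod_R. apply Rmult_le_compat; auto using Rabs_pos, Cmod_ge_0; [apply kernel_bound; auto|].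
      rewrite Rmult_0_l. left. apply Hd. rewrite Rminus_0_r, Rabs_pos_eq by nra. nra.
  - rewrite Rminus_0_r, Rmult_1_r. apply Rmult_lt_reg_r with (Kk + 1); [lra|].
    replace (Kk * (eps / (Kk + 1)) * (Kk + 1)) with (Kk * eps) by (field; lra). nra.
Qed.

Lemma avg_Data : Data (fun n x => avg d n (Rmax 0 x)).
Proof. apply Data_mk; [apply avg_Rder|apply avg_right_cont]. Qed.

Lemma avg_DBound : DBound (fun n x => avg d n (Rmax 0 x)) rho b (Kk * M).
Proof.
  intros n x Hx. rewrite Rmax_right by auto. assert (HM := DBound_pos _ _ _ _ Hrho HB). pose proof (fact_ratio_pos n rho Hrho) as Hf.
  unfold avg. eapply Rle_trans; [apply (CI_bound_const _ (Kk * (M * (INR (fact n) / rho ^ n) * exp (b * x))))|right; ring]; [lra|apply avg_cont|].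
  intros t Ht. destruct (Hphi t Ht) as [_ Hp]. rewrite Cmod_mult, Cmod_R.
  apply Rmult_le_compat; auto using Rabs_pos, Cmod_ge_0; [apply kernel_bound; auto|].
  eapply Rle_trans; [apply HB; nra|]. apply Rmult_le_compat_l; [nra|]. apply exp_le. assert (0 <= b * x) by nra. nra.
Qed.

Lemma avg_at_0 n : avg d n 0 = (RtoC (RInt (fun t => (phi t ^ n * kap t)%R) 0 1) * d n 0)%C.
Proof.
  unfold avg. rewrite (CI_ext _ (fun t => d n 0 * RtoC (phi t ^ n * kap t))%C); [|lra|].
  2: { intros t _. rewrite Rmult_0_l. ring. }
  rewrite CI_cmult; [|lra|intros t Ht; apply cont_RtoC, kernel_continuous; auto].
  rewrite Cmult_comm. f_equal. apply Ceq; simpl; [reflexivity|]. unfold Im; simpl.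
  rewrite RInt_const. unfold scal; simpl; unfold mult; simpl. ring.
Qed.

End AverageData.
End AverageOperator.

(** Iterated derivatives of [x f' + lam f]. *)
Definition Eul (lam : R) (d : nat -> R -> C) (n : nat) (x : R) : C :=
  (RtoC (Rmax 0 x) * d (S n) x + RtoC (INR n + lam) * d n x)%C.

Lemma Eul_Data lam d : Data d -> Data (Eul lam d).
Proof.
  intros HD n. split.
  - intros x. apply cont_plus; apply cont_mult; try apply HD; [apply cont_RtoC, continuous_Rmax0|apply cont_const].
  - intros x Hx. apply Rder_ext_loc with (fun x => RtoC x * d (S n) x + RtoC (INR n + lam) * d n x)%C x; auto.
    + intros t Ht. apply Rabs_def2 in Ht. unfold Eul. rewrite Rmax_right; [auto|lra].
    + eapply Rder_val.
      * apply Rder_plus; [apply Rder_mult; [apply Rder_id|apply HD; auto]|apply Rder_cmult, HD; auto].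
      * unfold Eul. rewrite Rmax_right by lra. rewrite S_INR, !RtoC_plus. ring.
Qed.

(** The operator introduces a factor [n + 1] and a factor [x]. The first is absorbed by
    [(rho'/rho)^n], the second by [exp ((b' - b) x)], whence the strict losses in radius and
    rate. *)
Lemma Eul_DBound lam d rho b M rho' b' : 0 <= lam -> 0 < rho' < rho -> b < b' -> DBound d rho b M ->
  exists M', DBound (Eul lam d) rho' b' M'.
Proof.
  intros Hl Hr Hb HB. assert (Hrho : 0 < rho) by lra. assert (HM := DBound_pos _ _ _ _ Hrho HB).
  set (q := rho' / rho). assert (Hq : 0 <= q < 1).
  { unfold q. split; [apply Rdiv_le_0_compat; lra|]. apply Rmult_lt_reg_r with rho; auto. replace (rho' / rho * rho) with rho' by (field; lra). lra. }
  set (Q := 1 / (1 - q)).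
  exists (M * Q / (rho * (b' - b)) + (1 + lam) * (M * Q)). intros n x Hx.
  pose proof (npow_bound q n Hq) as Hn. fold Q in Hn. pose proof (pos_INR n) as PN.
  assert (Hp : 0 < rho ^ n) by (apply pow_lt; auto). assert (Hp' : 0 < rho' ^ n) by (apply pow_lt; lra).
  assert (Hqn : q ^ n = rho' ^ n / rho ^ n) by (unfold q, Rdiv; rewrite Rpow_mult_distr, pow_inv; reflexivity).
  assert (Hqn0 : 0 <= q ^ n) by (apply pow_le; lra).
  assert (He : exp (b * x) <= exp (b' * x)) by (apply exp_le; nra).
  assert (Hxe : x * exp (b * x) <= exp (b' * x) / (b' - b)).
  { replace (b' * x) with ((b' - b) * x + b * x) by ring. rewrite exp_plus. pose proof (exp_pos (b * x)).
    pose proof (exp_ineq1_le ((b' - b) * x)). apply Rmult_le_reg_r with (b' - b); [lra|].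
    replace (exp ((b' - b) * x) * exp (b * x) / (b' - b) * (b' - b)) with (exp ((b' - b) * x) * exp (b * x)) by (field; lra). nra. }
  pose proof (INR_fact_lt_0 n) as Hf. pose proof (exp_pos (b * x)) as Pe. pose proof (exp_pos (b' * x)) as Pe'.
  unfold Eul. rewrite Rmax_right by auto. eapply Rle_trans; [apply Cmod_triangle|].
  rewrite !Cmod_mult, !Cmod_R, !Rabs_pos_eq by lra.
  rewrite (Rmult_plus_distr_r (M * Q / (rho * (b' - b)))), (Rmult_plus_distr_r (M * Q / (rho * (b' - b)) * (INR (fact n) / rho' ^ n))).
  apply Rplus_le_compat.
  - pose proof (HB (S n) x Hx) as H. change (fact (S n)) with (S n * fact n)%nat in H. rewrite mult_INR, S_INR in H. simpl pow in H.
    apply Rle_trans with (x * (M * ((INR n + 1) * INR (fact n) / (rho * rho ^ n)) * exp (b * x))); [apply Rmult_le_compat_l; auto|].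
    replace (x * (M * ((INR n + 1) * INR (fact n) / (rho * rho ^ n)) * exp (b * x)))
      with (M * INR (fact n) / rho / rho' ^ n * (((INR n + 1) * q ^ n) * (x * exp (b * x)))) by (rewrite Hqn; field; lra).
    replace (M * Q / (rho * (b' - b)) * (INR (fact n) / rho' ^ n) * exp (b' * x))
      with (M * INR (fact n) / rho / rho' ^ n * (Q * (exp (b' * x) / (b' - b)))) by (field; lra).
    apply Rmult_le_compat_l.
    + repeat apply Rdiv_le_0_compat; auto. apply Rmult_le_pos; lra.
    + apply Rmult_le_compat; auto; nra.
  - pose proof (HB n x Hx) as H.
    apply Rle_trans with (((1 + lam) * (INR n + 1)) * (M * (INR (fact n) / rho ^ n) * exp (b' * x))).
    + apply Rmult_le_compat; [lra|apply Cmod_ge_0|nra|]. eapply Rle_trans; [exact H|]. apply Rmult_le_compat_l; auto.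
      apply Rmult_le_pos; auto. left; apply fact_ratio_pos; auto.
    + replace ((1 + lam) * (INR n + 1) * (M * (INR (fact n) / rho ^ n) * exp (b' * x)))
        with ((1 + lam) * M * (INR (fact n) / rho' ^ n) * exp (b' * x) * ((INR n + 1) * q ^ n)) by (rewrite Hqn; field; lra).
      replace ((1 + lam) * (M * Q) * (INR (fact n) / rho' ^ n) * exp (b' * x)) with ((1 + lam) * M * (INR (fact n) / rho' ^ n) * exp (b' * x) * Q) by ring.
      apply Rmult_le_compat_l; auto. repeat apply Rmult_le_pos; try lra. left; apply Rinv_0_lt_compat; auto.
Qed.

Lemma Eul_at_0 lam d n : Eul lam d n 0 = (RtoC (INR n + lam) * d n 0)%C.
Proof. unfold Eul. rewrite Rmax_left by lra. ring. Qed.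

Lemma scale_Data c d : Data d -> Data (fun n x => c * d n x)%C.
Proof.
  intros HD n. split; [intros x; apply cont_mult; [apply cont_const|apply HD]|]. intros x Hx. apply Rder_cmult, HD; auto.
Qed.

Lemma scale_DBound c d rho b M : DBound d rho b M -> DBound (fun n x => c * d n x)%C rho b (Cmod c * M).
Proof.
  intros HB n x Hx. rewrite Cmod_mult. specialize (HB n x Hx).
  replace (Cmod c * M * (INR (fact n) / rho ^ n) * exp (b * x)) with (Cmod c * (M * (INR (fact n) / rho ^ n) * exp (b * x))) by ring.
  apply Rmult_le_compat_l; [apply Cmod_ge_0|auto].
Qed.

(** * Real powers and the Gamma function *)

(** [Rpower 0 a] is [1] in the library, hence this continuous version. *)
Definition ppow (a x : R) : R := if Rle_dec x 0 then 0 else Rpower x a.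

Lemma ppow_gt a x : 0 < x -> ppow a x = Rpower x a.
Proof. intros H. unfold ppow. destruct Rle_dec; [lra|auto]. Qed.

Lemma ppow_le a x : x <= 0 -> ppow a x = 0.
Proof. intros H. unfold ppow. destruct Rle_dec; [auto|lra]. Qed.

Lemma Rpower_pos x a : 0 < Rpower x a.
Proof. apply exp_pos. Qed.

Lemma ppow_pos a x : 0 <= ppow a x.
Proof. unfold ppow. destruct Rle_dec; [lra|left; apply Rpower_pos]. Qed.

Lemma is_derive_Rpower a x : 0 < x -> is_derive (fun t => Rpower t a) x (a * Rpower x (a - 1)).
Proof.
  intros Hx. unfold Rpower. auto_derive; auto.
  replace ((a - 1) * ln x) with (a * ln x + - ln x) by ring. rewrite exp_plus, exp_Ropp, exp_ln by auto. field. lra.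
Qed.

Lemma is_derive_ppow a x : 0 < x -> is_derive (ppow a) x (a * Rpower x (a - 1)).
Proof.
  intros Hx. apply is_derive_ext_loc with (fun t => Rpower t a); [|apply is_derive_Rpower; auto].
  exists (mkposreal x Hx). intros t Ht. change (Rabs (t - x) < x) in Ht. apply Rabs_def2 in Ht. rewrite ppow_gt; [auto|lra].
Qed.

Lemma continuous_ppow a x : 0 < a -> continuous (ppow a) x.
Proof.
  intros Ha. destruct (Rtotal_order x 0) as [Hx|[Hx|Hx]].
  - apply continuous_ext_loc with (fun _ => 0); [|apply continuous_const].
    assert (Hx' : 0 < - x) by lra. exists (mkposreal _ Hx'). intros t Ht. change (Rabs (t - x) < - x) in Ht.
    apply Rabs_def2 in Ht. rewrite ppow_le; [auto|lra].
  - subst x. apply filterlim_locally. intros eps. pose proof (cond_pos eps) as He.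
    exists (mkposreal _ (Rpower_pos eps (/ a))). intros t Ht. change (Rabs (t - 0) < Rpower eps (/ a)) in Ht.
    change (Rabs (ppow a t - ppow a 0) < eps). rewrite (ppow_le a 0), Rminus_0_r, Rabs_pos_eq by (lra || apply ppow_pos).
    rewrite Rminus_0_r in Ht. apply Rabs_def2 in Ht. unfold ppow. destruct (Rle_dec t 0) as [H|H]; [auto|].
    apply Rlt_le_trans with (Rpower (Rpower eps (/ a)) a); [apply Rlt_Rpower_l; lra|].
    rewrite Rpower_mult, Rinv_l, Rpower_1; [right; auto|auto|lra].
  - apply (ex_derive_continuous (ppow a)). eexists. apply is_derive_ppow; auto.
Qed.

Lemma ppow_bound a eps : 0 < a -> 0 < eps -> exists K, 0 <= K /\ forall x, 0 <= x -> ppow a x <= K * exp (eps * x).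
Proof.
  (* The maximum of [x^a exp (- eps x)], attained at [x = a/eps]. *)
  intros Ha He. exists (exp (a * (- 1 - ln (eps / a)))). split; [left; apply exp_pos|].
  intros x Hx. destruct (Req_dec x 0) as [->|Hn].
  { rewrite ppow_le by lra. left. apply Rmult_lt_0_compat; apply exp_pos. }
  rewrite ppow_gt by lra. unfold Rpower. rewrite <- exp_plus. apply exp_le.
  assert (Hea : 0 < eps / a) by (apply Rdiv_lt_0_compat; auto).
  pose proof (exp_ineq1_le (ln (eps / a * x))) as H. rewrite exp_ln in H by (apply Rmult_lt_0_compat; lra).
  rewrite ln_mult in H by lra.
  apply Rle_trans with (a * (eps / a * x - 1 - ln (eps / a))); [apply Rmult_le_compat_l; lra|].
  right. field. lra.
Qed.

(** This is [Gamma (a + 1) w^(-a-1)]. The exponent [a] in place of [a - 1] keeps the integrand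
    continuous at 0 for every [a > 0]. *)
Definition Lam (a : R) (w : C) : C := Lap (fun x => RtoC (ppow a x)) w.

Lemma ppow_cont a x : 0 < a -> cont (fun x => RtoC (ppow a x)) x.
Proof. intros Ha. apply cont_RtoC, continuous_ppow; auto. Qed.

Lemma ppow_Cbound a eps : 0 < a -> 0 < eps -> exists K, 0 <= K /\ forall x, 0 <= x -> Cmod (RtoC (ppow a x)) <= K * exp (eps * x).
Proof.
  intros Ha He. destruct (ppow_bound a eps Ha He) as [K [HK H]]. exists K. split; auto.
  intros x Hx. rewrite Cmod_R, Rabs_pos_eq by apply ppow_pos. auto.
Qed.

Lemma Lam_spec a w : 0 < a -> 0 < Re w -> Limp (fun X => CI (fun x => RtoC (ppow a x) * Cexp (- (w * RtoC x)))%C 0 X) (Lam a w).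
Proof.
  intros Ha Hw. destruct (ppow_Cbound a (Re w / 2) Ha) as [K [HK H]]; [lra|].
  apply (Lap_spec _ K (Re w / 2)); auto; [intros; apply ppow_cont; auto|lra].
Qed.

Lemma ppow_exp_limit a w : 0 < a -> 0 < Re w -> Limp (fun X => RtoC (ppow a X) * Cexp (- (w * RtoC X)))%C (RtoC 0).
Proof.
  intros Ha Hw eps He. destruct (ppow_Cbound a (Re w / 2) Ha) as [K [HK H]]; [lra|].
  destruct (exp_decay K (Re w / 2) eps) as [X0 HX0]; [lra|auto|].
  exists (Rmax 0 X0). intros X HX.
  replace (RtoC (ppow a X) * Cexp (- (w * RtoC X)) - RtoC 0)%C with (RtoC (ppow a X) * Cexp (- (w * RtoC X)))%C by ring.
  eapply Rle_lt_trans; [apply (Lap_integrand_bound (fun x => RtoC (ppow a x)) K (Re w / 2)); apply H; eapply Rle_trans; [apply Rmax_l|exact HX]|].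
  replace (- (Re w - Re w / 2) * X) with (- (Re w / 2) * X) by field. apply HX0. eapply Rle_trans; [apply Rmax_r|exact HX].
Qed.

Lemma Lam_step a w : 0 < a -> 0 < Re w -> (w * Lam (a + 1) w = RtoC (a + 1) * Lam a w)%C.
Proof.
  intros Ha Hw. apply (Limp_unique (fun X => w * CI (fun x => RtoC (ppow (a + 1) x) * Cexp (- (w * RtoC x))) 0 X)%C).
  { apply Limp_cmult, Lam_spec; lra. }
  apply (Limp_ext (fun X => RtoC (a + 1) * CI (fun x => RtoC (ppow a x) * Cexp (- (w * RtoC x))) 0 X - RtoC (ppow (a + 1) X) * Cexp (- (w * RtoC X)))%C _ _ 0).
  2: { replace (RtoC (a + 1) * Lam a w)%C with (RtoC (a + 1) * Lam a w - RtoC 0)%C by ring.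
       apply Limp_minus; [apply Limp_cmult, Lam_spec; lra|apply ppow_exp_limit; lra]. }
  intros X HX.
  assert (C1 : forall k, 0 < k -> contI (fun x => RtoC (ppow k x) * Cexp (- (w * RtoC x)))%C 0 X).
  { intros k Hk x _. apply cont_mult; [apply ppow_cont; auto|apply cont_Cexp_lin]. }
  pose proof (CI_FTC_open (fun x => RtoC (ppow (a + 1) x) * Cexp (- (w * RtoC x)))%C
    (fun x => RtoC (a + 1) * (RtoC (ppow a x) * Cexp (- (w * RtoC x))) - w * (RtoC (ppow (a + 1) x) * Cexp (- (w * RtoC x))))%C 0 X HX) as H.
  rewrite CI_minus, !CI_cmult in H; auto using contI_cmult; try (apply C1; lra); try (apply contI_cmult, C1; lra).
  rewrite (ppow_le (a + 1) 0) in H by lra.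
  set (A := CI (fun t => RtoC (ppow (a + 1) t) * Cexp (- (w * RtoC t)))%C 0 X) in *.
  set (B := CI (fun t => RtoC (ppow a t) * Cexp (- (w * RtoC t)))%C 0 X) in *.
  assert (H2 : (RtoC (a + 1) * B - w * A)%C = (RtoC (ppow (a + 1) X) * Cexp (- (w * RtoC X)) - RtoC 0 * Cexp (- (w * RtoC 0)))%C).
  { apply H.
    - apply C1; lra.
    - intros x Hx. apply cont_minus; apply cont_mult; try apply cont_const; apply C1; auto; lra.
    - intros x Hx. eapply Rder_val; [apply Rder_mult; [apply Rder_RtoC, is_derive_ppow; lra|apply Rder_Cexp_neg]|]. cbv beta.
      replace (a + 1 - 1) with a by ring. rewrite (ppow_gt a) by lra. rewrite RtoC_mult. ring. }
  replace (w * A)%C with (RtoC (a + 1) * B - (RtoC (a + 1) * B - w * A))%C by ring. rewrite H2. ring.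
Qed.

Lemma Lam_Cder a w : 0 < a -> 0 < Re w -> Cder (Lam a) w (- Lam (a + 1) w)%C.
Proof.
  intros Ha Hw. destruct (ppow_Cbound a (Re w / 2) Ha) as [K [HK H]]; [lra|].
  eapply Cder_unique_val; [apply (Lap_Cder _ K (Re w / 2)); auto; [intros; apply ppow_cont; auto|lra]|].
  destruct (ppow_Cbound (a + 1) (Re w / 2)) as [K1 [HK1 H1]]; [lra|lra|].
  assert (E : forall x, 0 <= x -> (- RtoC x * RtoC (ppow a x))%C = (-(1) * RtoC (ppow (a + 1) x))%C).
  { intros x Hx. destruct (Req_dec x 0) as [->|Hn]; [rewrite !ppow_le by lra; ring|].
    rewrite !ppow_gt, Rpower_plus, Rpower_1 by lra. rewrite RtoC_mult. ring. }
  apply (Lap_limit _ K1 (Re w / 2)); [auto| | |lra|].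
  - intros x Hx. apply cont_mult; [apply cont_opp, (Rder_cont _ _ _ (Rder_id x))|apply ppow_cont; auto].
  - intros x Hx. rewrite E by auto. rewrite Cmod_mult, Cmod_m1, Rmult_1_l. auto.
  - replace (- Lam (a + 1) w)%C with (-(1) * Lam (a + 1) w)%C by ring.
    apply (Limp_ext (fun X => -(1) * CI (fun x => RtoC (ppow (a + 1) x) * Cexp (- (w * RtoC x))) 0 X)%C _ _ 0); [|apply Limp_cmult, Lam_spec; lra].
    intros X HX. rewrite <- CI_cmult; auto.
    + apply CI_ext; auto. intros x Hx. rewrite E by lra. ring.
    + intros x _. apply cont_mult; [apply ppow_cont; lra|apply cont_Cexp_lin].
Qed.

(** Along the path [t |-> Cexp (t v)], which stays in the right half-plane, [w^(a+1) Lam a w] has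
    zero derivative: this is [Lam_Cder] combined with the integration by parts [Lam_step]. It plays
    the part of a rotation of the contour. *)
Lemma Lam_rotate a v : 0 < a -> - (PI / 2) < Im v < PI / 2 ->
  (Cexp (RtoC (a + 1) * v) * Lam a (Cexp v))%C = Lam a (RtoC 1).
Proof.
  intros Ha Hv.
  set (g := fun t => (Cexp (RtoC (a + 1) * (v * RtoC t)) * Lam a (Cexp (v * RtoC t)))%C).
  assert (Hre : forall t, 0 <= t <= 1 -> 0 < Re (Cexp (v * RtoC t))).
  { intros t Ht. change (0 < exp (Re (v * RtoC t)) * cos (Im (v * RtoC t))). apply Rmult_lt_0_compat; [apply exp_pos|].
    rewrite im_scal_r. apply cos_gt_0; nra. }
  assert (Dg : forall t, 0 <= t <= 1 -> Rder g t (RtoC 0)).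
  { intros t Ht. specialize (Hre t Ht). eapply Rder_val.
    - apply Rder_mult.
      + apply Rder_Cexp. apply Rder_cmult, Rder_cmult, Rder_id.
      + apply (Rder_comp_Cder (Lam a) (fun t => Cexp (v * RtoC t))); [apply Lam_Cder; auto|]. apply Rder_Cexp_lin.
    - cbv beta. set (E := Cexp (RtoC (a + 1) * (v * RtoC t))). set (W := Cexp (v * RtoC t)) in *.
      pose proof (Lam_step a W Ha Hre) as S.
      replace (E * (RtoC (a + 1) * (v * RtoC 1)) * Lam a W + E * (- Lam (a + 1) W * (v * W)))%C
        with (E * v * (RtoC (a + 1) * Lam a W - W * Lam (a + 1) W))%C by ring.
      rewrite S. ring. }
  pose proof (C_const_of_Rder0 g 0 1) as H. unfold g in H.
  replace (v * RtoC 1)%C with v in H by ring. replace (v * RtoC 0)%C with (RtoC 0) in H by ring.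
  replace (RtoC (a + 1) * RtoC 0)%C with (RtoC 0) in H by ring. rewrite Cexp_0, Cmult_1_l in H. apply H.
  - lra.
  - intros t Ht. eapply Rder_cont, Dg; auto.
  - intros t Ht. apply Dg. lra.
Qed.

Lemma CI_RtoC f a b : CI (fun t => RtoC (f t)) a b = RtoC (RInt f a b).
Proof. apply Ceq; simpl; [reflexivity|]. rewrite RInt_const. unfold scal; simpl; unfold mult; simpl. ring. Qed.

Lemma Cexp_neg1 x : Cexp (- (RtoC 1 * RtoC x)) = RtoC (exp (- x)).
Proof. rewrite <- Cexp_RtoC. f_equal. rewrite RtoC_opp. ring. Qed.

Lemma Lam_1_real a : 0 < a -> Lam a (RtoC 1) = RtoC (Re (Lam a (RtoC 1))) /\ 0 < Re (Lam a (RtoC 1)).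
Proof.
  intros Ha. assert (H := Lam_spec a (RtoC 1) Ha). simpl in H. specialize (H Rlt_0_1).
  set (I := Lam a (RtoC 1)) in *. set (f := fun x => ppow a x * exp (- x)).
  assert (E : forall X, 0 <= X -> CI (fun x => RtoC (ppow a x) * Cexp (- (RtoC 1 * RtoC x)))%C 0 X = RtoC (RInt f 0 X)).
  { intros X HX. rewrite <- CI_RtoC. apply CI_ext; auto. intros x _. rewrite Cexp_neg1, <- RtoC_mult. reflexivity. }
  assert (Cf : forall x, continuous f x).
  { intros x. apply (@continuous_mult _ R_AbsRing (ppow a)); [apply continuous_ppow; auto|].
    apply (ex_derive_continuous (fun x => exp (- x))). auto_derive; auto. }
  assert (Xf : forall x y, ex_RInt f x y) by (intros; apply (ex_RInt_continuous (V:=R_CompleteNormedModule)); intros; apply Cf).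
  split.
  - apply Ceq; simpl; auto. apply cond_eq. intros eps He. destruct (H eps He) as [X0 HX0].
    specialize (HX0 (Rmax 0 X0) (Rmax_r _ _)). rewrite E in HX0 by apply Rmax_l.
    eapply Rle_lt_trans; [|exact HX0]. eapply Rle_trans; [|apply im_le_Cmod]. right. creim.
    unfold Im. rewrite <- Rabs_Ropp. f_equal. ring.
  - assert (H1 : 0 < RInt f 0 1).
    { apply RInt_gt_0; [lra| |intros; apply Cf]. intros x Hx. unfold f. rewrite ppow_gt by lra.
      apply Rmult_lt_0_compat; [apply Rpower_pos|apply exp_pos]. }
    destruct (H (RInt f 0 1)) as [X0 HX0]; [auto|].
    specialize (HX0 (Rmax 1 X0) (Rmax_r _ _)). assert (Hm := Rmax_l 1 X0). rewrite E in HX0 by lra.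
    rewrite <- (RInt_Chasles f 0 1 (Rmax 1 X0)) in HX0 by auto.
    assert (0 <= RInt f 1 (Rmax 1 X0)).
    { apply RInt_ge_0; auto. intros x _. apply Rmult_le_pos; [apply ppow_pos|left; apply exp_pos]. }
    assert (Hr : Rabs (Re (RtoC (plus (RInt f 0 1) (RInt f 1 (Rmax 1 X0))) - I)) < RInt f 0 1) by (eapply Rle_lt_trans; [apply re_le_Cmod|exact HX0]).
    apply Rabs_def2 in Hr. unfold plus in Hr. unfold Re in *. simpl in *. lra.
Qed.

(** For [s < 1] the integrand [g] of [Gamma] is unbounded at 0. With [f x = x^s exp (-x)] one has
    [s g = f' + f], so the integral of [g] is that of [f] divided by [s], up to boundary terms that
    vanish at both ends. *)
Lemma Gamma_Lam s : 0 < s -> Gamma s = Re (Lam s (RtoC 1)) / s.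
Proof.
  intros Hs. unfold Gamma. set (g := fun t => Rpower t (s - 1) * exp (- t)).
  set (I := Lam s (RtoC 1)). destruct (Lam_1_real s Hs) as [Ereal _]. fold I in Ereal.
  apply is_RInt_gen_unique. intros P HP. destruct HP as [eps HP]. pose proof (cond_pos eps) as He.
  set (f := fun x => ppow s x * exp (- x)).
  assert (Cf : forall x, continuous f x).
  { intros x. apply (@continuous_mult _ R_AbsRing (ppow s)); [apply continuous_ppow; auto|].
    apply (ex_derive_continuous (fun x => exp (- x))). auto_derive; auto. }
  assert (Xf : forall x y, ex_RInt f x y) by (intros; apply (ex_RInt_continuous (V:=R_CompleteNormedModule)); intros; apply Cf).
  assert (Hg : forall a b, 0 < a <= b -> is_RInt g a b ((f b - f a) / s + RInt f a b / s)).
  { intros a b Hab.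
    evar_last.
    - apply (is_RInt_ext (V:=R_NormedModule) (fun t => plus (scal (/ s) (s * g t - f t)) (scal (/ s) (f t)))).
      + intros x _. unfold plus, scal; simpl; unfold mult; simpl. field. lra.
      + apply (is_RInt_plus (V:=R_NormedModule)); apply (is_RInt_scal (V:=R_NormedModule)).
        * apply (is_RInt_derive (V:=R_CompleteNormedModule) f (fun t => s * g t - f t)).
          -- intros x Hx. rewrite Rmin_left, Rmax_right in Hx by lra. unfold f, g.
             evar_last; [apply (is_derive_mult (ppow s) (fun x => exp (- x)) x (s * Rpower x (s - 1)) (- exp (- x)))|].
             ++ apply is_derive_ppow; lra.
             ++ auto_derive; auto; ring.
             ++ intros; apply Rmult_comm.
             ++ unfold plus, mult; simpl. ring.
          -- intros x Hx. rewrite Rmin_left, Rmax_right in Hx by lra.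
             apply (continuous_minus (fun t => s * g t) f); [|apply Cf].
             apply (@continuous_mult _ R_AbsRing (fun _ => s) g); [apply continuous_const|].
             apply (ex_derive_continuous g). unfold g, Rpower. auto_derive. lra.
        * apply (RInt_correct (V:=R_CompleteNormedModule)); auto.
    - unfold plus, scal, minus, opp; simpl; unfold mult, plus, opp; simpl. unfold Rdiv. ring. }
  assert (HL := Lam_spec s (RtoC 1) Hs). simpl in HL. specialize (HL Rlt_0_1). fold I in HL.
  assert (E : forall X, 0 <= X -> CI (fun x => RtoC (ppow s x) * Cexp (- (RtoC 1 * RtoC x)))%C 0 X = RtoC (RInt f 0 X)).
  { intros X HX. rewrite <- CI_RtoC. apply CI_ext; auto. intros x _. rewrite Cexp_neg1, <- RtoC_mult. reflexivity. }
  set (e := eps * s / 4). assert (He' : 0 < e) by (unfold e; nra).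
  destruct (HL e He') as [X1 HX1].
  assert (HL2 := ppow_exp_limit s (RtoC 1) Hs). simpl in HL2. specialize (HL2 Rlt_0_1). destruct (HL2 e He') as [X2 HX2].
  assert (HF0 : exists del, 0 < del /\ forall a, 0 < a < del -> Rabs (f a) < e /\ Rabs (RInt f 0 a) < e).
  { destruct (proj1 (filterlim_locally _ _) (Cf 0) (mkposreal _ (Rmin_pos _ _ He' Rlt_0_1))) as [d Hd]. simpl in Hd.
    exists (Rmin d e). split; [apply Rmin_pos; [apply cond_pos|auto]|]. intros a Ha.
    assert (Hf0 : f 0 = 0) by (unfold f; rewrite ppow_le by lra; ring).
    assert (Hb : forall t, 0 <= t <= a -> Rabs (f t) < Rmin e 1).
    { intros t Ht. assert (Hx : ball 0 d t).
      { change (Rabs (t - 0) < d). rewrite Rminus_0_r, Rabs_pos_eq by lra. pose proof (Rmin_l d e). lra. }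
      specialize (Hd t Hx). change (Rabs (f t - f 0) < Rmin e 1) in Hd. rewrite Hf0, Rminus_0_r in Hd. exact Hd. }
    split; [eapply Rlt_le_trans; [apply Hb; lra|apply Rmin_l]|].
    apply Rle_lt_trans with ((a - 0) * 1).
    - apply abs_RInt_le_const; [lra|auto|]. intros t Ht. left. eapply Rlt_le_trans; [apply Hb; auto|apply Rmin_r].
    - pose proof (Rmin_r d e). lra. }
  destruct HF0 as [del [Hdel HF0]].
  exists (fun a => 0 < a < Rmin del 1) (fun b => Rmax 1 (Rmax X1 X2) < b).
  - assert (Hm : 0 < Rmin del 1) by (apply Rmin_pos; lra). exists (mkposreal _ Hm). intros a Ha Ha0. split; [auto|].
    change (Rabs (a - 0) < Rmin del 1) in Ha. rewrite Rminus_0_r, Rabs_pos_eq in Ha by lra. exact Ha.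
  - exists (Rmax 1 (Rmax X1 X2)). auto.
  - intros a b [Ha1 Ha2] Hb. pose proof (Rmax_l 1 (Rmax X1 X2)) as M1. pose proof (Rmax_r 1 (Rmax X1 X2)) as M2.
    pose proof (Rmax_l X1 X2) as M3. pose proof (Rmax_r X1 X2) as M4.
    pose proof (Rmin_l del 1) as M5. pose proof (Rmin_r del 1) as M6. simpl.
    exists ((f b - f a) / s + RInt f a b / s). split; [apply Hg; lra|]. apply HP.
    change (Rabs ((f b - f a) / s + RInt f a b / s - Re I / s) < eps).
    specialize (HX1 b ltac:(lra)). rewrite E in HX1 by lra. rewrite Ereal in HX1. rewrite <- RtoC_minus, Cmod_R in HX1.
    specialize (HX2 b ltac:(lra)). rewrite Cexp_neg1, <- RtoC_mult in HX2.
    replace (RtoC (ppow s b * exp (- b)) - RtoC 0)%C with (RtoC (f b)) in HX2 by (unfold f; ring). rewrite Cmod_R in HX2.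
    destruct (HF0 a ltac:(lra)) as [F1 F2].
    assert (Ech : RInt f 0 b = RInt f 0 a + RInt f a b) by (rewrite <- (RInt_Chasles f 0 a b) by auto; reflexivity).
    replace ((f b - f a) / s + RInt f a b / s - Re I / s) with ((f b - f a - RInt f 0 a + (RInt f 0 b - Re I)) / s) by (rewrite Ech; field; lra).
    unfold Rdiv. rewrite Rabs_mult, (Rabs_pos_eq (/ s)) by (left; apply Rinv_0_lt_compat; auto).
    apply Rmult_lt_reg_r with s; auto. rewrite Rmult_assoc, Rinv_l, Rmult_1_r by lra.
    apply Rabs_def2 in HX1. apply Rabs_def2 in HX2. apply Rabs_def2 in F1. apply Rabs_def2 in F2.
    unfold e in *. apply Rabs_def1; lra.
Qed.

Lemma Lam_1 s : 0 < s -> Lam s (RtoC 1) = RtoC (s * Gamma s).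
Proof.
  intros Hs. rewrite (proj1 (Lam_1_real s Hs)), (Gamma_Lam s Hs). f_equal. field. lra.
Qed.

Lemma Gamma_pos s : 0 < s -> 0 < Gamma s.
Proof. intros Hs. rewrite Gamma_Lam by auto. apply Rdiv_lt_0_compat; auto. apply Lam_1_real; auto. Qed.

Lemma Gamma_step s : 0 < s -> Gamma (s + 1) = s * Gamma s.
Proof.
  intros Hs. pose proof (Lam_step s (RtoC 1) Hs) as H. simpl in H. specialize (H Rlt_0_1).
  rewrite !Lam_1, Cmult_1_l, <- RtoC_mult in H by lra. apply RtoC_inj in H.
  apply Rmult_eq_reg_l with (s + 1); lra.
Qed.

(** * Passing between the jets of the two Borel transforms *)

(** The recurrences between Beta moments below are obtained in this way, each from one explicit
    antiderivative [F] vanishing at both ends. *)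
Lemma RInt_two_term (F k k' : R -> R) (A B : R) :
  (forall t, 0 <= t <= 1 -> is_derive F t (A * k t - B * k' t)) ->
  (forall t, 0 <= t <= 1 -> continuous k t) -> (forall t, 0 <= t <= 1 -> continuous k' t) ->
  A * RInt k 0 1 - B * RInt k' 0 1 = F 1 - F 0.
Proof.
  intros HF Hk Hk'.
  assert (X : forall g : R -> R, (forall t, 0 <= t <= 1 -> continuous g t) -> is_RInt g 0 1 (RInt g 0 1)).
  { intros g Hg. apply (RInt_correct (V:=R_CompleteNormedModule)), (ex_RInt_continuous (V:=R_CompleteNormedModule)).
    intros t Ht. rewrite Rmin_left, Rmax_right in Ht by lra. auto. }
  assert (H1 : is_RInt (fun t => A * k t - B * k' t) 0 1 (A * RInt k 0 1 - B * RInt k' 0 1)).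
  { apply (is_RInt_minus (V:=R_NormedModule) (fun t => A * k t) (fun t => B * k' t));
      apply (is_RInt_scal (V:=R_NormedModule)); auto. }
  assert (H2 : is_RInt (fun t => A * k t - B * k' t) 0 1 (F 1 - F 0)).
  { apply (is_RInt_derive (V:=R_CompleteNormedModule) F); intros t Ht; rewrite Rmin_left, Rmax_right in Ht by lra; auto.
    apply (continuous_minus (fun t => A * k t) (fun t => B * k' t));
      [apply (@continuous_mult _ R_AbsRing (fun _ => A) k)|apply (@continuous_mult _ R_AbsRing (fun _ => B) k')]; auto; apply continuous_const. }
  rewrite <- (is_RInt_unique _ _ _ _ H1). apply is_RInt_unique; auto.
Qed.

Lemma pow_le_1 t n : 0 <= t <= 1 -> 0 <= t ^ n <= 1.
Proof. intros Ht. split; [apply pow_le; lra|]. rewrite <- (pow1 n). apply pow_incr; lra. Qed.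

Lemma continuous_pow_id n t : continuous (fun t => t ^ n) t.
Proof. apply (ex_derive_continuous (fun t => t ^ n)). auto_derive; auto. Qed.

Section Kernels.

Variables m l : nat.
Hypothesis Hl : (1 <= l <= m)%nat.

Let al := INR l / INR m.

Lemma INR_m_pos : 0 < INR m.
Proof. apply lt_0_INR. lia. Qed.

Lemma INR_l_pos : 0 < INR l.
Proof. apply lt_0_INR. lia. Qed.

Lemma al_bounds : 0 < al <= 1.
Proof.
  pose proof INR_m_pos. pose proof INR_l_pos. unfold al. split; [apply Rdiv_lt_0_compat; auto|].
  apply Rmult_le_reg_r with (INR m); auto. replace (INR l / INR m * INR m) with (INR l) by (field; lra).
  rewrite Rmult_1_l. apply le_INR. lia.
Qed.

(** The substitution [s = x (1 - t^m)] in the fractional integral of [(x - s)^(l/m - 1) d s] gives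
    [m x^(l/m)] times the integral of [t^(l-1) d (x (1 - t^m))]: the algebraic singularity has
    become a polynomial kernel. *)
Definition phi_f (t : R) := 1 - t ^ m.
Definition kap_f (t : R) := t ^ (l - 1).

Lemma phi_f_ok t : 0 <= t <= 1 -> continuous phi_f t /\ 0 <= phi_f t <= 1.
Proof.
  intros Ht. split; [|unfold phi_f; pose proof (pow_le_1 t m Ht); lra].
  apply (continuous_minus (fun _ => 1) (fun t => t ^ m)); [apply continuous_const|apply continuous_pow_id].
Qed.

Lemma kap_f_ok t : 0 <= t <= 1 -> continuous kap_f t /\ Rabs (kap_f t) <= 1.
Proof.
  intros Ht. split; [apply continuous_pow_id|]. unfold kap_f. pose proof (pow_le_1 t (l - 1) Ht). rewrite Rabs_pos_eq; lra.
Qed.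

(** The Beta value [B(l/m, n + 1) / m], that is [Gamma al n! / (m Gamma (al + n + 1))]. Only its
    recurrence and its value at [n = 0] are established. *)
Let bet n := RInt (fun t => phi_f t ^ n * kap_f t) 0 1.

Lemma pow_pred t k : (1 <= k)%nat -> t ^ k = t * t ^ (k - 1).
Proof. intros Hk. replace k with (S (k - 1)) at 1 by lia. reflexivity. Qed.

Lemma beta_f_step n : (INR l + (INR n + 1) * INR m) * bet (S n) = (INR n + 1) * INR m * bet n.
Proof.
  assert (H : (INR l + (INR n + 1) * INR m) * bet (S n) - (INR n + 1) * INR m * bet n = 0).
  { unfold bet. rewrite (RInt_two_term (fun t => phi_f t ^ S n * t ^ l) (fun t => phi_f t ^ S n * kap_f t) (fun t => phi_f t ^ n * kap_f t)).
    - unfold phi_f. rewrite !pow1, !pow_i by lia. simpl. ring.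
    - intros t Ht. unfold phi_f, kap_f. auto_derive; auto.
      change (match n with 0%nat => 1 | S _ => INR n + 1 end) with (INR (S n)). rewrite S_INR, <- !(Nat.sub_1_r m), <- !(Nat.sub_1_r l).
      rewrite (pow_pred t l), (pow_pred t m) by lia. simpl. unfold Rminus. generalize ((1 + - (t * t ^ (m - 1))) ^ n). intros q. ring.
    - intros t Ht. apply kernel_continuous with 1; [apply phi_f_ok|apply kap_f_ok|auto].
    - intros t Ht. apply kernel_continuous with 1; [apply phi_f_ok|apply kap_f_ok|auto]. }
  lra.
Qed.

Lemma beta_f_0 : bet 0 = / INR l.
Proof.
  pose proof INR_l_pos as Hlp. unfold bet. apply is_RInt_unique.
  evar_last.
  - apply (is_RInt_derive (V:=R_CompleteNormedModule) (fun t => t ^ l / INR l) (fun t => phi_f t ^ 0 * kap_f t)).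
    + intros t _. unfold kap_f. auto_derive; auto. rewrite <- (Nat.sub_1_r l). simpl. field. lra.
    + intros t _. apply (continuous_ext (fun t => t ^ (l - 1))); [intros; unfold kap_f; simpl; ring|apply continuous_pow_id].
  - unfold minus, plus, opp; simpl. rewrite pow1, pow_i by lia. field. lra.
Qed.

(** The moment [bet n] has [Gamma (al + n + 1)] in its denominator where [Gamma (al + n)] is wanted;
    the Euler operator with [lam = al] supplies the missing factor [n + al]. *)
Definition f_to_h (d : nat -> R -> C) (n : nat) (x : R) : C :=
  (RtoC (INR m / Gamma al) * Eul al (fun n x => avg phi_f kap_f d n (Rmax 0 x)) n x)%C.

Lemma Gamma_shift_pos n : 0 < Gamma (al + INR n).
Proof. apply Gamma_pos. pose proof al_bounds. pose proof (pos_INR n). lra. Qed.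

Lemma f_to_h_coef n : INR m / Gamma al * ((INR n + al) * bet n) = INR (fact n) / Gamma (al + INR n).
Proof.
  pose proof INR_m_pos as Hm. pose proof INR_l_pos as Hlp. pose proof al_bounds as Hal.
  induction n as [|n IH].
  - simpl. rewrite beta_f_0, Rplus_0_r. pose proof (Gamma_pos al (proj1 Hal)). unfold al at 2. field. lra.
  - pose proof (beta_f_step n) as Hb. pose proof (Gamma_shift_pos n) as G1. pose proof (pos_INR n) as Pn.
    assert (Hb2 : (INR (S n) + al) * bet (S n) = (INR n + 1) * bet n).
    { apply Rmult_eq_reg_r with (INR m); [|lra]. rewrite S_INR. unfold al.
      replace ((INR n + 1 + INR l / INR m) * bet (S n) * INR m) with ((INR l + (INR n + 1) * INR m) * bet (S n)) by (field; lra).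
      rewrite Hb. ring. }
    rewrite Hb2. replace (al + INR (S n)) with ((al + INR n) + 1) by (rewrite S_INR; ring).
    rewrite Gamma_step by lra. change (fact (S n)) with (S n * fact n)%nat. rewrite mult_INR, S_INR.
    replace (INR m / Gamma al * ((INR n + 1) * bet n)) with ((INR n + 1) / (INR n + al) * (INR m / Gamma al * ((INR n + al) * bet n))).
    2: { pose proof (Gamma_pos al (proj1 Hal)). field. split; lra. }
    rewrite IH. field. split; lra.
Qed.

Lemma f_to_h_spec d rho b M rho' b' : 0 < rho' < rho -> 0 <= b < b' -> Data d -> DBound d rho b M ->
  Data (f_to_h d) /\ (exists M', DBound (f_to_h d) rho' b' M') /\
  forall n, f_to_h d n 0 = (RtoC (INR (fact n) / Gamma (al + INR n)) * d n 0)%C.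
Proof.
  intros Hr Hb HD HB. pose proof al_bounds as Hal.
  assert (HD1 := avg_Data phi_f kap_f 1 phi_f_ok kap_f_ok d rho b M ltac:(lra) ltac:(lra) HD HB).
  assert (HB1 := avg_DBound phi_f kap_f 1 phi_f_ok kap_f_ok d rho b M ltac:(lra) ltac:(lra) HD HB).
  split; [|split].
  - apply scale_Data, Eul_Data, HD1.
  - destruct (Eul_DBound al _ rho b _ rho' b' ltac:(lra) Hr ltac:(lra) HB1) as [M' HM'].
    eexists. apply scale_DBound. exact HM'.
  - intros n. unfold f_to_h. rewrite Eul_at_0, (Rmax_left 0 0) by lra.
    rewrite (avg_at_0 phi_f kap_f 1 phi_f_ok kap_f_ok). fold (bet n).
    rewrite <- f_to_h_coef, !RtoC_mult. ring.
Qed.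

(** The powers [y^(2 - al)] and [y^(3 - al)]. The explicit factors [y] give the correct value 0 at
    the origin, where [Rpower] takes the value 1. *)
Let K1 (y : R) := y * Rpower y (1 - al).
Let K2 (y : R) := y * (y * Rpower y (1 - al)).

Lemma Rpower_nonpos y a : y <= 0 -> Rpower y a = 1.
Proof.
  intros Hy. unfold Rpower, ln. destruct (Rlt_dec 0 y); [exfalso; lra|]. rewrite Rmult_0_r. apply exp_0.
Qed.

Lemma Rpower_le_1 y a : 0 <= a -> y <= 1 -> Rpower y a <= 1.
Proof.
  intros Ha Hy. destruct (Rle_dec y 0); [rewrite Rpower_nonpos; lra|].
  unfold Rpower. rewrite <- exp_0. apply exp_le. assert (ln y <= 0) by (rewrite <- ln_1; apply ln_le; lra). nra.
Qed.

Lemma K1_continuous y : 0 <= y -> continuous K1 y.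
Proof.
  intros Hy. pose proof al_bounds. destruct (Req_dec y 0) as [->|Hn].
  - apply filterlim_locally. intros eps. pose proof (cond_pos eps) as He.
    exists (mkposreal _ (Rmin_pos _ _ He Rlt_0_1)). intros t Ht. change (Rabs (t - 0) < Rmin eps 1) in Ht.
    change (Rabs (K1 t - K1 0) < eps). unfold K1. rewrite Rmult_0_l, Rminus_0_r, Rabs_mult. rewrite Rminus_0_r in Ht.
    pose proof (Rmin_l eps 1). pose proof (Rmin_r eps 1). pose proof (Rpower_pos t (1 - al)).
    rewrite (Rabs_pos_eq (Rpower t (1 - al))) by lra. pose proof (Rabs_pos t).
    assert (Rpower t (1 - al) <= 1) by (apply Rpower_le_1; [lra|apply Rabs_def2 in Ht; lra]). nra.
  - apply (ex_derive_continuous K1). unfold K1, Rpower. auto_derive. lra.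
Qed.

Lemma K2_derive y : 0 <= y -> is_derive K2 y ((3 - al) * K1 y).
Proof.
  intros Hy. pose proof al_bounds. destruct (Req_dec y 0) as [->|Hn].
  (* At the origin [|K2 h| <= h^2] for small [h]; this includes negative [h], for which [Rpower] is
     1. *)
  - apply is_derive_eps. intros eps He. exists (Rmin eps 1). split; [apply Rmin_pos; lra|]. intros h Hh.
    unfold K2, K1. rewrite Rplus_0_l, !Rmult_0_l, Rmult_0_r, Rmult_0_l, !Rminus_0_r, !Rabs_mult.
    pose proof (Rmin_l eps 1). pose proof (Rmin_r eps 1). pose proof (Rpower_pos h (1 - al)).
    rewrite (Rabs_pos_eq (Rpower h (1 - al))) by lra. pose proof (Rabs_pos h).
    assert (Rpower h (1 - al) <= 1) by (apply Rpower_le_1; [lra|apply Rabs_def2 in Hh; lra]).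
    rewrite Rmult_comm. apply Rmult_le_compat_r; auto. nra.
  - assert (Hp : 0 < y) by lra. unfold K2, K1.
    evar_last.
    + apply (is_derive_mult (fun y => y) (fun y => y * Rpower y (1 - al)) y 1 (1 * Rpower y (1 - al) + y * ((1 - al) * Rpower y (1 - al - 1)))).
      * apply @is_derive_id.
      * apply (is_derive_mult (fun y => y) (fun y => Rpower y (1 - al)) y 1 ((1 - al) * Rpower y (1 - al - 1))); [apply @is_derive_id|apply is_derive_Rpower; auto|apply Rmult_comm].
      * apply Rmult_comm.
    + unfold plus, mult; simpl.
      assert (E : Rpower y (1 - al) = y * Rpower y (1 - al - 1)).
      { replace (1 - al) with (1 + (1 - al - 1)) at 1 by ring. rewrite Rpower_plus, Rpower_1 by auto. reflexivity. }
      rewrite E. ring.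
Qed.

(** With [y = t^m] these kernels have the moments [B(n + al, 3 - al) / m], proportional to
    [Gamma (n + al) / Gamma (n + 3)]. The exponent [- al] that would give [Gamma (n + al) / n!]
    directly is singular; it is raised by 2, and two Euler operators restore the factors [n + 1] and
    [n + 2]. *)
Definition phi_h (t : R) := t ^ m.
Definition kap_h (t : R) := t ^ (l - 1) * K1 (1 - t ^ m).

Lemma phi_h_ok t : 0 <= t <= 1 -> continuous phi_h t /\ 0 <= phi_h t <= 1.
Proof. intros Ht. split; [apply continuous_pow_id|apply pow_le_1; auto]. Qed.

Lemma K1_comp_continuous t : 0 <= t <= 1 -> continuous (fun t => K1 (1 - t ^ m)) t.
Proof.
  intros Ht. apply (continuous_comp (fun t => 1 - t ^ m) K1); [apply phi_f_ok; auto|].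
  apply K1_continuous. pose proof (pow_le_1 t m Ht). lra.
Qed.

Lemma kap_h_ok t : 0 <= t <= 1 -> continuous kap_h t /\ Rabs (kap_h t) <= 1.
Proof.
  intros Ht. split.
  - apply (@continuous_mult _ R_AbsRing (fun t => t ^ (l - 1)) (fun t => K1 (1 - t ^ m))); [apply continuous_pow_id|apply K1_comp_continuous; auto].
  - unfold kap_h, K1. pose proof al_bounds. pose proof (pow_le_1 t (l - 1) Ht). pose proof (pow_le_1 t m Ht).
    pose proof (Rpower_pos (1 - t ^ m) (1 - al)). pose proof (Rpower_le_1 (1 - t ^ m) (1 - al) ltac:(lra) ltac:(lra)).
    assert (0 <= (1 - t ^ m) * Rpower (1 - t ^ m) (1 - al) <= 1) by nra.
    rewrite Rabs_pos_eq; nra.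
Qed.

Let beth n := RInt (fun t => phi_h t ^ n * kap_h t) 0 1.

Lemma beta_h_step n : (INR n + al) * beth n = (INR n + 3) * beth (S n).
Proof.
  pose proof INR_m_pos as Hm.
  assert (H : (INR m * INR n + INR l) * beth n - (INR m * (INR n + 3)) * beth (S n) = 0).
  { unfold beth.
    rewrite (RInt_two_term (fun t => t ^ (m * n + l) * K2 (1 - t ^ m)) (fun t => phi_h t ^ n * kap_h t) (fun t => phi_h t ^ S n * kap_h t)).
    - rewrite pow1, pow_i by lia. unfold K2. rewrite pow1. ring.
    - intros t Ht. evar_last.
      + apply (is_derive_mult (fun t => t ^ (m * n + l)) (fun t => K2 (1 - t ^ m)) t
          (INR (m * n + l) * t ^ (m * n + l - 1)) (- (INR m * t ^ (m - 1)) * ((3 - al) * K1 (1 - t ^ m)))).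
        * auto_derive; auto. rewrite <- Nat.sub_1_r. ring.
        * apply (is_derive_comp K2 (fun t => 1 - t ^ m)); [apply K2_derive; pose proof (pow_le_1 t m Ht); lra|].
          auto_derive; auto. rewrite <- Nat.sub_1_r. ring.
        * apply Rmult_comm.
      + unfold plus, mult; simpl. unfold phi_h, kap_h. change (K2 (1 - t ^ m)) with ((1 - t ^ m) * K1 (1 - t ^ m)).
        rewrite plus_INR, mult_INR. rewrite <- !pow_mult.
        replace (m * n + l - 1)%nat with (m * n + (l - 1))%nat by lia. rewrite !pow_add.
        rewrite (pow_pred t l), (pow_pred t m) by lia. unfold al. field. lra.
    - intros t Ht. apply kernel_continuous with 1; [apply phi_h_ok|apply kap_h_ok|auto].
    - intros t Ht. apply kernel_continuous with 1; [apply phi_h_ok|apply kap_h_ok|auto]. }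
  apply Rmult_eq_reg_l with (INR m); [|lra]. unfold al.
  replace (INR m * ((INR n + INR l / INR m) * beth n)) with ((INR m * INR n + INR l) * beth n) by (field; lra). lra.
Qed.

Lemma beta_h_0_pos : 0 < beth 0.
Proof.
  unfold beth. apply RInt_gt_0; [lra| |].
  - intros t Ht. unfold kap_h, K1. simpl. rewrite Rmult_1_l.
    assert (t ^ m < 1).
    { replace m with (S (m - 1)) by lia. simpl. pose proof (pow_le_1 t (m - 1) ltac:(lra)). nra. }
    repeat apply Rmult_lt_0_compat; [apply pow_lt; lra|lra|apply Rpower_pos].
  - intros t Ht. apply (kernel_continuous phi_h kap_h 1 phi_h_ok kap_h_ok 0); auto.
Qed.

(** By [beta_h_step] and [Gamma_step] the product does not depend on [n], so it equals its value at
    [n = 0]. For normalizing, positivity of [beth 0] is then enough, without its value. *)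
Lemma h_to_f_coef n : (INR n + 1) * (INR n + 2) * beth n * (INR (fact n) / Gamma (al + INR n)) = 2 * beth 0 / Gamma al.
Proof.
  pose proof al_bounds as Hal. pose proof (Gamma_pos al (proj1 Hal)) as G0.
  induction n as [|n IH]; [simpl; rewrite Rplus_0_r; field; lra|].
  rewrite <- IH. pose proof (beta_h_step n) as Hb. pose proof (Gamma_shift_pos n) as G1. pose proof (pos_INR n) as Pn.
  replace (al + INR (S n)) with ((al + INR n) + 1) by (rewrite S_INR; ring). rewrite Gamma_step by lra.
  change (fact (S n)) with (S n * fact n)%nat. rewrite mult_INR, S_INR.
  replace ((INR n + 1 + 1) * (INR n + 1 + 2) * beth (S n) * ((INR n + 1) * INR (fact n) / ((al + INR n) * Gamma (al + INR n))))
    with ((INR n + 2) * ((INR n + 3) * beth (S n)) * ((INR n + 1) * INR (fact n) / ((al + INR n) * Gamma (al + INR n)))) by ring.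
  rewrite <- Hb. field. lra.
Qed.

Lemma h_to_f e rho b M rho' b' (A : nat -> C) : 0 < rho' < rho -> 0 <= b < b' -> Data e -> DBound e rho b M ->
  (forall n, e n 0 = RtoC (INR (fact n) / Gamma (al + INR n)) * A n)%C ->
  exists d M', Data d /\ DBound d rho' b' M' /\ forall n, d n 0 = A n.
Proof.
  intros Hr Hb HD HB HA. pose proof al_bounds as Hal. pose proof (Gamma_pos al (proj1 Hal)) as G0. pose proof beta_h_0_pos as B0.
  assert (HD1 := avg_Data phi_h kap_h 1 phi_h_ok kap_h_ok e rho b M ltac:(lra) ltac:(lra) HD HB).
  assert (HB1 := avg_DBound phi_h kap_h 1 phi_h_ok kap_h_ok e rho b M ltac:(lra) ltac:(lra) HD HB).
  (* Each Euler operator loses some radius and some rate, so an intermediate pair is inserted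
     between the two. *)
  set (r1 := (rho + rho') / 2). set (b1 := (b + b') / 2).
  destruct (Eul_DBound 2 _ rho b _ r1 b1 ltac:(lra) ltac:(unfold r1; lra) ltac:(unfold b1; lra) HB1) as [M2 HB2].
  destruct (Eul_DBound 1 _ r1 b1 _ rho' b' ltac:(lra) ltac:(unfold r1; lra) ltac:(unfold b1; lra) HB2) as [M3 HB3].
  set (c := 2 * beth 0 / Gamma al). assert (Hc : 0 < c) by (unfold c; apply Rdiv_lt_0_compat; lra).
  exists (fun n x => RtoC (/ c) * Eul 1 (Eul 2 (fun n x => avg phi_h kap_h e n (Rmax 0 x))) n x)%C. eexists. split; [|split].
  - apply scale_Data, Eul_Data, Eul_Data, HD1.
  - apply scale_DBound. exact HB3.
  - intros n. rewrite !Eul_at_0, (Rmax_left 0 0) by lra. rewrite (avg_at_0 phi_h kap_h 1 phi_h_ok kap_h_ok). fold (beth n).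
    rewrite HA, !Cmult_assoc, <- !RtoC_mult.
    replace (/ c * (INR n + 1) * (INR n + 2) * beth n * (INR (fact n) / Gamma (al + INR n))) with 1.
    + ring.
    + replace (/ c * (INR n + 1) * (INR n + 2) * beth n * (INR (fact n) / Gamma (al + INR n)))
        with (/ c * ((INR n + 1) * (INR n + 2) * beth n * (INR (fact n) / Gamma (al + INR n)))) by ring.
      rewrite h_to_f_coef. fold c. field. lra.
Qed.

End Kernels.

(** * Integrals along a vertical line *)

(** Shifting the Taylor coefficients of [f] at [w] by one gives a power series for the quotient,
    valid at [w] too. *)
Lemma Cder_quotient_removable f w R0 : 0 < R0 -> (forall z, Cmod (z - w) < R0 -> exists l, Cder f z l) ->
  exists l0 l1, Cder f w l0 /\ Cder (fun z => if Ceq_dec z w then l0 else ((f z - f w) / (z - w))%C) w l1.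
Proof.
  intros HR Hf. destruct (taylor f w R0 (R0 / 2)) as [c [_ HS]]; [lra|auto|].
  set (R1 := R0 / 2) in *. assert (HR1 : 0 < R1) by (unfold R1; lra).
  destruct (ps_deriv c (fun h => f (w + h)%C) R1 HS (RtoC 0)) as [l0 [L1 L2]]; [rewrite Cmod_0; auto|].
  apply Cder_shift in L2. replace (w + RtoC 0)%C with w in L2 by ring.
  assert (E0 : f w = c 0%nat).
  { assert (H := HS (RtoC 0)). rewrite Cmod_0 in H. specialize (H HR1). replace (w + RtoC 0)%C with w in H by ring.
    apply Cser_at_0 in H. auto. }
  assert (E1 : l0 = c 1%nat).
  { apply (Cser_at_0 (fun n => RtoC (INR (S n)) * c (S n))%C) in L1. rewrite L1. simpl. ring. }
  set (q := fun z => if Ceq_dec z w then l0 else ((f z - f w) / (z - w))%C).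
  assert (HQ : forall h, Cmod h < R1 -> Cser (fun n => c (S n) * h ^ n)%C (q (w + h)%C)).
  { intros h Hh. unfold q. destruct (Ceq_dec (w + h) w) as [E|E].
    - assert (h = RtoC 0) as ->. { replace h with (w + h - w)%C by ring. rewrite E. ring. }
      rewrite E1. intros eps He. exists 1%nat. intros [|k] Hk; [lia|].
      rewrite csum_shift. rewrite (csum_ext _ (fun _ => RtoC 0 * RtoC 0)%C) by (intros; rewrite Cpow_S; ring).
      rewrite csum_cmult. replace (c 1%nat * RtoC 0 ^ 0 + RtoC 0 * csum (fun _ => RtoC 0) k - c 1%nat)%C with (RtoC 0) by (simpl; ring).
      rewrite Cmod_0; auto.
    - assert (Hn : h <> RtoC 0) by (intros E2; apply E; rewrite E2; ring).
      replace (w + h - w)%C with h by ring. rewrite E0. replace ((f (w + h) - c 0%nat) / h)%C with (/ h * (f (w + h) - c 0%nat))%C by (unfold Cdiv; ring).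
      apply Cser_ext with (fun n => / h * (c (S n) * h ^ S n))%C; [intros; rewrite Cpow_S; field; auto|].
      apply Cser_cmult. specialize (HS h Hh). intros eps He. destruct (HS eps He) as [N HN]. exists N. intros n Hn2.
      specialize (HN (S n) ltac:(lia)). rewrite csum_shift in HN.
      replace (csum (fun n => c (S n) * h ^ S n) n - (f (w + h) - c 0%nat))%C with (c 0%nat * h ^ 0 + csum (fun n => c (S n) * h ^ S n) n - f (w + h))%C by (simpl; ring).
      exact HN. }
  destruct (ps_deriv (fun n => c (S n)) (fun h => q (w + h)%C) R1 HQ (RtoC 0)) as [l1 [_ L3]]; [rewrite Cmod_0; auto|].
  apply Cder_shift in L3. replace (w + RtoC 0)%C with w in L3 by ring. exists l0, l1. split; auto.
Qed.

Lemma goursat_box g c X : 0 <= X ->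
  (forall z, c <= Re z <= c + X -> - X <= Im z <= X -> exists l, Cder g z l) ->
  (CI (fun x => g (x, (- X)%R)) c (c + X) + Ci * CI (fun y => g ((c + X)%R, y)) (- X) X
   = CI (fun x => g (x, X)) c (c + X) + Ci * CI (fun y => g (c, y)) (- X) X)%C.
Proof.
  intros HX Hg.
  assert (Dx : forall x y, Rder (fun t => ((t, y) : C)) x (RtoC 1)) by (intros; split; simpl; [apply @is_derive_id|apply @is_derive_const]).
  assert (Dy : forall x y, Rder (fun t => ((x, t) : C)) y Ci) by (intros; split; simpl; [apply @is_derive_const|apply @is_derive_id]).
  pose proof (goursat g (fun x y => (x, y)) (fun _ _ => RtoC 1) (fun _ _ => Ci) c (c + X) (- X) X 1) as G.
  assert (Cx : forall y, - X <= y <= X -> contI (fun x => g (x, y)) c (c + X)).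
  { intros y Hy x Hx. destruct (Hg (x, y)) as [l Hl]; simpl; try lra.
    apply (cont_comp_Cder g (fun t => (t, y)) x l); auto. eapply Rder_cont, Dx. }
  assert (Cy : forall x, c <= x <= c + X -> contI (fun y => g (x, y)) (- X) X).
  { intros x Hx y Hy. destruct (Hg (x, y)) as [l Hl]; simpl; try lra.
    apply (cont_comp_Cder g (fun t => (x, t)) y l); auto. eapply Rder_cont, Dy. }
  assert (EX : forall y, - X <= y <= X -> CI (fun t => g (t, y) * RtoC 1)%C c (c + X) = CI (fun x => g (x, y)) c (c + X)).
  { intros y Hy. apply CI_ext; [lra|]. intros; ring. }
  assert (EY : forall x, c <= x <= c + X -> CI (fun t => g (x, t) * Ci)%C (- X) X = (Ci * CI (fun y => g (x, y)) (- X) X)%C).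
  { intros x Hx. rewrite <- CI_cmult by (try lra; auto). apply CI_ext; [lra|]. intros; ring. }
  rewrite !EX, !EY in G by lra. apply G; try lra. intros x y Hx Hy.
  refine (conj _ (conj _ (conj _ (conj _ (conj _ (conj _ _)))))); try apply Dx; try apply Dy; try apply cont_const.
  - rewrite Cmod_1; lra.
  - rewrite Cmod_Ci; lra.
  - apply Hg; simpl; lra.
Qed.

Section Line.

Variable c : R.
Hypothesis Hc : 0 < c.

Definition om (y : R) : C := (c, y).

Lemma om_nz y : om y <> RtoC 0.
Proof. intros E. injection E. lra. Qed.

Lemma om_sq y : Cmod (om y) ^ 2 = c ^ 2 + y ^ 2.
Proof. rewrite Cmod2_alt. reflexivity. Qed.

Lemma om_sq_pos y : 0 < c ^ 2 + y ^ 2.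
Proof. pose proof (pow2_ge_0 y). assert (0 < c ^ 2) by (apply pow_lt; auto). lra. Qed.

Lemma Rder_om y : Rder om y Ci.
Proof. split; simpl; [apply @is_derive_const|apply @is_derive_id]. Qed.

Lemma cont_om y : cont om y.
Proof. eapply Rder_cont, Rder_om. Qed.

Lemma Cmod_exp_om y x : Cmod (Cexp (om y * RtoC x)) = exp (c * x).
Proof. rewrite Cmod_Cexp, re_scal_r. reflexivity. Qed.

Lemma is_RInt_inv_sq X Y : X <= Y -> 0 < X \/ Y < 0 -> is_RInt (fun y => / y ^ 2) X Y (/ X - / Y).
Proof.
  intros HXY H0. evar_last.
  - apply (is_RInt_derive (fun y => - / y) (fun y => / y ^ 2)).
    + intros y Hy. rewrite Rmin_left, Rmax_right in Hy by lra. auto_derive; [lra|]. field. lra.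
    + intros y Hy. rewrite Rmin_left, Rmax_right in Hy by lra. apply (ex_derive_continuous (fun y => / y ^ 2)). auto_derive.
      assert (y <> 0) by lra. nra.
  - unfold minus, plus, opp; simpl. ring.
Qed.

(** The two tails beyond [X] are at most [K / X] each, and [K PI / c] is the integral of
    [K / (c^2 + y^2)]. The rate [2 K / X] is recorded because [Lint_Laplace] relies on truncation
    errors that are uniform after weighting. *)
Lemma line_exists q K : 0 <= K -> (forall y, cont q y) -> (forall y, Cmod (q y) <= K / (c ^ 2 + y ^ 2)) ->
  exists l, Limp (fun X => CI q (- X) X) l /\ Cmod l <= K * PI / c /\ forall X, 0 < X -> Cmod (CI q (- X) X - l) <= 2 * K / X.
Proof.
  intros HK Hq Hb. pose proof PI_RGT_0 as Hpi.
  assert (Hb2 : forall y, y <> 0 -> Cmod (q y) <= K * / y ^ 2).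
  { intros y Hy. eapply Rle_trans; [apply Hb|]. unfold Rdiv. apply Rmult_le_compat_l; auto.
    assert (0 < y ^ 2) by (apply pow2_gt_0; auto). apply Rinv_le_contravar; auto. pose proof (pow2_ge_0 c). lra. }
  assert (Hdiff : forall X Y, 0 < X -> X <= Y -> Cmod (CI q (- Y) Y - CI q (- X) X) <= 2 * K / X).
  { intros X Y HX HXY.
    rewrite <- (CI_chasles q (- Y) (- X) Y), <- (CI_chasles q (- X) X Y) by (try lra; intros y _; auto).
    replace (CI q (- Y) (- X) + (CI q (- X) X + CI q X Y) - CI q (- X) X)%C with (CI q (- Y) (- X) + CI q X Y)%C by ring.
    eapply Rle_trans; [apply Cmod_triangle|].
    assert (HiY : 0 < / Y) by (apply Rinv_0_lt_compat; lra).
    assert (T : forall a b, a <= b -> 0 < a \/ b < 0 -> Cmod (CI q a b) <= K * (/ a - / b)).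
    { intros a b Hab H0. apply (CI_bound q (fun y => K * / y ^ 2)); auto; [intros y _; auto|intros y Hy; apply Hb2; lra|].
      apply (is_RInt_scal (V:=R_NormedModule) (fun y => / y ^ 2)). apply is_RInt_inv_sq; auto. }
    pose proof (T X Y HXY ltac:(lra)) as T1. pose proof (T (- Y) (- X) ltac:(lra) ltac:(lra)) as T2.
    rewrite !Rinv_opp in T2.
    replace (2 * K / X) with (K * / X + K * / X) by (field; lra). nra. }
  destruct (C_cauchy_limit (fun n => CI q (- INR (S n)) (INR (S n))) (fun n => 2 * K / INR (S n))) as [l Hl].
  - intros n m Hnm. apply Hdiff; [apply lt_0_INR; lia|apply le_INR; lia].
  - intros eps He. destruct (nfloor_ex (2 * K / eps)) as [N [_ HN]]; [apply Rdiv_le_0_compat; lra|].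
    exists N. intros n Hn. rewrite S_INR. apply le_INR in Hn. pose proof (pos_INR n).
    apply Rmult_lt_reg_r with ((INR n + 1) / eps); [apply Rdiv_lt_0_compat; lra|].
    replace (2 * K / (INR n + 1) * ((INR n + 1) / eps)) with (2 * K / eps) by (field; lra).
    replace (eps * ((INR n + 1) / eps)) with (INR n + 1) by (field; lra). lra.
  - assert (HL : Limp (fun X => CI q (- X) X) l).
    { intros eps He. destruct (nfloor_ex (4 * K / eps)) as [N [_ HN]]; [apply Rdiv_le_0_compat; lra|].
      exists (INR (S N)). intros X HX. assert (HN0 : 0 < INR (S N)) by (apply lt_0_INR; lia).
      assert (Hs : 2 * K / INR (S N) < eps / 2).
      { rewrite S_INR in *. apply Rmult_lt_reg_r with (2 * (INR N + 1) / eps); [apply Rdiv_lt_0_compat; lra|].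
        replace (2 * K / (INR N + 1) * (2 * (INR N + 1) / eps)) with (4 * K / eps) by (field; lra).
        replace (eps / 2 * (2 * (INR N + 1) / eps)) with (INR N + 1) by (field; lra). lra. }
      replace (CI q (- X) X - l)%C with ((CI q (- X) X - CI q (- INR (S N)) (INR (S N))) + (CI q (- INR (S N)) (INR (S N)) - l))%C by ring.
      eapply Rle_lt_trans; [apply Cmod_triangle|]. pose proof (Hdiff (INR (S N)) X HN0 HX). pose proof (Hl N). lra. }
    exists l. split; [auto|split].
    + apply (Limp_bound (fun X => CI q (- X) X) l _ 0); auto. intros X HX.
      apply Rle_trans with (K * ((atan (X / c) - atan (- X / c)) / c)).
      * apply (CI_bound q (fun y => K * / (c ^ 2 + y ^ 2))); [lra|intros y _; auto|intros y _; apply Hb|].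
        apply (is_RInt_scal (V:=R_NormedModule) (fun y => / (c ^ 2 + y ^ 2))). evar_last.
        -- apply (is_RInt_derive (fun y => atan (y / c) / c) (fun y => / (c ^ 2 + y ^ 2))).
           ++ intros y _. auto_derive; auto. pose proof (om_sq_pos y). field; repeat split; try lra; nra.
           ++ intros y _. apply (ex_derive_continuous (fun y => / (c ^ 2 + y ^ 2))). auto_derive. pose proof (om_sq_pos y). nra.
        -- unfold minus, plus, opp; simpl. field. lra.
      * replace (K * PI / c) with (K * (PI / c)) by (field; lra). apply Rmult_le_compat_l; auto.
        unfold Rdiv. apply Rmult_le_compat_r; [left; apply Rinv_0_lt_compat; auto|].
        pose proof (atan_bound (X * / c)). pose proof (atan_bound (- X * / c)). unfold Rdiv in *. lra.
    + intros X HX. apply le_epsilon. intros eps He. destruct (HL eps He) as [X0 HX0].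
      specialize (HX0 (Rmax X X0) (Rmax_r _ _)). pose proof (Hdiff X (Rmax X X0) HX (Rmax_l _ _)) as H1.
      replace (CI q (- X) X - l)%C with ((CI q (- Rmax X X0) (Rmax X X0) - l) - (CI q (- Rmax X X0) (Rmax X X0) - CI q (- X) X))%C by ring.
      eapply Rle_trans; [apply Cmod_sub_triangle|]. lra.
Qed.

(** A total operator, so that inverse Laplace integrals can be handled as functions of [x]. The
    limit runs along the integers; [Lint_unique] identifies it with the limit of all symmetric
    truncations when that exists. *)
Definition Lint (q : R -> C) : C :=
  (real (Lim_seq (fun n => Re (CI q (- INR n) (INR n)))), real (Lim_seq (fun n => Im (CI q (- INR n) (INR n))))).

Lemma Lint_unique q l : Limp (fun X => CI q (- X) X) l -> Lint q = l.
Proof.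
  intros H.
  assert (G : forall p : C -> R, (forall x y, Rabs (p x - p y) <= Cmod (x - y)) -> real (Lim_seq (fun n => p (CI q (- INR n) (INR n)))) = p l).
  { intros p Hp. rewrite (is_lim_seq_unique _ (Finite (p l))); auto. apply is_lim_seq_spec. intros eps.
    destruct (H eps (cond_pos eps)) as [X0 HX0]. destruct (nfloor_ex (Rmax 0 X0)) as [N [_ HN]]; [apply Rmax_l|].
    exists (S N). intros n Hn. apply le_INR in Hn. rewrite S_INR in Hn. pose proof (Rmax_r 0 X0).
    eapply Rle_lt_trans; [apply Hp|apply HX0]. lra. }
  apply Ceq; [apply (G Re)|apply (G Im)]; intros x y; [eapply Rle_trans; [|apply re_le_Cmod]|eapply Rle_trans; [|apply im_le_Cmod]]; right; f_equal.
Qed.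

Lemma Lint_spec q K : 0 <= K -> (forall y, cont q y) -> (forall y, Cmod (q y) <= K / (c ^ 2 + y ^ 2)) ->
  Limp (fun X => CI q (- X) X) (Lint q) /\ Cmod (Lint q) <= K * PI / c /\ forall X, 0 < X -> Cmod (CI q (- X) X - Lint q) <= 2 * K / X.
Proof.
  intros HK Hq Hb. destruct (line_exists q K HK Hq Hb) as [l [H1 H2]]. rewrite (Lint_unique q l H1). auto.
Qed.

Lemma CI_Limp_cmult k q l : (forall y, cont q y) -> Limp (fun X => CI q (- X) X) l -> Limp (fun X => CI (fun y => k * q y)%C (- X) X) (k * l)%C.
Proof.
  intros Hq H. apply (Limp_ext (fun X => k * CI q (- X) X)%C _ _ 0); [|apply Limp_cmult; auto].
  intros X HX. rewrite CI_cmult; [auto|lra|intros y _; auto].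
Qed.

Lemma CI_Limp_plus p q l k : (forall y, cont p y) -> (forall y, cont q y) ->
  Limp (fun X => CI p (- X) X) l -> Limp (fun X => CI q (- X) X) k -> Limp (fun X => CI (fun y => p y + q y)%C (- X) X) (l + k)%C.
Proof.
  intros Hp Hq H1 H2. apply (Limp_ext (fun X => CI p (- X) X + CI q (- X) X)%C _ _ 0); [|apply Limp_plus; auto].
  intros X HX. rewrite CI_plus; [auto|lra|intros y _; auto|intros y _; auto].
Qed.

Lemma CI_Limp_ext p q l : (forall y, p y = q y) -> Limp (fun X => CI p (- X) X) l -> Limp (fun X => CI q (- X) X) l.
Proof.
  intros E. apply (Limp_ext _ _ _ 0). intros X HX. apply CI_ext; [lra|auto].
Qed.

Definition Efac (x : R) (q : R -> C) (y : R) : C := (Cexp (om y * RtoC x) * q y)%C.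

Lemma cont_Efac x q y : (forall y, cont q y) -> cont (Efac x q) y.
Proof. intros Hq. apply cont_mult; auto. apply cont_Cexp. apply cont_mult; [apply cont_om|apply cont_const]. Qed.

Lemma Efac_bound x q K : (forall y, Cmod (q y) <= K / (c ^ 2 + y ^ 2)) -> forall y, Cmod (Efac x q y) <= K * exp (c * x) / (c ^ 2 + y ^ 2).
Proof.
  intros Hb y. unfold Efac. rewrite Cmod_mult, Cmod_exp_om.
  replace (K * exp (c * x) / (c ^ 2 + y ^ 2)) with (exp (c * x) * (K / (c ^ 2 + y ^ 2))) by (unfold Rdiv; ring).
  apply Rmult_le_compat_l; [left; apply exp_pos|auto].
Qed.

Lemma om_q_cont q : (forall y, cont q y) -> forall y, cont (fun y => om y * q y)%C y.
Proof. intros Hq y. apply cont_mult; [apply cont_om|auto]. Qed.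

(** Decay of order 4 leaves room for two derivatives in [x]. *)
Lemma decay4_shift q K : 0 <= K -> (forall y, Cmod (q y) <= K / (c ^ 2 + y ^ 2) ^ 2) ->
  (forall y, Cmod (q y) <= K / c ^ 2 / (c ^ 2 + y ^ 2)) /\ (forall y, Cmod (om y * q y) <= K / c / (c ^ 2 + y ^ 2)).
Proof.
  intros HK H. assert (G : forall y, Cmod (q y) * Cmod (om y) ^ 4 <= K).
  { intros y. replace (Cmod (om y) ^ 4) with ((Cmod (om y) ^ 2) ^ 2) by ring. rewrite om_sq. pose proof (om_sq_pos y) as Hp.
    specialize (H y). assert (0 < (c ^ 2 + y ^ 2) ^ 2) by (apply pow_lt; auto).
    apply Rle_trans with (K / (c ^ 2 + y ^ 2) ^ 2 * (c ^ 2 + y ^ 2) ^ 2); [apply Rmult_le_compat_r; lra|right; field; lra]. }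
  assert (Ho : forall y, c <= Cmod (om y)).
  { intros y. eapply Rle_trans; [|apply re_le_Cmod]. simpl. apply Rle_abs. }
  split; intros y; specialize (G y); specialize (Ho y); rewrite <- om_sq; pose proof (Cmod_ge_0 (q y)).
  - apply Rmult_le_reg_r with (c ^ 2 * Cmod (om y) ^ 2); [apply Rmult_lt_0_compat; apply pow_lt; lra|].
    replace (K / c ^ 2 / Cmod (om y) ^ 2 * (c ^ 2 * Cmod (om y) ^ 2)) with K by (field; lra).
    eapply Rle_trans; [|exact G]. apply Rmult_le_compat_l; auto. replace (Cmod (om y) ^ 4) with (Cmod (om y) ^ 2 * Cmod (om y) ^ 2) by ring.
    apply Rmult_le_compat_r; [apply pow2_ge_0|]. apply pow_incr; lra.
  - rewrite Cmod_mult. apply Rmult_le_reg_r with (c * Cmod (om y) ^ 2); [apply Rmult_lt_0_compat; [auto|apply pow_lt; lra]|].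
    replace (K / c / Cmod (om y) ^ 2 * (c * Cmod (om y) ^ 2)) with K by (field; lra).
    eapply Rle_trans; [|exact G]. replace (Cmod (om y) * Cmod (q y) * (c * Cmod (om y) ^ 2)) with (Cmod (q y) * (Cmod (om y) ^ 3 * c)) by ring.
    apply Rmult_le_compat_l; auto. replace (Cmod (om y) ^ 4) with (Cmod (om y) ^ 3 * Cmod (om y)) by ring.
    apply Rmult_le_compat_l; [apply pow_le; lra|lra].
Qed.

(** With [s = om y h] and [|h| < 1], the error [Cexp s - 1 - s] is at most [4 |s|^2 exp c]. The
    factor [|s|^2 = |om y|^2 h^2] uses up half of the fourth order decay of [q], and the rest,
    [1 / (c^2 + y^2)], integrates to [PI / c]. *)
Lemma Lint_Rder q K x : 0 <= K -> (forall y, cont q y) -> (forall y, Cmod (q y) <= K / (c ^ 2 + y ^ 2) ^ 2) ->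
  Rder (fun x => Lint (Efac x q)) x (Lint (Efac x (fun y => om y * q y)%C)).
Proof.
  intros HK Hq Hb. destruct (decay4_shift q K HK Hb) as [B0 B1]. pose proof (om_q_cont q Hq) as Hq1.
  assert (K0 : 0 <= K / c ^ 2) by (apply Rdiv_le_0_compat; [auto|apply pow_lt; auto]).
  assert (K1 : 0 <= K / c) by (apply Rdiv_le_0_compat; auto).
  assert (KE : forall k x, 0 <= k -> 0 <= k * exp (c * x)) by (intros; apply Rmult_le_pos; [auto|left; apply exp_pos]).
  apply (Rder_of_quadratic _ x _ (4 * K * exp (c * x + c) * PI / c) 1); [lra|]. intros h Hh.
  destruct (Lint_spec (Efac (x + h) q) _ (KE _ (x + h) K0) (fun y => cont_Efac _ q y Hq) (Efac_bound (x + h) q _ B0)) as [L1 _].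
  destruct (Lint_spec (Efac x q) _ (KE _ x K0) (fun y => cont_Efac _ q y Hq) (Efac_bound x q _ B0)) as [L2 _].
  destruct (Lint_spec (Efac x (fun y => om y * q y)%C) _ (KE _ x K1) (fun y => cont_Efac _ _ y Hq1) (Efac_bound x _ _ B1)) as [L3 _].
  set (p := fun y => (Efac (x + h) q y - Efac x q y - RtoC h * Efac x (fun y => om y * q y) y)%C).
  assert (Cp : forall y, cont p y).
  { intros y. apply cont_minus; [apply cont_minus; apply cont_Efac; auto|]. apply cont_mult; [apply cont_const|apply cont_Efac; auto]. }
  assert (L : Limp (fun X => CI p (- X) X) (Lint (Efac (x + h) q) - Lint (Efac x q) - Lint (Efac x (fun y => om y * q y)%C) * RtoC h)%C).
  { apply (CI_Limp_ext (fun y => Efac (x + h) q y + (-(1) * Efac x q y + (- RtoC h) * Efac x (fun y => om y * q y) y))%C); [intros; unfold p; ring|].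
    replace (Lint (Efac (x + h) q) - Lint (Efac x q) - Lint (Efac x (fun y => om y * q y)%C) * RtoC h)%C
      with (Lint (Efac (x + h) q) + (-(1) * Lint (Efac x q) + (- RtoC h) * Lint (Efac x (fun y => om y * q y)%C)))%C by ring.
    assert (Ck : forall k g, (forall y, cont g y) -> forall y, cont (fun y => k * g y)%C y) by (intros; apply cont_mult; [apply cont_const|auto]).
    pose proof (fun y => cont_Efac x q y Hq) as C2. pose proof (fun y => cont_Efac x _ y Hq1) as C3.
    apply CI_Limp_plus; [intros; apply cont_Efac; auto|intros y; apply cont_plus; apply Ck; auto|auto|].
    apply CI_Limp_plus; try apply Ck; auto; apply CI_Limp_cmult; auto. }
  assert (Bp : forall y, Cmod (p y) <= (4 * K * exp (c * x + c) * (h * h)) / (c ^ 2 + y ^ 2)).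
  { intros y. unfold p, Efac. rewrite RtoC_plus, Cmult_plus_distr_l, Cexp_plus.
    set (s := (om y * RtoC h)%C).
    replace (Cexp (om y * RtoC x) * Cexp s * q y - Cexp (om y * RtoC x) * q y - RtoC h * (Cexp (om y * RtoC x) * (om y * q y)))%C
      with (Cexp (om y * RtoC x) * q y * (Cexp s - 1 - s))%C by (unfold s; ring).
    rewrite !Cmod_mult, Cmod_exp_om. pose proof (Cexp_bound_2 s) as H2.
    assert (Hs : Cmod s * Cmod s = (c ^ 2 + y ^ 2) * (h * h)).
    { unfold s. rewrite Cmod_mult, Cmod_R. rewrite <- om_sq.
      replace (Cmod (om y) * Rabs h * (Cmod (om y) * Rabs h)) with (Cmod (om y) ^ 2 * (Rabs h * Rabs h)) by ring.
      f_equal. rewrite <- Rabs_mult. apply Rabs_pos_eq. nra. }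
    assert (Hre : Rabs (Re s) <= c).
    { unfold s. rewrite re_scal_r. simpl. rewrite Rabs_mult, (Rabs_pos_eq c) by lra. nra. }
    pose proof (om_sq_pos y) as Hp. specialize (Hb y). pose proof (exp_pos (c * x)) as Pe. pose proof (exp_pos c) as Pe2.
    rewrite Hs in H2. assert (Hh0 : 0 <= h * h) by nra.
    assert (H3 : Cmod (Cexp s - 1 - s) <= 4 * ((c ^ 2 + y ^ 2) * (h * h)) * exp c).
    { eapply Rle_trans; [exact H2|]. apply Rmult_le_compat_l; [nra|apply exp_le; auto]. }
    apply Rle_trans with (exp (c * x) * (K / (c ^ 2 + y ^ 2) ^ 2) * (4 * ((c ^ 2 + y ^ 2) * (h * h)) * exp c)).
    - apply Rmult_le_compat; auto using Cmod_ge_0; [apply Rmult_le_pos; [lra|apply Cmod_ge_0]|]. apply Rmult_le_compat_l; lra.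
    - right. rewrite exp_plus. field. lra. }
  assert (HKp : 0 <= 4 * K * exp (c * x + c) * (h * h)).
  { apply Rmult_le_pos; [|nra]. apply Rmult_le_pos; [lra|left; apply exp_pos]. }
  destruct (line_exists p _ HKp Cp Bp) as [l [M1 [M2 _]]]. rewrite (Limp_unique _ _ _ L M1).
  eapply Rle_trans; [exact M2|]. right. field. lra.
Qed.

Lemma w_om_bound w y : c < Re w -> Re w - c <= Cmod (w - om y) /\ (w - om y)%C <> RtoC 0.
Proof.
  intros Hw. assert (H : Re w - c <= Cmod (w - om y)).
  { eapply Rle_trans; [|apply re_le_Cmod]. eapply Rle_trans; [|apply Rle_abs]. right; reflexivity. }
  split; auto. apply Cmod_gt_0. lra.
Qed.

(** An exchange of two integrals over a bounded rectangle. The right-hand side vanishes at [X = 0],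
    and its derivative in [X], computed under the integral sign, is the integrand on the left. *)
Lemma CI_Laplace_truncated q K w Y X : 0 <= K -> (forall y, cont q y) -> (forall y, Cmod (q y) <= K) -> c < Re w -> 0 <= Y -> 0 <= X ->
  CI (fun x => CI (Efac x q) (- Y) Y * Cexp (- (w * RtoC x)))%C 0 X
  = CI (fun y => q y * / (w - om y) * (RtoC 1 - Cexp ((om y - w) * RtoC X)))%C (- Y) Y.
Proof.
  intros HK Hq Hb Hw HY HX.
  set (V := fun t y => (q y * / (w - om y) * (RtoC 1 - Cexp ((om y - w) * RtoC t)))%C).
  assert (Cs : forall y, cont (fun y => om y - w)%C y) by (intros; apply cont_minus; [apply cont_om|apply cont_const]).
  assert (Ci' : forall y, cont (fun y => / (w - om y))%C y).
  { intros y. apply cont_inv; [apply cont_minus; [apply cont_const|apply cont_om]|apply w_om_bound; auto]. }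
  assert (Ce : forall t y, cont (fun y => Cexp ((om y - w) * RtoC t)) y) by (intros; apply cont_Cexp, cont_mult; [apply Cs|apply cont_const]).
  assert (CV : forall t, contI (V t) (- Y) Y).
  { intros t y _. apply cont_mult; [apply cont_mult; auto|]. apply cont_minus; [apply cont_const|apply Ce]. }
  set (dV := fun t y => (q y * Cexp ((om y - w) * RtoC t))%C).
  assert (CdV : forall t, contI (dV t) (- Y) Y) by (intros t y _; apply cont_mult; [auto|apply Ce]).
  set (Sm := c + Y + Cmod w).
  assert (HSm : forall y, - Y <= y <= Y -> Cmod (om y - w) <= Sm).
  { intros y Hy. eapply Rle_trans; [apply Cmod_sub_triangle|]. unfold Sm. pose proof (Cmod_le_sum (om y)) as H. simpl in H.
    rewrite (Rabs_pos_eq c) in H by lra. assert (Rabs y <= Y) by (apply Rabs_le; lra). lra. }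
  assert (DV : forall t, 0 <= t -> Rder (fun t => CI (V t) (- Y) Y) t (CI (dV t) (- Y) Y)).
  { intros t Ht. apply (param_der V (dV t) (- Y) Y t (K * (4 * Sm * exp Sm)) 1); try lra; auto.
    intros h y Hh Hy. unfold V, dV. set (s := (om y - w)%C). specialize (HSm y Hy). fold s in HSm.
    destruct (w_om_bound w y Hw) as [Hwy Hn]. pose proof (Cmod_ge_0 s) as Ps.
    assert (Hsn : s <> RtoC 0) by (intros E; apply Hn; replace (w - om y)%C with (- s)%C by (unfold s; ring); rewrite E; ring).
    assert (Hps : 0 < Cmod s) by (apply Cmod_gt_0; auto).
    replace (w - om y)%C with (- s)%C by (unfold s; ring).
    rewrite RtoC_plus, Cmult_plus_distr_l, Cexp_plus.
    replace (q y * / - s * (RtoC 1 - Cexp (s * RtoC t) * Cexp (s * RtoC h)) - q y * / - s * (RtoC 1 - Cexp (s * RtoC t)) - q y * Cexp (s * RtoC t) * RtoC h)%C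
      with (q y * Cexp (s * RtoC t) * (/ s * (Cexp (s * RtoC h) - 1 - s * RtoC h)))%C.
    2: { assert (Hsn2 : (- s)%C <> RtoC 0) by (intros E; apply Hsn; replace s with (- - s)%C by ring; rewrite E; ring). field; repeat split; auto. }
    rewrite !Cmod_mult, Cmod_inv by auto.
    assert (He : Cmod (Cexp (s * RtoC t)) <= 1).
    { rewrite Cmod_Cexp, re_scal_r, <- exp_0. apply exp_le. unfold s; creim; unfold Re in Hw; nra. }
    pose proof (Cexp_bound_2 (s * RtoC h)) as H2. rewrite Cmod_mult, Cmod_R in H2.
    assert (H3 : Cmod (Cexp (s * RtoC h) - 1 - s * RtoC h) <= 4 * (Cmod s * Cmod s * (h * h)) * exp Sm).
    { eapply Rle_trans; [exact H2|].
      replace (Cmod s * Rabs h * (Cmod s * Rabs h)) with (Cmod s * Cmod s * (Rabs h * Rabs h)) by ring.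
      replace (Rabs h * Rabs h) with (h * h) by (rewrite <- Rabs_mult; symmetry; apply Rabs_pos_eq; nra).
      apply Rmult_le_compat_l; [nra|]. apply exp_le. rewrite re_scal_r, Rabs_mult. pose proof (re_le_Cmod s). pose proof (Rabs_pos h). pose proof (Rabs_pos (Re s)). nra. }
    assert (H4 : / Cmod s * Cmod (Cexp (s * RtoC h) - 1 - s * RtoC h) <= 4 * Sm * exp Sm * (h * h)).
    { apply Rle_trans with (/ Cmod s * (4 * (Cmod s * Cmod s * (h * h)) * exp Sm)).
      - apply Rmult_le_compat_l; [left; apply Rinv_0_lt_compat; auto|auto].
      - replace (/ Cmod s * (4 * (Cmod s * Cmod s * (h * h)) * exp Sm)) with (4 * Cmod s * exp Sm * (h * h)) by (field; lra).
        apply Rmult_le_compat_r; [nra|]. apply Rmult_le_compat_r; [left; apply exp_pos|lra]. }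
    specialize (Hb y). rewrite (Rmult_assoc K).
    apply Rmult_le_compat; [apply Rmult_le_pos; apply Cmod_ge_0|apply Rmult_le_pos; [left; apply Rinv_0_lt_compat; auto|apply Cmod_ge_0]| |auto].
    rewrite <- (Rmult_1_r K). apply Rmult_le_compat; auto using Cmod_ge_0. }
  assert (EdV : forall t, CI (dV t) (- Y) Y = (CI (Efac t q) (- Y) Y * Cexp (- (w * RtoC t)))%C).
  { intros t. rewrite (Cmult_comm (CI _ _ _)), <- CI_cmult; [|lra|intros y _; apply cont_Efac; auto].
    apply CI_ext; [lra|]. intros y _. unfold dV, Efac.
    replace ((om y - w) * RtoC t)%C with (- (w * RtoC t) + om y * RtoC t)%C by ring. rewrite Cexp_plus. ring. }
  rewrite (CI_ext _ (fun x => CI (dV x) (- Y) Y)); [|auto|intros; symmetry; apply EdV].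
  rewrite (CI_FTC (fun t => CI (V t) (- Y) Y)); auto.
  - assert (E0 : CI (V 0) (- Y) Y = RtoC 0).
    { rewrite (CI_ext _ (fun _ => RtoC 0)); [|lra|].
      - rewrite CI_const by lra. ring.
      - intros y _. unfold V. replace ((om y - w) * RtoC 0)%C with (RtoC 0) by ring. rewrite Cexp_0. ring. }
    rewrite E0. unfold V. ring.
  - intros x Hx. apply DV. lra.
  - intros x Hx. apply (cont_ext (fun t => CI (Efac t q) (- Y) Y * Cexp (- (w * RtoC t)))%C); [intros; rewrite EdV; auto|].
    apply cont_mult; [|apply cont_Cexp_lin].
    apply (cont_ext (fun t => CI (dV t) (- Y) Y * Cexp (w * RtoC t))%C).
    { intros t. rewrite EdV, <- Cmult_assoc, <- Cexp_plus. replace (- (w * RtoC t) + w * RtoC t)%C with (RtoC 0) by ring. rewrite Cexp_0. ring. }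
    apply cont_mult; [|apply cont_Cexp, cont_mult; [apply cont_const|apply (Rder_cont _ _ _ (Rder_id x))]].
    apply cont_eps. intros eps He.
    (* A Lipschitz constant in [t], for [|t - x| < 1], of the integral of [dV t], obtained from
       [Cexp_bound_1]; the final [+ 1] keeps it positive. *)
    set (L := 2 * K * Sm * exp (Sm * (x + 2)) * (2 * Y) + 1).
    assert (HSm0 : 0 <= Sm) by (unfold Sm; pose proof (Cmod_ge_0 w); lra).
    assert (HL : 0 < L).
    { unfold L. assert (0 <= 2 * K * Sm * exp (Sm * (x + 2)) * (2 * Y)); [|lra].
      repeat apply Rmult_le_pos; try lra. left; apply exp_pos. }
    exists (Rmin 1 (eps / L)). split; [apply Rmin_pos; [lra|apply Rdiv_lt_0_compat; auto]|]. intros t Ht.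
    pose proof (Rlt_le_trans _ _ _ Ht (Rmin_l _ _)) as Ht1. pose proof (Rlt_le_trans _ _ _ Ht (Rmin_r _ _)) as Ht2.
    rewrite <- CI_minus by (try lra; apply CdV).
    assert (HB : Cmod (CI (fun y => dV t y - dV x y)%C (- Y) Y) <= 2 * K * Sm * exp (Sm * (x + 2)) * Rabs (t - x) * (Y - - Y)).
    { apply CI_bound_const; [lra|intros y Hy; apply cont_minus; apply CdV; auto|]. intros y Hy. unfold dV.
      set (s := (om y - w)%C). specialize (HSm y Hy). fold s in HSm.
      replace (q y * Cexp (s * RtoC t) - q y * Cexp (s * RtoC x))%C with (q y * (Cexp (s * RtoC x) * (Cexp (s * RtoC (t - x)) - 1)))%C.
      2: { replace (s * RtoC t)%C with (s * RtoC x + s * RtoC (t - x))%C by (rewrite RtoC_minus; ring). rewrite Cexp_plus. ring. }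
      rewrite !Cmod_mult. pose proof (Cexp_bound_1 (s * RtoC (t - x))) as H1. rewrite Cmod_mult, Cmod_R in H1.
      assert (H5 : Cmod (Cexp (s * RtoC x)) * Cmod (Cexp (s * RtoC (t - x)) - 1) <= exp (Sm * (x + 1)) * (2 * (Sm * Rabs (t - x)) * exp Sm)).
      { pose proof (Cmod_ge_0 s) as Ps. pose proof (Rabs_pos (t - x)) as Pt. pose proof (re_le_Cmod s) as Rs. pose proof (Rle_abs (Re s)) as Rs2.
        apply Rmult_le_compat; auto using Cmod_ge_0.
        - rewrite Cmod_Cexp, re_scal_r. apply exp_le. nra.
        - eapply Rle_trans; [exact H1|]. apply Rmult_le_compat; [nra|left; apply exp_pos|nra|]. apply exp_le. rewrite re_scal_r, Rabs_mult. pose proof (Rabs_pos (Re s)). nra. }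
      specialize (Hb y). apply Rle_trans with (K * (exp (Sm * (x + 1)) * (2 * (Sm * Rabs (t - x)) * exp Sm))).
      - apply Rmult_le_compat; auto using Cmod_ge_0. apply Rmult_le_pos; apply Cmod_ge_0.
      - right. replace (Sm * (x + 2)) with (Sm * (x + 1) + Sm) by ring. rewrite exp_plus. ring. }
    eapply Rle_lt_trans; [exact HB|].
    replace (2 * K * Sm * exp (Sm * (x + 2)) * Rabs (t - x) * (Y - - Y)) with ((L - 1) * Rabs (t - x)) by (unfold L; ring).
    apply Rle_lt_trans with (L * Rabs (t - x)); [pose proof (Rabs_pos (t - x)); nra|].
    apply Rlt_le_trans with (L * (eps / L)); [apply Rmult_lt_compat_l; auto|right; field; lra].
Qed.

(** The line is cut at height [Y] with an error [O(1/Y)] uniform in [X], so that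
    [CI_Laplace_truncated] applies. Once [Y] has gone to infinity, the discrepancy is the term
    carrying [Cexp ((om y - w) X)], of size [exp (- (Re w - c) X)]. *)
Lemma Lint_Laplace q K w : 0 <= K -> (forall y, cont q y) -> (forall y, Cmod (q y) <= K / (c ^ 2 + y ^ 2) ^ 2) -> c < Re w ->
  Limp (fun X => CI (fun x => Lint (Efac x q) * Cexp (- (w * RtoC x)))%C 0 X) (Lint (fun y => q y * / (w - om y))%C).
Proof.
  intros HK Hq Hb Hw. destruct (decay4_shift q K HK Hb) as [B0 _]. set (K0 := K / c ^ 2) in *.
  assert (HK0 : 0 <= K0) by (apply Rdiv_le_0_compat; [auto|apply pow_lt; auto]).
  set (de := Re w - c). assert (Hde : 0 < de) by (unfold de; lra).
  assert (HbK : forall y, Cmod (q y) <= K0 / c ^ 2).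
  { intros y. eapply Rle_trans; [apply B0|]. unfold Rdiv. apply Rmult_le_compat_l; auto.
    apply Rinv_le_contravar; [apply pow_lt; auto|]. pose proof (pow2_ge_0 y). lra. }
  assert (Cx : forall x, cont (fun x => Lint (Efac x q)) x) by (intros; eapply Rder_cont; apply (Lint_Rder q K); auto).
  set (p := fun y => (q y * / (w - om y))%C).
  assert (Cp : forall y, cont p y).
  { intros y. apply cont_mult; auto. apply cont_inv; [apply cont_minus; [apply cont_const|apply cont_om]|apply w_om_bound; auto]. }
  assert (Bp : forall y, Cmod (p y) <= K0 / de / (c ^ 2 + y ^ 2)).
  { intros y. unfold p. destruct (w_om_bound w y Hw) as [H1 H2]. fold de in H1. rewrite Cmod_mult, Cmod_inv by auto.
    replace (K0 / de / (c ^ 2 + y ^ 2)) with (K0 / (c ^ 2 + y ^ 2) * / de) by (unfold Rdiv; ring).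
    apply Rmult_le_compat; auto using Cmod_ge_0; [left; apply Rinv_0_lt_compat; lra|apply Rinv_le_contravar; auto]. }
  assert (HKp : 0 <= K0 / de) by (apply Rdiv_le_0_compat; auto).
  destruct (Lint_spec p _ HKp Cp Bp) as [_ [_ Tp]].
  assert (HX : forall X, 0 <= X -> Cmod (CI (fun x => Lint (Efac x q) * Cexp (- (w * RtoC x)))%C 0 X - Lint p) <= (K0 / de * PI / c) * exp (- de * X)).
  { intros X HX. apply le_epsilon. intros eps He.
    (* [Z / Y] is the sum of two truncation errors, that of the iterated integral and that of the
       limiting line integral. *)
    set (Z := 2 * K0 / de + 2 * (K0 / de)). assert (HZ : 0 <= Z) by (unfold Z; apply Rplus_le_le_0_compat; [apply Rdiv_le_0_compat; lra|lra]).
    set (Y := (Z + 1) / eps). assert (HY : 0 < Y) by (apply Rdiv_lt_0_compat; lra).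
    assert (HZY : Z / Y <= eps).
    { unfold Y. replace (Z / ((Z + 1) / eps)) with (eps * (Z / (Z + 1))) by (field; lra).
      rewrite <- (Rmult_1_r eps) at 2. apply Rmult_le_compat_l; [lra|]. apply Rmult_le_reg_r with (Z + 1); [lra|].
      replace (Z / (Z + 1) * (Z + 1)) with Z by (field; lra). lra. }
    assert (HKc : 0 <= K0 / c ^ 2) by (apply Rdiv_le_0_compat; [auto|apply pow_lt; auto]).
    pose proof (CI_Laplace_truncated q (K0 / c ^ 2) w Y X HKc Hq HbK Hw ltac:(lra) HX) as ET.
    assert (CY : forall x, cont (fun x => CI (Efac x q) (- Y) Y) x).
    { intros x. eapply Rder_cont. apply (param_der (fun x y => Efac x q y) (fun y => om y * Efac x q y)%C (- Y) Y x ((K0 / c ^ 2) * (exp (c * x) * (4 * (c + Y) ^ 2 * exp c))) 1); [lra|lra| | |].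
      - intros x' _ y _. apply cont_Efac; auto.
      - intros y _. apply cont_mult; [apply cont_om|apply cont_Efac; auto].
      - intros h y Hh Hy. unfold Efac. rewrite RtoC_plus, Cmult_plus_distr_l, Cexp_plus. set (s := (om y * RtoC h)%C).
        replace (Cexp (om y * RtoC x) * Cexp s * q y - Cexp (om y * RtoC x) * q y - om y * (Cexp (om y * RtoC x) * q y) * RtoC h)%C
          with (q y * (Cexp (om y * RtoC x) * (Cexp s - 1 - s)))%C by (unfold s; ring).
        rewrite !Cmod_mult, Cmod_exp_om. pose proof (Cexp_bound_2 s) as H2.
        assert (Hom : Cmod (om y) <= c + Y).
        { pose proof (Cmod_le_sum (om y)) as H. simpl in H. rewrite (Rabs_pos_eq c) in H by lra. assert (Rabs y <= Y) by (apply Rabs_le; lra). lra. }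
        assert (Hss : Cmod s * Cmod s <= (c + Y) ^ 2 * (h * h)).
        { unfold s. rewrite Cmod_mult, Cmod_R. replace (Cmod (om y) * Rabs h * (Cmod (om y) * Rabs h)) with (Cmod (om y) ^ 2 * (Rabs h * Rabs h)) by ring.
          replace (Rabs h * Rabs h) with (h * h) by (rewrite <- Rabs_mult; symmetry; apply Rabs_pos_eq; nra).
          apply Rmult_le_compat_r; [nra|]. apply pow_incr. split; [apply Cmod_ge_0|auto]. }
        assert (Hre : Rabs (Re s) <= c) by (unfold s; rewrite re_scal_r; simpl; rewrite Rabs_mult, (Rabs_pos_eq c) by lra; nra).
        assert (H3 : Cmod (Cexp s - 1 - s) <= 4 * (c + Y) ^ 2 * exp c * (h * h)).
        { eapply Rle_trans; [exact H2|]. apply Rle_trans with (4 * ((c + Y) ^ 2 * (h * h)) * exp c); [|right; ring].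
          apply Rmult_le_compat; [pose proof (Cmod_ge_0 s); nra|left; apply exp_pos|lra|apply exp_le; auto]. }
        pose proof (exp_pos (c * x)). rewrite !(Rmult_assoc (K0 / c ^ 2)). apply Rmult_le_compat; auto using Cmod_ge_0.
        + apply Rmult_le_pos; [lra|apply Cmod_ge_0].
        + rewrite !(Rmult_assoc (exp (c * x))). apply Rmult_le_compat_l; [lra|]. eapply Rle_trans; [exact H3|]. right; ring. }
    assert (D1 : Cmod (CI (fun x => Lint (Efac x q) * Cexp (- (w * RtoC x)))%C 0 X - CI (fun x => CI (Efac x q) (- Y) Y * Cexp (- (w * RtoC x)))%C 0 X) <= 2 * K0 / Y / de).
    { rewrite <- CI_minus; [|auto|intros x _; apply cont_mult; [apply Cx|apply cont_Cexp_lin]|intros x _; apply cont_mult; [apply CY|apply cont_Cexp_lin]].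
      eapply Rle_trans; [apply (CI_exp_bound _ (2 * K0 / Y) de 0 X)|rewrite Rmult_0_r, exp_0; right; ring]; auto.
      - apply Rdiv_le_0_compat; lra.
      - intros x _. apply cont_minus; apply cont_mult; auto using cont_Cexp_lin.
      - intros x Hx. replace (Lint (Efac x q) * Cexp (- (w * RtoC x)) - CI (Efac x q) (- Y) Y * Cexp (- (w * RtoC x)))%C
          with (- (CI (Efac x q) (- Y) Y - Lint (Efac x q)) * Cexp (- (w * RtoC x)))%C by ring.
        rewrite Cmod_mult, Cmod_opp, Cmod_Cexp_neg.
        assert (KE : 0 <= K0 * exp (c * x)) by (apply Rmult_le_pos; [auto|left; apply exp_pos]).
        destruct (Lint_spec (Efac x q) _ KE (fun y => cont_Efac _ q y Hq) (Efac_bound x q _ B0)) as [_ [_ T]]. specialize (T Y HY).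
        apply Rle_trans with (2 * (K0 * exp (c * x)) / Y * exp (- Re w * x)); [apply Rmult_le_compat_r; [left; apply exp_pos|auto]|].
        replace (- de * x) with (c * x + - Re w * x) by (unfold de; ring). rewrite exp_plus. right. field. lra. }
    rewrite ET in D1.
    assert (Ce : forall y, cont (fun y => Cexp ((om y - w) * RtoC X)) y).
    { intros y. apply cont_Cexp, cont_mult; [apply cont_minus; [apply cont_om|apply cont_const]|apply cont_const]. }
    assert (D2 : Cmod (CI (fun y => q y * / (w - om y) * (RtoC 1 - Cexp ((om y - w) * RtoC X)))%C (- Y) Y - CI p (- Y) Y) <= (K0 / de * PI / c) * exp (- de * X)).
    { rewrite <- CI_minus; [|lra|intros y _; apply cont_mult; [apply Cp|apply cont_minus; [apply cont_const|apply Ce]]|intros y _; apply Cp].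
      rewrite (CI_ext _ (fun y => - p y * Cexp ((om y - w) * RtoC X))%C); [|lra|intros y _; unfold p; ring].
      set (Ex := exp (- de * X)). assert (HEx : 0 < Ex) by apply exp_pos.
      apply Rle_trans with ((K0 / de * Ex) * ((atan (Y / c) - atan (- Y / c)) / c)).
      - apply (CI_bound _ (fun y => K0 / de * Ex * / (c ^ 2 + y ^ 2))); [lra|intros y _; apply cont_mult; [apply cont_opp, Cp|apply Ce]| |].
        + intros y _. rewrite Cmod_mult, Cmod_opp. replace (Cmod (Cexp ((om y - w) * RtoC X))) with Ex.
          * specialize (Bp y). replace (K0 / de * Ex * / (c ^ 2 + y ^ 2)) with (K0 / de / (c ^ 2 + y ^ 2) * Ex) by (unfold Rdiv; ring).
            apply Rmult_le_compat_r; lra.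
          * rewrite Cmod_Cexp, re_scal_r. unfold Ex, de. f_equal. creim. ring.
        + apply (is_RInt_scal (V:=R_NormedModule) (fun y => / (c ^ 2 + y ^ 2))). evar_last.
          * apply (is_RInt_derive (fun y => atan (y / c) / c) (fun y => / (c ^ 2 + y ^ 2))).
            -- intros y _. auto_derive; auto. pose proof (om_sq_pos y). field; repeat split; try lra; nra.
            -- intros y _. apply (ex_derive_continuous (fun y => / (c ^ 2 + y ^ 2))). auto_derive. pose proof (om_sq_pos y). nra.
          * unfold minus, plus, opp; simpl. field. lra.
      - replace (K0 / de * PI / c * Ex) with (K0 / de * Ex * (PI / c)) by (field; lra).
        apply Rmult_le_compat_l; [apply Rmult_le_pos; lra|]. unfold Rdiv. apply Rmult_le_compat_r; [left; apply Rinv_0_lt_compat; auto|].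
        pose proof (atan_bound (Y * / c)). pose proof (atan_bound (- Y * / c)). unfold Rdiv in *. lra. }
    specialize (Tp Y HY).
    set (u1 := CI (fun x => Lint (Efac x q) * Cexp (- (w * RtoC x)))%C 0 X) in *.
    set (u2 := CI (fun y => q y * / (w - om y) * (RtoC 1 - Cexp ((om y - w) * RtoC X)))%C (- Y) Y) in *.
    replace (u1 - Lint p)%C with ((u1 - u2) + ((u2 - CI p (- Y) Y) + (CI p (- Y) Y - Lint p)))%C by ring.
    eapply Rle_trans; [apply Cmod_triangle|]. pose proof (Cmod_triangle (u2 - CI p (- Y) Y) (CI p (- Y) Y - Lint p)).
    assert (EZ : 2 * K0 / Y / de + 2 * (K0 / de) / Y = Z / Y) by (unfold Z; field; lra). lra. }
  intros eps He. destruct (exp_decay (K0 / de * PI / c) de eps Hde He) as [X0 HX0].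
  exists (Rmax 0 X0). intros X HX2. eapply Rle_lt_trans; [apply HX; eapply Rle_trans; [apply Rmax_l|exact HX2]|].
  apply HX0. eapply Rle_trans; [apply Rmax_r|exact HX2].
Qed.

(** Goursat on the box of width [X] and height [2 X] to the right of the line: the other three sides
    have total length [4 X] and stay at distance at least [X] from [c], where [|g| <= K / X^2]. *)
Lemma line_zero g K X1 : (forall z, c <= Re z -> exists l, Cder g z l) -> 0 <= K ->
  (forall z, c <= Re z -> X1 <= Cmod (z - RtoC c) -> Cmod (g z) <= K / Cmod (z - RtoC c) ^ 2) ->
  Limp (fun X => CI (fun y => g (om y)) (- X) X) (RtoC 0).
Proof.
  intros Hg HK Hb.
  assert (H : forall X, 0 < X -> X1 <= X -> Cmod (CI (fun y => g (om y)) (- X) X) <= 4 * K / X).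
  { intros X HX HX1. assert (G := goursat_box g c X ltac:(lra)). specialize (G ltac:(intros; apply Hg; lra)).
    assert (HB : forall z, c <= Re z -> X <= Cmod (z - RtoC c) -> Cmod (g z) <= K / X ^ 2).
    { intros z Hz1 Hz2. eapply Rle_trans; [apply Hb; auto; lra|]. unfold Rdiv. apply Rmult_le_compat_l; auto.
      apply Rinv_le_contravar; [apply pow_lt; auto|]. apply pow_incr; lra. }
    assert (HI : forall x y, X <= Rabs y -> X <= Cmod ((x, y) - RtoC c)).
    { intros x y Hy. eapply Rle_trans; [exact Hy|]. eapply Rle_trans; [|apply im_le_Cmod]. right. f_equal. creim. ring. }
    assert (HR : forall y, X <= Cmod (((c + X)%R, y) - RtoC c)).
    { intros y. eapply Rle_trans; [|apply re_le_Cmod]. eapply Rle_trans; [|apply Rle_abs]. right. creim. ring. }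
    assert (Cg : forall z, c <= Re z -> forall f t, f t = z -> cont f t -> cont (fun t => g (f t)) t).
    { intros z Hz f t E Hf. destruct (Hg z Hz) as [l Hl]. apply (cont_comp_Cder g f t l); auto. rewrite E; auto. }
    assert (Cfx : forall y x, cont (fun t => ((t, y) : C)) x) by (intros; split; simpl; [apply continuous_id|apply continuous_const]).
    assert (Cfy : forall x y, cont (fun t => ((x, t) : C)) y) by (intros; split; simpl; [apply continuous_const|apply continuous_id]).
    assert (I1 : Cmod (CI (fun x => g (x, (- X)%R)) c (c + X)) <= K / X ^ 2 * (c + X - c)).
    { apply CI_bound_const; [lra|intros x Hx; apply (Cg (x, - X)); simpl; auto; lra|]. intros x Hx. apply HB; simpl; [lra|]. apply HI. rewrite Rabs_Ropp, Rabs_pos_eq; lra. }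
    assert (I2 : Cmod (CI (fun x => g (x, X)) c (c + X)) <= K / X ^ 2 * (c + X - c)).
    { apply CI_bound_const; [lra|intros x Hx; apply (Cg (x, X)); simpl; auto; lra|]. intros x Hx. apply HB; simpl; [lra|]. apply HI. rewrite Rabs_pos_eq; lra. }
    assert (I3 : Cmod (CI (fun y => g ((c + X)%R, y)) (- X) X) <= K / X ^ 2 * (X - - X)).
    { apply CI_bound_const; [lra|intros y Hy; apply (Cg (c + X, y)); simpl; auto; lra|]. intros y Hy. apply HB; simpl; [lra|]. apply HR. }
    set (A1 := CI (fun x => g (x, (- X)%R)) c (c + X)) in *. set (A2 := CI (fun x => g (x, X)) c (c + X)) in *.
    set (A3 := CI (fun y => g ((c + X)%R, y)) (- X) X) in *.
    change (CI (fun y => g (c, y)) (- X) X) with (CI (fun y => g (om y)) (- X) X) in G.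
    set (A4 := CI (fun y => g (om y)) (- X) X) in *.
    assert (E : (Ci * A4)%C = (A1 - A2 + Ci * A3)%C) by (replace (Ci * A4)%C with ((A2 + Ci * A4) - A2)%C by ring; rewrite <- G; ring).
    assert (E2 : Cmod A4 = Cmod (Ci * A4)) by (rewrite Cmod_mult, Cmod_Ci; ring). rewrite E2, E.
    eapply Rle_trans; [apply Cmod_triangle|]. rewrite Cmod_mult, Cmod_Ci, Rmult_1_l.
    pose proof (Cmod_sub_triangle A1 A2). replace (4 * K / X) with (K / X ^ 2 * (c + X - c) + K / X ^ 2 * (c + X - c) + K / X ^ 2 * (X - - X)) by (field; lra). lra. }
  intros eps He. exists (Rmax (Rmax 1 X1) (4 * K / eps + 1)). intros X HX.
  assert (M1 : 1 <= X) by (eapply Rle_trans; [apply Rmax_l|]; eapply Rle_trans; [apply Rmax_l|exact HX]).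
  assert (M2 : X1 <= X) by (eapply Rle_trans; [apply Rmax_r|]; eapply Rle_trans; [apply Rmax_l|exact HX]).
  assert (M3 : 4 * K / eps + 1 <= X) by (eapply Rle_trans; [apply Rmax_r|exact HX]).
  replace (CI (fun y => g (om y)) (- X) X - RtoC 0)%C with (CI (fun y => g (om y)) (- X) X) by ring.
  eapply Rle_lt_trans; [apply H; lra|]. apply Rmult_lt_reg_r with (X / eps); [apply Rdiv_lt_0_compat; lra|].
  replace (4 * K / X * (X / eps)) with (4 * K / eps) by (field; lra). replace (eps * (X / eps)) with X by (field; lra). lra.
Qed.

Lemma atan_limit eps : 0 < eps -> exists T, 0 < T /\ forall t, T <= t -> PI / 2 - eps < atan t.
Proof.
  intros He. assert (Hc0 : continuous atan 0) by (apply (ex_derive_continuous atan); eexists; apply is_derive_atan).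
  destruct (proj1 (filterlim_locally _ _) Hc0 (mkposreal _ He)) as [d Hd]. pose proof (cond_pos d) as Hd0.
  exists (2 / d). split; [apply Rdiv_lt_0_compat; lra|]. intros t Ht.
  assert (Ht0 : 0 < t) by (eapply Rlt_le_trans; [|exact Ht]; apply Rdiv_lt_0_compat; lra).
  assert (Hit : 0 < / t) by (apply Rinv_0_lt_compat; auto).
  assert (Hb : ball 0 d (/ t)).
  { change (Rabs (/ t - 0) < d). rewrite Rminus_0_r, Rabs_pos_eq by lra.
    apply Rmult_lt_reg_r with t; auto. rewrite Rinv_l by lra.
    apply Rmult_le_compat_l with (r := d) in Ht; [|lra]. replace (d * (2 / d)) with 2 in Ht by (field; lra). lra. }
  specialize (Hd _ Hb). change (Rabs (atan (/ t) - atan 0) < eps) in Hd. rewrite atan_0, Rminus_0_r in Hd.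
  apply Rabs_def2 in Hd. pose proof (atan_inv t Ht0). lra.
Qed.

Lemma poisson_mass p y0 : 0 < p -> Limp (fun X => CI (fun y => RtoC (2 * p / (p ^ 2 + (y - y0) ^ 2))) (- X) X) (RtoC (2 * PI)).
Proof.
  intros Hp.
  assert (Hpos : forall y, 0 < p ^ 2 + (y - y0) ^ 2) by (intros y; pose proof (pow2_ge_0 (y - y0)); assert (0 < p ^ 2) by (apply pow_lt; auto); lra).
  assert (E : forall X, 0 <= X -> CI (fun y => RtoC (2 * p / (p ^ 2 + (y - y0) ^ 2))) (- X) X = RtoC (2 * (atan ((X - y0) / p) - atan ((- X - y0) / p)))).
  { intros X HX. rewrite CI_RtoC. f_equal. apply is_RInt_unique. evar_last.
    - apply (is_RInt_derive (fun y => 2 * atan ((y - y0) / p)) (fun y => 2 * p / (p ^ 2 + (y - y0) ^ 2))).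
      + intros y _. auto_derive; auto. pose proof (Hpos y) as H. field; repeat split; try lra; nra.
      + intros y _. apply (ex_derive_continuous (fun y => 2 * p / (p ^ 2 + (y - y0) ^ 2))). auto_derive. pose proof (Hpos y). nra.
    - unfold minus, plus, opp; simpl. ring. }
  intros eps He. destruct (atan_limit (eps / 4)) as [T [HT Hat]]; [lra|].
  exists (p * T + Rabs y0). intros X HX. pose proof (Rle_abs y0). pose proof (Rle_abs (- y0)) as H2. rewrite Rabs_Ropp in H2. pose proof (Rabs_pos y0).
  assert (HpT : 0 < p * T) by (apply Rmult_lt_0_compat; auto).
  rewrite E by lra. rewrite <- RtoC_minus, Cmod_R.
  assert (Q : forall u, p * T <= u -> T <= u / p).
  { intros u Hu. apply Rmult_le_reg_r with p; auto. replace (u / p * p) with u by (field; lra). lra. }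
  pose proof (Hat _ (Q (X - y0) ltac:(lra))) as A1. pose proof (Hat _ (Q (X + y0) ltac:(lra))) as A2.
  replace ((- X - y0) / p) with (- ((X + y0) / p)) by (field; lra). rewrite atan_opp.
  pose proof (atan_bound ((X - y0) / p)). pose proof (atan_bound ((X + y0) / p)). apply Rabs_def1; lra.
Qed.

Lemma Cmod_sub_c z : c <= Re z -> Cmod (z - RtoC c) <= Cmod z.
Proof.
  intros Hz. unfold Cmod. apply sqrt_le_1_alt. destruct z as [p q]. unfold Re in Hz. simpl in *. nra.
Qed.

(** Let [ws] be the mirror image of [w] in the line. The kernels at [w] and [ws] differ by a Poisson
    kernel of mass [2 PI], which carries the value [g w]. The rest consists of [g / (ws - z)] and a
    multiple of [qt / (ws - z)], both holomorphic on the half-plane with quadratic decay, so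
    [line_zero] annihilates them. *)
Lemma line_cauchy (g : C -> C) K w : c < Re w -> 0 <= K -> (forall z, c <= Re z -> exists l, Cder g z l) ->
  (forall z, c <= Re z -> Cmod (g z) <= K / Cmod z ^ 2) ->
  Limp (fun X => CI (fun y => g (om y) * / (w - om y))%C (- X) X) (RtoC (2 * PI) * g w)%C.
Proof.
  intros Hw HK Hg Hb. set (p := Re w - c). assert (Hp : 0 < p) by (unfold p; lra).
  set (ws := ((c - p)%R, Im w) : C).
  assert (Hws : forall z, c <= Re z -> p <= Cmod (ws - z) /\ (ws - z)%C <> RtoC 0).
  { intros z Hz. assert (H : p <= Cmod (ws - z)).
    { rewrite Cmod_sub_sym. eapply Rle_trans; [|apply re_le_Cmod]. eapply Rle_trans; [|apply Rle_abs]. unfold ws. unfold Re in *; simpl. lra. }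
    split; auto. apply Cmod_gt_0. lra. }
  assert (Dinv : forall z, c <= Re z -> exists l, Cder (fun z => / (ws - z))%C z l).
  { intros z Hz. eexists. apply (Cder_comp (fun x => / x)%C (fun z => ws - z)%C); [apply Cder_inv, Hws; auto|].
    apply Cder_minus; [apply Cder_const|apply Cder_id]. }
  assert (Hcpos : 0 < c ^ 2) by (apply pow_lt; auto).
  assert (HbK : forall z, c <= Re z -> Cmod (g z) <= K / c ^ 2).
  { intros z Hz. eapply Rle_trans; [apply Hb; auto|]. unfold Rdiv. apply Rmult_le_compat_l; auto. apply Rinv_le_contravar; auto.
    apply pow_incr. split; [lra|]. eapply Rle_trans; [exact Hz|]. eapply Rle_trans; [apply Rle_abs|apply re_le_Cmod]. }
  assert (Comg : forall y, cont (fun y => g (om y)) y).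
  { intros y. destruct (Hg (om y)) as [l Hl]; [simpl; lra|]. apply (cont_comp_Cder g om y l); auto. apply cont_om. }
  assert (Cinvs : forall y, cont (fun y => / (ws - om y))%C y).
  { intros y. apply cont_inv; [apply cont_minus; [apply cont_const|apply cont_om]|apply Hws; simpl; lra]. }
  (* the reflected pole lies outside, so its contribution vanishes *)
  assert (L1 : Limp (fun X => CI (fun y => g (om y) * / (ws - om y))%C (- X) X) (RtoC 0)).
  { apply (line_zero (fun z => g z * / (ws - z))%C (K / p) 1).
    - intros z Hz. destruct (Hg z Hz) as [l1 H1]. destruct (Dinv z Hz) as [l2 H2]. eexists. apply (Cder_mult g (fun z => / (ws - z))%C); eauto.
    - apply Rdiv_le_0_compat; auto.
    - intros z Hz H1. destruct (Hws z Hz) as [H2 H3]. rewrite Cmod_mult, Cmod_inv by auto.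
      replace (K / p / Cmod (z - RtoC c) ^ 2) with (K / Cmod (z - RtoC c) ^ 2 * / p) by (unfold Rdiv; ring).
      apply Rmult_le_compat; [apply Cmod_ge_0|left; apply Rinv_0_lt_compat; lra| |apply Rinv_le_contravar; auto].
      eapply Rle_trans; [apply Hb; auto|]. unfold Rdiv. apply Rmult_le_compat_l; auto.
      apply Rinv_le_contravar; [apply pow_lt; lra|]. apply pow_incr. split; [lra|]. apply Cmod_sub_c; auto. }
  destruct (Cder_quotient_removable g w p Hp) as [l0 [l1 [Hl0 Hl1]]].
  { intros z Hz. apply Hg. assert (H := re_le_Cmod (z - w)). assert (H2 := Rle_abs (- Re (z - w))). rewrite Rabs_Ropp in H2.
    assert (E : Re (z - w) = Re z - Re w) by reflexivity. unfold p in *. lra. }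
  set (qt := fun z => if Ceq_dec z w then l0 else ((g z - g w) / (z - w))%C) in *.
  set (Wc := Cmod (w - RtoC c)).
  assert (EWs : Cmod (ws - RtoC c) = Wc).
  { unfold Wc, Cmod. f_equal. unfold ws, p. destruct w as [w1 w2]. unfold Re, Im; simpl. ring. }
  (* Far from [c], beyond twice the distance [|w - c|], both [|z - w|] and [|ws - z|] are at least
     half of [|z - c|]; hence the factor 4. *)
  set (K2 := 4 * (K / c ^ 2 + Cmod (g w))).
  assert (HK2 : 0 <= K2) by (unfold K2; pose proof (Cmod_ge_0 (g w)); assert (0 <= K / c ^ 2) by (apply Rdiv_le_0_compat; auto); lra).
  assert (Dqt : forall z, c <= Re z -> exists l, Cder qt z l).
  { intros z Hz. destruct (Ceq_dec z w) as [->|Hn]; [exists l1; auto|].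
    destruct (Hg z Hz) as [l Hl]. eexists.
    assert (Hd : 0 < Cmod (z - w)) by (apply Cmod_gt_0, Cminus_eq_contra; auto).
    apply (Cder_ext_loc (fun z => (g z - g w) / (z - w))%C qt z _ (Cmod (z - w)) Hd).
    - intros h Hh. unfold qt. destruct (Ceq_dec (z + h) w) as [E|E]; auto. exfalso.
      assert (Eh : h = (w - z)%C) by (rewrite <- E; ring). rewrite Eh, Cmod_sub_sym in Hh. lra.
    - apply Cder_quotient_diff; auto. exact Hl. }
  assert (L2 : Limp (fun X => CI (fun y => qt (om y) * / (ws - om y))%C (- X) X) (RtoC 0)).
  { apply (line_zero (fun z => qt z * / (ws - z))%C K2 (2 * Wc + 1)); auto.
    - intros z Hz. destruct (Dqt z Hz) as [k1 H1]. destruct (Dinv z Hz) as [k2 H2]. eexists. apply (Cder_mult qt (fun z => / (ws - z))%C); eauto.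
    - intros z Hz HzX. pose proof (Cmod_ge_0 (w - RtoC c)) as PW. fold Wc in PW. set (D := Cmod (z - RtoC c)) in *.
      assert (H1 : D / 2 <= Cmod (z - w)).
      { replace (z - w)%C with ((z - RtoC c) - (w - RtoC c))%C by ring. eapply Rle_trans; [|apply Cmod_sub_rev]. fold D Wc. lra. }
      assert (H2 : D / 2 <= Cmod (ws - z)).
      { rewrite Cmod_sub_sym. replace (z - ws)%C with ((z - RtoC c) - (ws - RtoC c))%C by ring. eapply Rle_trans; [|apply Cmod_sub_rev]. fold D. rewrite EWs. lra. }
      assert (Hzw : (z - w)%C <> RtoC 0) by (apply Cmod_gt_0; lra).
      unfold qt. destruct (Ceq_dec z w) as [E|E]; [exfalso; apply Hzw; rewrite E; ring|].
      rewrite Cmod_mult, Cmod_inv by (apply Hws; auto). rewrite Cmod_div by auto.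
      assert (Hnum : Cmod (g z - g w) <= K2 / 4).
      { eapply Rle_trans; [apply Cmod_sub_triangle|]. unfold K2. specialize (HbK z Hz). lra. }
      replace (K2 / D ^ 2) with (K2 / 4 * / (D / 2) * / (D / 2)) by (field; lra).
      unfold Rdiv at 1. apply Rmult_le_compat; [apply Rmult_le_pos; [apply Cmod_ge_0|left; apply Rinv_0_lt_compat; lra]|left; apply Rinv_0_lt_compat; lra| |apply Rinv_le_contravar; lra].
      apply Rmult_le_compat; [apply Cmod_ge_0|left; apply Rinv_0_lt_compat; lra|auto|apply Rinv_le_contravar; lra]. }
  assert (Cqt : forall y, cont (fun y => qt (om y) * / (ws - om y))%C y).
  { intros y. apply cont_mult; [|apply Cinvs]. destruct (Dqt (om y)) as [l Hl]; [simpl; lra|]. apply (cont_comp_Cder qt om y l); auto. apply cont_om. }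
  set (ker := fun y => RtoC (2 * p / (p ^ 2 + (y - Im w) ^ 2))).
  assert (Hker : forall y, ker y = (/ (w - om y) - / (ws - om y))%C).
  { intros y. destruct (w_om_bound w y Hw) as [_ N1]. destruct (Hws (om y)) as [_ N2]; [simpl; lra|].
    assert (N3 : p ^ 2 + (y - Im w) ^ 2 <> 0) by (pose proof (pow2_ge_0 (y - Im w)); assert (0 < p ^ 2) by (apply pow_lt; auto); lra).
    unfold ker. rewrite RtoC_div by auto.
    assert (E : ((w - om y) * (ws - om y))%C = (- RtoC (p ^ 2 + (y - Im w) ^ 2))%C).
    { apply Ceq; unfold ws, om, p; destruct w as [w1 w2]; unfold Re, Im; simpl; ring. }
    assert (E2 : (ws - w)%C = (- RtoC (2 * p))%C).
    { apply Ceq; unfold ws, p; destruct w as [w1 w2]; unfold Re, Im; simpl; ring. }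
    replace (/ (w - om y) - / (ws - om y))%C with ((ws - w) / ((w - om y) * (ws - om y)))%C by (field; auto).
    rewrite E, E2. field. apply RtoC_nz; auto. }
  assert (Cker : forall y, cont ker y).
  { intros y. apply (cont_ext (fun y => / (w - om y) - / (ws - om y))%C); [intros; symmetry; apply Hker|].
    apply cont_minus; [|apply Cinvs]. apply cont_inv; [apply cont_minus; [apply cont_const|apply cont_om]|apply w_om_bound; auto]. }
  apply (CI_Limp_ext (fun y => (w - ws) * (qt (om y) * / (ws - om y)) + (g w * ker y + g (om y) * / (ws - om y)))%C).
  - intros y. rewrite Hker. destruct (w_om_bound w y Hw) as [_ N1]. destruct (Hws (om y)) as [_ N2]; [simpl; lra|].
    unfold qt. destruct (Ceq_dec (om y) w) as [E|E]; [exfalso; apply N1; rewrite E; ring|].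
    assert (N3 : (om y - w)%C <> RtoC 0) by (apply Cminus_eq_contra; auto). field. auto.
  - replace (RtoC (2 * PI) * g w)%C with ((w - ws) * RtoC 0 + (g w * RtoC (2 * PI) + RtoC 0))%C by ring.
    assert (Ck : forall k f, (forall y, cont f y) -> forall y, cont (fun y => k * f y)%C y) by (intros; apply cont_mult; [apply cont_const|auto]).
    assert (C3 : forall y, cont (fun y => g (om y) * / (ws - om y))%C y) by (intros y; apply cont_mult; auto).
    apply CI_Limp_plus; [apply Ck; auto|intros y; apply cont_plus; [apply Ck; auto|auto]|apply CI_Limp_cmult; auto|].
    apply CI_Limp_plus; [apply Ck; auto|auto| |auto]. apply CI_Limp_cmult; auto. apply poisson_mass; auto.
Qed.

(** The inverse Laplace transform of [w^-4]. *)
Definition J4 (x : R) : C := Lint (Efac x (fun y => / om y ^ 4)%C).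

Lemma cont_om_inv_pow n y : cont (fun y => / om y ^ n)%C y.
Proof. apply cont_inv; [apply cont_pow, cont_om|apply Cpow_nz, om_nz]. Qed.

Lemma om_inv4_bound y : Cmod (/ om y ^ 4) <= 1 / (c ^ 2 + y ^ 2) ^ 2.
Proof.
  rewrite Cmod_inv by (apply Cpow_nz, om_nz). rewrite Cmod_pow. replace (Cmod (om y) ^ 4) with ((Cmod (om y) ^ 2) ^ 2) by ring.
  rewrite om_sq. right. unfold Rdiv. ring.
Qed.

(** [Cexp (z x) z^-3] tends to 0 at both ends of the line, so the integral of its derivative
    vanishes. By [J4_Rder] this is Euler's equation [x J4' = 3 J4]. *)
Lemma J4_ode x : (RtoC x * Lint (Efac x (fun y => om y * / om y ^ 4)%C) = RtoC 3 * J4 x)%C.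
Proof.
  destruct (decay4_shift _ 1 Rle_0_1 om_inv4_bound) as [B0 B1].
  assert (K0 : 0 <= 1 / c ^ 2 * exp (c * x)) by (apply Rmult_le_pos; [apply Rdiv_le_0_compat; [lra|apply pow_lt; auto]|left; apply exp_pos]).
  assert (K1 : 0 <= 1 / c * exp (c * x)) by (apply Rmult_le_pos; [apply Rdiv_le_0_compat; lra|left; apply exp_pos]).
  pose proof (cont_om_inv_pow 4) as C4. pose proof (om_q_cont _ C4) as C3.
  destruct (Lint_spec (Efac x (fun y => / om y ^ 4)%C) _ K0 (fun y => cont_Efac _ _ y C4) (Efac_bound x _ _ B0)) as [L0 _].
  destruct (Lint_spec (Efac x (fun y => om y * / om y ^ 4)%C) _ K1 (fun y => cont_Efac _ _ y C3) (Efac_bound x _ _ B1)) as [L1 _].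
  fold (J4 x) in L0.
  pose proof (fun y => cont_Efac x _ y C4) as E4. pose proof (fun y => cont_Efac x _ y C3) as E3.
  assert (LA : Limp (fun X => CI (fun y => RtoC x * Efac x (fun y => om y * / om y ^ 4) y + (- RtoC 3) * Efac x (fun y => / om y ^ 4) y)%C (- X) X)
     (RtoC x * Lint (Efac x (fun y => om y * / om y ^ 4)%C) + (- RtoC 3) * J4 x)%C).
  { apply CI_Limp_plus; try (intros y; apply cont_mult; [apply cont_const|auto]); apply CI_Limp_cmult; auto. }
  set (G := fun y => (/ Ci * (Cexp (om y * RtoC x) * / om y ^ 3))%C).
  assert (LB : Limp (fun X => CI (fun y => RtoC x * Efac x (fun y => om y * / om y ^ 4) y + (- RtoC 3) * Efac x (fun y => / om y ^ 4) y)%C (- X) X) (RtoC 0)).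
  { apply (Limp_ext (fun X => G X - G (- X)%R)%C _ _ 0).
    - intros X HX. symmetry. apply CI_FTC; [lra| |].
      + intros y _. unfold G, Efac. eapply Rder_val.
        * apply Rder_cmult. apply Rder_mult.
          -- apply Rder_Cexp. apply (Rder_mult om (fun _ => RtoC x)); [apply Rder_om|apply Rder_const].
          -- apply (Rder_comp_Cder (fun z => / z)%C (fun y => om y ^ 3)%C); [apply Cder_inv, Cpow_nz, om_nz|].
             apply (Rder_comp_Cder (fun z => z ^ 3)%C om); [apply Cder_pow|apply Rder_om].
        * cbv beta. simpl (INR 3). pose proof (om_nz y). pose proof Ci_nz.
          replace (1 + 1 + 1)%R with 3 by ring. field. auto.
      + intros y _. apply cont_plus; apply cont_mult; auto using cont_const.
    - intros eps He. set (Ke := exp (c * x)). assert (HKe : 0 < Ke) by apply exp_pos.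
      exists (1 + 2 * Ke / eps). intros X HX.
      assert (HX1 : 1 <= X) by (assert (0 < 2 * Ke / eps) by (apply Rdiv_lt_0_compat; lra); lra).
      assert (HG : forall y, X <= Rabs y -> Cmod (G y) <= Ke / X).
      { intros y Hy. unfold G. rewrite !Cmod_mult, Cmod_inv by apply Ci_nz. rewrite Cmod_Ci, Rinv_1, Rmult_1_l, Cmod_exp_om.
        rewrite Cmod_inv by (apply Cpow_nz, om_nz). rewrite Cmod_pow. fold Ke. unfold Rdiv. apply Rmult_le_compat_l; [lra|].
        assert (Hoy : X <= Cmod (om y)) by (eapply Rle_trans; [exact Hy|apply (im_le_Cmod (om y))]).
        apply Rinv_le_contravar; [lra|]. apply Rle_trans with (X ^ 3); [|apply pow_incr; lra]. simpl. nra. }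
      replace (G X - G (- X)%R - RtoC 0)%C with (G X - G (- X)%R)%C by ring.
      eapply Rle_lt_trans; [apply Cmod_sub_triangle|].
      pose proof (HG X ltac:(rewrite Rabs_pos_eq; lra)). pose proof (HG (- X) ltac:(rewrite Rabs_Ropp, Rabs_pos_eq; lra)).
      assert (Ke / X < eps / 2); [|lra].
      apply Rmult_lt_reg_r with (2 * X / eps); [apply Rdiv_lt_0_compat; lra|].
      replace (Ke / X * (2 * X / eps)) with (2 * Ke / eps) by (field; lra). replace (eps / 2 * (2 * X / eps)) with X by (field; lra). lra. }
  pose proof (Limp_unique _ _ _ LA LB) as E.
  replace (RtoC x * Lint (Efac x (fun y => om y * / om y ^ 4)%C))%C
    with ((RtoC x * Lint (Efac x (fun y => om y * / om y ^ 4)%C) + - RtoC 3 * J4 x) + RtoC 3 * J4 x)%C by ring. rewrite E. ring.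
Qed.

Lemma J4_Rder x : Rder J4 x (Lint (Efac x (fun y => om y * / om y ^ 4)%C)).
Proof. apply (Lint_Rder _ 1); [lra|apply cont_om_inv_pow|apply om_inv4_bound]. Qed.

Lemma J4_cubic x : 0 < x -> J4 x = (RtoC (x ^ 3) * J4 1)%C.
Proof.
  intros Hx. set (g := fun t => (RtoC (/ t ^ 3) * J4 t)%C).
  assert (Dg : forall t, 0 < t -> Rder g t (RtoC 0)).
  { intros t Ht. eapply Rder_val.
    - apply Rder_mult; [|apply J4_Rder]. apply (Rder_RtoC (fun t => / t ^ 3) t (- 3 / t ^ 4)).
      auto_derive; [assert (H3 : 0 < t ^ 3) by (apply pow_lt; auto); simpl in H3; lra|]. field. lra.
    - cbv beta. pose proof (J4_ode t) as E. set (L := Lint (Efac t (fun y => om y * / om y ^ 4)%C)) in *.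
      assert (Ht' : RtoC t <> RtoC 0) by (apply RtoC_nz; lra).
      replace (- 3 / t ^ 4) with (- (3 * (/ t ^ 3 * / t))) by (field; lra).
      rewrite RtoC_opp, !RtoC_mult, (RtoC_inv t) by lra.
      replace L with (/ RtoC t * (RtoC t * L))%C by (field; auto). rewrite E. ring. }
  assert (Eg : g x = g 1).
  { destruct (Rle_dec x 1).
    - symmetry. apply C_const_of_Rder0; auto; [intros t Ht; eapply Rder_cont; apply Dg; lra|intros; apply Dg; lra].
    - apply C_const_of_Rder0; [lra|intros t Ht; eapply Rder_cont; apply Dg; lra|intros; apply Dg; lra]. }
  unfold g in Eg. assert (Hx3 : x ^ 3 <> 0) by (apply pow_nonzero; lra).
  replace (J4 x) with (RtoC (x ^ 3) * (RtoC (/ x ^ 3) * J4 x))%C.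
  - rewrite Eg. rewrite pow1, Rinv_1. ring.
  - rewrite Cmult_assoc, <- RtoC_mult, Rinv_r by auto. ring.
Qed.

End Line.

(** * Nevanlinna's theorem *)

(** For [n = 0] this is the inverse Laplace transform of the first four terms of the expansion, and
    the index [n] shifts the coefficients. Its derivative is [pol A (n + 1)] up to the top cubic
    term, which [D_Rder] supplies. *)
Definition pol (A : nat -> C) (n : nat) (x : R) : C :=
  (A n + (A (n + 1)%nat * RtoC x + (A (n + 2)%nat * RtoC (x ^ 2 / 2) + A (n + 3)%nat * RtoC (x ^ 3 / 6))))%C.

Lemma pol_Rder A n x : Rder (pol A n) x (pol A (S n) x - A (n + 4)%nat * RtoC (x ^ 3 / 6))%C.
Proof.
  eapply Rder_val.
  - apply Rder_plus; [apply Rder_const|]. apply Rder_plus; [apply Rder_cmult, Rder_id|].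
    apply Rder_plus; apply Rder_cmult.
    + apply (Rder_RtoC (fun x => x ^ 2 / 2) x x). auto_derive; auto. field.
    + apply (Rder_RtoC (fun x => x ^ 3 / 6) x (x ^ 2 / 2)). auto_derive; auto. field.
  - unfold pol. replace (S n + 1)%nat with (n + 2)%nat by lia. replace (S n + 2)%nat with (n + 3)%nat by lia.
    replace (S n + 3)%nat with (n + 4)%nat by lia. replace (S n) with (n + 1)%nat by lia. ring.
Qed.

Lemma pol_0 A n : pol A n 0 = A n.
Proof. unfold pol. replace (0 ^ 2 / 2) with 0 by field. replace (0 ^ 3 / 6) with 0 by field. ring. Qed.

Lemma exp_ge_pow3 y : 0 <= y -> y ^ 3 <= 27 * exp y.
Proof.
  intros Hy. pose proof (exp_ineq1_le (y / 3)) as H. replace y with (y / 3 + y / 3 + y / 3) at 2 by field. rewrite !exp_plus.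
  assert (0 <= y / 3 <= exp (y / 3)) by lra. assert (H2 : (y / 3) ^ 3 <= exp (y / 3) ^ 3) by (apply pow_incr; lra). simpl in *. lra.
Qed.

(** Powers of [x] are absorbed by [exp (c x)]: with [y = c x], the bounds [y^2 <= 4 exp y] and
    [y^3 <= 27 exp y], divided by 2 and 6, give the constants 2 and 5, the latter rounded up. *)
Lemma pol_bound A n c Z x : 0 < c -> 0 <= x -> (forall i, (i <= 3)%nat -> Cmod (A (n + i)%nat) <= Z) ->
  Cmod (pol A n x) <= Z * (1 + 1 / c + 2 / c ^ 2 + 5 / c ^ 3) * exp (c * x).
Proof.
  intros Hc Hx HA. assert (H0 := HA 0%nat ltac:(lia)). assert (H1 := HA 1%nat ltac:(lia)). assert (H2 := HA 2%nat ltac:(lia)). assert (H3 := HA 3%nat ltac:(lia)).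
  rewrite Nat.add_0_r in H0. assert (HZ : 0 <= Z) by (eapply Rle_trans; [apply Cmod_ge_0|exact H0]).
  set (E := exp (c * x)). assert (Hcx : 0 <= c * x) by nra.
  assert (E0 : 1 <= E) by (unfold E; rewrite <- exp_0; apply exp_le; auto).
  assert (E1 : x <= 1 / c * E).
  { pose proof (exp_ineq1_le (c * x)) as H. fold E in H. apply Rmult_le_reg_l with c; auto. replace (c * (1 / c * E)) with E by (field; lra). lra. }
  assert (E2 : x ^ 2 / 2 <= 2 / c ^ 2 * E).
  { pose proof (sq_le_exp (c * x) Hcx) as H. fold E in H. apply Rmult_le_reg_l with (2 * c ^ 2); [nra|].
    replace (2 * c ^ 2 * (x ^ 2 / 2)) with ((c * x) ^ 2) by field. replace (2 * c ^ 2 * (2 / c ^ 2 * E)) with (4 * E) by (field; lra). lra. }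
  assert (E3 : x ^ 3 / 6 <= 5 / c ^ 3 * E).
  { pose proof (exp_ge_pow3 (c * x) Hcx) as H. fold E in H. assert (0 < c ^ 3) by (apply pow_lt; auto). apply Rmult_le_reg_l with (6 * c ^ 3); [lra|].
    replace (6 * c ^ 3 * (x ^ 3 / 6)) with ((c * x) ^ 3) by field. replace (6 * c ^ 3 * (5 / c ^ 3 * E)) with (30 * E) by (field; lra). lra. }
  assert (P2 : 0 <= x ^ 2 / 2) by nra. assert (P3 : 0 <= x ^ 3 / 6) by (assert (0 <= x ^ 3) by (apply pow_le; auto); lra).
  assert (T : forall k y F, Cmod k <= Z -> 0 <= y <= F -> Cmod (k * RtoC y) <= Z * F).
  { intros k y F Hk Hy. rewrite Cmod_mult, Cmod_R, Rabs_pos_eq by lra. apply Rmult_le_compat; auto using Cmod_ge_0; lra. }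
  unfold pol. eapply Rle_trans; [apply Cmod_triangle|].
  pose proof (Cmod_triangle (A (n + 1)%nat * RtoC x) (A (n + 2)%nat * RtoC (x ^ 2 / 2) + A (n + 3)%nat * RtoC (x ^ 3 / 6))) as T1.
  pose proof (Cmod_triangle (A (n + 2)%nat * RtoC (x ^ 2 / 2)) (A (n + 3)%nat * RtoC (x ^ 3 / 6))) as T2.
  pose proof (T _ _ _ H1 (conj Hx E1)). pose proof (T _ _ _ H2 (conj P2 E2)). pose proof (T _ _ _ H3 (conj P3 E3)).
  assert (Cmod (A n) <= Z * E) by nra. replace (Z * (1 + 1 / c + 2 / c ^ 2 + 5 / c ^ 3) * E) with (Z * E + (Z * (1 / c * E) + (Z * (2 / c ^ 2 * E) + Z * (5 / c ^ 3 * E)))) by ring. lra.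
Qed.

Lemma pol_Lap A c w : 0 < c -> c < Re w ->
  Limp (fun X => CI (fun x => pol A 0 x * Cexp (- (w * RtoC x)))%C 0 X) (csum (fun j => A j / w ^ S j)%C 4).
Proof.
  (* Cutting the sequence after four terms makes [pol T] an exact jet whose member of index 4 is 0,
     so its expansion of order 4 has no remainder. *)
  intros Hc Hw. set (T := fun j => if Nat.ltb j 4 then A j else RtoC 0).
  assert (HT : Data (pol T)).
  { intros n. split; [intros x; eapply Rder_cont, pol_Rder|]. intros x _. eapply Rder_val; [apply pol_Rder|].
    replace (T (n + 4)%nat) with (RtoC 0); [ring|]. unfold T. destruct (Nat.ltb_spec (n + 4) 4); [lia|auto]. }
  set (Z := Cmod (A 0%nat) + Cmod (A 1%nat) + Cmod (A 2%nat) + Cmod (A 3%nat)).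
  assert (HZ : forall j, Cmod (T j) <= Z).
  { intros j. unfold T, Z. pose proof (Cmod_ge_0 (A 0%nat)). pose proof (Cmod_ge_0 (A 1%nat)). pose proof (Cmod_ge_0 (A 2%nat)). pose proof (Cmod_ge_0 (A 3%nat)).
    destruct j as [|[|[|[|j]]]]; simpl; try lra. rewrite Cmod_0. lra. }
  set (P := 1 + 1 / c + 2 / c ^ 2 + 5 / c ^ 3).
  assert (HB : DBound (pol T) 1 c (Z * P)).
  { intros n x Hx. eapply Rle_trans; [apply (pol_bound T n c Z x); auto|]. fold P. rewrite pow1, Rdiv_1_r.
    apply Rmult_le_compat_r; [left; apply exp_pos|]. assert (0 <= Z * P).
    { apply Rmult_le_pos; [eapply Rle_trans; [apply Cmod_ge_0|apply (HZ 0%nat)]|]. unfold P.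
      assert (0 < c ^ 3) by (apply pow_lt; auto). assert (0 < c ^ 2) by (apply pow_lt; auto).
      repeat apply Rplus_le_le_0_compat; try lra; left; apply Rdiv_lt_0_compat; lra. }
    rewrite <- (Rmult_1_r (Z * P)) at 1. apply Rmult_le_compat_l; auto. change 1 with (INR 1). apply le_INR. pose proof (lt_O_fact n). lia. }
  pose proof (Lap_data_expansion (pol T) 1 c (Z * P) Rlt_0_1 ltac:(lra) HT HB 4 w Hw) as E.
  destruct (Lap_data_spec (pol T) 1 c (Z * P) Rlt_0_1 HT HB 4 w Hw) as [L4 _].
  assert (E4 : Lap (pol T 4) w = RtoC 0).
  { apply (Limp_unique _ _ _ L4). apply (Limp_ext (fun _ => RtoC 0) _ _ 0); [|apply Limp_const].
    intros X HX. rewrite (CI_ext _ (fun _ => RtoC 0)); auto.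
    - rewrite CI_const by auto. ring.
    - intros x _. unfold pol, T. simpl. ring. }
  destruct (Lap_data_spec (pol T) 1 c (Z * P) Rlt_0_1 HT HB 0 w Hw) as [L0 _].
  assert (E0 : Lap (pol T 0) w = csum (fun j => A j / w ^ S j)%C 4).
  { replace (Lap (pol T 0) w) with ((Lap (pol T 0) w - csum (fun j => pol T j 0 / w ^ S j) 4) + csum (fun j => pol T j 0 / w ^ S j) 4)%C by ring.
    rewrite E, E4. rewrite (csum_ext (fun j => pol T j 0 / w ^ S j)%C (fun j => A j / w ^ S j)%C).
    - unfold Cdiv at 1. ring.
    - intros k Hk. rewrite pol_0. unfold T. destruct (Nat.ltb_spec k 4); [auto|lia]. }
  rewrite <- E0. apply (Limp_ext (fun X => CI (fun x => pol T 0 x * Cexp (- (w * RtoC x)))%C 0 X) _ _ 0); auto.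
Qed.

(** By [J4_cubic] only the value at 1 is missing. It is read off at the single point [w = 2 c], by
    computing the Laplace transform of [J4] twice: [Lint_Laplace] with [line_cauchy] gives
    [2 PI / w^4], and [pol_Lap] gives [6 J4 1 / w^4]. *)
Lemma J4_eq c x : 0 < c -> 0 < x -> J4 c x = RtoC (2 * PI * (x ^ 3 / 6)).
Proof.
  intros Hc Hx. set (w := RtoC (2 * c)).
  assert (Hw : c < Re w) by (unfold w; simpl; lra).
  assert (Hwn : w <> RtoC 0) by (apply RtoC_nz; lra).
  pose proof (Lint_Laplace c Hc (fun y => / om c y ^ 4)%C 1 w Rle_0_1 (cont_om_inv_pow c Hc 4) (om_inv4_bound c Hc) Hw) as L1.
  assert (L2 : Limp (fun X => CI (fun y => / om c y ^ 4 * / (w - om c y))%C (- X) X) (RtoC (2 * PI) * / w ^ 4)%C).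
  { apply (line_cauchy c Hc (fun z => / z ^ 4)%C (/ c ^ 2) w Hw); [left; apply Rinv_0_lt_compat, pow_lt; auto| |].
    - intros z Hz. assert (Hzn : z <> RtoC 0) by (intros E; rewrite E in Hz; simpl in Hz; lra).
      eexists. apply (Cder_comp (fun x => / x)%C (fun z => z ^ 4)%C); [apply Cder_inv, Cpow_nz; auto|apply Cder_pow].
    - intros z Hz. assert (Hzn : z <> RtoC 0) by (intros E; rewrite E in Hz; simpl in Hz; lra).
      assert (Hzc : c <= Cmod z) by (eapply Rle_trans; [exact Hz|]; eapply Rle_trans; [apply Rle_abs|apply re_le_Cmod]).
      rewrite Cmod_inv by (apply Cpow_nz; auto). rewrite Cmod_pow.
      replace (/ c ^ 2 / Cmod z ^ 2) with (/ (c ^ 2 * Cmod z ^ 2)) by (field; lra).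
      apply Rinv_le_contravar; [apply Rmult_lt_0_compat; apply pow_lt; lra|].
      replace (Cmod z ^ 4) with (Cmod z ^ 2 * Cmod z ^ 2) by ring. apply Rmult_le_compat_r; [apply pow2_ge_0|]. apply pow_incr; lra. }
  cbv beta in L1. rewrite (Lint_unique _ _ L2) in L1.
  set (A := fun j : nat => if Nat.eqb j 3 then (RtoC 6 * J4 c 1)%C else RtoC 0).
  assert (L3 := pol_Lap A c w Hc Hw).
  assert (L4 : Limp (fun X => CI (fun x => Lint (Efac c x (fun y => / om c y ^ 4)%C) * Cexp (- (w * RtoC x)))%C 0 X) (csum (fun j => A j / w ^ S j)%C 4)).
  { apply (Limp_ext _ _ _ 0) with (2 := L3). intros X HX. apply CI_ext; auto. intros t Ht. f_equal.
    change (pol A 0 t = J4 c t). rewrite J4_cubic by lra. unfold pol, A. simpl.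
    replace (t * (t * (t * 1)) / 6) with (/ 6 * (t * (t * (t * 1)))) by field. rewrite !RtoC_mult, RtoC_inv by lra. field. }
  pose proof (Limp_unique _ _ _ L1 L4) as E. unfold A in E. cbn [csum Nat.eqb] in E.
  assert (Hw4 : (w ^ 4)%C <> RtoC 0) by (apply Cpow_nz; auto).
  assert (E2 : (RtoC 6 * J4 c 1)%C = RtoC (2 * PI)).
  { replace (RtoC (2 * PI)) with (RtoC (2 * PI) * / w ^ 4 * w ^ 4)%C by (field; auto). rewrite E. field. auto. }
  rewrite J4_cubic by auto. replace (J4 c 1) with (/ RtoC 6 * (RtoC 6 * J4 c 1))%C by (field; apply RtoC_nz; lra).
  rewrite E2, <- RtoC_inv, <- !RtoC_mult by lra. f_equal. field.
Qed.

Lemma fact4_bound r rho : 0 < rho < r -> exists K, 0 <= K /\ forall n, INR (fact (n + 4)) / r ^ n <= K * (INR (fact n) / rho ^ n).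
Proof.
  intros Hr. set (q := rho / r). assert (Hq : 0 <= q < 1).
  { unfold q. split; [apply Rdiv_le_0_compat; lra|]. apply Rmult_lt_reg_r with r; [lra|]. replace (rho / r * r) with rho by (field; lra). lra. }
  (* Each of the four factors [n + 1] to [n + 4] is absorbed by one [n]-th power of the fourth root
     of [rho / r]. *)
  set (s := sqrt (sqrt q)).
  assert (Hs1 : 0 <= sqrt q < 1) by (split; [apply sqrt_pos|rewrite <- sqrt_1; apply sqrt_lt_1; lra]).
  assert (Hs : 0 <= s < 1) by (unfold s; split; [apply sqrt_pos|rewrite <- sqrt_1; apply sqrt_lt_1; lra]).
  assert (Hs4 : (s * s) * (s * s) = q) by (unfold s; rewrite sqrt_sqrt by lra; apply sqrt_sqrt; lra).
  exists (24 * (1 / (1 - s)) ^ 4). split.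
  { apply Rmult_le_pos; [lra|]. apply pow_le. apply Rdiv_le_0_compat; lra. }
  intros n. pose proof (npow_bound s n Hs) as H. pose proof (pos_INR n) as Pn. assert (Hsn : 0 <= s ^ n) by (apply pow_le; lra).
  assert (H4 : ((INR n + 1) * s ^ n) ^ 4 <= (1 / (1 - s)) ^ 4) by (apply pow_incr; split; [apply Rmult_le_pos; lra|auto]).
  assert (Eq : (s ^ n) ^ 4 = rho ^ n / r ^ n).
  { replace ((s ^ n) ^ 4) with ((s ^ n * s ^ n) * (s ^ n * s ^ n)) by ring. rewrite <- !Rpow_mult_distr, Hs4. unfold q, Rdiv. rewrite Rpow_mult_distr, pow_inv. reflexivity. }
  assert (Hp : 0 < rho ^ n) by (apply pow_lt; lra). assert (Hp2 : 0 < r ^ n) by (apply pow_lt; lra).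
  assert (F : INR (fact (n + 4)) = (INR n + 4) * ((INR n + 3) * ((INR n + 2) * ((INR n + 1) * INR (fact n))))).
  { replace (n + 4)%nat with (S (S (S (S n)))) by lia. change (fact (S (S (S (S n))))) with (S (S (S (S n))) * (S (S (S n)) * (S (S n) * (S n * fact n))))%nat.
    rewrite !mult_INR, !S_INR. ring. }
  rewrite F. pose proof (INR_fact_lt_0 n) as Hf.
  rewrite Rpow_mult_distr, Eq in H4.
  apply Rle_trans with (24 * ((INR n + 1) ^ 4 * (rho ^ n / r ^ n)) * (INR (fact n) / rho ^ n)).
  - replace (24 * ((INR n + 1) ^ 4 * (rho ^ n / r ^ n)) * (INR (fact n) / rho ^ n)) with (24 * (INR n + 1) ^ 4 * INR (fact n) / r ^ n) by (field; lra).
    unfold Rdiv. apply Rmult_le_compat_r; [left; apply Rinv_0_lt_compat; auto|].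
    replace ((INR n + 4) * ((INR n + 3) * ((INR n + 2) * ((INR n + 1) * INR (fact n))))) with (((INR n + 4) * (INR n + 3) * (INR n + 2) * (INR n + 1)) * INR (fact n)) by ring.
    apply Rmult_le_compat_r; [lra|].
    assert (A1 : (INR n + 4) * (INR n + 3) <= 4 * (INR n + 1) * (3 * (INR n + 1))) by (apply Rmult_le_compat; lra).
    assert (A2 : (INR n + 2) * (INR n + 1) <= 2 * (INR n + 1) * (INR n + 1)) by (apply Rmult_le_compat; lra).
    replace (24 * (INR n + 1) ^ 4) with ((4 * (INR n + 1) * (3 * (INR n + 1))) * (2 * (INR n + 1) * (INR n + 1))) by ring.
    rewrite (Rmult_assoc ((INR n + 4) * (INR n + 3))). apply Rmult_le_compat; nra.
  - apply Rmult_le_compat_r; [left; apply Rdiv_lt_0_compat; auto|]. lra.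
Qed.

Section Nevanlinna.

Variables (S : C -> C) (A : nat -> C) (r B Q c : R).
Hypothesis Hr : 0 < r.
Hypothesis HB : 0 < B.
Hypothesis Hc : B < c.
Hypothesis HQ : 0 <= Q.
Hypothesis HS : forall w, B < Re w -> exists l, Cder S w l.

(** [S] names the function being inverted here, hence [Datatypes.S] for the successor. *)
Let rem (n : nat) (w : C) : C := (S w - csum (fun j => A j / w ^ Datatypes.S j) n)%C.

Hypothesis Hrem : forall w n, B < Re w -> (1 <= n)%nat ->
  Cmod (rem n w) <= Q * (INR (fact n) / r ^ n) * / (Cmod w ^ n * (Re w - B)).

Let Kn n := Q * (INR (fact n) / r ^ n) / (c - B).

Lemma nev_c_pos : 0 < c.
Proof. lra. Qed.

Lemma Kn_nonneg n : 0 <= Kn n.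
Proof.
  unfold Kn. apply Rdiv_le_0_compat; [|lra]. apply Rmult_le_pos; [auto|left; apply fact_ratio_pos; auto].
Qed.

Lemma half_plane_nz z : c <= Re z -> z <> RtoC 0 /\ c <= Cmod z.
Proof.
  intros Hz. split; [intros E; rewrite E in Hz; simpl in Hz; lra|].
  eapply Rle_trans; [exact Hz|]. eapply Rle_trans; [apply Rle_abs|apply re_le_Cmod].
Qed.

Lemma rem_bound n z : (1 <= n)%nat -> c <= Re z -> Cmod (rem n z) <= Kn n / Cmod z ^ n.
Proof.
  intros Hn Hz. destruct (half_plane_nz z Hz) as [H1 H2]. assert (Hp : 0 < Cmod z ^ n) by (apply pow_lt; lra).
  eapply Rle_trans; [apply Hrem; [lra|auto]|]. unfold Kn.
  replace (Q * (INR (fact n) / r ^ n) / (c - B) / Cmod z ^ n) with (Q * (INR (fact n) / r ^ n) * / (Cmod z ^ n * (c - B))).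
  - apply Rmult_le_compat_l; [apply Rmult_le_pos; [auto|left; apply fact_ratio_pos; auto]|].
    apply Rinv_le_contravar; [apply Rmult_lt_0_compat; lra|]. apply Rmult_le_compat_l; lra.
  - field. repeat split; try lra. apply pow_nonzero; lra.
Qed.

Lemma rem_Cder n z : c <= Re z -> exists l, Cder (rem n) z l.
Proof.
  intros Hz. destruct (half_plane_nz z Hz) as [H1 _].
  assert (H : exists l, Cder (fun w => csum (fun j => A j / w ^ Datatypes.S j)%C n) z l).
  { induction n as [|k [l IH]]; [exists (RtoC 0); apply (Cder_ext (fun _ => RtoC 0)); [reflexivity|apply Cder_const]|].
    eexists. apply (Cder_ext (fun w => csum (fun j => A j / w ^ Datatypes.S j) k + A k / w ^ Datatypes.S k)%C); [reflexivity|].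
    apply Cder_plus; [exact IH|].
    apply (Cder_cmult (A k) (fun w => / w ^ Datatypes.S k)%C). apply (Cder_comp (fun x => / x)%C (fun w => w ^ Datatypes.S k)%C); [apply Cder_inv, Cpow_nz; auto|apply Cder_pow]. }
  destruct H as [l Hl]. destruct (HS z) as [k Hk]; [lra|]. eexists. apply Cder_minus; eauto.
Qed.

Lemma rem_step n w : rem n w = (rem (Datatypes.S n) w + A n / w ^ Datatypes.S n)%C.
Proof. unfold rem. cbn [csum]. ring. Qed.

(** Multiplication by [w^n] amounts to [n] derivatives in [x]; removing [n + 4] terms of the
    expansion leaves fourth order decay on the line. *)
Let q (n : nat) (y : R) : C := (om c y ^ n * rem (n + 4) (om c y))%C.

Lemma q_cont n y : cont (q n) y.
Proof.
  apply cont_mult; [apply cont_pow, cont_om|]. destruct (rem_Cder (n + 4) (om c y)) as [l Hl]; [simpl; lra|].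
  apply (cont_comp_Cder (rem (n + 4)) (om c) y l); auto. apply cont_om.
Qed.

Lemma pow_rem_bound n z : c <= Re z -> Cmod (z ^ n * rem (n + 4) z) <= Kn (n + 4) / Cmod z ^ 4.
Proof.
  intros Hz. destruct (half_plane_nz z Hz) as [H1 H2]. rewrite Cmod_mult, Cmod_pow.
  assert (Hp : 0 < Cmod z ^ n) by (apply pow_lt; lra).
  apply Rle_trans with (Cmod z ^ n * (Kn (n + 4) / Cmod z ^ (n + 4))); [apply Rmult_le_compat_l; [lra|apply rem_bound; auto; lia]|].
  rewrite pow_add. right. field. split; lra.
Qed.

Lemma q_bound n y : Cmod (q n y) <= Kn (n + 4) / (c ^ 2 + y ^ 2) ^ 2.
Proof.
  rewrite <- om_sq. replace ((Cmod (om c y) ^ 2) ^ 2) with (Cmod (om c y) ^ 4) by ring. apply pow_rem_bound. simpl; lra.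
Qed.

Let D n x := (/ RtoC (2 * PI) * Lint (Efac c x (q n)))%C.

Lemma twoPI_nz : RtoC (2 * PI) <> RtoC 0.
Proof. apply RtoC_nz. pose proof PI_RGT_0. lra. Qed.

(** Differentiation multiplies the integrand by [w], and [w w^n rem (n + 4)] equals
    [w^(n+1) rem (n + 5)] plus [A (n + 4) / w^4]. By [J4_eq] the last term contributes
    [A (n + 4) x^3 / 6], exactly what [pol_Rder] is short of. *)
Lemma D_Rder n x : 0 < x -> Rder (D n) x (D (Datatypes.S n) x + A (n + 4)%nat * RtoC (x ^ 3 / 6))%C.
Proof.
  intros Hx. pose proof nev_c_pos as Hc0. eapply Rder_val.
  - apply Rder_cmult. apply (Lint_Rder c Hc0 (q n) _ x (Kn_nonneg _) (q_cont n) (q_bound n)).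
  - destruct (decay4_shift c Hc0 (q (Datatypes.S n)) _ (Kn_nonneg _) (q_bound (Datatypes.S n))) as [B0 _].
    assert (K0 : 0 <= Kn (Datatypes.S n + 4) / c ^ 2 * exp (c * x)).
    { apply Rmult_le_pos; [apply Rdiv_le_0_compat; [apply Kn_nonneg|apply pow_lt; auto]|left; apply exp_pos]. }
    destruct (Lint_spec c Hc0 (Efac c x (q (Datatypes.S n))) _ K0 (fun y => cont_Efac c x _ y (q_cont _)) (Efac_bound c x _ _ B0)) as [L1 _].
    destruct (decay4_shift c Hc0 _ 1 Rle_0_1 (om_inv4_bound c Hc0)) as [B4 _].
    assert (K4 : 0 <= 1 / c ^ 2 * exp (c * x)) by (apply Rmult_le_pos; [apply Rdiv_le_0_compat; [lra|apply pow_lt; auto]|left; apply exp_pos]).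
    destruct (Lint_spec c Hc0 (Efac c x (fun y => / om c y ^ 4)%C) _ K4 (fun y => cont_Efac c x _ y (cont_om_inv_pow c Hc0 4)) (Efac_bound c x _ _ B4)) as [L2 _].
    assert (L : Limp (fun X => CI (Efac c x (fun y => om c y * q n y)%C) (- X) X) (Lint (Efac c x (q (Datatypes.S n))) + A (n + 4)%nat * J4 c x)%C).
    { apply (CI_Limp_ext (fun y => Efac c x (q (Datatypes.S n)) y + A (n + 4)%nat * Efac c x (fun y => / om c y ^ 4) y)%C).
      - intros y. unfold Efac, q. pose proof (om_nz c Hc0 y) as Hn. rewrite (rem_step (n + 4)).
        replace (Datatypes.S n + 4)%nat with (Datatypes.S (n + 4)) by lia. rewrite !Cpow_S, !Cpow_add_r.
        assert (Hpn : (om c y ^ n)%C <> RtoC 0) by (apply Cpow_nz; auto). field. repeat split; auto using Cpow_nz.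
      - apply CI_Limp_plus; auto.
        + intros y; apply cont_Efac; auto; apply q_cont.
        + intros y. apply cont_mult; [apply cont_const|apply cont_Efac, cont_om_inv_pow; auto].
        + apply CI_Limp_cmult; [intros y; apply cont_Efac, cont_om_inv_pow; auto|exact L2]. }
    rewrite (Lint_unique _ _ L), J4_eq by auto. unfold D. rewrite (RtoC_mult (2 * PI)). field. apply twoPI_nz.
Qed.

(** At [x = 0] the exponential disappears and the integrand is holomorphic with enough decay on the
    half-plane for [line_zero]. *)
Lemma D_0 n : D n 0 = RtoC 0.
Proof.
  pose proof nev_c_pos as Hc0. unfold D.
  assert (L : Limp (fun X => CI (Efac c 0 (q n)) (- X) X) (RtoC 0)).
  { apply (CI_Limp_ext (q n)).
    - intros y. unfold Efac. replace (om c y * RtoC 0)%C with (RtoC 0) by ring. rewrite Cexp_0. ring.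
    - apply (line_zero c (fun z => z ^ n * rem (n + 4) z)%C (Kn (n + 4) / c ^ 2) 1).
      + intros z Hz. destruct (rem_Cder (n + 4) z Hz) as [l Hl]. destruct n as [|k].
        * eexists. apply Cder_mult; [apply (Cder_const (RtoC 1))|exact Hl].
        * eexists. apply Cder_mult; [apply Cder_pow|exact Hl].
      + apply Rdiv_le_0_compat; [apply Kn_nonneg|apply pow_lt; auto].
      + intros z Hz H1. destruct (half_plane_nz z Hz) as [H2 H3]. eapply Rle_trans; [apply pow_rem_bound; auto|].
        unfold Rdiv. rewrite Rmult_assoc, <- Rinv_mult. apply Rmult_le_compat_l; [apply Kn_nonneg|].
        apply Rinv_le_contravar; [apply Rmult_lt_0_compat; apply pow_lt; lra|].
        replace (Cmod z ^ 4) with (Cmod z ^ 2 * Cmod z ^ 2) by ring. pose proof (Cmod_sub_c c Hc0 z Hz).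
        apply Rmult_le_compat; try (apply pow_incr); try apply pow2_ge_0; lra. }
  rewrite (Lint_unique _ _ L). ring.
Qed.

Lemma D_bound n x : Cmod (D n x) <= Kn (n + 4) / c ^ 3 * exp (c * x).
Proof.
  pose proof nev_c_pos as Hc0. pose proof PI_RGT_0 as Hpi. unfold D. rewrite Cmod_mult, Cmod_inv, Cmod_R, Rabs_pos_eq by (apply twoPI_nz || lra).
  destruct (decay4_shift c Hc0 (q n) _ (Kn_nonneg _) (q_bound n)) as [B0 _].
  assert (K0 : 0 <= Kn (n + 4) / c ^ 2 * exp (c * x)).
  { apply Rmult_le_pos; [apply Rdiv_le_0_compat; [apply Kn_nonneg|apply pow_lt; auto]|left; apply exp_pos]. }
  destruct (Lint_spec c Hc0 (Efac c x (q n)) _ K0 (fun y => cont_Efac c x _ y (q_cont _)) (Efac_bound c x _ _ B0)) as [_ [L1 _]].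
  apply Rle_trans with (/ (2 * PI) * (Kn (n + 4) / c ^ 2 * exp (c * x) * PI / c)); [apply Rmult_le_compat_l; [left; apply Rinv_0_lt_compat; lra|auto]|].
  replace (/ (2 * PI) * (Kn (n + 4) / c ^ 2 * exp (c * x) * PI / c)) with (/ 2 * (Kn (n + 4) / c ^ 3 * exp (c * x))) by (field; lra).
  assert (0 <= Kn (n + 4) / c ^ 3 * exp (c * x)).
  { apply Rmult_le_pos; [apply Rdiv_le_0_compat; [apply Kn_nonneg|apply pow_lt; auto]|left; apply exp_pos]. }
  lra.
Qed.

Lemma coef_bound : exists KA, 0 <= KA /\ forall j, Cmod (A j) <= KA * (INR (fact (j + 1)) / r ^ j).
Proof.
  pose proof nev_c_pos as Hc0. set (K1 := Q / (c - B) * (c + / r)).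
  assert (HK1 : 0 <= K1).
  { unfold K1. apply Rmult_le_pos; [apply Rdiv_le_0_compat; lra|]. assert (0 < / r) by (apply Rinv_0_lt_compat; auto). lra. }
  (* The remainder estimates start at order 1, so differences of successive remainders at [w = c]
     give [A j] for [j >= 1] only; [A 0] is added by hand. *)
  exists (K1 + Cmod (A 0%nat)). pose proof (Cmod_ge_0 (A 0%nat)) as P0. split; [lra|]. intros j.
  assert (Hf : 1 <= INR (fact (j + 1))) by (change 1 with (INR 1); apply le_INR; pose proof (lt_O_fact (j + 1)); lia).
  destruct j as [|k].
  { simpl. replace (1 / 1) with 1 by field. lra. }
  set (j := Datatypes.S k) in *. set (w := RtoC c).
  assert (Hw : c <= Re w) by (simpl; lra). assert (Cw : Cmod w = c) by (unfold w; rewrite Cmod_R, Rabs_pos_eq; lra).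
  assert (Hwn : w <> RtoC 0) by (apply RtoC_nz; lra).
  assert (E : A j = ((rem j w - rem (Datatypes.S j) w) * w ^ Datatypes.S j)%C).
  { rewrite (rem_step j w). field. apply Cpow_nz; auto. }
  rewrite E, Cmod_mult, Cmod_pow, Cw.
  pose proof (rem_bound j w ltac:(unfold j; lia) Hw) as R1. pose proof (rem_bound (Datatypes.S j) w ltac:(unfold j; lia) Hw) as R2. rewrite Cw in R1, R2.
  pose proof (Cmod_sub_triangle (rem j w) (rem (Datatypes.S j) w)) as T.
  assert (Hcj : 0 < c ^ j) by (apply pow_lt; auto). assert (Hrj : 0 < r ^ j) by (apply pow_lt; auto).
  apply Rle_trans with ((Kn j / c ^ j + Kn (Datatypes.S j) / c ^ Datatypes.S j) * c ^ Datatypes.S j).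
  { apply Rmult_le_compat_r; [apply pow_le; lra|lra]. }
  assert (Ffact : INR (fact j) <= INR (fact (j + 1))) by (apply le_INR; apply fact_le; lia).
  replace ((Kn j / c ^ j + Kn (Datatypes.S j) / c ^ Datatypes.S j) * c ^ Datatypes.S j)
    with (Q / (c - B) * (c * (INR (fact j) / r ^ j) + / r * (INR (fact (j + 1)) / r ^ j))).
  - apply Rle_trans with (K1 * (INR (fact (j + 1)) / r ^ j)).
    + unfold K1. rewrite Rmult_assoc. apply Rmult_le_compat_l; [apply Rdiv_le_0_compat; lra|].
      rewrite Rmult_plus_distr_r. apply Rplus_le_compat_r. apply Rmult_le_compat_l; [lra|]. unfold Rdiv. apply Rmult_le_compat_r; [left; apply Rinv_0_lt_compat; auto|auto].
    + apply Rmult_le_compat_r; [apply Rdiv_le_0_compat; lra|lra].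
  - unfold Kn. replace (j + 1)%nat with (Datatypes.S j) by lia. simpl pow. field. repeat split; try lra; apply pow_nonzero; lra.
Qed.

(** The jet is [pol A n + D n]: the cubic corrections in [pol_Rder] and [D_Rder] cancel, and
    [D n 0 = 0] leaves the values [A n] at the origin. In the Laplace transform [pol] contributes
    the first four terms and [D 0], through [line_cauchy], the remainder [rem 4 w]. *)
Theorem nevanlinna rho : 0 < rho < r ->
  exists d M, Data d /\ DBound d rho c M /\ (forall n, d n 0 = A n) /\ forall w, c < Re w -> Lap (d 0%nat) w = S w.
Proof.
  intros Hrho. pose proof nev_c_pos as Hc0.
  set (e := fun n x => (pol A n x + D n x)%C).
  assert (De : forall n x, 0 < x -> Rder (e n) x (e (Datatypes.S n) x)).
  { intros n x Hx. eapply Rder_val; [apply Rder_plus; [apply pol_Rder|apply D_Rder; auto]|]. unfold e. ring. }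
  assert (DD : forall n x, exists l, Rder (D n) x l).
  { intros n x. eexists. apply Rder_cmult. apply (Lint_Rder c Hc0 (q n) _ x (Kn_nonneg _) (q_cont n) (q_bound n)). }
  assert (Ce : forall n x, cont (e n) x).
  { intros n x. apply cont_plus; [eapply Rder_cont, pol_Rder|]. destruct (DD n x) as [l Hl]. eapply Rder_cont; exact Hl. }
  assert (E0 : forall n, e n 0 = A n) by (intros n; unfold e; rewrite pol_0, D_0; ring).
  set (d := fun n x => e n (Rmax 0 x)).
  assert (HD : Data d).
  { apply Data_mk; auto. intros n eps He. destruct (proj1 (cont_eps _ _) (Ce n 0) eps He) as [del [Hdel Hy]].
    exists del. split; auto. intros y Hy0. apply Hy. rewrite Rminus_0_r, Rabs_pos_eq; lra. }
  destruct coef_bound as [KA [HKA HA]]. destruct (fact4_bound r rho Hrho) as [K4 [HK4 HF]].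
  set (P := 1 + 1 / c + 2 / c ^ 2 + 5 / c ^ 3).
  assert (HP : 0 <= P).
  { unfold P. assert (0 < c ^ 3) by (apply pow_lt; auto). assert (0 < c ^ 2) by (apply pow_lt; auto).
    repeat apply Rplus_le_le_0_compat; try lra; left; apply Rdiv_lt_0_compat; lra. }
  (* Dominates [r^-i] for every [i <= 3], whether [r] is above or below 1. *)
  set (ri := 1 + / r + / r ^ 2 + / r ^ 3).
  assert (I1 : 0 < / r) by (apply Rinv_0_lt_compat; auto).
  assert (I2 : 0 < / r ^ 2) by (apply Rinv_0_lt_compat, pow_lt; auto).
  assert (I3 : 0 < / r ^ 3) by (apply Rinv_0_lt_compat, pow_lt; auto).
  assert (HAi : forall n i, (i <= 3)%nat -> Cmod (A (n + i)%nat) <= KA * ri * (INR (fact (n + 4)) / r ^ n)).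
  { intros n i Hi. eapply Rle_trans; [apply HA|]. rewrite pow_add. assert (Hrn : 0 < r ^ n) by (apply pow_lt; auto).
    assert (Hri : / r ^ i <= ri).
    { unfold ri. destruct i as [|[|[|[|i]]]]; [rewrite pow_O, Rinv_1; lra|rewrite pow_1; lra|lra|lra|lia]. }
    assert (Hff : INR (fact (n + i + 1)) <= INR (fact (n + 4))) by (apply le_INR, fact_le; lia).
    pose proof (INR_fact_lt_0 (n + i + 1)). rewrite Rmult_assoc. apply Rmult_le_compat_l; auto.
    replace (INR (fact (n + i + 1)) / (r ^ n * r ^ i)) with (/ r ^ i * (INR (fact (n + i + 1)) / r ^ n)) by (field; split; [apply pow_nonzero; lra|lra]).
    apply Rmult_le_compat; auto; [left; apply Rinv_0_lt_compat, pow_lt; auto|apply Rdiv_le_0_compat; lra|].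
    unfold Rdiv. apply Rmult_le_compat_r; [left; apply Rinv_0_lt_compat; auto|auto]. }
  set (M := KA * ri * K4 * P + Q / (c - B) * / r ^ 4 / c ^ 3 * K4).
  assert (HBd : DBound d rho c M).
  { intros n x Hx. unfold d, e. rewrite Rmax_right by auto. eapply Rle_trans; [apply Cmod_triangle|].
    specialize (HF n). set (Fn := INR (fact (n + 4)) / r ^ n) in *. set (G := INR (fact n) / rho ^ n) in *. pose proof (exp_pos (c * x)) as Pe.
    assert (HFn : 0 < Fn) by (apply Rdiv_lt_0_compat; [apply INR_fact_lt_0|apply pow_lt; auto]).
    assert (HKr : 0 <= KA * ri) by (apply Rmult_le_pos; [auto|unfold ri; lra]).
    pose proof (pol_bound A n c (KA * ri * Fn) x Hc0 Hx (HAi n)) as B1. fold P in B1.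
    pose proof (D_bound n x) as B2.
    assert (Hq : 0 <= Q / (c - B) * / r ^ 4 / c ^ 3).
    { apply Rdiv_le_0_compat; [apply Rmult_le_pos; [apply Rdiv_le_0_compat; lra|left; apply Rinv_0_lt_compat, pow_lt; auto]|apply pow_lt; auto]. }
    assert (EK : Kn (n + 4) / c ^ 3 = Q / (c - B) * / r ^ 4 / c ^ 3 * Fn).
    { unfold Kn, Fn. rewrite pow_add. field. repeat split; try lra; apply pow_nonzero; lra. }
    rewrite EK in B2. unfold M. rewrite (Rmult_plus_distr_r (KA * ri * K4 * P)), (Rmult_plus_distr_r (KA * ri * K4 * P * G)).
    apply Rplus_le_compat.
    - eapply Rle_trans; [exact B1|]. apply Rmult_le_compat_r; [lra|].
      replace (KA * ri * K4 * P * G) with (KA * ri * P * (K4 * G)) by ring. replace (KA * ri * Fn * P) with (KA * ri * P * Fn) by ring.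
      apply Rmult_le_compat_l; auto. apply Rmult_le_pos; auto.
    - eapply Rle_trans; [exact B2|]. apply Rmult_le_compat_r; [lra|].
      rewrite (Rmult_assoc (Q / (c - B) * / r ^ 4 / c ^ 3)). apply Rmult_le_compat_l; auto. }
  exists d, M. split; [auto|split; [auto|split]].
  - intros n. unfold d. rewrite Rmax_left by lra. apply E0.
  - intros w Hw. assert (Hrp : 0 < rho) by lra.
    destruct (Lap_data_spec d rho c M Hrp HD HBd 0 w Hw) as [L0 _].
    apply (Limp_unique _ _ _ L0).
    pose proof (pol_Lap A c w Hc0 Hw) as L1.
    pose proof (Lint_Laplace c Hc0 (q 0) _ w (Kn_nonneg _) (q_cont 0) (q_bound 0) Hw) as L2.
    assert (L3 : Limp (fun X => CI (fun y => q 0 y * / (w - om c y))%C (- X) X) (RtoC (2 * PI) * rem 4 w)%C).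
    { apply (CI_Limp_ext (fun y => rem 4 (om c y) * / (w - om c y))%C); [intros y; unfold q; simpl; ring|].
      apply (line_cauchy c Hc0 (rem 4) (Kn 4 / c ^ 2) w Hw).
      - apply Rdiv_le_0_compat; [apply Kn_nonneg|apply pow_lt; auto].
      - intros z Hz. apply rem_Cder; auto.
      - intros z Hz. destruct (half_plane_nz z Hz) as [H2 H3]. eapply Rle_trans; [apply rem_bound; auto; lia|].
        unfold Rdiv. rewrite Rmult_assoc, <- Rinv_mult. apply Rmult_le_compat_l; [apply Kn_nonneg|].
        apply Rinv_le_contravar; [apply Rmult_lt_0_compat; apply pow_lt; lra|].
        replace (Cmod z ^ 4) with (Cmod z ^ 2 * Cmod z ^ 2) by ring. apply Rmult_le_compat_r; [apply pow2_ge_0|]. apply pow_incr; lra. }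
    rewrite (Lint_unique _ _ L3) in L2.
    apply (Limp_ext (fun X => CI (fun x => pol A 0 x * Cexp (- (w * RtoC x))) 0 X + / RtoC (2 * PI) * CI (fun x => Lint (Efac c x (q 0)) * Cexp (- (w * RtoC x))) 0 X)%C _ _ 0).
    + intros X HX. assert (CL : forall x, cont (fun x => Lint (Efac c x (q 0))) x).
      { intros x. eapply Rder_cont. apply (Lint_Rder c Hc0 (q 0) _ x (Kn_nonneg _) (q_cont 0) (q_bound 0)). }
      rewrite <- CI_cmult; [|auto|intros x _; apply cont_mult; [apply CL|apply cont_Cexp_lin]].
      rewrite <- CI_plus; [|auto| |].
      * apply CI_ext; auto. intros x Hx. unfold d, e, D. rewrite Rmax_right by lra. ring.
      * intros x _. apply cont_mult; [eapply Rder_cont, pol_Rder|apply cont_Cexp_lin].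
      * intros x _. apply cont_mult; [apply cont_const|]. apply cont_mult; [apply CL|apply cont_Cexp_lin].
    + replace (S w) with (csum (fun j => A j / w ^ Datatypes.S j) 4 + / RtoC (2 * PI) * (RtoC (2 * PI) * rem 4 w))%C.
      * apply Limp_plus; auto. apply Limp_cmult; auto.
      * replace (/ RtoC (2 * PI) * (RtoC (2 * PI) * rem 4 w))%C with (rem 4 w) by (field; apply twoPI_nz). unfold rem. ring.
Qed.

End Nevanlinna.

(** * Logarithms *)

Definition Clog1 (s : C) : C := (ln (Cmod s), atan (Im s / Re s)).

Lemma Cexp_Clog1 s : 0 < Re s -> Cexp (Clog1 s) = s.
Proof.
  intros Hs. destruct s as [x y]. unfold Re in Hs; simpl in Hs.
  assert (Hn : (x, y) <> RtoC 0) by (intros E; injection E; intros; lra).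
  assert (Hp : 0 < Cmod (x, y)) by (apply Cmod_gt_0; auto).
  assert (E : Cmod (x, y) = x * sqrt (1 + (y / x)²)).
  { unfold Cmod; simpl. rewrite <- (sqrt_square x) at 3 by lra. rewrite <- sqrt_mult_alt by nra. f_equal. unfold Rsqr. field. lra. }
  assert (Hq : 0 < sqrt (1 + (y / x)²)) by (apply sqrt_lt_R0; pose proof (Rle_0_sqr (y / x)); lra).
  unfold Clog1, Cexp. unfold Re at 1 3, Im at 1 3; simpl. rewrite exp_ln by auto.
  unfold Re, Im; simpl. rewrite cos_atan, sin_atan, E. apply Ceq; simpl; field; lra.
Qed.

(** The estimate of the exponential is inverted: with [v = Clog1 (1 + h)], [Cexp_bound_2] gives
    [|h - v| = O(|v|^2)], and continuity of [Clog1] at 1 makes [v] small enough to conclude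
    [|v| <= 2 |h|]. *)
Lemma Clog1_Cder : Cder Clog1 (RtoC 1) (RtoC 1).
Proof.
  assert (HC : forall eta, 0 < eta -> exists del, 0 < del <= 1 / 2 /\ forall h, Cmod h < del -> Cmod (Clog1 (RtoC 1 + h)) <= eta).
  { intros eta He.
    assert (C1 : continuous ln 1) by (apply (ex_derive_continuous ln); auto_derive; lra).
    assert (C2 : continuous atan 0) by (apply (ex_derive_continuous atan); eexists; apply is_derive_atan).
    assert (He2 : 0 < eta / 2) by lra.
    destruct (proj1 (filterlim_locally _ _) C1 (mkposreal _ He2)) as [d1 D1].
    destruct (proj1 (filterlim_locally _ _) C2 (mkposreal _ He2)) as [d2 D2].
    pose proof (cond_pos d1) as P1. pose proof (cond_pos d2) as P2.
    exists (Rmin (1 / 2) (Rmin d1 (d2 / 2))). split; [split; [repeat apply Rmin_pos; lra|apply Rmin_l]|].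
    intros h Hh. assert (H1 : Cmod h < 1 / 2) by (eapply Rlt_le_trans; [exact Hh|apply Rmin_l]).
    assert (H2 : Cmod h < d1) by (eapply Rlt_le_trans; [exact Hh|]; eapply Rle_trans; [apply Rmin_r|apply Rmin_l]).
    assert (H3 : Cmod h < d2 / 2) by (eapply Rlt_le_trans; [exact Hh|]; eapply Rle_trans; [apply Rmin_r|apply Rmin_r]).
    eapply Rle_trans; [apply Cmod_le_sum|]. unfold Clog1. unfold Re at 1, Im at 1; simpl.
    assert (B1 : ball 1 d1 (Cmod (RtoC 1 + h))).
    { change (Rabs (Cmod (RtoC 1 + h) - 1) < d1). apply Rabs_def1.
      - pose proof (Cmod_triangle (RtoC 1) h). rewrite Cmod_1 in H. lra.
      - pose proof (Cmod_sub_rev (RtoC 1) (- h)). rewrite Cmod_1, Cmod_opp in H. replace (RtoC 1 - - h)%C with (RtoC 1 + h)%C in H by ring. lra. }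
    pose proof (re_le_Cmod h) as R1. pose proof (im_le_Cmod h) as R2. pose proof (Rle_abs (- Re h)) as R3. rewrite Rabs_Ropp in R3.
    assert (B2 : ball 0 d2 (Im (RtoC 1 + h) / Re (RtoC 1 + h))).
    { change (Rabs (Im (RtoC 1 + h) / Re (RtoC 1 + h) - 0) < d2). rewrite Rminus_0_r.
      replace (Im (RtoC 1 + h)) with (Im h) by (creim; ring). replace (Re (RtoC 1 + h)) with (1 + Re h) by reflexivity.
      unfold Rdiv. rewrite Rabs_mult, Rabs_inv, (Rabs_pos_eq (1 + Re h)) by lra.
      apply Rmult_lt_reg_r with (1 + Re h); [lra|]. rewrite Rmult_assoc, Rinv_l by lra. nra. }
    specialize (D1 _ B1). specialize (D2 _ B2). change (Rabs (ln (Cmod (RtoC 1 + h)) - ln 1) < eta / 2) in D1.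
    change (Rabs (atan (Im (RtoC 1 + h) / Re (RtoC 1 + h)) - atan 0) < eta / 2) in D2.
    rewrite ln_1, Rminus_0_r in D1. rewrite atan_0, Rminus_0_r in D2. unfold Re, Im in *; simpl in *. lra. }
  assert (L1 : Clog1 (RtoC 1) = RtoC 0).
  { unfold Clog1. rewrite Cmod_1, ln_1. unfold Im, Re; simpl. replace (0 / 1) with 0 by field. rewrite atan_0. reflexivity. }
  intros eps He. set (K := 4 * exp 1). assert (HK : 0 < K) by (unfold K; pose proof (exp_pos 1); lra).
  (* The three thresholds ensure in turn [exp |Re v| <= exp 1], [|v| <= 2 |h|], and a final error of
     at most [eps |h|]. *)
  destruct (HC (Rmin 1 (Rmin (1 / (2 * K)) (eps / (2 * K))))) as [del [Hdel Hh]].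
  { repeat apply Rmin_pos; try lra; apply Rdiv_lt_0_compat; lra. }
  exists del. split; [lra|]. intros h Hlt. specialize (Hh h Hlt). rewrite L1.
  set (v := Clog1 (RtoC 1 + h)) in *.
  assert (V1 : Cmod v <= 1) by (eapply Rle_trans; [exact Hh|apply Rmin_l]).
  assert (V2 : Cmod v <= 1 / (2 * K)) by (eapply Rle_trans; [exact Hh|]; eapply Rle_trans; [apply Rmin_r|apply Rmin_l]).
  assert (V3 : Cmod v <= eps / (2 * K)) by (eapply Rle_trans; [exact Hh|]; eapply Rle_trans; [apply Rmin_r|apply Rmin_r]).
  assert (E : Cexp v = (RtoC 1 + h)%C).
  { apply Cexp_Clog1. pose proof (re_le_Cmod h). pose proof (Rle_abs (- Re h)) as R3. rewrite Rabs_Ropp in R3.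
    replace (Re (RtoC 1 + h)) with (1 + Re h) by reflexivity. lra. }
  pose proof (Cexp_bound_2 v) as H2. rewrite E in H2. replace (RtoC 1 + h - 1 - v)%C with (h - v)%C in H2 by ring.
  pose proof (Cmod_ge_0 v) as Pv.
  assert (H3 : Cmod (h - v) <= K * Cmod v * Cmod v).
  { eapply Rle_trans; [exact H2|]. unfold K. replace (4 * exp 1 * Cmod v * Cmod v) with (4 * (Cmod v * Cmod v) * exp 1) by ring.
    apply Rmult_le_compat_l; [nra|]. apply exp_le. pose proof (re_le_Cmod v). lra. }
  assert (KV1 : K * Cmod v <= 1 / 2).
  { apply Rle_trans with (K * (1 / (2 * K))); [apply Rmult_le_compat_l; lra|right; field; lra]. }
  assert (KV2 : K * Cmod v <= eps / 2).
  { apply Rle_trans with (K * (eps / (2 * K))); [apply Rmult_le_compat_l; lra|right; field; lra]. }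
  assert (Hv : Cmod v <= 2 * Cmod h).
  { pose proof (Cmod_sub_rev v h). rewrite Cmod_sub_sym in H. nra. }
  replace (v - RtoC 0 - RtoC 1 * h)%C with (- (h - v))%C by ring. rewrite Cmod_opp. eapply Rle_trans; [exact H3|]. nra.
Qed.

Lemma local_log u0 : exists L d, 0 < d /\ L (Cexp u0) = u0 /\ (forall z, Cmod (z - Cexp u0) < d -> Cexp (L z) = z) /\
  exists l, Cder L (Cexp u0) l.
Proof.
  set (z0 := Cexp u0). assert (Hz0 : z0 <> RtoC 0) by apply Cexp_nz. assert (Hp : 0 < Cmod z0) by (apply Cmod_gt_0; auto).
  exists (fun z => u0 + Clog1 (/ z0 * z))%C, (Cmod z0 / 2). split; [lra|]. split; [|split].
  - replace (/ z0 * z0)%C with (RtoC 1) by (field; auto).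
    replace (Clog1 (RtoC 1)) with (RtoC 0); [ring|]. unfold Clog1. rewrite Cmod_1, ln_1. unfold Im, Re; simpl. replace (0 / 1) with 0 by field. rewrite atan_0. reflexivity.
  - intros z Hz. rewrite Cexp_plus. fold z0. rewrite Cexp_Clog1; [field; auto|].
    set (h := (/ z0 * (z - z0))%C). replace (/ z0 * z)%C with (RtoC 1 + h)%C by (unfold h; field; auto).
    assert (Hh : Cmod h < 1 / 2).
    { unfold h. rewrite Cmod_mult, Cmod_inv by auto. apply Rmult_lt_reg_l with (Cmod z0); auto. rewrite <- Rmult_assoc, Rinv_r by lra. lra. }
    pose proof (re_le_Cmod h). pose proof (Rle_abs (- Re h)) as R3. rewrite Rabs_Ropp in R3. replace (Re (RtoC 1 + h)) with (1 + Re h) by reflexivity. lra.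
  - eexists. apply Cder_plus; [apply Cder_const|].
    apply (Cder_comp Clog1 (fun z => / z0 * z)%C).
    + replace (/ z0 * z0)%C with (RtoC 1) by (field; auto). apply Clog1_Cder.
    + apply Cder_cmult, Cder_id.
Qed.

(** A half turn or a quarter turn brings the remaining points into the right half-plane, where
    [Clog1] is available. *)
Lemma Cexp_surj z : z <> RtoC 0 -> exists u, Cexp u = z.
Proof.
  intros Hz.
  assert (HI : forall t, Cexp (Ci * RtoC t) = (cos t, sin t)).
  { intros t. unfold Cexp. rewrite re_scal_r, im_scal_r. unfold Ci, Re, Im; simpl. rewrite Rmult_0_l, exp_0, !Rmult_1_l. reflexivity. }
  assert (HR : forall z, 0 < Re z -> exists u, Cexp u = z) by (intros s Hs; exists (Clog1 s); apply Cexp_Clog1; auto).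
  destruct (Rtotal_order (Re z) 0) as [H|[H|H]].
  - destruct (HR (- z)%C) as [u Hu]; [unfold Re in *; simpl; lra|]. exists (u + Ci * RtoC PI)%C.
    rewrite Cexp_plus, Hu, HI, cos_PI, sin_PI. apply Ceq; creim; ring.
  - destruct (Rtotal_order (Im z) 0) as [H2|[H2|H2]].
    + destruct (HR (Ci * z)%C) as [u Hu]; [unfold Re, Im in *; simpl; lra|]. exists (u + Ci * RtoC (- (PI / 2)))%C.
      rewrite Cexp_plus, Hu, HI, cos_neg, sin_neg, cos_PI2, sin_PI2. apply Ceq; creim; ring.
    + exfalso. apply Hz. apply Ceq; simpl; auto.
    + destruct (HR (- Ci * z)%C) as [u Hu]; [unfold Re, Im in *; simpl; lra|]. exists (u + Ci * RtoC (PI / 2))%C.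
      rewrite Cexp_plus, Hu, HI, cos_PI2, sin_PI2. apply Ceq; creim; ring.
  - apply HR; auto.
Qed.

Definition tpi (t : R) : C := (0, 2 * PI * t).

Ltac tcreim := unfold tpi, Re, Im; simpl.

Lemma Cexp_eq_1 u : Cexp u = RtoC 1 -> exists k : Z, u = tpi (IZR k).
Proof.
  intros H. assert (Hm : exp (Re u) = 1) by (rewrite <- Cmod_Cexp, H; apply Cmod_1).
  assert (Hre : Re u = 0) by (apply exp_inv; rewrite exp_0; auto).
  assert (Hcos : cos (Im u) = 1).
  { apply (f_equal Re) in H. unfold Cexp in H. unfold Re at 1 in H. cbn [fst] in H. rewrite Hm in H. unfold Re in H; simpl in H. lra. }
  assert (Hs : sin (Im u / 2) = 0).
  { replace (Im u) with (2 * (Im u / 2)) in Hcos by field. rewrite cos_2a_sin in Hcos. nra. }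
  apply sin_eq_0_0 in Hs. destruct Hs as [k Hk]. exists k. apply Ceq; simpl; [auto|]. unfold Im in *; simpl. lra.
Qed.

Lemma Cexp_2PI k : Cexp (tpi (IZR k)) = RtoC 1.
Proof.
  assert (Hn : forall n : nat, Cexp (tpi (INR n)) = RtoC 1).
  { intros n. unfold Cexp, tpi, Re, Im; simpl. rewrite exp_0, !Rmult_1_l.
    replace (2 * PI * INR n) with (0 + 2 * INR n * PI) by ring. rewrite cos_period, sin_period, cos_0, sin_0. reflexivity. }
  destruct k as [|p|p].
  - replace (tpi (IZR 0)) with (RtoC 0) by (apply Ceq; tcreim; ring). apply Cexp_0.
  - rewrite <- (positive_nat_Z p), <- INR_IZR_INZ. apply Hn.
  - replace (tpi (IZR (Z.neg p)) : C) with (- tpi (INR (Pos.to_nat p)))%C.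
    + rewrite Cexp_opp, Hn. field.
    + rewrite INR_IZR_INZ, positive_nat_Z. change (IZR (Z.neg p)) with (- IZR (Z.pos p)). apply Ceq; tcreim; ring.
Qed.

Lemma Cexp_inj u v : Cexp u = Cexp v -> exists k : Z, u = (v + tpi (IZR k))%C.
Proof.
  intros H. destruct (Cexp_eq_1 (u - v)%C) as [k Hk].
  - unfold Cminus. rewrite Cexp_plus, Cexp_opp, H. field. apply Cexp_nz.
  - exists k. rewrite <- Hk. ring.
Qed.

(** An arbitrary choice of logarithm, without any continuity. It is only composed with a function of
    period [tpi 1], which does not see the choice. *)
Definition Clog (z : C) : C := epsilon (inhabits (RtoC 0)) (fun u => Cexp u = z).

Lemma Cexp_Clog z : z <> RtoC 0 -> Cexp (Clog z) = z.
Proof. intros Hz. apply (epsilon_spec (inhabits (RtoC 0)) (fun u => Cexp u = z)). apply Cexp_surj; auto. Qed.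

(** Near [z], [Clog] differs from a logarithm differentiable at [z] by integral multiples of the
    period of [h], so either may be used to compute [g]. *)
Lemma descend_Cder h z : (forall u, h (u + tpi 1)%C = h u) -> z <> RtoC 0 ->
  (forall u, Cexp u = z -> exists l, Cder h u l) -> forall g, (forall z, z <> RtoC 0 -> g z = h (Clog z)) -> exists l, Cder g z l.
Proof.
  intros Hper Hz Hh g Hg.
  assert (HpN : forall (n : nat) u, h (u + tpi (INR n))%C = h u).
  { induction n as [|n IH]; intros u.
    - f_equal. apply Ceq; tcreim; ring.
    - rewrite <- (IH u), <- (Hper (u + tpi (INR n))%C). f_equal. rewrite S_INR. apply Ceq; tcreim; ring. }
  assert (HpZ : forall (k : Z) u, h (u + tpi (IZR k))%C = h u).
  { intros k u. destruct k as [|p|p].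
    - f_equal. apply Ceq; tcreim; ring.
    - rewrite <- (positive_nat_Z p), <- INR_IZR_INZ. apply HpN.
    - rewrite <- (HpN (Pos.to_nat p)). f_equal. rewrite INR_IZR_INZ, positive_nat_Z. change (IZR (Z.neg p)) with (- IZR (Z.pos p)). apply Ceq; tcreim; ring. }
  destruct (Cexp_surj z Hz) as [u0 Hu0]. destruct (local_log u0) as [L [d [Hd [L0 [L1 [l Hl]]]]]]. rewrite Hu0 in *.
  destruct (Hh u0 Hu0) as [k Hk]. exists (k * l)%C.
  apply (Cder_ext_loc (fun z => h (L z)) g z (k * l)%C d Hd).
  - intros s Hs. assert (E : Cexp (L (z + s)%C) = (z + s)%C) by (apply L1; replace (z + s - z)%C with s by ring; auto).
    assert (Hn : (z + s)%C <> RtoC 0) by (rewrite <- E; apply Cexp_nz).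
    rewrite Hg by auto. destruct (Cexp_inj (Clog (z + s)%C) (L (z + s)%C)) as [j Hj]; [rewrite E; apply Cexp_Clog; auto|].
    rewrite Hj, HpZ. reflexivity.
  - apply (Cder_comp h L); auto. rewrite L0. exact Hk.
Qed.

(** * Splitting a function on the covering into its isotypic components *)

Lemma csum_block b m i0 J : (i0 < m)%nat -> (forall j i, (i < m)%nat -> i <> i0 -> b (m * j + i)%nat = RtoC 0) ->
  csum b (m * J) = csum (fun j => b (m * j + i0)%nat) J.
Proof.
  intros Hi Hb. induction J as [|J IH]; [rewrite Nat.mul_0_r; reflexivity|].
  cbn [csum]. rewrite <- IH. replace (m * S J)%nat with (m * J + m)%nat by lia.
  assert (G : forall k, (k <= m)%nat -> csum b (m * J + k) = (csum b (m * J) + if Nat.ltb i0 k then b (m * J + i0)%nat else RtoC 0)%C).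
  { induction k as [|k IHk]; intros Hk.
    - rewrite Nat.add_0_r. simpl. ring.
    - rewrite Nat.add_succ_r. cbn [csum]. rewrite IHk by lia.
      destruct (Nat.ltb_spec i0 k); destruct (Nat.ltb_spec i0 (S k)); try lia.
      + rewrite (Hb J k) by lia. ring.
      + assert (k = i0) as -> by lia. ring.
      + rewrite (Hb J k) by lia. ring. }
  rewrite G by lia. destruct (Nat.ltb_spec i0 m); [auto|lia].
Qed.

Lemma Cser_block b m i0 s : (i0 < m)%nat -> (forall j i, (i < m)%nat -> i <> i0 -> b (m * j + i)%nat = RtoC 0) ->
  Cser b s -> Cser (fun j => b (m * j + i0)%nat) s.
Proof.
  intros Hi Hb H eps He. destruct (H eps He) as [N HN]. exists N. intros n Hn. rewrite <- (csum_block b m i0 n); auto. apply HN. nia.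
Qed.

Lemma csum_geom w n : ((w - 1) * csum (fun k => w ^ k) n = w ^ n - 1)%C.
Proof. induction n as [|n IH]; cbn [csum]; [simpl; ring|]. rewrite Cmult_plus_distr_l, IH. simpl. ring. Qed.

Lemma csum_const c n : csum (fun _ => c) n = (RtoC (INR n) * c)%C.
Proof. induction n as [|n IH]; cbn [csum]; [simpl; ring|]. rewrite IH, S_INR, RtoC_plus. ring. Qed.

Lemma Cser_csum (b : nat -> nat -> C) (s : nat -> C) m : (forall k, (k < m)%nat -> Cser (b k) (s k)) ->
  Cser (fun n => csum (fun k => b k n) m) (csum s m).
Proof.
  induction m as [|m IH]; intros H.
  - simpl. intros eps He. exists 0%nat. intros n _. rewrite csum_const. replace (RtoC (INR n) * RtoC 0 - RtoC 0)%C with (RtoC 0) by ring. rewrite Cmod_0; auto.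
  - cbn [csum]. apply Cser_plus; auto.
Qed.

Section Components.

Variables (m : nat) (a : nat -> C) (l : nat).
Hypothesis Hl : (1 <= l <= m)%nat.

Let al := INR l / INR m.

Lemma INR_m_nz : INR m <> 0.
Proof. apply not_0_INR. lia. Qed.

Definition hcoef (j : nat) : C := (a (l + m * j)%nat / RtoC (Gamma (al + INR j)))%C.

Variables (F : C -> C) (r rho : R).
Hypothesis Hper : forall u : C, F (u + tpi (INR m))%C = F u.
Hypothesis Hder : forall u : C, InB r (Cexp u) -> exists k, Cder F u k.
Hypothesis Hrho : 0 < rho.
Hypothesis Hser : forall u : C, exp (Re u) < rho -> Cser (borel_term m a u) (F u).

Let psi (u : C) : C := (F u * Cexp (RtoC (1 - al) * u))%C.
Let sh (u : C) (k : nat) : C := (u + tpi (INR k))%C.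
Definition hlog (u : C) : C := (/ RtoC (INR m) * csum (fun k => psi (sh u k)) m)%C.

Lemma Cexp_sh u k : Cexp (sh u k) = Cexp u.
Proof. unfold sh. rewrite Cexp_plus, INR_IZR_INZ, Cexp_2PI. ring. Qed.

(** A turn through all [m] sheets multiplies [zeta^(1 - l/m)] by [exp (2 pi i (m - l)) = 1]. *)
Lemma psi_period u : psi (sh u m) = psi u.
Proof.
  unfold psi, sh. rewrite Hper. f_equal. rewrite Cmult_plus_distr_l, Cexp_plus.
  replace (RtoC (1 - al) * tpi (INR m))%C with (tpi (IZR (Z.of_nat (m - l))) : C); [rewrite Cexp_2PI; ring|].
  rewrite <- INR_IZR_INZ, minus_INR by lia. pose proof INR_m_nz. apply Ceq; unfold al; tcreim; field; auto.
Qed.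

(** One turn permutes the [m] sheets cyclically, so the average descends to the punctured plane. *)
Lemma hlog_period u : hlog (u + tpi 1)%C = hlog u.
Proof.
  unfold hlog. f_equal.
  rewrite (csum_ext _ (fun k => psi (sh u (S k)))).
  2: { intros k _. f_equal. unfold sh. rewrite S_INR. apply Ceq; tcreim; ring. }
  assert (H1 := csum_shift (fun k => psi (sh u k)) m). cbn [csum] in H1. rewrite psi_period in H1.
  replace (sh u 0) with u in H1 by (unfold sh; apply Ceq; tcreim; ring).
  replace (csum (fun k => psi (sh u (S k))) m) with ((psi u + csum (fun k => psi (sh u (S k))) m) - psi u)%C by ring. rewrite <- H1. ring.
Qed.

Lemma hlog_Cder u : InB r (Cexp u) -> exists k, Cder hlog u k.
Proof.
  intros Hu. assert (G : forall n, exists k, Cder (fun u => csum (fun k => psi (sh u k)) n) u k).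
  { induction n as [|n [k IH]]; [exists (RtoC 0); apply (Cder_ext (fun _ => RtoC 0)); [reflexivity|apply Cder_const]|].
    destruct (Hder (sh u n)) as [k1 Hk1]; [rewrite Cexp_sh; auto|].
    eexists. apply (Cder_ext (fun u => csum (fun k => psi (sh u k)) n + psi (sh u n))%C); [reflexivity|].
    apply Cder_plus; [exact IH|]. apply (Cder_comp psi (fun u => sh u n)).
    - unfold psi. apply Cder_mult; [exact Hk1|]. apply (Cder_comp Cexp (fun u => RtoC (1 - al) * u)%C); [apply Cder_Cexp|apply Cder_cmult, Cder_id].
    - unfold sh. apply Cder_plus; [apply Cder_id|apply Cder_const]. }
  destruct (G m) as [k Hk]. eexists. apply Cder_cmult. exact Hk.
Qed.

(** Averaging over the sheets kills all exponents outside one residue class. *)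
Lemma hlog_series u : exp (Re u) < rho -> Cser (fun j => hcoef j * Cexp u ^ j)%C (hlog u).
Proof.
  intros Hu. pose proof INR_m_nz as Hm. assert (HmC : RtoC (INR m) <> RtoC 0) by (apply RtoC_nz; auto).
  set (b := fun n => (/ RtoC (INR m) * csum (fun k => borel_term m a (sh u k) n * Cexp (RtoC (1 - al) * sh u k)) m)%C).
  assert (HS : Cser b (hlog u)).
  { apply Cser_cmult. apply (Cser_csum (fun k n => borel_term m a (sh u k) n * Cexp (RtoC (1 - al) * sh u k))%C (fun k => psi (sh u k))).
    intros k _. unfold psi. apply Cser_ext with (fun n => Cexp (RtoC (1 - al) * sh u k) * borel_term m a (sh u k) n)%C; [intros; ring|].
    rewrite (Cmult_comm (F _)). apply Cser_cmult. apply Hser. unfold sh. replace (Re (u + tpi (INR k))) with (Re u) by (tcreim; ring). auto. }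
  (* The factor gained by the term of index [n] from one sheet to the next: an [m]-th root of unity,
     equal to 1 exactly when [n + 1] is congruent to [l] modulo [m]. *)
  set (om1 := fun n => Cexp (tpi ((INR (S n) - INR l) / INR m))).
  assert (Eb : forall n, b n = (a (S n) / RtoC (Gamma (INR (S n) / INR m)) * Cexp (RtoC ((INR (S n) - INR l) / INR m) * u)
     * (/ RtoC (INR m) * csum (fun k => om1 n ^ k) m))%C).
  { intros n. unfold b. rewrite (csum_ext _ (fun k => (a (S n) / RtoC (Gamma (INR (S n) / INR m)) * Cexp (RtoC ((INR (S n) - INR l) / INR m) * u)) * om1 n ^ k)%C).
    - rewrite csum_cmult. rewrite !Cmult_assoc. f_equal. rewrite <- !Cmult_assoc. rewrite (Cmult_comm (/ RtoC (INR m))). rewrite <- !Cmult_assoc. reflexivity.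
    - intros k _. unfold borel_term, om1. rewrite <- Cexp_nat.
      assert (E : (Cexp (RtoC (INR (S n) / INR m - 1) * sh u k) * Cexp (RtoC (1 - al) * sh u k))%C
        = (Cexp (RtoC ((INR (S n) - INR l) / INR m) * u) * Cexp (RtoC (INR k) * tpi ((INR (S n) - INR l) / INR m)))%C).
      { rewrite <- !Cexp_plus. f_equal. unfold sh, al. apply Ceq; tcreim; field; auto. }
      unfold Cdiv. revert E. generalize (Cexp (RtoC (INR (S n) / INR m - 1) * sh u k)) (Cexp (RtoC (1 - al) * sh u k)) (/ RtoC (Gamma (INR (S n) / INR m)))%C.
      intros x y g E. transitivity (a (S n) * g * (x * y))%C; [ring|rewrite E; ring]. }
  assert (Hz : forall j i, (i < m)%nat -> i <> (l - 1)%nat -> b (m * j + i)%nat = RtoC 0).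
  { intros j i Hi Hne. rewrite Eb. set (n := (m * j + i)%nat). set (w := om1 n).
    assert (Hwm : (w ^ m)%C = RtoC 1).
    { unfold w, om1. rewrite <- Cexp_nat.
      replace (RtoC (INR m) * tpi ((INR (S n) - INR l) / INR m))%C with (tpi (IZR (Z.of_nat (S n) - Z.of_nat l)) : C); [apply Cexp_2PI|].
      rewrite minus_IZR, <- !INR_IZR_INZ. apply Ceq; unfold RtoC; tcreim; field; auto. }
    assert (Hw1 : w <> RtoC 1).
    { intros E. apply Cexp_eq_1 in E. destruct E as [k Hk]. apply (f_equal Im) in Hk. unfold Im in Hk; cbn [snd] in Hk.
      pose proof PI_RGT_0 as Hpi. apply Rmult_eq_reg_l in Hk; [|lra].
      assert (E2 : INR (S n) - INR l = IZR k * INR m) by (rewrite <- Hk; field; auto).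
      rewrite !INR_IZR_INZ, <- minus_IZR, <- mult_IZR in E2. apply eq_IZR in E2. unfold n in E2.
      assert (E3 : (Z.of_nat i + 1 - Z.of_nat l = (k - Z.of_nat j) * Z.of_nat m)%Z) by lia.
      set (kk := (k - Z.of_nat j)%Z) in *. destruct (Z.eq_dec kk 0) as [Hk0|Hk0]; [rewrite Hk0 in E3; lia|]. nia. }
    assert (H0 : csum (fun k => w ^ k)%C m = RtoC 0).
    { assert (Hd : (w - 1)%C <> RtoC 0) by (apply Cminus_eq_contra; auto).
      replace (csum (fun k => w ^ k)%C m) with (/ (w - 1) * ((w - 1) * csum (fun k => w ^ k) m))%C by (field; auto).
      rewrite csum_geom, Hwm. ring. }
    rewrite H0. ring. }
  apply Cser_ext with (fun j => b (m * j + (l - 1))%nat); [|apply Cser_block; auto; lia].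
  intros j. rewrite Eb. replace (S (m * j + (l - 1))) with (l + m * j)%nat by lia.
  assert (Ew : om1 (m * j + (l - 1))%nat = RtoC 1).
  { unfold om1. replace (S (m * j + (l - 1))) with (l + m * j)%nat by lia. rewrite plus_INR, mult_INR.
    replace ((INR l + INR m * INR j - INR l) / INR m) with (IZR (Z.of_nat j)) by (rewrite <- INR_IZR_INZ; field; auto).
    apply Cexp_2PI. }
  rewrite Ew, (csum_ext _ (fun _ => RtoC 1)) by (intros; apply Cpow_1_l). rewrite csum_const. unfold hcoef.
  rewrite plus_INR, mult_INR. replace ((INR l + INR m * INR j) / INR m) with (al + INR j) by (unfold al; field; auto).
  replace ((INR l + INR m * INR j - INR l) / INR m) with (INR j) by (field; auto). rewrite Cexp_nat. field.
  split; [|auto]. apply RtoC_nz. pose proof (Gamma_shift_pos m l Hl j). unfold al. lra.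
Qed.

(** The value at 0 is the one that removes the singularity: the power series of [hlog_series] then
    represents [hz] on a full disc. *)
Definition hz (z : C) : C := if Ceq_dec z (RtoC 0) then hcoef 0 else hlog (Clog z).

Lemma hz_series z : Cmod z < rho -> Cser (fun j => hcoef j * z ^ j)%C (hz z).
Proof.
  intros Hz. unfold hz. destruct (Ceq_dec z (RtoC 0)) as [->|Hn].
  - intros eps He. exists 1%nat. intros [|k] Hk; [lia|].
    rewrite csum_shift. rewrite (csum_ext _ (fun _ => RtoC 0 * RtoC 0)%C) by (intros; rewrite Cpow_S; ring).
    rewrite csum_cmult. replace (hcoef 0 * RtoC 0 ^ 0 + RtoC 0 * csum (fun _ => RtoC 0) k - hcoef 0)%C with (RtoC 0) by (simpl; ring).
    rewrite Cmod_0; auto.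
  - pose proof (Cexp_Clog z Hn) as E. pose proof (hlog_series (Clog z)) as H. rewrite E, <- Cmod_Cexp, E in H. auto.
Qed.

Lemma hz_Cder z : InB r z -> exists k, Cder hz z k.
Proof.
  intros Hz. destruct (Ceq_dec z (RtoC 0)) as [->|Hn].
  - destruct (ps_deriv hcoef hz rho hz_series (RtoC 0)) as [k [_ Hk]]; [rewrite Cmod_0; auto|]. eauto.
  - apply (descend_Cder hlog z hlog_period Hn).
    + intros u Hu. apply hlog_Cder. rewrite Hu. auto.
    + intros s Hs. unfold hz. destruct (Ceq_dec s (RtoC 0)); [contradiction|auto].
Qed.

Variables (A B : R).
Hypothesis HA : 0 < A.
Hypothesis HB : 0 < B.
Hypothesis Hr : 0 < r.
Hypothesis Hgrow : forall u : C, InB r (Cexp u) ->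
  Cmod (F u * Cexp (RtoC (INR (m - 1) / INR m) * u)) <= A * exp (B * Cmod (Cexp u)).

Lemma csum_bound b K n : (forall k, (k < n)%nat -> Cmod (b k) <= K) -> Cmod (csum b n) <= INR n * K.
Proof.
  induction n as [|n IH]; intros H; [simpl; rewrite Cmod_0; lra|]. cbn [csum]. eapply Rle_trans; [apply Cmod_triangle|].
  rewrite S_INR. specialize (IH (fun k Hk => H k (Nat.lt_lt_succ_r _ _ Hk))). specialize (H n (Nat.lt_succ_diag_r n)). lra.
Qed.

Lemma hlog_bound u : InB r (Cexp u) -> Cmod (hlog u) <= A * exp (B * Cmod (Cexp u)) * exp ((1 - INR l) / INR m * Re u).
Proof.
  intros Hu. pose proof INR_m_nz as Hm. assert (Hmp : 0 < INR m) by (apply lt_0_INR; lia).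
  unfold hlog. rewrite Cmod_mult, Cmod_inv, Cmod_R, Rabs_pos_eq by (lra || (apply RtoC_nz; auto)).
  apply Rle_trans with (/ INR m * (INR m * (A * exp (B * Cmod (Cexp u)) * exp ((1 - INR l) / INR m * Re u)))); [|right; field; auto].
  apply Rmult_le_compat_l; [left; apply Rinv_0_lt_compat; auto|]. apply csum_bound. intros k _. unfold psi.
  replace (Cexp (RtoC (1 - al) * sh u k)) with (Cexp (RtoC (INR (m - 1) / INR m) * sh u k) * Cexp (RtoC ((1 - INR l) / INR m) * sh u k))%C.
  - rewrite Cmult_assoc, Cmod_mult. apply Rmult_le_compat; auto using Cmod_ge_0.
    + eapply Rle_trans; [apply Hgrow; rewrite Cexp_sh; auto|]. rewrite Cexp_sh. lra.
    + rewrite Cmod_Cexp, re_scal_l. right. f_equal. f_equal. unfold sh. tcreim. ring.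
  - rewrite <- Cexp_plus. f_equal. rewrite minus_INR by lia. unfold al. simpl (INR 1).
    rewrite <- Cmult_plus_distr_r, <- RtoC_plus. f_equal. f_equal. field. auto.
Qed.

(** The growth hypothesis concerns [F zeta^((m-1)/m)], so [hlog_bound] carries a factor
    [|z|^((1-l)/m)] that blows up at 0 when [l > 1]. Away from 0 this factor is bounded; near 0 the
    continuity of [hz] takes over. *)
Lemma hz_bound : exists K, 0 <= K /\ forall z, InB r z -> Cmod (hz z) <= K * exp (B * Cmod z).
Proof.
  destruct (hz_Cder (RtoC 0)) as [k Hk].
  { exists 0. split; [lra|]. replace (RtoC 0 - RtoC 0)%C with (RtoC 0) by ring. rewrite Cmod_0; auto. }
  destruct (Cder_continuous _ _ _ Hk 1 Rlt_0_1) as [d [Hd Hc]].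
  assert (Hmp : 0 < INR m) by (apply lt_0_INR; lia).
  assert (Hl1 : 1 <= INR l) by (change 1 with (INR 1); apply le_INR; lia).
  set (E := exp ((1 - INR l) / INR m * ln d)). assert (HE : 0 < E) by apply exp_pos.
  pose proof (Cmod_ge_0 (hz (RtoC 0))) as P0.
  exists (Cmod (hz (RtoC 0)) + 1 + A * E). split; [nra|]. intros z Hz.
  assert (Hex : 1 <= exp (B * Cmod z)) by (rewrite <- exp_0; apply exp_le; pose proof (Cmod_ge_0 z); nra).
  destruct (Rlt_dec (Cmod z) d) as [Hzd|Hzd].
  - specialize (Hc z Hzd). replace (RtoC 0 + z)%C with z in Hc by ring.
    pose proof (Cmod_sub_rev (hz z) (hz (RtoC 0))). assert (0 <= A * E) by nra. nra.
  - assert (Hn : z <> RtoC 0) by (intros E0; apply Hzd; rewrite E0, Cmod_0; auto).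
    unfold hz at 1. destruct (Ceq_dec z (RtoC 0)); [contradiction|]. pose proof (Cexp_Clog z Hn) as Ez.
    pose proof (hlog_bound (Clog z)) as Hb. rewrite Ez in Hb. specialize (Hb Hz).
    assert (HRe : ln d <= Re (Clog z)).
    { apply Rnot_lt_le in Hzd. rewrite <- (ln_exp (Re (Clog z))). rewrite <- Cmod_Cexp, Ez. apply ln_le; auto. }
    assert (He : exp ((1 - INR l) / INR m * Re (Clog z)) <= E).
    { apply exp_le. assert (0 <= (INR l - 1) / INR m) by (apply Rdiv_le_0_compat; lra).
      replace ((1 - INR l) / INR m) with (- ((INR l - 1) / INR m)) by (field; lra). nra. }
    pose proof (exp_pos (B * Cmod z)). eapply Rle_trans; [exact Hb|].
    apply Rle_trans with (A * exp (B * Cmod z) * E); [apply Rmult_le_compat_l; nra|]. nra.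
Qed.

(** Cauchy's estimates on discs of radius [r/2] centred on the half-line, where [|z| <= x + r/2].
    This halves the radius and brings in the factor [exp (B r/2)]. *)
Theorem h_data : exists e M, Data e /\ DBound e (r / 2) B M /\
  forall n, e n 0 = (RtoC (INR (fact n) / Gamma (al + INR n)) * a (l + m * n)%nat)%C.
Proof.
  destruct hz_bound as [K [HK Hb]].
  assert (Hdisc : forall x z, 0 <= x -> Cmod (z - RtoC x) < r -> exists k, Cder hz z k).
  { intros x z Hx Hz. apply hz_Cder. exists x. auto. }
  set (e := fun n x => Cder_n hz n (RtoC x)).
  assert (De : forall n x, 0 <= x -> Rder (e n) x (e (S n) x)).
  { intros n x Hx. eapply Rder_val; [apply (Rder_comp_Cder (Cder_n hz n) RtoC); [apply (holo_Cder_n hz (RtoC x) r n Hr); intros z; apply Hdisc; auto|apply Rder_id]|].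
    unfold e. ring. }
  exists (fun n x => e n (Rmax 0 x)), (K * exp (B * (r / 2))). split; [|split].
  - apply Data_mk; [intros n x Hx; apply De; lra|]. intros n eps He.
    destruct (proj1 (cont_eps _ _) (Rder_cont _ _ _ (De n 0 (Rle_refl 0))) eps He) as [del [Hdel Hy]].
    exists del. split; auto. intros y Hy0. apply Hy. rewrite Rminus_0_r, Rabs_pos_eq; lra.
  - intros n x Hx. rewrite Rmax_right by auto. unfold e.
    eapply Rle_trans; [apply (cauchy_estimate hz (RtoC x) r (r / 2) (K * exp (B * (x + r / 2)))); [lra|intros z; apply Hdisc; auto|]|].
    + intros z Hz. eapply Rle_trans; [apply Hb; exists x; split; auto; lra|]. apply Rmult_le_compat_l; auto. apply exp_le.
      apply Rmult_le_compat_l; [lra|]. replace z with (RtoC x + (z - RtoC x))%C by ring. eapply Rle_trans; [apply Cmod_triangle|].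
      rewrite Hz, Cmod_R, Rabs_pos_eq; lra.
    + rewrite Rmult_plus_distr_l, exp_plus. right. unfold Rdiv. ring.
  - intros n. rewrite Rmax_left by lra. unfold e.
    rewrite (ps_Cder_n_0 hz (RtoC 0) rho hcoef Hrho).
    + unfold hcoef. assert (HG : Gamma (al + INR n) <> 0) by (pose proof (Gamma_shift_pos m l Hl n); unfold al; lra).
      rewrite RtoC_div by auto. field. apply RtoC_nz; auto.
    + intros h Hh. replace (RtoC 0 + h)%C with h by ring. apply hz_series; auto.
Qed.

End Components.

(** * Laplace transform of a fractional integral *)

Lemma Limp_mult_0 u v k : Limp u (RtoC 0) -> Limp v k ->
  Limp (fun X => u X * v X)%C (RtoC 0).
Proof.
  intros Hu Hv eps He. set (K := Cmod k + 1). assert (HK : 0 < K) by (unfold K; pose proof (Cmod_ge_0 k); lra).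
  destruct (Hu (eps / K)) as [X1 H1]; [apply Rdiv_lt_0_compat; auto|]. destruct (Hv 1 Rlt_0_1) as [X2 H2].
  exists (Rmax X1 X2). intros X HX. specialize (H1 X (Rle_trans _ _ _ (Rmax_l _ _) HX)). specialize (H2 X (Rle_trans _ _ _ (Rmax_r _ _) HX)).
  replace (u X - RtoC 0)%C with (u X) in H1 by ring. replace (u X * v X - RtoC 0)%C with (u X * v X)%C by ring. rewrite Cmod_mult.
  assert (H3 : Cmod (v X) < K) by (pose proof (Cmod_sub_rev (v X) k); unfold K; lra).
  apply Rle_lt_trans with (Cmod (u X) * K); [apply Rmult_le_compat_l; [apply Cmod_ge_0|lra]|].
  apply Rlt_le_trans with (eps / K * K); [apply Rmult_lt_compat_r; auto|right; field; lra].
Qed.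

Lemma Limp_mult u v l k : Limp u l -> Limp v k -> Limp (fun X => u X * v X)%C (l * k)%C.
Proof.
  intros Hu Hv. replace (l * k)%C with (RtoC 0 + l * k)%C by ring.
  apply Limp_ext with (fun X => (u X - l) * v X + l * v X)%C 0; [intros; ring|].
  apply Limp_plus; [|apply Limp_cmult; auto].
  apply (Limp_mult_0 (fun X => u X - l)%C v k); auto.
  intros eps He. destruct (Hu eps He) as [X0 H]. exists X0. intros X HX. replace (u X - l - RtoC 0)%C with (u X - l)%C by ring. auto.
Qed.

Section FractionalIntegral.

Variables m l : nat.
Hypothesis Hl : (1 <= l <= m)%nat.

Let al := INR l / INR m.
Let HH (D : nat -> R -> C) (x : R) : C := avg (phi_f m) (kap_f l) D 0 (Rmax 0 x).

(* [INR m * pH D x] is the integral of [(x - s)^(al - 1) D 0 s] over [0 <= s <= x]. *)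
Definition pH (D : nat -> R -> C) (x : R) : C := (RtoC (ppow al x) * HH D x)%C.

Lemma avg_f_contI D n k x : Data D -> contI (fun t => RtoC (phi_f m t ^ k * kap_f l t) * D n (x * phi_f m t)%R)%C 0 1.
Proof.
  intros HD t Ht. apply cont_mult.
  - apply cont_RtoC. apply (@continuous_mult _ R_AbsRing (fun t => phi_f m t ^ k) (kap_f l)); [|apply kap_f_ok; auto].
    apply continuous_pow, phi_f_ok; auto.
  - apply (cont_comp_real (D n) (fun t => x * phi_f m t)); [apply HD|].
    apply (@continuous_mult _ R_AbsRing (fun _ => x) (phi_f m)); [apply continuous_const|apply phi_f_ok; auto].
Qed.

(** The derivative of [t^l D 0 (x (1 - t^m))] in [t] is integrated over [[0, 1]]. The relation
    serves to let the fractional integral commute with differentiation up to a boundary term at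
    0. *)
Lemma avg_parts D x : Data D -> 0 < x ->
  (RtoC al * avg (phi_f m) (kap_f l) D 0 x + RtoC x * avg (phi_f m) (kap_f l) D 1 x
   = RtoC x * avg (phi_f m) (kap_f l) (fun n => D (S n)) 0 x + D 0%nat 0%R / RtoC (INR m))%C.
Proof.
  intros HD Hx. pose proof (INR_m_pos m l Hl) as Hm.
  assert (HmC : RtoC (INR m) <> RtoC 0) by (apply RtoC_nz; lra).
  assert (HD1 : Data (fun n => D (S n))) by (intros n; apply HD).
  set (f1 := fun t => (RtoC (phi_f m t ^ 0 * kap_f l t) * D 0%nat (x * phi_f m t)%R)%C).
  set (f2 := fun t => (RtoC (phi_f m t ^ 1 * kap_f l t) * D 1%nat (x * phi_f m t)%R)%C).
  set (f3 := fun t => (RtoC (phi_f m t ^ 0 * kap_f l t) * D 1%nat (x * phi_f m t)%R)%C).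
  assert (C1 : contI f1 0 1) by (apply avg_f_contI; auto).
  assert (C2 : contI f2 0 1) by (apply avg_f_contI; auto).
  assert (C3 : contI f3 0 1) by (apply avg_f_contI; auto).
  set (g := fun t => (RtoC (INR l) * f1 t + RtoC (INR m * x) * (f2 t - f3 t))%C).
  assert (C23 : contI (fun t => f2 t - f3 t)%C 0 1) by (intros t Ht; apply cont_minus; auto).
  assert (E : CI g 0 1 = D 0%nat 0).
  { set (f := fun t => (RtoC (t ^ l) * D 0%nat (x * phi_f m t)%R)%C).
    replace (D 0%nat 0) with (f 1 - f 0)%C.
    2: { unfold f, phi_f. rewrite !pow1, (pow_ne_zero l) by lia. replace (x * (1 - 1)) with 0 by ring. ring. }
    apply CI_FTC_open; [lra| | |].
    - intros t Ht. apply cont_mult; [apply cont_RtoC, continuous_pow_id|].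
      apply (cont_comp_real (D 0%nat) (fun t => x * phi_f m t)); [apply HD|].
      apply (@continuous_mult _ R_AbsRing (fun _ => x) (phi_f m)); [apply continuous_const|apply phi_f_ok; auto].
    - intros t Ht. apply cont_plus; [apply cont_mult; [apply cont_const|auto]|apply cont_mult; [apply cont_const|auto]].
    - intros t Ht. assert (Hp : 0 < phi_f m t).
      { unfold phi_f. assert (t ^ m < 1); [|lra]. apply pow_lt_1_compat; [lra|lia]. }
      eapply Rder_val.
      + apply Rder_mult; [apply Rder_RtoC; auto_derive; [auto|reflexivity]|].
        apply (Rder_comp_real (D 0%nat) (fun t => x * phi_f m t) t (D 1%nat (x * phi_f m t)) (- (x * (INR m * t ^ (pred m))))).
        * apply HD. apply Rmult_lt_0_compat; auto.
        * unfold phi_f. auto_derive; auto. ring.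
      + unfold g, f1, f2, f3, kap_f. replace (pred l) with (l - 1)%nat by lia.
        assert (E1 : t ^ l * t ^ pred m = t ^ (l - 1) * t ^ m) by (rewrite <- !pow_add; f_equal; lia).
        apply (f_equal RtoC) in E1. rewrite !RtoC_mult in E1.
        replace (phi_f m t ^ 1) with (1 - t ^ m) by (unfold phi_f; ring). rewrite pow_O, !Rmult_1_l.
        rewrite ?RtoC_opp, ?RtoC_mult, ?RtoC_minus, ?RtoC_opp, ?RtoC_mult.
        transitivity (RtoC (INR l) * RtoC (t ^ (l - 1)) * D 0%nat (x * phi_f m t)%R - RtoC (INR m) * RtoC x * (RtoC (t ^ l) * RtoC (t ^ pred m)) * D 1%nat (x * phi_f m t)%R)%C; [ring|].
        rewrite E1. ring. }
  unfold g in E. rewrite CI_plus, !CI_cmult, CI_minus in E; auto; try lra; try (apply contI_cmult; auto).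
  unfold avg. change (CI (fun t => RtoC (phi_f m t ^ 0 * kap_f l t) * D 0%nat (x * phi_f m t)%R)%C 0 1) with (CI f1 0 1).
  change (CI (fun t => RtoC (phi_f m t ^ 1 * kap_f l t) * D 1%nat (x * phi_f m t)%R)%C 0 1) with (CI f2 0 1).
  change (CI (fun t => RtoC (phi_f m t ^ 0 * kap_f l t) * D 1%nat (x * phi_f m t)%R)%C 0 1) with (CI f3 0 1).
  rewrite <- E. unfold al. rewrite RtoC_div, RtoC_mult by lra. field. auto.
Qed.

Section WithData.

Variables (D : nat -> R -> C) (rho b M : R).
Hypothesis Hrho : 0 < rho.
Hypothesis Hb : 0 <= b.
Hypothesis HD : Data D.
Hypothesis HB : DBound D rho b M.

Lemma HH_Data : Data (fun n x => avg (phi_f m) (kap_f l) D n (Rmax 0 x)).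
Proof. apply (avg_Data (phi_f m) (kap_f l) 1 (phi_f_ok m) (kap_f_ok l) D rho b M); auto. Qed.

Lemma pH_cont x : cont (pH D) x.
Proof. apply cont_mult; [apply ppow_cont, al_bounds; auto|]. apply (HH_Data 0%nat). Qed.

Lemma pH_0 : pH D 0 = RtoC 0.
Proof. unfold pH. rewrite ppow_le by lra. ring. Qed.

Lemma pH_Rder_Eul x : 0 < x -> Rder (pH D) x
  (RtoC (Rpower x (al - 1)) * Eul al (fun n x => avg (phi_f m) (kap_f l) D n (Rmax 0 x)) 0 x)%C.
Proof.
  intros Hx. eapply Rder_val.
  - apply Rder_mult; [apply Rder_RtoC, is_derive_ppow; auto|]. apply (HH_Data 0%nat). auto.
  - cbv beta. unfold HH, Eul. rewrite ppow_gt, Rmax_right by lra. simpl (INR 0). rewrite Rplus_0_l.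
    replace (Rpower x al) with (Rpower x (al - 1) * x); [rewrite !RtoC_mult; ring|].
    rewrite <- (Rpower_1 x) at 2 by auto. rewrite <- Rpower_plus. f_equal. ring.
Qed.

(** A convolution with [x^(al - 1)] is differentiated by differentiating the other factor and adding
    its boundary term; [avg_parts] turns the Euler form of [pH_Rder_Eul] into this one. *)
Lemma pH_Rder x : 0 < x -> Rder (pH D) x
  (pH (fun n => D (S n)) x + RtoC (Rpower x (al - 1)) * (D 0%nat 0%R / RtoC (INR m)))%C.
Proof.
  intros Hx. eapply Rder_val; [apply pH_Rder_Eul; auto|]. unfold Eul, pH, HH. simpl (INR 0). rewrite Rplus_0_l, Rmax_right by lra.
  rewrite (Cplus_comm (RtoC x * _)), avg_parts by auto. rewrite ppow_gt by auto.
  replace (Rpower x al) with (Rpower x (al - 1) * x); [rewrite !RtoC_mult; ring|].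
  rewrite <- (Rpower_1 x) at 2 by auto. rewrite <- Rpower_plus. f_equal. ring.
Qed.

End WithData.

(** * The convolution theorem for the fractional integral *)

Section Convolution.

Variables (d : nat -> R -> C) (rho b M : R) (z : C).
Hypothesis Hrho : 0 < rho.
Hypothesis Hb : 0 <= b.
Hypothesis HD : Data d.
Hypothesis HB : DBound d rho b M.
Hypothesis Hz : b < Re z.

Let P (x : R) : C := CI (fun t => d 0%nat t * Cexp (- (z * RtoC t)))%C 0 x.

(* Derivatives of [x |-> exp (z x) P x], for which the convolution with [s^(al - 1)] is [exp (z x)] times the
   convolution of [P] with [s^(al - 1) exp (- z s)]. *)
Fixpoint conv_data (n : nat) (x : R) : C :=
  match n with
  | O => Cexp (z * RtoC x) * P x
  | S k => z * conv_data k x + d k x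
  end%C.

(** The jet of [exp (z x)]. Its fractional integral times [exp (- z X)] is the truncated Gamma
    integral of [s^(al - 1) exp (- z s)] over [[0, X]], divided by [m]. *)
Definition exp_data (n : nat) (x : R) : C := (z ^ n * Cexp (z * RtoC x))%C.

Let p_cont t : cont (fun t => d 0%nat t * Cexp (- (z * RtoC t)))%C t.
Proof. apply cont_mult; [apply HD|apply cont_Cexp_lin]. Qed.

Lemma Cexp_cancel w : (Cexp w * Cexp (- w))%C = RtoC 1.
Proof. rewrite Cexp_opp. field. apply Cexp_nz. Qed.

Lemma conv_data_Data : Data conv_data.
Proof.
  assert (H0 : forall x, Rder (conv_data 0) x (conv_data 1 x)).
  { intros x. eapply Rder_val; [apply Rder_mult; [apply Rder_Cexp_lin|apply Rder_CI; apply p_cont]|].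
    cbv beta. simpl. fold (P x). pose proof (Cexp_cancel (z * RtoC x)) as E.
    transitivity (z * (Cexp (z * RtoC x) * P x) + d 0%nat x * (Cexp (z * RtoC x) * Cexp (- (z * RtoC x))))%C; [ring|]. rewrite E. ring. }
  intros n. induction n as [|n [IH1 IH2]].
  - split; [intros x; apply (Rder_cont _ _ _ (H0 x))|intros x _; apply H0].
  - split.
    + intros x. apply (cont_plus (fun x => z * conv_data n x)%C (d n)); [apply cont_mult; [apply cont_const|auto]|apply HD].
    + intros x Hx. apply (Rder_plus (fun x => z * conv_data n x)%C (d n)); [apply Rder_cmult; auto|apply HD; auto].
Qed.

Lemma P_bound x y : 0 <= y -> y <= x -> Cmod (P x - P y) <= M / (Re z - b) * exp (- (Re z - b) * y).
Proof.
  intros Hy Hxy. unfold P.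
  rewrite <- (CI_chasles _ 0 y x) by (auto; intros t _; apply p_cont).
  match goal with |- Cmod (?u + ?v - ?u) <= _ => replace (u + v - u)%C with v by ring end.
  apply CI_exp_bound; auto; [lra|apply (DBound_pos _ _ _ _ Hrho HB)|intros t _; apply p_cont|].
  intros t Ht. apply Lap_integrand_bound. pose proof (HB 0%nat t) as H. simpl in H. rewrite Rdiv_1_r, Rmult_1_r in H. apply H. lra.
Qed.

Lemma conv_data_DBound : exists rho' M', 0 < rho' /\ DBound conv_data rho' (Re z) M'.
Proof.
  pose proof (DBound_pos _ _ _ _ Hrho HB) as HM. pose proof (Cmod_ge_0 z) as Hzp.
  set (K := Rmax 1 (M / (Re z - b) + M)).
  (* A step of [conv_data] multiplies the bound by at most [|z| + 1], while the target gains
     [(n + 1) / r]; hence the requirement [r <= 1 / (|z| + 1)]. *)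
  set (r := Rmin rho (/ (Cmod z + 1))).
  assert (Hr : 0 < r) by (apply Rmin_pos; [auto|apply Rinv_0_lt_compat; lra]).
  assert (Hr1 : r <= rho) by apply Rmin_l.
  assert (Hr2 : r * (Cmod z + 1) <= 1).
  { apply Rle_trans with (/ (Cmod z + 1) * (Cmod z + 1)); [apply Rmult_le_compat_r; [lra|apply Rmin_r]|right; field; lra]. }
  assert (HMd : 0 <= M / (Re z - b)) by (apply Rdiv_le_0_compat; lra).
  assert (HK : M <= K /\ M / (Re z - b) <= K /\ 0 < K).
  { unfold K. pose proof (Rmax_r 1 (M / (Re z - b) + M)). pose proof (Rmax_l 1 (M / (Re z - b) + M)). lra. }
  exists r, K. split; auto. intros n x Hx. induction n as [|n IH].
  - simpl. rewrite Rdiv_1_r, Rmult_1_r, Cmod_mult, Cmod_Cexp.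
    replace (Re (z * RtoC x)) with (Re z * x) by (creim; ring). rewrite Rmult_comm. apply Rmult_le_compat_r; [left; apply exp_pos|].
    pose proof (P_bound x 0 (Rle_refl 0) Hx) as H. unfold P in H at 2. rewrite CI_point in H.
    replace (P x - RtoC 0)%C with (P x) in H by ring. rewrite Rmult_0_r, exp_0 in H. lra.
  - cbn [conv_data]. eapply Rle_trans; [apply Cmod_triangle|]. rewrite Cmod_mult.
    pose proof (HB n x Hx) as Hd. set (e := exp (Re z * x)) in *. assert (He : 0 < e) by apply exp_pos.
    assert (Hbe : exp (b * x) <= e) by (apply exp_le; nra).
    pose proof (INR_fact_lt_0 n) as Hf. set (q := INR (fact n) / r ^ n) in *.
    assert (Hrn : 0 < r ^ n) by (apply pow_lt; auto).
    assert (Hq : 0 < q) by (apply Rdiv_lt_0_compat; auto).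
    assert (Hq2 : INR (fact n) / rho ^ n <= q).
    { unfold q, Rdiv. apply Rmult_le_compat_l; [lra|]. apply Rinv_le_contravar; auto. apply pow_incr; lra. }
    assert (Hd2 : Cmod (d n x) <= K * q * e).
    { eapply Rle_trans; [exact Hd|]. apply Rmult_le_compat; [|left; apply exp_pos| |auto].
      - apply Rmult_le_pos; auto. apply Rdiv_le_0_compat; [lra|apply pow_lt; auto].
      - apply Rmult_le_compat; try lra. apply Rdiv_le_0_compat; [lra|apply pow_lt; auto]. }
    apply Rle_trans with ((Cmod z + 1) * (K * q * e)); [nra|].
    rewrite fact_simpl, mult_INR, S_INR. replace (K * ((INR n + 1) * INR (fact n) / r ^ S n) * e) with ((INR n + 1) * / r * (K * q * e)).
    2: { unfold q. simpl. field. lra. }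
    apply Rmult_le_compat_r; [apply Rmult_le_pos; [apply Rmult_le_pos|]; lra|].
    apply Rmult_le_reg_r with r; auto. rewrite Rmult_assoc, Rinv_l, Rmult_1_r by lra. pose proof (pos_INR n). lra.
Qed.

Lemma exp_data_Data : Data exp_data.
Proof.
  assert (H : forall n x, Rder (exp_data n) x (exp_data (S n) x)).
  { intros n x. eapply Rder_val; [apply Rder_cmult, Rder_Cexp_lin|]. unfold exp_data. simpl. ring. }
  intros n. split; [intros x; apply (Rder_cont _ _ _ (H n x))|intros x _; apply H].
Qed.

Lemma exp_data_DBound : exists rho' M', 0 < rho' /\ DBound exp_data rho' (Re z) M'.
Proof.
  pose proof (Cmod_ge_0 z) as Hzp. exists (/ (Cmod z + 1)), 1. assert (Hi : 0 < / (Cmod z + 1)) by (apply Rinv_0_lt_compat; lra).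
  split; auto. intros n x Hx. unfold exp_data. rewrite Cmod_mult, Cmod_Cexp, Cmod_pow.
  replace (Re (z * RtoC x)) with (Re z * x) by (creim; ring). apply Rmult_le_compat_r; [left; apply exp_pos|].
  rewrite Rmult_1_l, pow_inv. unfold Rdiv. rewrite Rinv_inv. rewrite <- (Rmult_1_l (Cmod z ^ n)).
  apply Rmult_le_compat; [lra|apply pow_le; auto| |apply pow_incr; lra].
  change 1 with (INR 1). apply le_INR. pose proof (lt_O_fact n). lia.
Qed.

Let ez (x : R) : C := Cexp (- (z * RtoC x)).

(** [ez] acts as an integrating factor. Since [conv_data 1 = z conv_data 0 + d 0] and [conv_data 0]
    vanishes at 0, the terms in [z] cancel in the derivative and [ez x pH d x] remains. *)
Lemma pH_conv_integral X : 0 <= X -> (ez X * pH conv_data X)%C = CI (fun x => pH d x * ez x)%C 0 X.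
Proof.
  intros HX. destruct conv_data_DBound as [r' [M' [Hr' HB']]]. assert (Hz0 : 0 <= Re z) by lra.
  rewrite (CI_FTC_open (fun x => ez x * pH conv_data x)%C).
  - rewrite pH_0. ring.
  - auto.
  - intros x _. apply cont_mult; [apply cont_Cexp_lin|apply (pH_cont _ r' (Re z) M'); auto using conv_data_Data].
  - intros x _. apply cont_mult; [apply (pH_cont _ rho b M); auto|apply cont_Cexp_lin].
  - intros x Hx. eapply Rder_val; [apply Rder_mult; [apply Rder_Cexp_neg|apply (pH_Rder _ r' (Re z) M'); auto using conv_data_Data; lra]|].
    cbv beta. fold (ez x).
    assert (E0 : conv_data 0 0 = RtoC 0) by (simpl; unfold P; rewrite CI_point; ring).
    assert (E : pH (fun n => conv_data (S n)) x = (z * pH conv_data x + pH d x)%C).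
    { unfold pH, HH, avg.
      transitivity (RtoC (ppow al x) * (z * CI (fun t => RtoC (phi_f m t ^ 0 * kap_f l t) * conv_data 0 (Rmax 0 x * phi_f m t)%R) 0 1
        + CI (fun t => RtoC (phi_f m t ^ 0 * kap_f l t) * d 0%nat (Rmax 0 x * phi_f m t)%R) 0 1))%C; [|ring].
      f_equal. rewrite <- CI_cmult, <- CI_plus.
      - apply CI_ext; [lra|]. intros t _. cbn [conv_data]. ring.
      - lra.
      - apply contI_cmult, avg_f_contI, conv_data_Data.
      - apply avg_f_contI; auto.
      - lra.
      - apply avg_f_contI, conv_data_Data. }
    rewrite E, E0. unfold Cdiv. ring.
Qed.

(** The same integrating factor, now with initial value 1: [ez x pH exp_data x] has derivative
    [x^(al-1) ez x / m]. The right-hand side is the corresponding integral after an integration by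
    parts, which removes the singularity at 0. *)
Lemma pH_exp_integral X : 0 <= X ->
  (RtoC (al * INR m) * (ez X * pH exp_data X) = RtoC (ppow al X) * ez X + z * CI (fun x => RtoC (ppow al x) * ez x) 0 X)%C.
Proof.
  intros HX. destruct exp_data_DBound as [r' [M' [Hr' HB']]]. assert (Hz0 : 0 <= Re z) by lra.
  pose proof (INR_m_pos m l Hl) as Hm. destruct (al_bounds m l Hl) as [Hal _]. fold al in Hal.
  assert (Cq : forall x, cont (fun x => RtoC (ppow al x) * ez x)%C x) by (intros x; apply cont_mult; [apply ppow_cont; auto|apply cont_Cexp_lin]).
  set (f := fun X => (RtoC (al * INR m) * (ez X * pH exp_data X) - (RtoC (ppow al X) * ez X + z * CI (fun x => RtoC (ppow al x) * ez x) 0 X))%C).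
  assert (E : f X = f 0).
  { apply C_const_of_Rder0; auto.
    - intros x _. apply cont_minus; [apply cont_mult; [apply cont_const|apply cont_mult; [apply cont_Cexp_lin|apply (pH_cont _ r' (Re z) M'); auto using exp_data_Data]]|].
      apply cont_plus; [apply Cq|]. apply cont_mult; [apply cont_const|]. apply (Rder_cont _ _ _ (Rder_CI _ 0 x Cq)).
    - intros x Hx. eapply Rder_val.
      + apply Rder_minus; [apply Rder_cmult, Rder_mult; [apply Rder_Cexp_neg|apply (pH_Rder _ r' (Re z) M'); auto using exp_data_Data; lra]|].
        apply Rder_plus; [apply Rder_mult; [apply Rder_RtoC, is_derive_ppow; lra|apply Rder_Cexp_neg]|apply Rder_cmult, Rder_CI, Cq].
      + cbv beta. fold (ez x).
        assert (E0 : exp_data 0 0 = RtoC 1) by (unfold exp_data; rewrite Cmult_0_r, Cexp_0; simpl; ring).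
        assert (E : pH (fun n => exp_data (S n)) x = (z * pH exp_data x)%C).
        { unfold pH, HH, avg. rewrite (CI_ext _ (fun t => z * (RtoC (phi_f m t ^ 0 * kap_f l t) * exp_data 0 (Rmax 0 x * phi_f m t)%R))%C) by (try lra; intros t _; unfold exp_data; simpl; ring).
          rewrite CI_cmult; [ring|lra|apply avg_f_contI, exp_data_Data]. }
        rewrite E, E0, !RtoC_mult. field. apply RtoC_nz; lra. }
  assert (F0 : f 0 = RtoC 0) by (unfold f; rewrite pH_0, CI_point, ppow_le by lra; ring).
  rewrite F0 in E. unfold f in E. set (u := (RtoC (al * INR m) * (ez X * pH exp_data X))%C) in *.
  match goal with |- u = ?v => replace u with (u - v + v)%C by ring end. unfold ez in *. rewrite E. ring.
Qed.

(** The difference is [X^al] times an average of [exp (- z (X - y)) (P y - P X)] over [0 <= y <= X].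
    By [P_bound] the last factor is [O(exp (- (Re z - b) y))], and since [b >= 0] the product is
    [O(exp (- (Re z - b) X))], which beats [X^al]. *)
Lemma pH_conv_limit : Limp (fun X => ez X * pH conv_data X - P X * (ez X * pH exp_data X))%C (RtoC 0).
Proof.
  destruct (al_bounds m l Hl) as [Hal _]. fold al in Hal. pose proof (DBound_pos _ _ _ _ Hrho HB) as HM.
  set (dl := Re z - b). assert (Hdl : 0 < dl) by (unfold dl; lra).
  destruct (ppow_bound al (dl / 2) Hal) as [K [HK Hp]]; [lra|]. intros eps He.
  destruct (exp_decay (K * (M / dl)) (dl / 2) eps) as [X0 HX0]; [lra|auto|].
  exists (Rmax 1 X0). intros X HX. assert (HX1 : 1 <= X) by (eapply Rle_trans; [apply Rmax_l|exact HX]).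
  specialize (HX0 X (Rle_trans _ _ _ (Rmax_r _ _) HX)). eapply Rle_lt_trans; [|exact HX0].
  assert (Cv := conv_data_Data). assert (Ce := exp_data_Data).
  assert (E : (ez X * pH conv_data X - P X * (ez X * pH exp_data X) - RtoC 0
     = RtoC (ppow al X) * CI (fun t => ez X * (RtoC (phi_f m t ^ 0 * kap_f l t) * conv_data 0 (X * phi_f m t)%R)
        - P X * ez X * (RtoC (phi_f m t ^ 0 * kap_f l t) * exp_data 0 (X * phi_f m t)%R)) 0 1)%C).
  { rewrite CI_minus, !CI_cmult by (try lra; try (apply contI_cmult); apply avg_f_contI; auto).
    unfold pH, HH, avg. rewrite Rmax_right by lra. ring. }
  rewrite E, Cmod_mult, Cmod_R, Rabs_pos_eq by apply ppow_pos.
  apply Rle_trans with (K * exp (dl / 2 * X) * (M / dl * exp (- dl * X))).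
  - apply Rmult_le_compat; [apply ppow_pos|apply Cmod_ge_0|apply Hp; lra|].
    replace (M / dl * exp (- dl * X)) with (M / dl * exp (- dl * X) * (1 - 0)) by ring. apply CI_bound_const; [lra| |].
    + intros t Ht. apply cont_minus; apply cont_mult; try apply cont_const; apply avg_f_contI; auto.
    + intros t Ht. destruct (phi_f_ok m t Ht) as [_ Hph]. destruct (kap_f_ok l t Ht) as [_ Hk].
      set (y := X * phi_f m t). assert (Hy : 0 <= y <= X) by (unfold y; nra).
      replace (ez X * (RtoC (phi_f m t ^ 0 * kap_f l t) * conv_data 0 y) - P X * ez X * (RtoC (phi_f m t ^ 0 * kap_f l t) * exp_data 0 y))%C
        with (RtoC (kap_f l t) * (ez X * Cexp (z * RtoC y)) * (P y - P X))%C by (unfold exp_data; simpl; rewrite Rmult_1_l; ring).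
      rewrite !Cmod_mult, Cmod_R. unfold ez. rewrite Cmod_Cexp_neg, Cmod_Cexp, <- exp_plus.
      replace (Re (z * RtoC y)) with (Re z * y) by (creim; ring).
      rewrite (Cmod_sub_sym (P y)). pose proof (P_bound X y (proj1 Hy) (proj2 Hy)) as HP. fold dl in HP.
      apply Rle_trans with (1 * exp (- Re z * X + Re z * y) * (M / dl * exp (- dl * y))).
      * apply Rmult_le_compat; auto using Cmod_ge_0. { apply Rmult_le_pos; [apply Rabs_pos|left; apply exp_pos]. }
        apply Rmult_le_compat_r; [left; apply exp_pos|auto].
      * replace (1 * exp (- Re z * X + Re z * y) * (M / dl * exp (- dl * y))) with (M / dl * exp (- Re z * X + Re z * y + - dl * y)) by (rewrite exp_plus; ring).
        apply Rmult_le_compat_l; [apply Rdiv_le_0_compat; lra|]. apply exp_le. unfold dl. nra.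
  - right. replace (exp (- (dl / 2) * X)) with (exp (dl / 2 * X) * exp (- dl * X)) by (rewrite <- exp_plus; f_equal; field). ring.
Qed.

(** Up to the error of [pH_conv_limit], the truncated transform is [P X] times the truncated Gamma
    integral; the second factor of the limit is [Gamma al z^(-al) / m]. *)
Lemma pH_Laplace : Limp (fun X => CI (fun x => pH d x * ez x)%C 0 X) (Lap (d 0%nat) z * (z * Lam al z / RtoC (al * INR m)))%C.
Proof.
  destruct (al_bounds m l Hl) as [Hal _]. fold al in Hal. pose proof (INR_m_pos m l Hl) as Hm.
  assert (HamC : RtoC (al * INR m) <> RtoC 0) by (apply RtoC_nz; nra). assert (Hz0 : 0 < Re z) by lra.
  assert (LP : Limp P (Lap (d 0%nat) z)) by (apply (Lap_data_spec d rho b M Hrho HD HB 0); auto).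
  assert (LK : Limp (fun X => ez X * pH exp_data X)%C (z * Lam al z / RtoC (al * INR m))%C).
  { apply Limp_ext with (fun X => / RtoC (al * INR m) * (RtoC (ppow al X) * ez X + z * CI (fun x => RtoC (ppow al x) * ez x) 0 X))%C 0.
    - intros X HX. rewrite <- pH_exp_integral by auto. field. auto.
    - replace (z * Lam al z / RtoC (al * INR m))%C with (/ RtoC (al * INR m) * (RtoC 0 + z * Lam al z))%C by (field; auto).
      apply Limp_cmult, Limp_plus; [apply ppow_exp_limit; auto|apply Limp_cmult, Lam_spec; auto]. }
  apply Limp_ext with (fun X => (ez X * pH conv_data X - P X * (ez X * pH exp_data X)) + P X * (ez X * pH exp_data X))%C 0.
  - intros X HX. rewrite <- pH_conv_integral by auto. ring.
  - match goal with |- Limp _ ?L => replace L with (RtoC 0 + L)%C by ring end.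
    apply Limp_plus; [apply pH_conv_limit|apply Limp_mult; auto].
Qed.

End Convolution.
End FractionalIntegral.

(** * The function on the covering assembled from its components *)

Lemma csum_delta f k n : (k < n)%nat -> csum (fun i => if Nat.eqb k i then f i else RtoC 0) n = f k.
Proof.
  intros Hk.
  assert (Z : forall n, (n <= k)%nat -> csum (fun i => if Nat.eqb k i then f i else RtoC 0) n = RtoC 0).
  { induction n0 as [|n0 IH]; intros H; [reflexivity|]. cbn [csum]. rewrite IH by lia. destruct (Nat.eqb_spec k n0); [lia|ring]. }
  induction n as [|n IH]; [lia|]. cbn [csum]. destruct (Nat.eqb_spec k n) as [->|Hn].
  - rewrite Z by lia. ring.
  - rewrite IH by lia. ring.
Qed.

(** Spreading a series out with zeros lets the [m] residue classes be added term by term, which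
    rebuilds the interleaved Borel series without rearranging it. *)
Lemma Cser_dilate c s m i : (i < m)%nat -> Cser c s ->
  Cser (fun n => if Nat.eqb (n mod m) i then c (n / m)%nat else RtoC 0) s.
Proof.
  intros Hi H. set (b := fun n => if Nat.eqb (n mod m) i then c (n / m)%nat else RtoC 0).
  assert (Eb : forall j k, (k < m)%nat -> b (m * j + k)%nat = if Nat.eqb k i then c j else RtoC 0).
  { intros j k Hk. unfold b. rewrite <- (Nat.mod_unique (m * j + k) m j k), <- (Nat.div_unique (m * j + k) m j k) by lia. reflexivity. }
  assert (G : forall J k, (k <= m)%nat -> csum b (m * J + k) = csum c (if Nat.ltb i k then S J else J)).
  { intros J. assert (E0 : csum b (m * J) = csum c J).
    { rewrite (csum_block b m i); auto.
      - apply csum_ext. intros j _. rewrite Eb, Nat.eqb_refl by auto. reflexivity.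
      - intros j k Hk Hn. rewrite Eb by auto. destruct (Nat.eqb_spec k i); [contradiction|reflexivity]. }
    induction k as [|k IH]; intros Hk; [rewrite Nat.add_0_r; exact E0|].
    rewrite Nat.add_succ_r. cbn [csum]. rewrite IH, Eb by lia.
    destruct (Nat.ltb_spec i k); destruct (Nat.ltb_spec i (S k)); destruct (Nat.eqb_spec k i); subst; try lia; cbn [csum]; ring. }
  intros eps He. destruct (H eps He) as [N HN]. exists (m * N)%nat. intros n Hn.
  assert (Hm : m <> 0%nat) by lia. pose proof (Nat.mod_upper_bound n m Hm) as Hmod.
  rewrite (Nat.div_mod_eq n m), G by lia. apply HN.
  assert (N <= n / m)%nat by (apply Nat.div_le_lower_bound; auto). destruct (Nat.ltb i (n mod m)); lia.
Qed.

Lemma Cder_csum (f : nat -> C -> C) n u : (forall k, (k < n)%nat -> exists l, Cder (f k) u l) ->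
  exists l, Cder (fun u => csum (fun k => f k u) n) u l.
Proof.
  induction n as [|n IH]; intros H.
  - exists (RtoC 0). apply (Cder_ext (fun _ => RtoC 0)); [reflexivity|apply Cder_const].
  - destruct IH as [k Hk]; [intros; apply H; lia|]. destruct (H n) as [k1 Hk1]; [lia|].
    exists (k + k1)%C. apply (Cder_ext (fun u => csum (fun k => f k u) n + f n u)%C); [reflexivity|]. apply Cder_plus; auto.
Qed.

Lemma InB_le r r' z : r <= r' -> InB r z -> InB r' z.
Proof. intros H [t [Ht Hz]]. exists t. split; auto. lra. Qed.

Section Assembled.

Variables (m : nat) (a : nat -> C) (e : nat -> nat -> R -> C) (rho b M : R).
Hypothesis Hm : (1 <= m)%nat.
Hypothesis Hrho : 0 < rho.
Hypothesis Hb : 0 <= b.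
Hypothesis HD : forall l, (1 <= l <= m)%nat -> Data (e l).
Hypothesis HB : forall l, (1 <= l <= m)%nat -> DBound (e l) rho b M.
Hypothesis He0 : forall l n, (1 <= l <= m)%nat -> e l n 0 = (RtoC (INR (fact n) / Gamma (INR l / INR m + INR n)) * a (l + m * n)%nat)%C.

Let ex (i : nat) : R := INR (S i) / INR m - 1.

(** The index [i] stands for [l - 1], so that [ex i] is [l/m - 1] and [e (S i)] is the jet of
    [h_l]. *)
Definition Fc (u : C) : C := csum (fun i => Cexp (RtoC (ex i) * u) * data_fun (e (S i)) (Cexp u))%C m.

Let Hmp : 0 < INR m.
Proof. apply lt_0_INR. lia. Qed.

Lemma Fc_period u : Fc (u + tpi (INR m))%C = Fc u.
Proof.
  unfold Fc. apply csum_ext. intros i Hi. rewrite (Cexp_plus u). rewrite INR_IZR_INZ at 2. rewrite Cexp_2PI, Cmult_1_r. f_equal.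
  rewrite Cmult_plus_distr_l, Cexp_plus.
  replace (RtoC (ex i) * tpi (INR m))%C with (tpi (IZR (Z.of_nat (S i) - Z.of_nat m))); [rewrite Cexp_2PI; ring|].
  rewrite minus_IZR, <- !INR_IZR_INZ. unfold ex. set (x := INR (S i)). apply Ceq; unfold RtoC; tcreim; field; lra.
Qed.

Lemma Fc_Cder u : InB rho (Cexp u) -> exists l, Cder Fc u l.
Proof.
  intros Hu. apply (Cder_csum (fun i u => Cexp (RtoC (ex i) * u) * data_fun (e (S i)) (Cexp u))%C). intros i Hi.
  destruct (data_fun_Cder (e (S i)) rho b M Hrho Hb (HD (S i) ltac:(lia)) (HB (S i) ltac:(lia)) (Cexp u) Hu) as [k Hk].
  eexists. apply Cder_mult.
  - apply (Cder_comp Cexp (fun u => RtoC (ex i) * u)%C); [apply Cder_Cexp|apply Cder_cmult, Cder_id].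
  - apply (Cder_comp (data_fun (e (S i))) Cexp); [exact Hk|apply Cder_Cexp].
Qed.

Lemma Fc_series u : exp (Re u) < rho -> Cser (borel_term m a u) (Fc u).
Proof.
  intros Hu. set (t := fun i j => borel_term m a u (m * j + i)%nat).
  apply Cser_ext with (fun n => csum (fun i => if Nat.eqb (n mod m) i then t i (n / m)%nat else RtoC 0) m).
  - intros n. rewrite (csum_delta (fun i => t i (n / m)%nat)) by (apply Nat.mod_upper_bound; lia).
    unfold t. f_equal. symmetry. apply Nat.div_mod_eq.
  - unfold Fc. apply (Cser_csum (fun i n => if Nat.eqb (n mod m) i then t i (n / m)%nat else RtoC 0)). intros i Hi. apply Cser_dilate; auto.
    assert (Hl : (1 <= S i <= m)%nat) by lia.
    pose proof (data_fun_at_0 (e (S i)) rho b M Hrho Hb (HD _ Hl) (HB _ Hl) (Cexp u)) as H. rewrite Cmod_Cexp in H. specialize (H Hu).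
    apply (Cser_cmult (Cexp (RtoC (ex i) * u))) in H. revert H. apply Cser_ext. intros j.
    unfold t, borel_term. rewrite He0 by auto. pose proof (Gamma_shift_pos m (S i) Hl j) as HG. pose proof (INR_fact_lt_0 j) as Hf.
    assert (E : INR (S (m * j + i)) / INR m = INR (S i) / INR m + INR j).
    { rewrite !S_INR, plus_INR, mult_INR. field. lra. }
    rewrite E. replace (S (m * j + i)) with (S i + m * j)%nat by lia.
    replace (RtoC (INR (S i) / INR m + INR j - 1) * u)%C with (RtoC (ex i) * u + RtoC (INR j) * u)%C.
    2: { rewrite <- Cmult_plus_distr_r, <- RtoC_plus. f_equal. f_equal. unfold ex. ring. }
    rewrite Cexp_plus, Cexp_nat, RtoC_div by lra. field. split; apply RtoC_nz; lra.
Qed.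

Lemma Fc_IsBorelCont r : r <= rho -> IsBorelCont m a r Fc.
Proof.
  intros Hr. split; [exact Fc_period|split].
  - intros u Hu. destruct (Fc_Cder u) as [l Hl]; [apply (InB_le r); auto|]. exists l. apply Cder_is_derive; auto.
  - exists rho. split; auto. intros u Hu. apply Cser_is_series, Fc_series; auto.
Qed.

(** After multiplication by [zeta^((m-1)/m)] the exponents are [i/m], between 0 and 1, and
    [|zeta|^(i/m) <= exp |zeta|]. This is the extra unit in the rate. *)
Lemma Fc_bound r : 0 < r < rho -> exists A, 0 < A /\ forall u, InB r (Cexp u) ->
  Cmod (Fc u * Cexp (RtoC (INR (m - 1) / INR m) * u)) <= A * exp ((b + 1) * Cmod (Cexp u)).
Proof.
  intros Hr. set (K := M / (1 - r / rho)).
  assert (HM : 0 <= M) by (apply (DBound_pos (e 1%nat) rho b M Hrho); apply HB; lia).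
  assert (H1 : 0 < 1 - r / rho) by (apply Rlt_0_minus; apply Rmult_lt_reg_r with rho; auto; unfold Rdiv; rewrite Rmult_assoc, Rinv_l by lra; lra).
  assert (HK : 0 <= K) by (apply Rdiv_le_0_compat; auto).
  exists (INR m * K + 1). split; [nra|]. intros u Hu. set (x := Cmod (Cexp u)). assert (Hx : 0 < x) by (unfold x; rewrite Cmod_Cexp; apply exp_pos).
  unfold Fc. rewrite Cmult_comm, <- csum_cmult. pose proof (exp_pos ((b + 1) * x)) as Hex.
  apply Rle_trans with (INR m * (K * exp ((b + 1) * x))); [|nra]. apply csum_bound. intros i Hi.
  assert (Hl : (1 <= S i <= m)%nat) by lia.
  pose proof (data_fun_bound (e (S i)) rho b M Hrho Hb (HB _ Hl) r (Cexp u) Hr Hu) as H. fold K x in H.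
  rewrite Cmult_assoc, <- Cexp_plus, Cmod_mult, Cmod_Cexp.
  replace (Re (RtoC (INR (m - 1) / INR m) * u + RtoC (ex i) * u)) with (INR i / INR m * Re u).
  2: { unfold ex. rewrite minus_INR, (S_INR i) by lia. set (y := INR i). simpl (INR 1). creim. field. lra. }
  assert (Hi1 : 0 <= INR i / INR m <= 1).
  { split; [apply Rdiv_le_0_compat; [apply pos_INR|auto]|]. apply Rmult_le_reg_r with (INR m); auto.
    unfold Rdiv. rewrite Rmult_assoc, Rinv_l, Rmult_1_r, Rmult_1_l by lra. apply le_INR. lia. }
  replace (K * exp ((b + 1) * x)) with (exp x * (K * exp (b * x))).
  2: { rewrite Rmult_plus_distr_r, exp_plus, Rmult_1_l. ring. }
  apply Rmult_le_compat; auto using Cmod_ge_0; [left; apply exp_pos|]. apply exp_le.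
  destruct (Rle_dec (Re u) 0); [apply Rle_trans with 0; nra|]. apply Rle_trans with (Re u); [nra|].
  unfold x. rewrite Cmod_Cexp. left. pose proof (exp_ineq1 (Re u)). lra.
Qed.

Lemma Fc_real t : 0 < t -> Fc (RtoC (ln t)) = csum (fun i => RtoC (Rpower t (ex i)) * e (S i) 0%nat t)%C m.
Proof.
  intros Ht. unfold Fc. apply csum_ext. intros i Hi. rewrite Cexp_RtoC, exp_ln by auto.
  assert (Hl : (1 <= S i <= m)%nat) by lia. rewrite (data_fun_real (e (S i)) rho b M Hrho Hb (HD _ Hl) (HB _ Hl)) by lra.
  f_equal. rewrite <- RtoC_mult, Cexp_RtoC. reflexivity.
Qed.

End Assembled.

(** In logarithmic coordinates the ray is a real line and a punctured disc a left half-plane. Up to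
    [ln t], an increment [h] moves [Cexp] by at most [K |h|], so discs of one radius
    [Rmin 1 (r / K)] serve along the whole segment. *)
Lemma identity_log_segment f r t : 0 < r -> 0 < t -> (forall u, InB r (Cexp u) -> exists l, Cder f u l) ->
  (forall u, exp (Re u) < r -> f u = RtoC 0) -> f (RtoC (ln t)) = RtoC 0.
Proof.
  intros Hr Ht Hd H0. set (x1 := ln t). set (x0 := Rmin x1 (ln r - 1)).
  set (K := 2 * exp x1 * exp 1). assert (HK : 0 < K) by (unfold K; pose proof (exp_pos x1); pose proof (exp_pos 1); nra).
  assert (H1 : x0 <= ln r - 1) by apply Rmin_r.
  apply (identity_on_segment f x0 x1 (Rmin 1 (r / K)) 1); [apply Rmin_l|apply Rmin_pos; [lra|apply Rdiv_lt_0_compat; auto]|lra| | |split; [apply Rmin_l|lra]].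
  - intros x z Hx Hz. apply Hd. exists (exp x). split; [left; apply exp_pos|].
    set (h := (z - RtoC x)%C) in *. replace z with (RtoC x + h)%C by (unfold h; ring).
    rewrite Cexp_plus, Cexp_RtoC. replace (RtoC (exp x) * Cexp h - RtoC (exp x))%C with (RtoC (exp x) * (Cexp h - 1))%C by ring.
    rewrite Cmod_mult, Cmod_R, Rabs_pos_eq by (left; apply exp_pos).
    assert (Hh1 : Cmod h < 1) by (eapply Rlt_le_trans; [exact Hz|apply Rmin_l]).
    assert (Hh2 : Cmod h < r / K) by (eapply Rlt_le_trans; [exact Hz|apply Rmin_r]).
    apply Rle_lt_trans with (K * Cmod h).
    + unfold K. replace (2 * exp x1 * exp 1 * Cmod h) with (exp x1 * (2 * Cmod h * exp 1)) by ring.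
      apply Rmult_le_compat; [left; apply exp_pos|apply Cmod_ge_0|apply exp_le; lra|].
      eapply Rle_trans; [apply Cexp_bound_1|]. apply Rmult_le_compat_l; [pose proof (Cmod_ge_0 h); lra|]. apply exp_le. pose proof (re_le_Cmod h). lra.
    + apply Rlt_le_trans with (K * (r / K)); [apply Rmult_lt_compat_l; auto|right; field; lra].
  - intros z Hz. apply H0. rewrite <- (exp_ln r) by auto. apply exp_increasing.
    pose proof (re_le_Cmod (z - RtoC x0)) as Hre. pose proof (Rle_abs (Re (z - RtoC x0))) as Ha.
    replace (Re (z - RtoC x0)) with (Re z - x0) in * by reflexivity. lra.
Qed.

(** * Laplace transform of a component *)

Definition Limr (f : R -> C) (I : C) : Prop := forall eps, 0 < eps -> exists del X0, 0 < del /\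
  forall x y, 0 < x < del -> X0 <= y -> x <= y -> Cmod (CI f x y - I) < eps.

Lemma Limr_csum (f : nat -> R -> C) (I : nat -> C) n : (forall k x, (k < n)%nat -> 0 < x -> cont (f k) x) ->
  (forall k, (k < n)%nat -> Limr (f k) (I k)) -> Limr (fun x => csum (fun k => f k x) n) (csum I n).
Proof.
  induction n as [|n IH]; intros Hc H.
  - intros eps He. exists 1, 0. split; [lra|]. intros x y Hx Hy Hxy. cbn [csum]. rewrite CI_const by auto.
    replace (RtoC (y - x) * RtoC 0 - RtoC 0)%C with (RtoC 0) by ring. rewrite Cmod_0; auto.
  - intros eps He. assert (He2 : 0 < eps / 2) by lra.
    destruct (IH (fun k x Hk => Hc k x (Nat.lt_lt_succ_r _ _ Hk)) (fun k Hk => H k (Nat.lt_lt_succ_r _ _ Hk)) (eps / 2) He2) as [d1 [X1 [P1 H1]]].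
    destruct (H n (Nat.lt_succ_diag_r n) (eps / 2) He2) as [d2 [X2 [P2 H2]]].
    exists (Rmin d1 d2), (Rmax X1 X2). split; [apply Rmin_pos; auto|]. intros x y Hx Hy Hxy.
    pose proof (Rmin_l d1 d2). pose proof (Rmin_r d1 d2). pose proof (Rmax_l X1 X2). pose proof (Rmax_r X1 X2).
    specialize (H1 x y ltac:(lra) ltac:(lra) Hxy). specialize (H2 x y ltac:(lra) ltac:(lra) Hxy). cbn [csum].
    assert (Hcs : forall j, (j <= n)%nat -> forall z, 0 < z -> cont (fun x => csum (fun k => f k x) j) z).
    { induction j as [|j IHj]; intros Hj z Hz; [apply cont_const|]. cbn [csum]. apply cont_plus; [apply IHj; [lia|auto]|apply Hc; [lia|auto]]. }
    rewrite CI_plus by (auto; intros z Hz; (apply Hcs || apply Hc); lia || lra).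
    match goal with |- Cmod (?p + ?q - (?s + ?t)) < _ => replace (p + q - (s + t))%C with ((p - s) + (q - t))%C by ring end.
    eapply Rle_lt_trans; [apply Cmod_triangle|]. lra.
Qed.

Section ComponentLaplace.

Variables m l : nat.
Hypothesis Hl : (1 <= l <= m)%nat.
Variables (d : nat -> R -> C) (rho b M : R) (v : C).
Hypothesis Hrho : 0 < rho.
Hypothesis Hb : 0 <= b.
Hypothesis HD : Data d.
Hypothesis HB : DBound d rho b M.
Hypothesis Hv : - (PI / 2) < Im v < PI / 2.

Let al := INR l / INR m.
Let z := Cexp v.
Hypothesis Hz : b < Re (Cexp v).

Let g (t : R) : C := (RtoC (Rpower t (al - 1)) * f_to_h m l d 0 t * Cexp (- (z * RtoC t)))%C.

Lemma component_cont t : 0 < t -> cont g t.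
Proof.
  intros Ht. destruct (f_to_h_spec m l Hl d rho b M (rho / 2) (b + 1)) as [Hd _]; auto; try lra.
  apply cont_mult; [apply cont_mult|apply cont_Cexp_lin].
  - apply cont_RtoC. apply (ex_derive_continuous (fun t => Rpower t (al - 1))). eexists. apply is_derive_Rpower; auto.
  - apply (Hd 0%nat).
Qed.

(** By [pH_Rder_Eul], [g] is [c] times the derivative of [pH] times the exponential. Integrating by
    parts moves the singularity at 0 into the continuous function [q], whose boundary values vanish
    at both ends, and leaves [c z] times the transform of [pH]. *)
Lemma component_Laplace : Limr g (Cexp (RtoC (1 - al) * v) * Lap (d 0%nat) z)%C.
Proof.
  destruct (al_bounds m l Hl) as [Hal _]. fold al in Hal. pose proof (INR_m_pos m l Hl) as Hm.
  assert (Hz0 : 0 < Re z) by (unfold z; lra).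
  pose proof (Gamma_pos al Hal) as HG. set (c := RtoC (INR m / Gamma al)).
  set (ez := fun t => Cexp (- (z * RtoC t))). set (q := fun t => (pH m l d t * ez t)%C).
  assert (Hc : forall t, cont q t) by (intros t; apply cont_mult; [apply (pH_cont m l Hl d rho b M); auto|apply cont_Cexp_lin]).
  assert (E : forall x y, 0 < x -> x <= y -> CI g x y = (c * (q y - q x) + c * z * (CI q 0 y - CI q 0 x))%C).
  { intros x y Hx Hxy. rewrite <- (CI_chasles q 0 x y) by (try lra; intros t _; apply Hc).
    replace (c * (q y - q x) + c * z * (CI q 0 x + CI q x y - CI q 0 x))%C with ((c * q y - c * q x) + c * z * CI q x y)%C by ring.
    rewrite <- CI_cmult by (auto; intros t _; apply Hc).
    set (h := fun t => (g t - c * z * q t)%C).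
    assert (Ch : contI h x y).
    { intros t Ht. apply cont_minus; [apply component_cont; lra|]. apply cont_mult; [apply cont_const|auto]. }
    rewrite <- (CI_FTC_open (fun t => c * q t)%C h x y Hxy); auto.
    - rewrite <- CI_plus; auto.
      + apply CI_ext; auto. intros t _. unfold h. ring.
      + intros t _. apply cont_mult; [apply cont_const|auto].
    - intros t _. apply cont_mult; [apply cont_const|auto].
    - intros t Ht. eapply Rder_val.
      + apply Rder_cmult, Rder_mult; [apply (pH_Rder_Eul m l d rho b M); auto; lra|apply Rder_Cexp_neg].
      + cbv beta. unfold h, g, q, f_to_h, c, ez, al. ring. }
  set (Q := (Lap (d 0%nat) z * (z * Lam al z / RtoC (al * INR m)))%C).
  assert (LQ : Limp (fun X => CI q 0 X) Q) by (apply (pH_Laplace m l Hl d rho b M z); auto).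
  assert (Lq : Limp (fun X => q X) (RtoC 0)).
  { pose proof (HH_Data m l d rho b M Hrho Hb HD HB) as HHD.
    destruct (ppow_bound al ((Re z - b) / 2) Hal) as [K [HK Hp]]; [unfold z; lra|]. pose proof (DBound_pos _ _ _ _ Hrho HB) as HM.
    intros eps He. destruct (exp_decay (K * M) ((Re z - b) / 2) eps) as [X0 HX0]; [unfold z; lra|auto|].
    exists (Rmax 0 X0). intros X HX. assert (HX1 : 0 <= X) by (eapply Rle_trans; [apply Rmax_l|exact HX]).
    specialize (HX0 X (Rle_trans _ _ _ (Rmax_r _ _) HX)). eapply Rle_lt_trans; [|exact HX0].
    replace (q X - RtoC 0)%C with (q X) by ring. unfold q, pH, ez. rewrite !Cmod_mult, Cmod_Cexp_neg, Cmod_R, Rabs_pos_eq by apply ppow_pos.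
    pose proof (avg_DBound (phi_f m) (kap_f l) 1 (phi_f_ok m) (kap_f_ok l) d rho b M Hrho Hb HD HB 0%nat X HX1) as HA. cbv beta in HA.
    simpl (INR (fact 0)) in HA. rewrite pow_O, Rdiv_1_r, Rmult_1_r, Rmult_1_l in HA.
    apply Rle_trans with (K * exp ((Re z - b) / 2 * X) * (M * exp (b * X)) * exp (- Re z * X)).
    - apply Rmult_le_compat_r; [left; apply exp_pos|]. apply Rmult_le_compat; auto using ppow_pos, Cmod_ge_0.
    - right. replace (exp (- ((Re z - b) / 2) * X)) with (exp ((Re z - b) / 2 * X) * exp (b * X) * exp (- Re z * X)) by (rewrite <- !exp_plus; f_equal; field). ring. }
  assert (EI : (Cexp (RtoC (1 - al) * v) * Lap (d 0%nat) z)%C = (c * z * Q)%C).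
  { pose proof (Lam_rotate al v Hal Hv) as Hr. rewrite Lam_1 in Hr by auto. fold z in Hr.
    (* One [z] comes from the integration by parts and one from [pH_Laplace]; the power [z^(al + 1)]
       is split off to meet [Lam al z] in [Lam_rotate], leaving [z^(1 - al)]. *)
    assert (Ez : (z * z)%C = (Cexp (RtoC (1 - al) * v) * Cexp (RtoC (al + 1) * v))%C).
    { unfold z. rewrite <- !Cexp_plus. f_equal. apply Ceq; creim; ring. }
    unfold Q, c. transitivity (RtoC (INR m / Gamma al) / RtoC (al * INR m) * (z * z) * Lam al z * Lap (d 0%nat) z)%C.
    - rewrite Ez. transitivity (RtoC (INR m / Gamma al) / RtoC (al * INR m) * Cexp (RtoC (1 - al) * v) * (Cexp (RtoC (al + 1) * v) * Lam al z) * Lap (d 0%nat) z)%C; [|ring].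
      rewrite Hr. rewrite RtoC_div, !RtoC_mult by lra. field. repeat split; apply RtoC_nz; lra.
    - unfold Cdiv. ring. }
  rewrite EI. intros eps He.
  set (K := 1 + Cmod c + Cmod (c * z)). pose proof (Cmod_ge_0 c) as Pc. pose proof (Cmod_ge_0 (c * z)) as Pcz.
  assert (HK : 0 < K) by (unfold K; lra). assert (He4 : 0 < eps / (4 * K)) by (apply Rdiv_lt_0_compat; lra).
  destruct (LQ _ He4) as [X1 H1]. destruct (Lq _ He4) as [X2 H2].
  assert (q0 : q 0 = RtoC 0) by (unfold q; rewrite pH_0; ring).
  destruct (proj1 (cont_eps _ _) (Hc 0) _ He4) as [d1 [P1 D1]].
  assert (CC : cont (fun x => CI q 0 x) 0) by (apply (Rder_cont _ _ _ (Rder_CI q 0 0 Hc))).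
  destruct (proj1 (cont_eps _ _) CC _ He4) as [d2 [P2 D2]].
  exists (Rmin d1 d2), (Rmax X1 X2). split; [apply Rmin_pos; auto|]. intros x y Hx Hy Hxy.
  pose proof (Rmin_l d1 d2). pose proof (Rmin_r d1 d2). pose proof (Rmax_l X1 X2). pose proof (Rmax_r X1 X2).
  specialize (H1 y ltac:(lra)). specialize (H2 y ltac:(lra)).
  specialize (D1 x). specialize (D2 x). cbv beta in D1, D2, H1, H2. rewrite Rminus_0_r, Rabs_pos_eq in D1, D2 by lra.
  specialize (D1 ltac:(lra)). specialize (D2 ltac:(lra)). rewrite q0 in D1. rewrite CI_point in D2.
  replace (q x - RtoC 0)%C with (q x) in D1 by ring. replace (CI q 0 x - RtoC 0)%C with (CI q 0 x) in D2 by ring. replace (q y - RtoC 0)%C with (q y) in H2 by ring.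
  rewrite E by lra.
  replace (c * (q y - q x) + c * z * (CI q 0 y - CI q 0 x) - c * z * Q)%C with (c * (q y - q x) + c * z * ((CI q 0 y - Q) - CI q 0 x))%C by ring.
  eapply Rle_lt_trans; [apply Cmod_triangle|]. rewrite !(Cmod_mult _ (_ - _)%C).
  assert (T1 : Cmod (q y - q x) <= 2 * (eps / (4 * K))).
  { unfold Cminus. eapply Rle_trans; [apply Cmod_triangle|]. rewrite Cmod_opp. lra. }
  assert (T2 : Cmod (CI q 0 y - Q - CI q 0 x) <= 2 * (eps / (4 * K))).
  { unfold Cminus at 1. eapply Rle_trans; [apply Cmod_triangle|]. rewrite Cmod_opp. lra. }
  apply Rle_lt_trans with (K * (2 * (eps / (4 * K)))); [unfold K at 1; nra|].
  replace (K * (2 * (eps / (4 * K)))) with (eps / 2) by (field; lra). lra.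
Qed.

End ComponentLaplace.

(** * The equivalence *)

Lemma choose_upto (T : Type) (x0 : T) (P : nat -> T -> Prop) m : (forall l, (1 <= l <= m)%nat -> exists x, P l x) ->
  exists f, forall l, (1 <= l <= m)%nat -> P l (f l).
Proof. intros H. exists (fun l => epsilon (inhabits x0) (P l)). intros l Hl. apply epsilon_spec. auto. Qed.

Lemma maxA_ge A m l : (1 <= l <= m)%nat -> A l <= maxA A m.
Proof.
  induction m as [|m IH]; intros H; [lia|]. cbn [maxA]. destruct (Nat.eq_dec l (S m)) as [->|]; [apply Rmax_l|].
  eapply Rle_trans; [apply IH; lia|apply Rmax_r].
Qed.

Lemma sum_n_m_1_csum (f : nat -> C) n : sum_n_m f 1 n = csum (fun j => f (S j)) n.
Proof.
  induction n as [|n IH]; [rewrite sum_n_m_zero by lia; reflexivity|].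
  rewrite sum_n_Sm by lia. rewrite IH. reflexivity.
Qed.

Lemma alj_S m a l n : alj m a l (S n) = a (l + m * n)%nat.
Proof. unfold alj. f_equal. lia. Qed.

Lemma cond1_cond2 m a : (1 <= m)%nat -> cond1 m a -> exists r B A S0, cond2 m a r B A S0.
Proof.
  intros Hm [r [Hr [F [[Fp [Fd [rho [Hrho Fs]]]] [A [B [HA [HB Hg]]]]]]]].
  assert (H : forall l, (1 <= l <= m)%nat -> exists p : (nat -> R -> C) * R,
    Data (fst p) /\ DBound (fst p) (r / 4) (B + 1) (snd p) /\ forall n, fst p n 0 = a (l + m * n)%nat).
  { intros l Hl. destruct (h_data m a l Hl F r rho) with (A := A) (B := B) as [e [M [H1 [H2 H3]]]]; auto.
    - intros u Hu. destruct (Fd u Hu) as [k Hk]. exists k. apply Cder_is_derive; auto.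
    - intros u Hu. apply Cser_is_series; auto.
    - destruct (h_to_f m l Hl e (r / 2) B M (r / 4) (B + 1) (fun n => a (l + m * n)%nat)) as [d [M' Hd]]; auto; try lra.
      exists (d, M'). exact Hd. }
  apply choose_upto in H; [|exact (fun _ _ => RtoC 0, 0)]. destruct H as [p Hp].
  set (d := fun l => fst (p l)). set (M := fun l => snd (p l)).
  assert (Hr4 : 0 < r / 4) by lra. assert (HB1 : 0 <= B + 1) by lra.
  assert (HM : forall l, (1 <= l <= m)%nat -> 0 <= M l) by (intros l Hl; destruct (Hp l Hl) as [_ [Hb _]]; apply (DBound_pos _ _ _ _ Hr4 Hb)).
  (* Cauchy's estimates reduce [r] to [r/2], and [h_to_f] to [r/4] with rate [B + 1]. [M l + 1] is
     positive even when [M l] is 0, and the factor [exp (B r)] in [Ras] is at least 1. *)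
  exists (r / 4), (B + 1), (fun l => M l + 1), (fun l => Lap (d l 0%nat)).
  split; [auto|split; [lra|split; [|split]]].
  - intros l Hl. specialize (HM l Hl). lra.
  - intros l Hl w Hw. destruct (Hp l Hl) as [H1 [H2 _]].
    destruct (Lap_data_Cder (d l) (r / 4) (B + 1) (M l) Hr4 H1 H2 w Hw) as [k Hk]. exists k. apply Cder_is_derive; auto.
  - intros w Hw n Hn l Hl. destruct (Hp l Hl) as [H1 [H2 H3]]. specialize (HM l Hl).
    pose proof (Lap_data_bound (d l) (r / 4) (B + 1) (M l) Hr4 HB1 H1 H2 n w Hw) as H.
    rewrite sum_n_m_1_csum, (csum_ext _ (fun j => d l j 0 / w ^ S j)%C).
    2: { intros j _. rewrite alj_S, Cpow_Cpow. unfold d. rewrite H3. reflexivity. }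
    eapply Rle_trans; [exact H|]. unfold Ras.
    assert (Hw0 : 0 < Cmod w) by (eapply Rlt_le_trans; [|apply (Rle_trans _ _ _ (Rle_abs _) (re_le_Cmod w))]; lra).
    apply Rmult_le_compat_r; [left; apply Rinv_0_lt_compat, Rmult_lt_0_compat; [apply pow_lt; auto|lra]|].
    unfold Rdiv. rewrite (Rmult_assoc (M l)), (Rmult_assoc (_ * exp _)). apply Rmult_le_compat_r.
    + apply Rmult_le_pos; [apply pos_INR|left; apply Rinv_0_lt_compat, pow_lt; auto].
    + assert (1 <= exp ((B + 1) * (r * / 4))) by (rewrite <- exp_0 at 1; apply exp_le, Rmult_le_pos; lra). apply Rle_trans with ((M l + 1) * 1); [lra|]. apply Rmult_le_compat_l; lra.
Qed.

Section FromCond2.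

Variables (m : nat) (a : nat -> C) (r B : R) (A : nat -> R) (S0 : nat -> C -> C).
Hypothesis Hm : (1 <= m)%nat.
Hypothesis H2 : cond2 m a r B A S0.

Let Hr : 0 < r.
Proof. apply H2. Qed.

Let HBp : 0 < B.
Proof. apply H2. Qed.

Let r_half : 0 < r / 2.
Proof. lra. Qed.

(** The rate [c] is left free above [B]: the inversion takes place on the line of abscissa [c], and
    the transform is recovered only to the right of it. *)
Lemma cond2_data l c : (1 <= l <= m)%nat -> B < c -> exists d M, Data d /\ DBound d (r / 2) c M /\
  (forall n, d n 0 = a (l + m * n)%nat) /\ forall w, c < Re w -> Lap (d 0%nat) w = S0 l w.
Proof.
  intros Hl Hc. destruct H2 as [_ [_ [HA [Hd Hb]]]].
  destruct (nevanlinna (S0 l) (fun n => a (l + m * n)%nat) r B (A l * exp (B * r)) c Hr HBp Hc) with (rho := r / 2) as [d [M H]]; try lra.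
  - specialize (HA l Hl). pose proof (exp_pos (B * r)). nra.
  - intros w Hw. destruct (Hd l Hl w Hw) as [k Hk]. exists k. apply Cder_is_derive; auto.
  - intros w n Hw Hn. specialize (Hb w Hw n Hn l Hl). rewrite sum_n_m_1_csum in Hb.
    rewrite (csum_ext _ (fun j => alj m a l (S j) / Defs.Cpow w (S j))%C).
    2: { intros j _. rewrite alj_S. reflexivity. }
    eapply Rle_trans; [exact Hb|]. right. unfold Ras, Rdiv. ring.
  - exists d, M. exact H.
Qed.

Lemma cond2_data_family c : B < c -> exists (d : nat -> nat -> R -> C) (M' : R),
  (forall l, (1 <= l <= m)%nat -> Data (d l) /\ (exists M, DBound (d l) (r / 2) c M) /\
     (forall w, c < Re w -> Lap (d l 0%nat) w = S0 l w) /\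
     Data (f_to_h m l (d l)) /\ DBound (f_to_h m l (d l)) (r / 4) (c + 1) M' /\
     forall n, f_to_h m l (d l) n 0 = (RtoC (INR (fact n) / Gamma (INR l / INR m + INR n)) * a (l + m * n)%nat)%C).
Proof.
  intros Hc. assert (H : forall l, (1 <= l <= m)%nat -> exists p : (nat -> R -> C) * R,
    Data (fst p) /\ (exists M, DBound (fst p) (r / 2) c M) /\ (forall w, c < Re w -> Lap (fst p 0%nat) w = S0 l w) /\
     Data (f_to_h m l (fst p)) /\ DBound (f_to_h m l (fst p)) (r / 4) (c + 1) (snd p) /\
     forall n, f_to_h m l (fst p) n 0 = (RtoC (INR (fact n) / Gamma (INR l / INR m + INR n)) * a (l + m * n)%nat)%C).
  { intros l Hl. destruct (cond2_data l c Hl Hc) as [d [M [D1 [D2 [D3 D4]]]]].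
    destruct (f_to_h_spec m l Hl d (r / 2) c M (r / 4) (c + 1)) as [E1 [[M' E2] E3]]; auto; try lra.
    exists (d, M'). cbn [fst snd]. split; [auto|]. split; [eauto|]. split; [auto|]. split; [auto|]. split; [auto|].
    intros n. rewrite E3, D3. reflexivity. }
  apply choose_upto in H; [|exact (fun _ _ => RtoC 0, 0)]. destruct H as [p Hp].
  exists (fun l => fst (p l)), (maxA (fun l => snd (p l)) m). intros l Hl. destruct (Hp l Hl) as [E1 [E2 [E3 [E4 [E5 E6]]]]].
  repeat (split; auto). intros n x Hx. eapply Rle_trans; [apply E5; auto|].
  apply Rmult_le_compat_r; [left; apply exp_pos|]. apply Rmult_le_compat_r; [|apply (maxA_ge (fun l => snd (p l))); auto].
  apply Rdiv_le_0_compat; [apply pos_INR|apply pow_lt; lra].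
Qed.

Lemma cond2_cond1 : cond1 m a.
Proof.
  destruct (cond2_data_family (B + 1)) as [d [M Hd]]; [lra|].
  set (e := fun l => f_to_h m l (d l)).
  assert (E1 : forall l, (1 <= l <= m)%nat -> Data (e l)) by (intros l Hl; apply (Hd l Hl)).
  assert (E2 : forall l, (1 <= l <= m)%nat -> DBound (e l) (r / 4) (B + 1 + 1) M) by (intros l Hl; apply (Hd l Hl)).
  assert (E3 : forall l n, (1 <= l <= m)%nat -> e l n 0 = (RtoC (INR (fact n) / Gamma (INR l / INR m + INR n)) * a (l + m * n)%nat)%C) by (intros l n Hl; apply (Hd l Hl)).
  (* The jets [f_to_h] have radius [r/4] and one unit more of rate than those of [cond2_data];
     [Fc_bound] takes a strictly smaller radius and a further unit. *)
  destruct (Fc_bound m e (r / 4) (B + 1 + 1) M) with (r := r / 8) as [K [HK HF]]; auto; try lra.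
  exists (r / 8). split; [lra|]. exists (Fc m e). split; [apply (Fc_IsBorelCont m a e (r / 4) (B + 1 + 1) M); auto; lra|].
  exists K, (B + 1 + 1 + 1). split; [auto|split; [lra|exact HF]].
Qed.

(** * Borel sums *)

Lemma borelL_exists l : (1 <= l <= m)%nat -> exists rho G, 0 < rho /\ IsBorelContL m a l rho G.
Proof.
  intros Hl. destruct (cond2_data l (B + 1) Hl) as [d [M [D1 [D2 [D3 _]]]]]; [lra|].
  exists (r / 2), (data_fun d). split; [lra|]. split.
  - intros xi Hxi. destruct (data_fun_Cder d (r / 2) (B + 1) M) with (z := xi) as [k Hk]; auto; try lra. exists k. apply Cder_is_derive; auto.
  - exists (r / 2). split; [lra|]. intros xi Hxi. apply Cser_is_series.
    pose proof (data_fun_at_0 d (r / 2) (B + 1) M r_half ltac:(lra) D1 D2 xi Hxi) as H. revert H. apply Cser_ext.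
    intros n. unfold borel_l_term. change (Defs.Cpow xi n) with (xi ^ n)%C. rewrite alj_S, D3. unfold Cdiv. ring.
Qed.

Lemma borelL_Laplace l rho G w : (1 <= l <= m)%nat -> 0 < rho -> IsBorelContL m a l rho G -> B < Re w ->
  is_RInt_gen (V:=C_R_NormedModule) (fun t : R => G (RtoC t) * Cexp (- (w * RtoC t)))%C (at_point 0) (Rbar_locally p_infty) (S0 l w).
Proof.
  intros Hl Hrho [Gd [r1 [Hr1 Gs]]] Hw. set (c := (B + Re w) / 2).
  assert (Hc : B < c < Re w) by (unfold c; lra). destruct (cond2_data l c Hl) as [d [M [D1 [D2 [D3 D4]]]]]; [lra|].
  assert (Hc0 : 0 <= c) by lra.
  assert (E : forall t, 0 <= t -> G (RtoC t) = d 0%nat t).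
  { intros t Ht. rewrite <- (data_fun_real d (r / 2) c M r_half Hc0 D1 D2 t Ht).
    set (f := fun z => (G z - data_fun d z)%C). assert (Hf : f (RtoC t) = RtoC 0).
    { apply (identity_on_segment f 0 t (Rmin rho (r / 2)) (Rmin r1 (r / 2))); auto; try (apply Rmin_pos; lra); try lra.
      - intros x z Hx Hz. destruct (Gd z) as [k1 K1].
        { exists x. split; [lra|]. eapply Rlt_le_trans; [exact Hz|apply Rmin_l]. }
        destruct (data_fun_Cder d (r / 2) c M r_half Hc0 D1 D2 z) as [k2 K2].
        { exists x. split; [lra|]. eapply Rlt_le_trans; [exact Hz|apply Rmin_r]. }
        exists (k1 - k2)%C. apply Cder_minus; [apply Cder_is_derive; auto|auto].
      - intros z Hz. replace (z - RtoC 0)%C with z in Hz by ring.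
        assert (Z1 : Cmod z < r1) by (eapply Rlt_le_trans; [exact Hz|apply Rmin_l]).
        assert (Z2 : Cmod z < r / 2) by (eapply Rlt_le_trans; [exact Hz|apply Rmin_r]).
        unfold f. rewrite (Cser_unique (borel_l_term m a l z) (G z) (data_fun d z)); [ring|apply Cser_is_series; auto|].
        pose proof (data_fun_at_0 d (r / 2) c M r_half Hc0 D1 D2 z Z2) as H. revert H. apply Cser_ext.
        intros n. unfold borel_l_term. change (Defs.Cpow z n) with (z ^ n)%C. rewrite alj_S, D3. unfold Cdiv. ring. }
    unfold f in Hf. replace (G (RtoC t)) with (G (RtoC t) - data_fun d (RtoC t) + data_fun d (RtoC t))%C by ring. rewrite Hf. ring. }
  rewrite <- D4 by lra.
  apply (is_RInt_gen_ext (V:=C_R_NormedModule) (fun x => d 0%nat x * Cexp (- (w * RtoC x)))%C).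
  - exists (fun x => x = 0) (fun y => 0 < y).
    + reflexivity.
    + exists 0. auto.
    + intros x y -> Hy t Ht. simpl in Ht. rewrite Rmin_left in Ht by lra. rewrite E by lra. reflexivity.
  - apply (Lap_is_RInt_gen (d 0%nat) M c); try lra.
    + apply (DBound_pos _ _ _ _ r_half D2).
    + intros x _. apply D1.
    + intros x Hx. pose proof (D2 0%nat x Hx) as H. simpl in H. rewrite Rdiv_1_r, Rmult_1_r in H. exact H.
Qed.

(** On the rays of argument [PI/2] and [- PI/2] the real part is 0, below [B]. The argument is
    therefore strictly inside the quarter turns, as [Lam_rotate] requires. *)
Lemma InP_arg v : InP B v -> - (PI / 2) < Im v < PI / 2.
Proof.
  intros [Hi Hre]. assert (Hc : cos (Im v) <> 0).
  { intros E. unfold Cexp in Hre. unfold Re at 1 in Hre. cbn [fst] in Hre. rewrite E, Rmult_0_r in Hre. lra. }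
  split.
  - destruct (Req_dec (Im v) (- (PI / 2))) as [E|]; [|lra]. exfalso. apply Hc. rewrite E, cos_neg. apply cos_PI2.
  - destruct (Req_dec (Im v) (PI / 2)) as [E|]; [|lra]. exfalso. apply Hc. rewrite E. apply cos_PI2.
Qed.

Lemma borel_Laplace rho F v : 0 < rho -> IsBorelCont m a rho F -> InP B v ->
  is_RInt_gen (V:=C_R_NormedModule) (fun t : R => F (RtoC (ln t)) * Cexp (- (Cexp v * RtoC t)))%C (at_right 0) (Rbar_locally p_infty)
    (csum (fun i => Cexp (RtoC (INR (m - S i) / INR m) * v) * S0 (S i) (Cexp v))%C m).
Proof.
  intros Hrho [_ [Fd [r1 [Hr1 Fs]]]] Hv. pose proof (InP_arg v Hv) as Ha. destruct Hv as [_ Hv].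
  set (w := Cexp v) in *. set (c := (B + Re w) / 2). assert (Hc : B < c < Re w) by (unfold c; lra). assert (Hc1 : 0 <= c) by lra.
  destruct (cond2_data_family c) as [d [M Hd]]; [lra|].
  set (e := fun l => f_to_h m l (d l)).
  assert (E1 : forall l, (1 <= l <= m)%nat -> Data (e l)) by (intros l Hl; apply (Hd l Hl)).
  assert (E2 : forall l, (1 <= l <= m)%nat -> DBound (e l) (r / 4) (c + 1) M) by (intros l Hl; apply (Hd l Hl)).
  assert (E3 : forall l n, (1 <= l <= m)%nat -> e l n 0 = (RtoC (INR (fact n) / Gamma (INR l / INR m + INR n)) * a (l + m * n)%nat)%C) by (intros l n Hl; apply (Hd l Hl)).
  assert (Hr4 : 0 < r / 4) by lra. assert (Hc2 : 0 <= c + 1) by lra.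
  assert (EF : forall t, 0 < t -> F (RtoC (ln t)) = csum (fun i => RtoC (Rpower t (INR (S i) / INR m - 1)) * e (S i) 0%nat t)%C m).
  { intros t Ht. rewrite <- (Fc_real m e (r / 4) (c + 1) M) by auto.
    set (f := fun u => (F u - Fc m e u)%C). assert (Hf : f (RtoC (ln t)) = RtoC 0).
    { apply (identity_log_segment f (Rmin (Rmin rho r1) (r / 4))); auto; [repeat apply Rmin_pos; auto| |].
      - intros u Hu. destruct (Fd u) as [k1 K1].
        { eapply InB_le; [|exact Hu]. eapply Rle_trans; [apply Rmin_l|apply Rmin_l]. }
        destruct (Fc_Cder m e (r / 4) (c + 1) M) with (u := u) as [k2 K2]; auto.
        { eapply InB_le; [|exact Hu]. apply Rmin_r. }
        exists (k1 - k2)%C. apply Cder_minus; [apply Cder_is_derive; auto|auto].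
      - intros u Hu. unfold f. rewrite (Cser_unique (borel_term m a u) (F u) (Fc m e u)); [ring| |].
        + apply Cser_is_series. apply Fs. eapply Rlt_le_trans; [exact Hu|]. eapply Rle_trans; [apply Rmin_l|apply Rmin_r].
        + apply (Fc_series m a e (r / 4) (c + 1) M); auto. eapply Rlt_le_trans; [exact Hu|apply Rmin_r]. }
    unfold f in Hf. replace (F (RtoC (ln t))) with (F (RtoC (ln t)) - Fc m e (RtoC (ln t)) + Fc m e (RtoC (ln t)))%C by ring. rewrite Hf. ring. }
  set (g := fun i t => (RtoC (Rpower t (INR (S i) / INR m - 1)) * e (S i) 0%nat t * Cexp (- (w * RtoC t)))%C).
  assert (Cg : forall i x, (i < m)%nat -> 0 < x -> cont (g i) x).
  { intros i x Hi Hx. assert (Hl : (1 <= S i <= m)%nat) by lia. destruct (Hd _ Hl) as [D1 [[M1 D2] _]].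
    apply (component_cont m (S i) Hl (d (S i)) (r / 2) c M1 v); auto; lra. }
  apply (is_RInt_gen_ext (V:=C_R_NormedModule) (fun t => csum (fun i => g i t) m)).
  - exists (fun x => 0 < x) (fun y => 0 < y).
    + exists (mkposreal 1 Rlt_0_1). intros y _ Hy. exact Hy.
    + exists 0. auto.
    + intros x y Hx Hy t Ht. simpl in Ht. assert (Ht0 : 0 < t) by (pose proof (Rmin_glb_lt x y 0 Hx Hy); lra).
      rewrite EF by auto. rewrite Cmult_comm, <- csum_cmult. apply csum_ext. intros i _. unfold g. ring.
  - apply is_RInt_gen_right_infty.
    + intros x Hx. assert (H : forall n, (n <= m)%nat -> cont (fun t => csum (fun i => g i t) n) x).
      { induction n as [|n IH]; intros Hn; [apply cont_const|]. cbn [csum]. apply cont_plus; [apply IH; lia|apply Cg; auto]. }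
      apply H; auto.
    + apply (Limr_csum g); auto. intros i Hi. assert (Hl : (1 <= S i <= m)%nat) by lia.
      destruct (Hd _ Hl) as [D1 [[M1 D2] [D3 _]]]. rewrite <- D3 by lra.
      replace (INR (m - S i) / INR m) with (1 - INR (S i) / INR m).
      * apply (component_Laplace m (S i) Hl (d (S i)) (r / 2) c M1 v); auto; unfold w in *; lra.
      * rewrite minus_INR by lia. field. apply not_0_INR. lia.
Qed.

Lemma csum_add b n k : csum b (n + k) = (csum b n + csum (fun i => b (n + i)%nat) k)%C.
Proof. induction k as [|k IH]; [rewrite Nat.add_0_r; cbn [csum]; ring|]. rewrite Nat.add_succ_r. cbn [csum]. rewrite IH. ring. Qed.

Lemma csum_double b k n : csum b (k * n) = csum (fun i => csum (fun j => b (k * j + i)%nat) n) k.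
Proof.
  induction n as [|n IH].
  - rewrite Nat.mul_0_r. cbn [csum]. rewrite csum_const. ring.
  - replace (k * S n)%nat with (k * n + k)%nat by lia. rewrite csum_add, IH, <- csum_plus. reflexivity.
Qed.

Lemma csum_rev f n : csum (fun i => f (n - S i)%nat) n = csum f n.
Proof.
  induction n as [|n IH]; [reflexivity|]. rewrite csum_shift. cbn [csum]. rewrite <- IH.
  replace (S n - 1)%nat with n by lia. rewrite (csum_ext _ (fun i => f (n - S i)%nat)) by (intros; f_equal; lia). ring.
Qed.

Lemma Cmod_csum_le f (g : nat -> R) n : (forall k, (k < n)%nat -> Cmod (f k) <= g k) -> Cmod (csum f n) <= Re (csum (fun k => RtoC (g k)) n).
Proof.
  induction n as [|n IH]; intros H; [cbn [csum]; rewrite Cmod_0; simpl; lra|]. cbn [csum]. eapply Rle_trans; [apply Cmod_triangle|].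
  specialize (IH (fun k Hk => H k (Nat.lt_lt_succ_r _ _ Hk))). specialize (H n (Nat.lt_succ_diag_r n)).
  replace (Re (csum (fun k => RtoC (g k)) n + RtoC (g n))) with (Re (csum (fun k => RtoC (g k)) n) + g n) by reflexivity. lra.
Qed.

Lemma sum_n_m_0_Re (g : nat -> R) n : sum_n_m g 0 n = Re (csum (fun k => RtoC (g k)) (S n)).
Proof.
  induction n as [|n IH].
  - rewrite sum_n_n. cbn [csum]. creim. ring.
  - rewrite sum_n_Sm by lia. rewrite IH. reflexivity.
Qed.

(** Indices are written [S (m j + i)] with [l = i + 1]. For fixed [i] the terms form [z^((m-l)/m)]
    times the partial sum of order [n] of [f_l]: exactly [n] terms for each [l], whence the cutoff
    [m n]. As [l] varies, [(m - l)/m] runs through the exponents [0, 1/m, ..., (m-1)/m] in reverse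
    order. *)
Lemma borel_sum_error v n : InP B v -> (1 <= n)%nat ->
  Cmod (csum (fun i => Cexp (RtoC (INR (m - S i) / INR m) * v) * S0 (S i) (Cexp v))%C m
        - csum (fun k => a (S k) / Cexp (RtoC (INR (S k) / INR m) * v))%C (m * n))
  <= maxA A m * exp (B * r) * INR (fact n) / r ^ n
       * (sum_n_m (fun i => Rpower (Cmod (Cexp v)) (INR i / INR m)) 0 (m - 1) / (Cmod (Cexp v) ^ n * (Re (Cexp v) - B))).
Proof.
  intros [_ Hv] Hn. assert (Hmp : 0 < INR m) by (apply lt_0_INR; lia). destruct H2 as [_ [_ [HA [_ Hb]]]].
  rewrite csum_double. unfold Cminus at 1.
  replace (- csum (fun i => csum (fun j => a (S (m * j + i)) / Cexp (RtoC (INR (S (m * j + i)) / INR m) * v)) n) m)%C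
    with (RtoC (-1) * csum (fun i => csum (fun j => a (S (m * j + i)) / Cexp (RtoC (INR (S (m * j + i)) / INR m) * v)) n) m)%C by (apply Ceq; creim; ring).
  rewrite <- csum_cmult, <- csum_plus.
  set (q := exp (B * r) * INR (fact n) / r ^ n / (Cmod (Cexp v) ^ n * (Re (Cexp v) - B))).
  assert (Hq : 0 <= q).
  { unfold q. apply Rdiv_le_0_compat.
    - apply Rdiv_le_0_compat; [apply Rmult_le_pos; [left; apply exp_pos|apply pos_INR]|apply pow_lt; auto].
    - apply Rmult_lt_0_compat; [apply pow_lt; rewrite Cmod_Cexp; apply exp_pos|lra]. }
  set (p := fun i => Rpower (Cmod (Cexp v)) (INR i / INR m)).
  assert (HpE : forall i, p i = exp (INR i / INR m * Re v)) by (intros i; unfold p, Rpower; rewrite Cmod_Cexp, ln_exp; reflexivity).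
  eapply Rle_trans; [apply (Cmod_csum_le _ (fun i => maxA A m * q * p (m - S i)%nat))|].
  - intros i Hi. assert (Hl : (1 <= S i <= m)%nat) by lia.
    assert (E : csum (fun j => a (S (m * j + i)) / Cexp (RtoC (INR (S (m * j + i)) / INR m) * v))%C n
      = (Cexp (RtoC (INR (m - S i) / INR m) * v) * sum_n_m (fun j => alj m a (S i) j / Defs.Cpow (Cexp v) j) 1 n)%C).
    { rewrite sum_n_m_1_csum, <- csum_cmult. apply csum_ext. intros j _. rewrite alj_S, Cpow_Cpow. replace (S (m * j + i)) with (S i + m * j)%nat by lia.
      rewrite <- Cexp_nat. unfold Cdiv. rewrite <- !Cexp_opp.
      transitivity (a (S i + m * j)%nat * (Cexp (RtoC (INR (m - S i) / INR m) * v) * Cexp (- (RtoC (INR (S j)) * v))))%C; [|ring].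
      f_equal. rewrite <- Cexp_plus. f_equal.
      replace (INR (S i + m * j) / INR m) with (INR (S j) - INR (m - S i) / INR m).
      2: { rewrite minus_INR, plus_INR, mult_INR, (S_INR j) by lia. field. lra. }
      rewrite RtoC_minus. ring. }
    rewrite E. set (s := sum_n_m (fun j => alj m a (S i) j / Defs.Cpow (Cexp v) j)%C 1 n).
    replace (Cexp (RtoC (INR (m - S i) / INR m) * v) * S0 (S i) (Cexp v) + RtoC (-1) * (Cexp (RtoC (INR (m - S i) / INR m) * v) * s))%C
      with (Cexp (RtoC (INR (m - S i) / INR m) * v) * (S0 (S i) (Cexp v) - s))%C by (replace (RtoC (-1)) with (- RtoC 1)%C by (apply Ceq; creim; ring); ring).
    rewrite Cmod_mult, Cmod_Cexp. replace (Re (RtoC (INR (m - S i) / INR m) * v)) with (INR (m - S i) / INR m * Re v) by (creim; ring).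
    rewrite <- HpE, Rmult_comm. apply Rmult_le_compat_r; [rewrite HpE; left; apply exp_pos|].
    eapply Rle_trans; [apply (Hb (Cexp v) Hv n Hn (S i) Hl)|]. unfold Ras.
    replace (A (S i) * exp (B * r) * INR (fact n) / r ^ n * / (Cmod (Cexp v) ^ n * (Re (Cexp v) - B))) with (A (S i) * q) by (unfold q, Rdiv; ring).
    apply Rmult_le_compat_r; auto. apply maxA_ge; auto.
  - rewrite (csum_ext _ (fun i => RtoC (maxA A m * q) * RtoC (p (m - S i)%nat))%C) by (intros; rewrite RtoC_mult; ring).
    rewrite csum_cmult, (csum_rev (fun i => RtoC (p i))). rewrite sum_n_m_0_Re. replace (S (m - 1)) with m by lia.
    right. fold p. rewrite re_scal_l. unfold q, Rdiv. ring.
Qed.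

End FromCond2.

Local Open Scope C_scope.

Theorem theorem4p3 (m : nat) (a : nat -> C) (hm : (1 <= m)%nat) (hG : Gevrey1 m a) :
  (cond1 m a <-> exists (r B : R) (A : nat -> R) (S0 : nat -> C -> C), cond2 m a r B A S0)
  /\
  (forall (r B : R) (A : nat -> R) (S0 : nat -> C -> C), cond2 m a r B A S0 ->
     (* Laplace integral of tilde f_l *)
     (forall l, (1 <= l <= m)%nat ->
        (exists (rho : R) (G : C -> C), (0 < rho)%R /\ IsBorelContL m a l rho G) /\
        (forall (rho : R) (G : C -> C), (0 < rho)%R -> IsBorelContL m a l rho G ->
           forall w : C, (Re w > B)%R ->
             is_RInt_gen (fun t : R => G (RtoC t) * Cexp (- (w * RtoC t)))
               (at_point 0) (Rbar_locally p_infty) (S0 l w)))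
     /\
     (* Laplace integral of tilde f, decomposition and error bound on P(B) *)
     (forall (rho : R) (F : C -> C), (0 < rho)%R -> IsBorelCont m a rho F ->
        forall v : C, InP B v ->
          let S := a 0%nat + sum_n_m (fun l => Cexp (RtoC (INR (m - l) / INR m) * v)
                                              * S0 l (Cexp v)) 1 m in
          is_RInt_gen (fun t : R => F (RtoC (ln t)) * Cexp (- (Cexp v * RtoC t)))
            (at_right 0) (Rbar_locally p_infty) (S - a 0%nat)
          /\
          forall n : nat, (1 <= n)%nat ->
            Rle (Cmod (S - sum_n_m (fun k => a k / Cexp (RtoC (INR k / INR m) * v)) 0 (m * n)))
               (maxA A m * exp (B * r) * INR (fact n) / r ^ n
                  * (sum_n_m (fun i => Rpower (Cmod (Cexp v)) (INR i / INR m)) 0 (m - 1)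
                     / (Cmod (Cexp v) ^ n * (Re (Cexp v) - B))))%R)).
Proof.
  split; [split|].
  - apply cond1_cond2; auto.
  - intros [r [B [A [S0 H]]]]. apply (cond2_cond1 m a r B A S0); auto.
  - intros r B A S0 H. split.
    + intros l Hl. split; [apply (borelL_exists m a r B A S0); auto|].
      intros rho G Hrho HG w Hw. apply (borelL_Laplace m a r B A S0 H l rho G w); auto.
    + intros rho F Hrho HF v Hv. cbv zeta. rewrite sum_n_m_1_csum. split.
      * replace (a 0%nat + csum (fun j => Cexp (RtoC (INR (m - S j) / INR m) * v) * S0 (S j) (Cexp v)) m - a 0%nat)
          with (csum (fun j => Cexp (RtoC (INR (m - S j) / INR m) * v) * S0 (S j) (Cexp v)) m) by ring.
        apply (borel_Laplace m a r B A S0 hm H rho F v); auto.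
      * intros n Hn. pose proof (borel_sum_error m a r B A S0 hm H v n Hv Hn) as Hb.
        match type of Hb with Rle (Cmod ?x) _ => match goal with |- Rle (Cmod ?y) _ => replace y with x; [exact Hb|] end end.
        (* The term of index 0 is [a 0], which cancels against the constant of the Borel sum. *)
        assert (E : sum_n_m (fun k => a k / Cexp (RtoC (INR k / INR m) * v)) 0 (m * n)
          = (a 0%nat + csum (fun k => a (S k) / Cexp (RtoC (INR (S k) / INR m) * v)) (m * n))).
        { change (sum_n_m (fun k => a k / Cexp (RtoC (INR k / INR m) * v)) 0 (m * n)) with (sum_n (fun k => a k / Cexp (RtoC (INR k / INR m) * v)) (m * n)).
          rewrite sum_n_csum, csum_shift. f_equal. simpl (INR 0). replace (RtoC (0 / INR m) * v) with (RtoC 0).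
          - rewrite Cexp_0. field.
          - unfold Rdiv. rewrite Rmult_0_l. ring. }
        rewrite E. ring.
Qed.
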